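(* Let $\gamma$ be the generating curve of a $C^2$ complete, connected, rotationally invariant surface $\Sigma$ in $(\mathbb{S}^3,g_h)$ with constant mean curvature $H$ and energy $E$. Then $\Sigma$ must be of one of the following types: (i) If $H=0$ and $E=0$ then $\gamma$ is a half-meridian and $\Sigma$ is a totally geodesic $2$-sphere in $(\mathbb{S}^3,g)$. (ii) If $H=0$ and $E\neq0$ then $\Sigma$ coincides either with the minimal Clifford torus $\mathcal{T}_{\sqrt2/2}$ or with a compact embedded surface of unduloidal type. (iii) If $H\neq0$ and $E=0$ then $\Sigma$ is a compact surface congruent with a sphere $\mathcal{S}_H$. (iv) If $EH\neq0$ and $H\neq-E$ then $\Sigma$ coincides either with a non-minimal Clifford torus $\mathcal{T}_\rho$ (with $\rho\neq\sqrt2/2$), or with an unduloidal type surface, or with a nodoidal type surface which has selfintersections. Moreover, unduloids and nodoids are compact surfaces if and only if $H/\sqrt{1+H^2}$ is a rational number. (v) If $H=-E\neq 0$ then $\gamma$ consists of a union of (topological) circles meeting at the north pole. The generated $\Sigma$ is a compact surface if and only if $H/\sqrt{1+H^2}$ is a rational number.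
   Context: Identify $(x_1,y_1,x_2,y_2)\in\mathbb{R}^4$ with the quaternion $x_1+iy_1+jx_2+ky_2$ and with $(z_1,z_2)$, $z_n=x_n+iy_n$; $\cdot$ is the quaternion product and $\langle\cdot,\cdot\rangle$ the Euclidean product. $\mathbb{S}^3$ is the unit sphere with the induced Riemannian metric $g$, with Levi-Civita connection $D$. Put $V(p)=i\cdot p$, $E_1(p)=j\cdot p$, $E_2(p)=k\cdot p$. The horizontal distribution $\mathcal{H}$ is spanned by $E_1,E_2$, and $g_h$ is the restriction of $g$ to $\mathcal{H}$. For a $C^2$ surface with unit normal $N$, put $N_h=N-\langle N,V\rangle V$; singular points are those with $N_h=0$; off these, $\nu_h=N_h/|N_h|$ and the mean curvature $H$ is given by $-2H=\mathrm{div}_\Sigma\nu_h$. Constant mean curvature means $H$ constant off the singular set. Complete means complete in $(\mathbb{S}^3,g)$. Two surfaces are congruent if some isometry of $(\mathbb{S}^3,g)$ preserving $\mathcal{H}$ maps one onto the other. $\mathcal{T}_\rho=\{(z_1,z_2)\in\mathbb{S}^3:|z_1|^2=\rho^2\}$, $\rho\in(0,1)$; ''minimal'' means $H\equiv0$. Spheres $\mathcal{S}_\lambda$: let $p=(1,0,0,0)$, and let $\gamma_\theta$ be the curve in $\mathbb{S}^3$ tangent to $\mathcal{H}$, parameterized by arc-length, with $D_{\dot\gamma}\dot\gamma+2\lambda\, i\cdot\dot\gamma=0$, $\gamma_\theta(0)=p$, $\dot\gamma_\theta(0)=(\cos\theta)E_1(p)+(\sin\theta)E_2(p)$. Then $\mathcal{S}_\lambda=\{\gamma_\theta(s):\theta\in[0,2\pi],\,s\in[0,\pi/\sqrt{1+\lambda^2}]\}$.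 Rotationally invariant: $\Sigma$ is invariant under all $r_\theta(x_1,y_1,x_2,y_2)=(x_1,y_1,(\cos\theta)x_2-(\sin\theta)y_2,(\sin\theta)x_2+(\cos\theta)y_2)$; these fix the great circle $R=\mathbb{S}^3\cap\{x_2=y_2=0\}$. The generating curve $\gamma=(x_1,y_1,x_2)$ is the curve of $\Sigma$ in the hemisphere $\mathbb{S}^2_+=\{x_2\geq0,\ y_2=0\}\subset\mathbb{S}^3$, parameterized by arc-length $s$. The north pole is $x_2=1$. The normal used along $\Sigma-R$, at $r_\theta(\gamma(s))$, is $N=(x_2\dot y_1-\dot x_2y_1,\ x_1\dot x_2-\dot x_1x_2,\ (\dot x_1y_1-x_1\dot y_1)\cos\theta,\ (\dot x_1y_1-x_1\dot y_1)\sin\theta)$. Spherical coordinates $(\omega,\tau)$, $\omega\in[0,\pi/2)$, $\tau\in\mathbb{R}$: $x_1=\cos\omega\cos\tau$, $y_1=\cos\omega\sin\tau$, $x_2=\sin\omega$. Let $\sigma$ be the oriented angle between $\partial_\omega$ and $\dot\gamma$, so that $\dot\omega=\cos\sigma$, $\dot\tau=\sin\sigma/\cos\omega$. When $H$ is constant, the function $$\frac{\sin\omega\cos\omega\sin\sigma}{\sqrt{\sin^2\omega\cos^2\sigma+\sin^2\sigma}}-H\sin^2\omega$$ is constant along $\gamma$; its value is the energy $E$. A half-meridian is the great semicircle of $\mathbb{S}^2_+$ through the north pole orthogonal to $R$ (endpoints on $R$). Unduloidal type surface (unduloid): in the coordinates $(\tau,\omega)$ the curve $\gamma$ is the graph of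 a nonconstant periodic function $\omega(\tau)$ oscillating between two values in $(0,\pi/2)$, strictly monotone between consecutive critical points, and symmetric about the vertical lines through its critical points. Nodoidal type surface (nodoid): in the coordinates $(\tau,\omega)$ the curve $\gamma$ is invariant under a nontrivial translation in $\tau$, oscillates between two values of $\omega$ in $(0,\pi/2)$, is symmetric about the lines $\{\tau=\text{const}\}$ through the critical points of $\omega$, and is not a graph over the $\tau$-axis, since its tangent angle $\sigma$ is strictly monotone along $\gamma$. *)

(* Defs.v *)
From HB Require Import structures.
From mathcomp Require Import all_boot all_order all_algebra.
From mathcomp Require Import all_classical all_reals all_analysis.
Import Order.TTheory GRing.Theory Num.Theory.
Import numFieldNormedType.Exports.

Set Implicit Arguments.
Unset Strict Implicit.
Unset Printing Implicit Defensive.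

Local Open Scope classical_set_scope.
Local Open Scope ring_scope.

Section Euclidean.
Context {R : realType}.

Definition vec4 (a b c d : R) : 'rV[R]_4 := \row_(i < 4) [:: a; b; c; d]`_i.

Definition x1 (p : 'rV[R]_4) : R := p 0 (@Ordinal 4 0 isT).
Definition y1 (p : 'rV[R]_4) : R := p 0 (@Ordinal 4 1 isT).
Definition x2 (p : 'rV[R]_4) : R := p 0 (@Ordinal 4 2 isT).
Definition y2 (p : 'rV[R]_4) : R := p 0 (@Ordinal 4 3 isT).

(* The library norm on row vectors is the maximum norm, hence [enorm]; both
   induce the same topology and the same derivatives. *)
Definition dot n (p q : 'rV[R]_n) : R := \sum_(i < n) p 0 i * q 0 i.
Definition enorm n (p : 'rV[R]_n) : R := Num.sqrt (dot p p).

Definition usphere n : set 'rV[R]_n := [set p | dot p p = 1].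
Arguments usphere n p : clear implicits.
Definition S3 : set 'rV[R]_4 := usphere 4.

(* Hamilton product in the basis 1, i, j, k. *)
Definition qmul (p q : 'rV[R]_4) : 'rV[R]_4 :=
  vec4 (x1 p * x1 q - y1 p * y1 q - x2 p * x2 q - y2 p * y2 q)
       (x1 p * y1 q + y1 p * x1 q + x2 p * y2 q - y2 p * x2 q)
       (x1 p * x2 q - y1 p * y2 q + x2 p * x1 q + y2 p * y1 q)
       (x1 p * y2 q + y1 p * x2 q - x2 p * y1 q + y2 p * x1 q).

Definition qi : 'rV[R]_4 := vec4 0 1 0 0.
Definition qj : 'rV[R]_4 := vec4 0 0 1 0.
Definition qk : 'rV[R]_4 := vec4 0 0 0 1.

Definition fV (p : 'rV[R]_4) := qmul qi p.
Definition fE1 (p : 'rV[R]_4) := qmul qj p.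
Definition fE2 (p : 'rV[R]_4) := qmul qk p.

Definition horizontal (p v : 'rV[R]_4) : Prop :=
  exists a b : R, v = a *: fE1 p + b *: fE2 p.

Definition tangentS3 (p v : 'rV[R]_4) : Prop := dot p v = 0.

Definition rot (t : R) (p : 'rV[R]_4) : 'rV[R]_4 :=
  vec4 (x1 p) (y1 p) (cos t * x2 p - sin t * y2 p) (sin t * x2 p + cos t * y2 p).

Definition hemisphere : set 'rV[R]_4 := [set p | S3 p /\ 0 <= x2 p /\ y2 p = 0].
Definition north : 'rV[R]_4 := vec4 0 0 1 0.

End Euclidean.

Section Regularity.
Context {R : realType} {V W : normedModType R}.

Definition C1_on (U : set V) (f : V -> W) : Prop :=
  forall u, U u -> differentiable f u /\
    forall v, {for u, continuous (fun u' => 'D_v f u')}.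

Definition C2_on (U : set V) (f : V -> W) : Prop :=
  C1_on U f /\ forall v, C1_on U (fun u => 'D_v f u).

End Regularity.

Definition homeomorphic_sets (S T : topologicalType) (A : set S) (B : set T) : Prop :=
  exists (f : S -> T) (g : T -> S),
    [/\ {within A, continuous f}, {within B, continuous g},
        (forall x, A x -> B (f x) /\ g (f x) = x) &
        (forall y, B y -> A (g y) /\ f (g y) = y)].

Section Surfaces.
Context {R : realType}.

Definition immersion_on (U : set (R * R)) (X : R * R -> 'rV[R]_4) : Prop :=
  [/\ open U, C2_on U X & forall u v, U u -> 'D_v X u = 0 -> v = 0].

(* An immersed surface is a topological space [M] with a map [phi : M -> S3];
   its C^2 structure is the one for which [phi] is a C^2 immersion: a local
   parameter is a homeomorphism of an open subset of the plane onto an open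
   subset of [M] whose composition with [phi] is a C^2 immersion.  Changes of
   such parameters are automatically C^2.  The surface as a subset of S3 is
   [range phi]. *)
Definition local_param (M : topologicalType) (phi : M -> 'rV[R]_4)
    (U : set (R * R)) (psi : R * R -> M) : Prop :=
  [/\ (forall u, U u -> {for u, continuous psi}),
      (forall u u', U u -> U u' -> psi u = psi u' -> u = u'),
      (forall A, A `<=` U -> open A -> open (psi @` A)) &
      immersion_on U (phi \o psi)].

Definition length_le (alpha : R -> 'rV[R]_4) (a b L : R) : Prop :=
  forall (n : nat) (t : nat -> R),
    a <= t 0%N -> (forall i, t i <= t i.+1) -> t n <= b ->
    \sum_(0 <= i < n) enorm (alpha (t i.+1) - alpha (t i)) <= L.

(* The Riemannian distance induced by [phi] is the infimum of the lengths of
   the images in S3 of paths of [M]; since S3 has the induced metric, these are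
   lengths in the Euclidean space. *)
Definition joined (M : topologicalType) (phi : M -> 'rV[R]_4) (x y : M) (L : R) :=
  exists c : R -> M, [/\ {within `[0, 1], continuous c}, c 0 = x, c 1 = y &
                         length_le (phi \o c) 0 1 L].

Definition complete_surface (M : topologicalType) (phi : M -> 'rV[R]_4) : Prop :=
  forall x : nat -> M,
    (forall e : R, 0 < e -> exists n0 : nat, forall n k : nat,
       (n0 <= n)%N -> (n0 <= k)%N -> joined phi (x n) (x k) e) ->
    exists m : M, x @ \oo --> m.

Record C2_complete_connected_surface (M : topologicalType)
    (phi : M -> 'rV[R]_4) : Prop := {
  surf_hausdorff : hausdorff_space M;
  surf_connected : connected [set: M];
  surf_S3 : forall m, S3 (phi m);
  surf_charts : forall m, exists U psi u,
    [/\ local_param phi U psi, U u & psi u = m];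
  surf_complete : complete_surface phi }.

(* For a surface which is a subset of S3, [rho] is just the restriction of
   [rot]; for an immersed one the rotations have to be lifted to [M]. *)
Record rotationally_invariant (M : topologicalType) (phi : M -> 'rV[R]_4)
    (rho : R -> M -> M) : Prop := {
  rho_continuous : continuous (fun tm : R * M => rho tm.1 tm.2);
  rho_0 : forall m, rho 0 m = m;
  rho_D : forall s t m, rho (s + t) m = rho s (rho t m);
  rho_rot : forall t m, phi (rho t m) = rot t (phi m) }.

Record unit_normal (M : topologicalType) (phi N : M -> 'rV[R]_4) : Prop := {
  normal_continuous : continuous N;
  normal_unit : forall m, dot (N m) (N m) = 1;
  normal_S3 : forall m, tangentS3 (phi m) (N m);
  normal_orth : forall U psi, local_param phi U psi ->
    forall u v, U u -> dot (N (psi u)) ('D_v (phi \o psi) u) = 0 }.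

Definition horizontal_part (p n : 'rV[R]_4) : 'rV[R]_4 := n - dot n (fV p) *: fV p.

Definition horizontal_normal (p n : 'rV[R]_4) : 'rV[R]_4 :=
  (enorm (horizontal_part p n))^-1 *: horizontal_part p n.

Definition orthonormal2 (v w : 'rV[R]_4) : Prop :=
  [/\ dot v v = 1, dot w w = 1 & dot v w = 0].

(* [d] is the divergence at [u], relative to the surface parameterized by [X],
   of the field [nu]: the trace of the derivative of [nu] in an orthonormal
   basis of the tangent plane. *)
Definition surface_div (X nu : R * R -> 'rV[R]_4) (u : R * R) (d : R) : Prop :=
  forall v w : R * R, orthonormal2 ('D_v X u) ('D_w X u) ->
    d = dot ('D_v nu u) ('D_v X u) + dot ('D_w nu u) ('D_w X u).

Definition constant_mean_curvature (M : topologicalType) (phi N : M -> 'rV[R]_4)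
    (H : R) : Prop :=
  forall U psi, local_param phi U psi -> forall u, U u ->
    horizontal_part (phi (psi u)) (N (psi u)) != 0 ->
    surface_div (phi \o psi)
      (fun u' => horizontal_normal (phi (psi u')) (N (psi u'))) u (- 2 * H).

(* Vanishing second fundamental form. *)
Definition totally_geodesic (M : topologicalType) (phi N : M -> 'rV[R]_4) : Prop :=
  forall U psi, local_param phi U psi -> forall u v w, U u ->
    dot ('D_v (fun u' => 'D_w (phi \o psi) u') u) (N (psi u)) = 0.

Definition embedded_surface (S : set 'rV[R]_4) : Prop :=
  S `<=` S3 /\
  forall p, S p -> exists (U : set (R * R)) (W : set 'rV[R]_4)
      (X : R * R -> 'rV[R]_4) (Y : 'rV[R]_4 -> R * R),
    [/\ immersion_on U X, open W /\ W p, X @` U = S `&` W,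
        (forall u, U u -> Y (X u) = u) & {within S `&` W, continuous Y}].

Definition clifford_torus (r : R) : set 'rV[R]_4 :=
  [set p | S3 p /\ x1 p ^+ 2 + y1 p ^+ 2 = r ^+ 2].

Record S3_isometry (f : 'rV[R]_4 -> 'rV[R]_4) : Prop := {
  iso_bij : set_bij S3 S3 f;
  iso_diff : forall p, S3 p -> differentiable f p;
  iso_metric : forall p v w, S3 p -> tangentS3 p v -> tangentS3 p w ->
    dot ('d f p v) ('d f p w) = dot v w }.

Definition congruent (A B : set 'rV[R]_4) : Prop :=
  exists f, [/\ S3_isometry f,
                (forall p v, S3 p -> horizontal p v -> horizontal (f p) ('d f p v)) &
                f @` A = B].

(* The Levi-Civita derivative of the velocity is the projection on the tangent
   space of S3 of the Euclidean acceleration. *)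
Definition covariant_acceleration (g : R -> 'rV[R]_4) (s : R) : 'rV[R]_4 :=
  let a := derive1 (derive1 g) s in a - dot a (g s) *: g s.

Definition pole : 'rV[R]_4 := vec4 1 0 0 0.

Record sphere_geodesic (lam theta : R) (g : R -> 'rV[R]_4) : Prop := {
  geo_C2 : C2_on [set: R] g;
  geo_S3 : forall s, S3 (g s);
  geo_horizontal : forall s, horizontal (g s) (derive1 g s);
  geo_arclength : forall s, enorm (derive1 g s) = 1;
  geo_eq : forall s,
    covariant_acceleration g s + (2 * lam) *: qmul qi (derive1 g s) = 0;
  geo_start : g 0 = pole;
  geo_velocity : derive1 g 0 = cos theta *: fE1 pole + sin theta *: fE2 pole }.

Definition sphere_S (lam : R) : set 'rV[R]_4 :=
  [set q | exists theta s g,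
     [/\ 0 <= theta <= 2 * pi, 0 <= s <= pi / Num.sqrt (1 + lam ^+ 2),
         sphere_geodesic lam theta g & q = g s]].

End Surfaces.

Section GeneratingCurve.
Context {R : realType}.

(* An arc-length curve of the surface in the closed hemisphere, defined on an
   interval [J] (possibly containing some of its endpoints) and lifted to [M];
   off the rotation axis its rotations parameterize the surface. *)
Record profile_curve (M : topologicalType) (phi : M -> 'rV[R]_4)
    (rho : R -> M -> M) (J : set R) (c : R -> M) : Prop := {
  profile_interval : is_interval J;
  profile_continuous : {within J, continuous c};
  profile_hemisphere : forall s, J s -> hemisphere (phi (c s));
  profile_C2 : C2_on J° (phi \o c);
  profile_arclength : forall s, J° s -> enorm (derive1 (phi \o c) s) = 1;
  profile_sweeps : forall s t, J s -> 0 < x2 (phi (c s)) ->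
    exists U : set (R * R),
      [/\ U (s, t), (forall u, U u -> J u.1) &
          local_param phi U (fun u => rho u.2 (c u.1))] }.

(* The whole curve of the surface in the hemisphere: a profile curve which
   cannot be prolonged and whose rotations cover the surface. *)
Record generating_curve (M : topologicalType) (phi : M -> 'rV[R]_4)
    (rho : R -> M -> M) (J : set R) (c : R -> M) : Prop := {
  gen_profile : profile_curve phi rho J c;
  gen_maximal : forall (J' : set R) (c' : R -> M),
    J `<=` J' -> (forall s, J s -> c' s = c s) ->
    profile_curve phi rho J' c' -> J' = J;
  gen_cover : forall m, exists s t, J s /\ m = rho t (c s) }.

Definition profile_normal (g : R -> 'rV[R]_4) (s t : R) : 'rV[R]_4 :=
  let p := g s in let dp := derive1 g s in
  let k := x1 dp * y1 p - x1 p * y1 dp in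
  vec4 (x2 p * y1 dp - x2 dp * y1 p) (x1 p * x2 dp - x1 dp * x2 p)
       (k * cos t) (k * sin t).

Definition normal_along (M : topologicalType) (phi N : M -> 'rV[R]_4)
    (rho : R -> M -> M) (J : set R) (c : R -> M) : Prop :=
  forall s t, J s -> 0 < x2 (phi (c s)) ->
    N (rho t (c s)) = profile_normal (phi \o c) s t.

Definition spherical (om ta : R) : 'rV[R]_4 :=
  vec4 (cos om * cos ta) (cos om * sin ta) (sin om) 0.
Definition d_om (om ta : R) : 'rV[R]_4 :=
  vec4 (- sin om * cos ta) (- sin om * sin ta) (cos om) 0.
Definition d_ta (om ta : R) : 'rV[R]_4 :=
  vec4 (- cos om * sin ta) (cos om * cos ta) 0 0.

(* The defining expression of the energy makes sense off the rotation axis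
   (om = 0) and off the north pole, where (om, ta) are not coordinates. *)
Definition has_energy (J : set R) (g : R -> 'rV[R]_4) (H E : R) : Prop :=
  forall s om ta sg, J° s -> 0 < om < pi / 2 -> g s = spherical om ta ->
    derive1 g s = cos sg *: d_om om ta + (sin sg / cos om) *: d_ta om ta ->
    sin om * cos om * sin sg
      / Num.sqrt (sin om ^+ 2 * cos sg ^+ 2 + sin sg ^+ 2)
    - H * sin om ^+ 2 = E.

Definition half_meridian (C : set 'rV[R]_4) : Prop :=
  exists ta : R, C = [set vec4 (cos a * cos ta) (cos a * sin ta) (sin a) 0
                     | a in `[0, pi]].

(* A continuous choice of the coordinates (om, ta) along the curve. *)
Definition spherical_lift (J : set R) (g : R -> 'rV[R]_4) (om ta : R -> R) : Prop :=
  [/\ {within J, continuous om}, {within J, continuous ta} &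
      forall s, J s -> 0 <= om s < pi / 2 /\ g s = spherical (om s) (ta s)].

Definition plane_trace (J : set R) (om ta : R -> R) : set (R * R) :=
  [set (ta s, om s) | s in J].

Definition strictly_monotone_on (A : set R) (f : R -> R) : Prop :=
  (forall x y, A x -> A y -> x < y -> f x < f y) \/
  (forall x y, A x -> A y -> x < y -> f y < f x).

(* Critical points of the periodic function are isolated, and each has a next
   one; by symmetry each also has a previous one. *)
Definition unduloidal (J : set R) (g : R -> 'rV[R]_4) : Prop :=
  exists om ta w : R -> R,
    [/\ spherical_lift J g om ta,
        plane_trace J om ta = [set (t, w t) | t in [set: R]],
        (forall t, derivable w t 1) /\
        (exists T : R, 0 < T /\ forall t, w (t + T) = w t),
        (exists a b : R, [/\ 0 < a, a < b, b < pi / 2 &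
           range w = [set` `[a, b]]]) &
        (forall t0, derive1 w t0 = 0 ->
           (forall t, w (t0 + t) = w (t0 - t)) /\
           exists t1, [/\ t0 < t1, derive1 w t1 = 0,
             (forall t, t0 < t < t1 -> derive1 w t != 0) &
             strictly_monotone_on `[t0, t1] w])].

Definition nodoidal (J : set R) (g : R -> 'rV[R]_4) : Prop :=
  exists om ta : R -> R,
    [/\ spherical_lift J g om ta,
        (exists T : R, T != 0 /\
           [set (q.1 + T, q.2) | q in plane_trace J om ta] = plane_trace J om ta),
        (exists a b : R, [/\ 0 < a, a < b, b < pi / 2 & om @` J = [set` `[a, b]]]),
        (forall s0, J° s0 -> derive1 om s0 = 0 ->
           [set (2 * ta s0 - q.1, q.2) | q in plane_trace J om ta]
             = plane_trace J om ta) &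
        (exists sg : R -> R,
           (forall s, J° s -> is_derive s 1 om (cos (sg s)) /\
                              is_derive s 1 ta (sin (sg s) / cos (om s))) /\
           {within J, continuous sg} /\ strictly_monotone_on J sg) /\
        ~ (exists w : R -> R, forall q, plane_trace J om ta q -> q.2 = w q.1)].

(* Two branches of the curve crossing at a point; coincidences due to the
   periodicity of the parameterization do not count. *)
Definition self_intersecting (J : set R) (g : R -> 'rV[R]_4) : Prop :=
  exists s t, [/\ J° s, J° t, g s = g t,
    derive1 g s != derive1 g t & derive1 g s != - derive1 g t].

Definition topological_circle (C : set 'rV[R]_4) : Prop :=
  homeomorphic_sets (@usphere R 2) C.

Definition circles_at_north (C : set 'rV[R]_4) : Prop :=
  exists K : int -> set 'rV[R]_4,
    (forall n, topological_circle (K n) /\ K n north) /\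
    C = \bigcup_n K n.

Definition is_rational (x : R) : Prop := exists q : rat, x = ratr q.

End GeneratingCurve.

(* Main.v *)
Require Import Defs.
From HB Require Import structures.
From mathcomp Require Import all_boot all_order all_algebra.
From mathcomp Require Import all_classical all_reals all_analysis.
From mathcomp Require Import ring lra.
Import Order.TTheory GRing.Theory Num.Theory.
Import numFieldNormedType.Exports.
Local Open Scope classical_set_scope.
Local Open Scope ring_scope.
Set Implicit Arguments.
Unset Strict Implicit.
Unset Printing Implicit Defensive.

(** Off the rotation axis the surface is swept by its generating curve, so the
    classification is the study of an ordinary differential equation. Write the
    curve as (z, r) with z = x1 + i y1 and height r = x2 > 0, and use a time t in
    which the projection z is traversed with speed r ([xi] in [normal_form]). The
    energy identity says that the angular momentum of z is E + H r^2. Where r' <> 0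
    its derivative gives the equation z'' + 2 i H z' + z = 0, and on stretches of
    constant height the mean curvature equation itself gives it; so it holds
    everywhere ([pd_system]). In the frame rotating with angular velocity - H this is
    a harmonic oscillator of frequency L = sqrt (1 + H^2), hence, with principal
    semi-axes P >= |Q| and a phase ph ([normal_form]),
      z = e^(i (ph - H t)) (P cos (L t) + i Q sin (L t)),
      r^2 = A^2 sin^2 (L t) + B^2 cos^2 (L t),
    where A = L P - H Q, B = L Q - H P, P^2 + B^2 = Q^2 + A^2 = 1, L P Q = E + H and
    L A B = E ([shape]).

    How much of this model curve is covered depends on the ends of the generating
    curve. Completeness gives it a limit at a finite end. A limit off the axis would
    lie in a strip swept by the curve itself, and a rotated piece of the curve would
    prolong it; a limit on the axis can be added. Since the curve cannot be
    prolonged, its finite ends are on the axis ([right_end_on_axis]). The height is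
    at least |B|, and B = 0 if and only if E = 0. So for E <> 0 the curve is the
    whole model ([domain_unbounded]), and for E = 0 it is one half period from the
    axis to the axis ([bounded_structure]).

    If E = 0 then P = 1, Q = H / L, B = 0. For H = 0 this is a great semicircle and
    the surface is the section of the sphere by a hyperplane ([minimal_sphere]). For
    H <> 0, multiplying z1 by e^(- i ph) maps the rotated profiles to the geodesics
    which define the sphere with the same mean curvature ([half_swept_congruent]).

    If E <> 0 and Q = P the height is constant and the surface is a Clifford torus
    ([torus_swept]). If Q = 0, that is H = - E, the curve passes through the north pole
    once in each half period ([loops_at_north]). Otherwise, after reversing the time,
    0 < Q < P, and the polar angle tau has a derivative with the sign of the momentum
    P B cos^2 (L t) + Q A sin^2 (L t). For B > 0 it is positive and the curve is the
    graph of a periodic function ([model_unduloidal]). For B < 0 it changes its sign,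
    while the tangent turns always in the same sense ([model_nodoidal]); tau first
    decreases and then overtakes its initial value, so the curve crosses itself
    ([model_self_intersecting]).

    In one half period the factor P cos + i Q sin changes its sign and the frame turns
    by - H pi / L. If H / L is rational the model is therefore periodic and the surface
    compact. Otherwise the points with |z| = P have phases which are dense in a circle
    without filling it, and the surface is not closed ([swept_compact_rational]). For
    H = 0 the frame is fixed, and the position and the rotation angle are recovered
    from linear functionals on R^4, so the surface is embedded ([swept_embedded]). *)

(** * Vectors of R^4 and their derivatives *)

Section Coordinates.
Context {R : realType}.
Implicit Types p q : 'rV[R]_4.

Lemma x1E a b c d : x1 (vec4 a b c d) = a :> R.
Proof. by rewrite /x1 mxE. Qed.
Lemma y1E a b c d : y1 (vec4 a b c d) = b :> R.
Proof. by rewrite /y1 mxE. Qed.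
Lemma x2E a b c d : x2 (vec4 a b c d) = c :> R.
Proof. by rewrite /x2 mxE. Qed.
Lemma y2E a b c d : y2 (vec4 a b c d) = d :> R.
Proof. by rewrite /y2 mxE. Qed.
Definition vecE := (x1E, y1E, x2E, y2E).

Lemma ord4P (P : 'I_4 -> Prop) : P (@Ordinal 4 0 isT) -> P (@Ordinal 4 1 isT) ->
  P (@Ordinal 4 2 isT) -> P (@Ordinal 4 3 isT) -> forall i, P i.
Proof.
move=> h0 h1 h2 h3 [[|[|[|[|//]]]] h]; by rewrite (bool_irrelevance h isT).
Qed.

Lemma vec4P p q : x1 p = x1 q -> y1 p = y1 q -> x2 p = x2 q -> y2 p = y2 q -> p = q.
Proof.
move=> h1 h2 h3 h4; apply/rowP; exact: ord4P.
Qed.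

Lemma vec4_eta p : p = vec4 (x1 p) (y1 p) (x2 p) (y2 p).
Proof. by apply: vec4P; rewrite !vecE. Qed.

Lemma x1D p q : x1 (p + q) = x1 p + x1 q. Proof. by rewrite /x1 mxE. Qed.
Lemma y1D p q : y1 (p + q) = y1 p + y1 q. Proof. by rewrite /y1 mxE. Qed.
Lemma x2D p q : x2 (p + q) = x2 p + x2 q. Proof. by rewrite /x2 mxE. Qed.
Lemma y2D p q : y2 (p + q) = y2 p + y2 q. Proof. by rewrite /y2 mxE. Qed.
Lemma x1N p : x1 (- p) = - x1 p. Proof. by rewrite /x1 mxE. Qed.
Lemma y1N p : y1 (- p) = - y1 p. Proof. by rewrite /y1 mxE. Qed.
Lemma x2N p : x2 (- p) = - x2 p. Proof. by rewrite /x2 mxE. Qed.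
Lemma y2N p : y2 (- p) = - y2 p. Proof. by rewrite /y2 mxE. Qed.
Lemma x1Z k p : x1 (k *: p) = k * x1 p. Proof. by rewrite /x1 mxE. Qed.
Lemma y1Z k p : y1 (k *: p) = k * y1 p. Proof. by rewrite /y1 mxE. Qed.
Lemma x2Z k p : x2 (k *: p) = k * x2 p. Proof. by rewrite /x2 mxE. Qed.
Lemma y2Z k p : y2 (k *: p) = k * y2 p. Proof. by rewrite /y2 mxE. Qed.
Lemma x10 : x1 (0 : 'rV[R]_4) = 0. Proof. by rewrite /x1 mxE. Qed.
Lemma y10 : y1 (0 : 'rV[R]_4) = 0. Proof. by rewrite /y1 mxE. Qed.
Lemma x20 : x2 (0 : 'rV[R]_4) = 0. Proof. by rewrite /x2 mxE. Qed.
Lemma y20 : y2 (0 : 'rV[R]_4) = 0. Proof. by rewrite /y2 mxE. Qed.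
Definition coordE := (vecE, (x1D, y1D, x2D, y2D), (x1N, y1N, x2N, y2N),
  (x1Z, y1Z, x2Z, y2Z), (x10, y10, x20, y20)).

Lemma dot4 p q : dot p q = x1 p * x1 q + y1 p * y1 q + x2 p * x2 q + y2 p * y2 q.
Proof.
rewrite /dot !big_ord_recr big_ord0 /= add0r /x1 /y1 /x2 /y2.
congr (_ * _ + _ * _ + _ * _ + _ * _);
  by congr (_ 0 _); apply/val_inj.
Qed.

Lemma S3E p : S3 p <-> x1 p ^+ 2 + y1 p ^+ 2 + x2 p ^+ 2 + y2 p ^+ 2 = 1.
Proof. by rewrite /S3 /usphere /= dot4 !expr2. Qed.

Lemma enorm_ge0 p : 0 <= enorm p. Proof. exact: sqrtr_ge0. Qed.

Lemma dot_ge0 p : 0 <= dot p p.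
Proof. by rewrite dot4; nra. Qed.

Lemma enorm_sqr p : enorm p ^+ 2 = dot p p.
Proof. by rewrite sqr_sqrtr ?dot_ge0. Qed.

Lemma enorm1 p : enorm p = 1 <-> dot p p = 1.
Proof.
split=> h; first by rewrite -enorm_sqr h expr1n.
by rewrite /enorm h sqrtr1.
Qed.

Lemma cauchy_schwarz4 p q : dot p q ^+ 2 <= dot p p * dot q q.
Proof.
rewrite !dot4 -subr_ge0.
set a1 := x1 p; set b1 := y1 p; set c1 := x2 p; set d1 := y2 p.
set a2 := x1 q; set b2 := y1 q; set c2 := x2 q; set d2 := y2 q.
have -> : (a1 * a1 + b1 * b1 + c1 * c1 + d1 * d1) * (a2 * a2 + b2 * b2 + c2 * c2 + d2 * d2)
   - (a1 * a2 + b1 * b2 + c1 * c2 + d1 * d2) ^+ 2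
  = (a1 * b2 - b1 * a2) ^+ 2 + (a1 * c2 - c1 * a2) ^+ 2 + (a1 * d2 - d1 * a2) ^+ 2
   + (b1 * c2 - c1 * b2) ^+ 2 + (b1 * d2 - d1 * b2) ^+ 2 + (c1 * d2 - d1 * c2) ^+ 2 by ring.
by rewrite !addr_ge0 ?sqr_ge0.
Qed.

Lemma dot_le_enorm p q : dot p q <= enorm p * enorm q.
Proof.
have [h|/ltW h] := leP (dot p q) 0.
  by rewrite (le_trans h)// mulr_ge0 ?enorm_ge0.
rewrite -(@ler_pXn2r _ 2) ?nnegrE ?mulr_ge0 ?enorm_ge0//.
by rewrite exprMn !enorm_sqr cauchy_schwarz4.
Qed.

End Coordinates.

Section VectorCalculus.
Context {R : realType}.

Section Normed.
Context {V : normedModType R}.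
Implicit Types (F : V -> 'rV[R]_4) (f : V -> R).

Lemma is_derive_vec4 f1 f2 f3 f4 (u v : V) d1 d2 d3 d4 :
  is_derive u v f1 d1 -> is_derive u v f2 d2 -> is_derive u v f3 d3 ->
  is_derive u v f4 d4 ->
  is_derive u v (fun x => vec4 (f1 x) (f2 x) (f3 x) (f4 x)) (vec4 d1 d2 d3 d4).
Proof.
move=> h1 h2 h3 h4.
have H : derivable (fun x => vec4 (f1 x) (f2 x) (f3 x) (f4 x)) u v.
  apply/derivable_mxP => i; apply: ord4P; rewrite (ord1 i).
  - by rewrite (_ : (fun x => _) = f1) //; apply/funext => x; rewrite mxE.
  - by rewrite (_ : (fun x => _) = f2) //; apply/funext => x; rewrite mxE.
  - by rewrite (_ : (fun x => _) = f3) //; apply/funext => x; rewrite mxE.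
  - by rewrite (_ : (fun x => _) = f4) //; apply/funext => x; rewrite mxE.
split => //; rewrite derive_mx //; apply/rowP; apply: ord4P; rewrite !mxE /=.
- by rewrite (_ : (fun x => _) = f1) ?derive_val //; apply/funext => x; rewrite mxE.
- by rewrite (_ : (fun x => _) = f2) ?derive_val //; apply/funext => x; rewrite mxE.
- by rewrite (_ : (fun x => _) = f3) ?derive_val //; apply/funext => x; rewrite mxE.
- by rewrite (_ : (fun x => _) = f4) ?derive_val //; apply/funext => x; rewrite mxE.
Qed.

Lemma is_derive_coord F u v i : derivable F u v ->
  is_derive u v (fun x => F x 0 i) ('D_v F u 0 i).
Proof.
move=> h; split; first by move/derivable_mxP: h; exact.
by rewrite derive_mx // mxE.
Qed.

Lemma is_derive_x1 F u v : derivable F u v -> is_derive u v (fun x => x1 (F x)) (x1 ('D_v F u)).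
Proof. exact: is_derive_coord. Qed.
Lemma is_derive_y1 F u v : derivable F u v -> is_derive u v (fun x => y1 (F x)) (y1 ('D_v F u)).
Proof. exact: is_derive_coord. Qed.
Lemma is_derive_x2 F u v : derivable F u v -> is_derive u v (fun x => x2 (F x)) (x2 ('D_v F u)).
Proof. exact: is_derive_coord. Qed.
Lemma is_derive_y2 F u v : derivable F u v -> is_derive u v (fun x => y2 (F x)) (y2 ('D_v F u)).
Proof. exact: is_derive_coord. Qed.

End Normed.

Lemma cvg_vec4 {T : Type} {F : set_system T} {FF : Filter F} (f1 f2 f3 f4 : T -> R) a b c d :
  f1 @ F --> a -> f2 @ F --> b -> f3 @ F --> c -> f4 @ F --> d ->
  (fun x => vec4 (f1 x) (f2 x) (f3 x) (f4 x)) @ F --> vec4 a b c d.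
Proof.
move=> h1 h2 h3 h4.
have E (k1 k2 k3 k4 : R) : vec4 k1 k2 k3 k4 = k1 *: vec4 1 0 0 0 + k2 *: vec4 0 1 0 0 +
    k3 *: vec4 0 0 1 0 + k4 *: vec4 0 0 0 1.
  by apply: vec4P; rewrite !coordE; ring.
rewrite E; under eq_fun do rewrite E.
by apply: cvgD; [apply: cvgD; [apply: cvgD|]|]; exact: cvgZr_tmp.
Qed.

Lemma continuous_x1 : continuous (@x1 R). Proof. exact: coord_continuous. Qed.
Lemma continuous_y1 : continuous (@y1 R). Proof. exact: coord_continuous. Qed.
Lemma continuous_x2 : continuous (@x2 R). Proof. exact: coord_continuous. Qed.
Lemma continuous_y2 : continuous (@y2 R). Proof. exact: coord_continuous. Qed.

Lemma cvg_dot {T : Type} {F : set_system T} {FF : Filter F} (f g : T -> 'rV[R]_4) p q :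
  f @ F --> p -> g @ F --> q -> (fun x => dot (f x) (g x)) @ F --> dot p q.
Proof.
move=> hf hg; rewrite dot4; under eq_fun do rewrite dot4.
have cc (i : 'rV[R]_4 -> R) : continuous i -> (fun x => i (f x) * i (g x)) @ F --> i p * i q.
  move=> ci; apply: cvgM; first exact: (cvg_comp f i hf (ci p)).
  exact: (cvg_comp g i hg (ci q)).
apply: cvgD; [apply: cvgD; [apply: cvgD|]|]; apply: cc.
- exact: continuous_x1.
- exact: continuous_y1.
- exact: continuous_x2.
- exact: continuous_y2.
Qed.

Lemma differentiable_vec4 {V : normedModType R} (f1 f2 f3 f4 : V -> R) u :
  differentiable f1 u -> differentiable f2 u -> differentiable f3 u -> differentiable f4 u ->
  differentiable (fun x => vec4 (f1 x) (f2 x) (f3 x) (f4 x)) u.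
Proof.
move=> h1 h2 h3 h4.
have E (k1 k2 k3 k4 : R) : vec4 k1 k2 k3 k4 = k1 *: vec4 1 0 0 0 + k2 *: vec4 0 1 0 0 +
    k3 *: vec4 0 0 1 0 + k4 *: vec4 0 0 0 1.
  by apply: vec4P; rewrite !coordE; ring.
under eq_fun do rewrite E.
by do 3 (apply: differentiableD; last exact: differentiableZl); exact: differentiableZl.
Qed.

Lemma is_derive_dot (F : R -> 'rV[R]_4) (e : 'rV[R]_4) s : differentiable F s ->
  is_derive s 1 (fun u => dot (F u) e) (dot (derive1 F s) e).
Proof.
move=> dF; have h : derivable F s 1 by exact: diff_derivable.
rewrite (_ : (fun u => _) = (fun u => x1 (F u) * x1 e + y1 (F u) * y1 e + x2 (F u) * x2 e
  + y2 (F u) * y2 e)); last by apply/funext => u; rewrite dot4.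
have := (is_derive_x1 h, is_derive_y1 h, is_derive_x2 h, is_derive_y2 h) => -[[[d1 d2] d3] d4].
apply: is_derive_eq; rewrite dot4 derive1E.
by rewrite !scaler0 !add0r /GRing.scale /=; ring.
Qed.

End VectorCalculus.

(** * Real functions on an interval *)

Lemma within_continuousE (S T : topologicalType) (A : set S) (f : S -> T) :
  {within A, continuous f} <->
  forall s, A s -> forall B, nbhs (f s) B -> nbhs s [set y | A y -> B (f y)].
Proof. by rewrite subspace_continuousP. Qed.

Section RealAnalysis.
Context {R : realType}.
Implicit Types (I : set R) (f g : R -> R).

Lemma is_derive_continuous f (s d : R) : is_derive s 1 f d -> {for s, continuous f}.
Proof.
by move=> [h _]; apply: differentiable_continuous; exact/derivable1_diffP.
Qed.

Lemma chain_rule f g (x y a b d : R) : g x = y -> is_derive y 1 f a -> is_derive x 1 g b ->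
  d = a * b -> is_derive x 1 (fun u => f (g u)) d.
Proof. by move=> <- hf hg ->; exact: is_derive1_comp. Qed.

Lemma near_const_derive f (s d k : R) : is_derive s 1 f d -> (\forall y \near s, f y = k) -> d = 0.
Proof.
move=> h hk; have h0 : is_derive s 1 f 0.
  have hc : is_derive s 1 (cst k) (0 : R) := is_derive_cst k s 1.
  by apply: near_eq_is_derive hc; apply: filterS hk => y ->.
by case: h h0 => [_ <-] [_ <-].
Qed.

Lemma interval_mem {I} (s t u : R) : is_interval I -> I s -> I t -> s <= u <= t -> I u.
Proof. by move=> h hs ht /h; exact. Qed.

Lemma interior_interval I : is_interval I -> is_interval (I°).
Proof.
move=> hI x y hx hy z /andP[]; rewrite le_eqVlt => /orP[/eqP <- //|xz].
rewrite le_eqVlt => /orP[/eqP -> //|zy].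
have sub : `]x, y[ `<=` I.
  move=> u /=; rewrite in_itv /= => hu; apply: (hI x y); [exact: interior_subset..|lra].
rewrite /interior; apply: filterS sub _; apply: open_nbhs_nbhs; split; first exact: itv_open.
by rewrite /= in_itv /= xz zy.
Qed.

Lemma derive_mvt I f f' (s t : R) : is_interval I -> (forall u, I u -> is_derive u 1 f (f' u)) ->
  I s -> I t -> s < t -> exists2 u, s < u < t & f t - f s = f' u * (t - s).
Proof.
move=> hI hf hs ht st.
have Iin u : s <= u <= t -> I u by exact: interval_mem.
have [u||u hu e] := @MVT R f f' s t st.
- by rewrite in_itv /= => /andP[h1 h2]; apply: hf; apply: Iin; lra.
- apply: continuous_in_subspaceT => u /[!inE] /= /[!in_itv] /= h.
  exact/is_derive_continuous/hf/Iin.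
by exists u => //; move: hu; rewrite in_itv.
Qed.

Lemma derive0_const I f (s t : R) : is_interval I -> (forall u, I u -> is_derive u 1 f 0) ->
  I s -> I t -> f s = f t.
Proof.
move=> hI hf; wlog st : s t / s <= t.
  by move=> h hs ht; case: (leP s t) => [/h|/ltW/h hh]; [exact|apply/esym/hh].
move=> hs ht; move: st; rewrite le_eqVlt => /orP[/eqP -> //|st].
have [u _] := @derive_mvt I f (fun=> 0) s t hI hf hs ht st.
by rewrite mul0r => /eqP; rewrite subr_eq0 => /eqP.
Qed.

Lemma derive_gt0_lt I f f' (s t : R) : is_interval I ->
  (forall u, I u -> is_derive u 1 f (f' u)) -> (forall u, I u -> 0 < f' u) ->
  I s -> I t -> s < t -> f s < f t.
Proof.
move=> hI hf f0 hs ht st; have [u /andP[su ut] e] := derive_mvt hI hf hs ht st.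
have hu : I u by apply: (interval_mem hI hs ht); rewrite !ltW.
by rewrite -subr_gt0 e mulr_gt0 ?subr_gt0// f0.
Qed.

Lemma derive_ge1_le I f f' (s t : R) : is_interval I ->
  (forall u, I u -> is_derive u 1 f (f' u)) -> (forall u, I u -> 1 <= f' u) ->
  I s -> I t -> s <= t -> t - s <= f t - f s.
Proof.
move=> hI hf f0 hs ht; rewrite le_eqVlt => /orP[/eqP ->|st]; first by rewrite !subrr.
have [u /andP[su ut] e] := derive_mvt hI hf hs ht st.
have hu : I u by apply: (interval_mem hI hs ht); rewrite !ltW.
by rewrite e ler_peMl ?subr_ge0 ?(ltW st)// f0.
Qed.

Lemma ivt_interval I f (s t v : R) : is_interval I ->
  (forall u, I u -> {for u, continuous f}) -> I s -> I t -> f s <= v <= f t ->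
  exists2 u, I u & f u = v.
Proof.
move=> hI hf hs ht /andP[h1 h2].
have [st|/ltW st] := leP s t.
  have [||u hu e] := @IVT R f s t v st.
  - apply: continuous_in_subspaceT => u /[!inE] /= /[!in_itv] /= h.
    by apply: hf; exact: (interval_mem hI hs ht).
  - by rewrite ge_min h1 le_max h2 orbT.
  by exists u => //; move: hu; rewrite in_itv /=; exact: (interval_mem hI hs ht).
have [||u hu e] := @IVT R f t s v st.
- apply: continuous_in_subspaceT => u /[!inE] /= /[!in_itv] /= h.
  by apply: hf; exact: (interval_mem hI ht hs).
- by rewrite ge_min h1 le_max h2 !orbT.
by exists u => //; move: hu; rewrite in_itv /=; exact: (interval_mem hI ht hs).
Qed.

(** A continuous derivative with values 1 and -1 cannot jump. *)
Lemma unit_slope_affine f D (a b : R) : a < b ->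
  (forall s, a < s < b -> is_derive s 1 f (D s)) -> (forall s, a < s < b -> D s ^+ 2 = 1) ->
  (forall s, a < s < b -> {for s, continuous D}) ->
  exists e C, e * e = 1 /\ forall s, a < s < b -> f s = C + e * s.
Proof.
move=> ab df D1 cD.
have itv : is_interval [set s : R | a < s < b] by move=> x y /= hx hy z hz; lra.
have [c0 hc0] : exists c0, a < c0 < b by exists ((a + b) / 2); lra.
pose e := D c0; have e1 : e * e = 1 by rewrite -expr2 D1.
have nz u : a < u < b -> D u <> 0.
  by move=> hu h0; have := D1 u hu; rewrite h0 expr0n /= => /eqP; rewrite eq_sym oner_eq0.
have Dcst s : a < s < b -> D s = e.
  move=> hs; have /orP[/eqP //|/eqP opp] : (D s == e) || (D s == - e).
    by rewrite -eqf_sqr D1// expr2 e1.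
  exfalso; have [e0|e0] := leP 0 e.
    have [|u hu u0] := @ivt_interval _ D s c0 0 itv cD hs hc0.
      by rewrite -/e opp; lra.
    exact: nz u hu u0.
  have [|u hu u0] := @ivt_interval _ D c0 s 0 itv cD hc0 hs.
    by rewrite -/e opp; lra.
  exact: nz u hu u0.
exists e, (f c0 - e * c0); split => // s hs.
have := @derive0_const _ (fun x => f x - e * x) s c0 itv.
move=> /(_ _ hs hc0) h; apply/eqP; rewrite -subr_eq; apply/eqP; apply: h => u hu.
have du := df u hu; rewrite Dcst// in du.
have dl : is_derive u 1 (fun x : R => e * x) e.
  by apply: is_derive_eq; rewrite /GRing.scale /= mulr1 ?mul0r ?addr0 ?mulr0 ?add0r.
by rewrite -(subrr e); exact: is_deriveB.
Qed.

Lemma open_interval_room I (s : R) : open I -> I s -> exists2 e : R, 0 < e &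
  forall u, `|u - s| < e -> I u.
Proof.
move=> oI hs; have /nbhs_ballP[e /= e0 he] : nbhs s I by exact: open_nbhs_nbhs.
by exists e => // u hu; apply: he; rewrite /ball /= distrC.
Qed.

(** The interval may be unbounded and [f] is only continuous on [I], so the
    primitive is the difference of the integrals over [s0, x] and [x, s0]. *)
Lemma antiderivative I f (s0 : R) : open I -> is_interval I -> I s0 ->
  (forall s, I s -> {for s, continuous f}) ->
  exists F : R -> R, forall s, I s -> is_derive s 1 F (f s).
Proof.
move=> oI hI hs0 cf.
pose mu := @lebesgue_measure R.
have int a b : I a -> I b -> mu.-integrable `[a, b] (EFin \o f).
  move=> ha hb; apply: continuous_compact_integrable; first exact: segment_compact.
  apply: continuous_in_subspaceT => u /[!inE] /= /[!in_itv] /= h.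
  by apply: cf; exact: (interval_mem hI ha hb).
pose F (x : R) := ((\int[mu]_(u in `[s0, x]) f u) - (\int[mu]_(u in `[x, s0]) f u))%R.
have sub a x y : I a -> I y -> a <= x -> x <= y ->
    ((\int[mu]_(u in `[a, y]) f u) - (\int[mu]_(u in `[a, x]) f u) =
     \int[mu]_(u in `[x, y]) f u)%R.
  move=> ha hy ax xy.
  have hx : I x by apply: (interval_mem hI ha hy); rewrite ax xy.
  rewrite Rintegral_itvB ?bnd_simp//; last exact: int.
  rewrite Rintegral_itv_obnd_cbnd//.
  by apply: (integrableS _ _ _ (int _ _ hx hy)) => //; exact: subset_itv_oc_cc.
have z (x y : R) : y <= x -> (\int[mu]_(u in `[x, y]) f u = 0)%R.
  rewrite le_eqVlt => /orP[/eqP ->|yx]; first by rewrite set_itv1 Rintegral_set1.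
  by rewrite set_itv_ge ?Rintegral_set0// bnd_simp -ltNge.
exists F => s hs.
have [e1 e10 he1] := open_interval_room oI hs.
have [e2 e20 he2] := open_interval_room oI hs0.
have [a [ha as_ as0]] : exists a, [/\ I a, a < s & a < s0].
  have [ss|ss] := leP s s0.
    exists (s - e1 / 2); split; [|lra|lra].
    by apply: he1; rewrite addrAC subrr add0r normrN ger0_norm; lra.
  exists (s0 - e2 / 2); split; [|lra|lra].
  by apply: he2; rewrite addrAC subrr add0r normrN ger0_norm; lra.
have hb : I (s + e1 / 2) by apply: he1; rewrite addrAC subrr add0r ger0_norm; lra.
pose G (x : R) := (\int[mu]_(u in `[a, x]) f u)%R.
have [dG dGE] := @continuous_FTC1_closed R f a s (s + e1 / 2) (ltac:(lra)) (int _ _ ha hb) as_ (cf _ hs).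
have dG' : is_derive s 1 G (f s) by split; [exact: dG|rewrite -derive1E; exact: dGE].
apply: (@near_eq_is_derive _ _ _ (fun x => G x - G s0)); last first.
  by rewrite -[f s]subr0; apply: is_deriveB.
apply/nbhs_ballP; exists (Order.min (e1 / 2) (s - a)).
  by rewrite /= lt_min; lra.
move=> x; rewrite /ball /= lt_min => /andP[]; rewrite distrC !ltr_distl => h1 h2.
have hx : I x by apply: (interval_mem hI ha hb); lra.
rewrite /F /G; have [xs|/ltW xs] := leP s0 x.
  by rewrite (z x s0)// subr0 sub//; lra.
rewrite (z s0 x)// sub0r -(sub a x s0)//; last lra.
by rewrite opprB.
Qed.

Lemma angle (a b : R) : a ^+ 2 + b ^+ 2 = 1 -> exists t, a = cos t /\ b = sin t.
Proof.
move=> h; have ha : -1 <= a <= 1 by have := sqr_ge0 b; nra.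
have e : cos (acos a) = a by apply: acosK; rewrite in_itv.
have s2 : sin (acos a) ^+ 2 = b ^+ 2 by rewrite sin2cos2 e -h; ring.
have /orP[/eqP <-|/eqP hb] : (sin (acos a) == b) || (sin (acos a) == - b) by rewrite -eqf_sqr; apply/eqP.
  by exists (acos a).
by exists (- acos a); rewrite cosN sinN e hb opprK.
Qed.

Lemma polar (a b : R) : exists t, a = Num.sqrt (a ^+ 2 + b ^+ 2) * cos t /\
  b = Num.sqrt (a ^+ 2 + b ^+ 2) * sin t.
Proof.
set n := Num.sqrt _.
have n2 : n ^+ 2 = a ^+ 2 + b ^+ 2 by rewrite sqr_sqrtr// addr_ge0 ?sqr_ge0.
have [n0|n0] := eqVneq n 0.
  have := (sqr_ge0 a, sqr_ge0 b) => -[ga gb].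
  move: n2; rewrite n0 expr0n /= => n2.
  exists 0; rewrite !mul0r; split; apply/eqP; rewrite -sqrf_eq0; apply/eqP; lra.
have [|t [h1 h2]] := @angle (a / n) (b / n).
  by rewrite !expr_div_n -mulrDl -n2 divff// expf_neq0.
by exists t; rewrite -h1 -h2 !(mulrC n) !divfK.
Qed.

Lemma cos_periodz (k : int) (x : R) : cos (x + (k%:~R * 2) * pi) = cos x.
Proof.
have P n (y : R) : cos (y + (n%:R * 2) * pi) = cos y.
  have := periodicn (@cosD2pi R) n y.
  by move=> <-; congr (cos (y + _)); rewrite -mulrA mulr_natl mulr_natl.
case: k => n; first exact: P.
rewrite NegzE mulrNz -[LHS](P n.+1); congr cos.
by rewrite -pmulrn; ring.
Qed.

Lemma sin_periodz (k : int) (x : R) : sin (x + (k%:~R * 2) * pi) = sin x.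
Proof.
have e (y : R) : sin y = cos (y - pi / 2) by rewrite cosBpihalf.
by rewrite e addrAC cos_periodz -e.
Qed.

Lemma cos_sin_eq (s t : R) : cos s = cos t -> sin s = sin t -> exists m : int, s = t + (m%:~R * 2) * pi.
Proof.
move=> hc hs.
have c1 : cos (s - t) = 1 by rewrite cosB hc hs -!expr2 cos2Dsin2.
have pi0 := @pi_gt0 R.
pose m := Num.floor ((s - t) / (2 * pi)).
have [m1 m2] : m%:~R <= (s - t) / (2 * pi) /\ (s - t) / (2 * pi) < m%:~R + 1.
  split; first exact: floor_le_tmp.
  have := floorD1_gt ((s - t) / (2 * pi)); by rewrite intrD.
move: m1 m2; rewrite ler_pdivlMr ?ltr_pdivrMr; [|lra|lra] => m1 m2.
pose d := s - t - m%:~R * (2 * pi).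
have d0 : 0 <= d by rewrite /d subr_ge0.
have d1 : d < 2 * pi by rewrite /d; lra.
have cper (k : int) (x : R) : cos (x - k%:~R * (2 * pi)) = cos x.
  by rewrite -(cos_periodz k) -mulrA subrK.
have cd : cos d = 1 by rewrite cper.
have : d = 0.
  have [dp|dp] := leP d pi.
    apply: cos_inj; rewrite ?in_itv /= ?cos0//; lra.
  have : cos (2 * pi - d) = 1.
    rewrite -cosN opprB -[X in _ - X]mul1r; have := cper 1 d; by rewrite cd.
  rewrite -[RHS]cos0 => /cos_inj; rewrite !in_itv /= => h.
  have : 2 * pi - d = 0 by apply: h; lra.
  by lra.
by rewrite /d => e; exists m; lra.
Qed.

End RealAnalysis.

(** * Regularity and changes of parameters *)

Section LocalRegularity.
Context {R : realType} {V W : normedModType R}.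
Implicit Types (U : set V) (f g : V -> W).

Lemma near_eq_differentiable f g (x : V) :
  (\forall y \near x, f y = g y) -> differentiable f x -> differentiable g x.
Proof.
move=> fg df.
have fgx : f x = g x by apply: nbhs_singleton fg.
have E : g \o shift x = cst (g x) + 'd f x +o_ 0 id.
  apply/eqaddoP => e e0.
  have /eqaddoP /(_ e e0) h := diff_locally df.
  have h' : \forall y \near (0 : V), f (y + x) = g (y + x).
    by move: fg; rewrite (near_shift 0); apply: filterS => y /=; rewrite subr0.
  near=> y; rewrite !fctE /= -fgx.
  rewrite -(near h' y) //.
  have : `|(f \o shift x - (cst (f x) + 'd f x)) y| <= e * `|y| by near: y; exact: h.
  by rewrite !fctE /=.
apply/diff_locallyP; rewrite (diff_unique _ E); first by split => //; exact: diff_continuous.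
exact: diff_continuous.
Unshelve. all: by end_near. Qed.

Lemma C1_on_local U f : (forall u, U u -> exists A g,
    [/\ open A, A u, C1_on A g & forall u', A u' -> f u' = g u']) -> C1_on U f.
Proof.
move=> h u hu; have [A [g [oA Au Cg fg]]] := h u hu.
have nA : \forall y \near u, A y by exact: open_nbhs_nbhs.
have [dg cg] := Cg u Au; split.
  by apply: near_eq_differentiable dg; near=> y; apply/esym/fg; near: y.
move=> v.
have e y : A y -> 'D_v f y = 'D_v g y.
  move=> Ay; apply: near_eq_derive; have : \forall y' \near y, A y' by exact: open_nbhs_nbhs.
  by apply: filterS => y'; exact: fg.
change ('D_v f y @[y --> u] --> 'D_v f u); rewrite e //; apply: cvg_trans (cg v); apply: near_eq_cvg.
by near=> y; apply/esym/e; near: y.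
Unshelve. all: by end_near. Qed.

End LocalRegularity.

Section LocalRegularity2.
Context {R : realType} {V W : normedModType R}.
Implicit Types (U : set V) (f g : V -> W).

Lemma C2_on_local U f : (forall u, U u -> exists A g,
    [/\ open A, A u, C2_on A g & forall u', A u' -> f u' = g u']) -> C2_on U f.
Proof.
move=> h; split.
  apply: C1_on_local => u /h [A [g [oA Au [Cg _] fg]]]; by exists A, g.
move=> v; apply: C1_on_local => u /h [A [g [oA Au [_ Cg] fg]]].
exists A, (fun u => 'D_v g u); split => // y Ay.
apply: near_eq_derive; have : \forall y' \near y, A y' by exact: open_nbhs_nbhs.
by apply: filterS => y'; exact: fg.
Qed.

Lemma C2_onS U U' f : U' `<=` U -> C2_on U f -> C2_on U' f.
Proof. by move=> s [h1 h2]; split=> [u /s /h1 //|v u /s]; exact: h2. Qed.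

Lemma C2_on_eq U f g : open U -> (forall u, U u -> f u = g u) -> C2_on U f -> C2_on U g.
Proof.
by move=> oU fg Cf; apply: C2_on_local => u hu; exists U, f; split => // u' /fg.
Qed.

(** Stated for maps with a given linear part, so that it serves both the changes
    of parameters of the surface and the two projections of the plane. *)
Lemma affine_comp_derive (V' : normedModType R) (L : V' -> V) (l : {linear V' -> V}) f (u v : V') :
  continuous l -> (forall x, L x = l x + L 0) -> differentiable f (L u) ->
  differentiable (f \o L) u /\ 'D_v (f \o L) u = 'D_(l v) f (L u).
Proof.
move=> cl hL df.
have dL : is_diff u L l.
  have -> : L = (fun x => l x + cst (L 0) x) by apply/funext => x; rewrite hL.
  have dl : is_diff u l l.
    by apply: DiffDef; [exact: linear_differentiable|rewrite diff_lin].
  have := is_diffD dl (is_diff_cst (L 0) u).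
  by rewrite (_ : (l : _ -> _) + 0 = l) ?addr0.
have d : differentiable (f \o L) u by apply: differentiable_comp => //; exact: ex_diff.
split => //; rewrite !deriveE // diff_comp //=.
by rewrite diff_val.
Qed.

Section AffineChange.
Variables (V' : normedModType R) (L : V' -> V) (l : {linear V' -> V}) (U : set V) (f : V -> W).
Hypotheses (cl : continuous l) (hL : forall x, L x = l x + L 0) (oU : open U).

Lemma affine_continuous : continuous L.
Proof.
move=> x; have -> : L = (fun x => l x + L 0) by apply/funext => y; rewrite -hL.
by apply: cvgD; [exact: cl|exact: cvg_cst].
Qed.

Lemma C1_on_affine (g : V -> W) : C1_on U g -> C1_on (L @^-1` U) (g \o L).
Proof.
have cL := affine_continuous.
have oU' : open (L @^-1` U) by move/continuousP: cL; exact.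
move=> Cg u hu; have [dg cg] := Cg _ hu.
split; first by have [] := affine_comp_derive 0 cl hL dg.
move=> v; change ('D_v (g \o L) y @[y --> u] --> 'D_v (g \o L) u).
have [_ ->] := affine_comp_derive v cl hL dg.
apply: (@cvg_trans _ (('D_(l v) g \o L) y @[y --> u])); last first.
  exact: (cvg_comp L ('D_(l v) g) (cL u) (cg (l v))).
apply: near_eq_cvg; have : \forall y \near u, (L @^-1` U) y by exact: open_nbhs_nbhs.
by apply: filterS => y hy /=; have [_ ->] := affine_comp_derive v cl hL (proj1 (Cg _ hy)).
Qed.

Lemma C2_on_affine : C2_on U f -> C2_on (L @^-1` U) (f \o L).
Proof.
move=> [C1 C2]; split; first exact: C1_on_affine.
move=> v; apply: C1_on_local => u' hu'; exists (L @^-1` U), ('D_(l v) f \o L).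
have oU' : open (L @^-1` U) by move/continuousP: affine_continuous; exact.
split; [exact: oU'|exact: hu'|exact: (C1_on_affine (C2 _))|].
by move=> y hy; have [_ ->] := affine_comp_derive v cl hL (proj1 (C1 _ hy)).
Qed.

End AffineChange.

End LocalRegularity2.

Section LocalParameters.
Context {R : realType} (M : topologicalType) (phi : M -> 'rV[R]_4).
Implicit Types (U : set (R * R)) (psi : R * R -> M).

Lemma local_param_open U psi : local_param phi U psi -> open U.
Proof. by case=> _ _ _ []. Qed.

Lemma local_param_eq U U' psi psi' : open U' -> U' `<=` U ->
  (forall u, U' u -> psi u = psi' u) -> local_param phi U psi -> local_param phi U' psi'.
Proof.
move=> oU' sU epsi [cpsi ipsi opsi [oU CX imm]].
have nU' u : U' u -> \forall y \near u, U' y by move=> ?; exact: open_nbhs_nbhs.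
split.
- move=> u hu; change (psi' y @[y --> u] --> psi' u); rewrite -(epsi _ hu).
  apply: cvg_trans (cpsi u (sU _ hu)); apply: near_eq_cvg.
  by apply: filterS (nU' u hu) => y /epsi.
- by move=> u u' hu hu'; rewrite -!epsi//; apply: ipsi; exact: sU.
- move=> A AU oA; have -> : psi' @` A = psi @` A.
    by apply/seteqP; split=> x /= [y Ay <-]; exists y => //; rewrite epsi//; exact: AU.
  by apply: opsi => // y /AU/sU.
split; first exact: oU'.
- apply: (C2_on_eq oU' _ (C2_onS sU CX)) => u hu /=; by rewrite epsi.
move=> u v hu; rewrite -(@near_eq_derive _ _ _ (phi \o psi)); first by apply: imm; exact: sU.
by apply: filterS (nU' u hu) => y hy /=; rewrite epsi.
Qed.

(** Reversing a profile curve and shifting its parameter act on the parameter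
    plane of the swept surface through these maps, with [e] = 1 or -1. *)
Definition slide (e p q : R) (u : R * R) : R * R := (e * u.1 + p, u.2 + q).

Lemma cvg_pair_at (T : topologicalType) (f g : T -> R) (x : T) : f y @[y --> x] --> f x ->
  g y @[y --> x] --> g x -> (f y, g y) @[y --> x] --> (f x, g x).
Proof. by move=> hf hg; have := cvg_pair hf hg; exact. Qed.

Let lin (e : R) (u : R * R) : R * R := (e * u.1, u.2).
Fact lin_is_linear e : linear (lin e).
Proof. by move=> k u v; rewrite /lin /= mulrDr [e * (k *: _)]mulrCA. Qed.
HB.instance Definition _ e := GRing.isLinear.Build _ _ _ _ (lin e) (lin_is_linear e).

Lemma slide_continuous e p q : continuous (slide e p q).
Proof.
move=> u; apply: (@cvg_pair_at _ (fun u : R * R => e * u.1 + p) (fun u => u.2 + q)) => /=.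
  apply: cvgD; [|exact: cvg_cst]; apply: cvgM; [exact: cvg_cst|exact: cvg_fst].
by apply: cvgD; [exact: cvg_snd|exact: cvg_cst].
Qed.

Lemma slideK e p q : e * e = 1 -> cancel (slide e p q) (slide e (- e * p) (- q)).
Proof.
move=> e1 [u1 u2]; rewrite /slide /=; congr (_, _); last by rewrite addrK.
by rewrite mulrDr mulrA e1 mul1r mulNr addrK.
Qed.

Lemma slideKV e p q : e * e = 1 -> cancel (slide e (- e * p) (- q)) (slide e p q).
Proof.
move=> e1 [u1 u2]; rewrite /slide /=; congr (_, _); last by rewrite subrK.
by rewrite mulrDr !mulrA e1 mul1r mulrN e1 mulN1r subrK.
Qed.

Lemma local_param_slide U psi e p q : e * e = 1 -> local_param phi U psi ->
  local_param phi (slide e p q @^-1` U) (psi \o slide e p q).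
Proof.
move=> e1 [cpsi ipsi opsi [oU [C1 C2] imm]].
set L := slide e p q.
have cL : continuous L by exact: slide_continuous.
have oU' : open (L @^-1` U) by move/continuousP: cL; exact.
have cl : continuous (lin e).
  move=> u; apply: (@cvg_pair_at _ (fun u : R * R => e * u.1) snd) => /=; last exact: cvg_snd.
  by apply: cvgM; [exact: cvg_cst|exact: cvg_fst].
have hL u : L u = lin e u + L 0.
  by rewrite /L /slide /lin /=; congr (_, _); rewrite /= ?mulr0 ?add0r.
have e0 : e != 0 by apply: contra_eq_neq e1 => ->; rewrite mulr0 eq_sym oner_eq0.
split.
- by move=> u hu; apply: continuous_comp; [exact: cL|exact: cpsi].
- move=> u u' hu hu' /= h; apply: (can_inj (slideK p q e1)); exact: ipsi.
- move=> A AU oA; have -> : (psi \o L) @` A = psi @` (slide e (- e * p) (- q) @^-1` A).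
    apply/seteqP; split=> x /= [y Ay <-].
      by exists (L y) => //=; rewrite slideK.
    by exists (slide e (- e * p) (- q) y) => //=; rewrite /L slideKV.
  apply: opsi; first by move=> y /= /AU /=; rewrite /L slideKV.
  by have /continuousP := @slide_continuous e (- e * p) (- q); exact.
split; first exact: oU'.
- exact: (@C2_on_affine R (R * R)%type 'rV[R]_4 (R * R)%type L (lin e) U (phi \o psi) cl hL oU (conj C1 C2)).
move=> u v hu.
have [_ E] := affine_comp_derive v cl hL (proj1 (C1 _ hu)).
change ('D_v ((phi \o psi) \o L) u = 0 -> v = 0); rewrite E => /imm => /(_ hu).
case: v {E} => v1 v2 [] /= h1 h2; apply/eqP; rewrite /eq_op /= h2 eqxx andbT.
by move/eqP: h1; rewrite mulf_eq0 (negPf e0).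
Qed.

End LocalParameters.

(** * Limits of profile curves *)

Section ProfileCurves.
Context {R : realType} (M : topologicalType) (phi : M -> 'rV[R]_4) (rho : R -> M -> M).
Implicit Types (J : set R) (c : R -> M).

Lemma profile_differentiable J c s : profile_curve phi rho J c -> J° s ->
  differentiable (phi \o c) s.
Proof. by move=> P hs; have [C1 _] := profile_C2 P; have [] := C1 s hs. Qed.

Lemma profile_velocity_continuous J c s : profile_curve phi rho J c -> J° s ->
  {for s, continuous (derive1 (phi \o c))}.
Proof.
move=> P hs; have -> : derive1 (phi \o c) = 'D_1 (phi \o c) by apply/funext => y; rewrite derive1E.
by have [C1 _] := profile_C2 P; have [_ /(_ 1)] := C1 s hs.
Qed.

Lemma interior_opp J s : (-%R @^-1` J)° s <-> J° (- s).
Proof.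
have co : continuous (-%R : R -> R) by move=> x; exact: opp_continuous.
split=> h; last exact: (co s).
have : nbhs (- s) (-%R @^-1` (-%R @^-1` J)) by apply: (co (- s)); rewrite /= opprK.
by rewrite /= -[X in nbhs _ X -> _]/(fun y => J (- - y)); under eq_fun do rewrite opprK.
Qed.

Lemma is_interval_opp J : is_interval J -> is_interval (-%R @^-1` J).
Proof.
move=> hJ x y /= hx hy z /andP[h1 h2]; apply: (hJ _ _ hy hx); lra.
Qed.

Lemma profile_reverse J c : profile_curve phi rho J c ->
  profile_curve phi rho (-%R @^-1` J) (c \o -%R).
Proof.
move=> P; case: (P) => iJ cc hc C2 al sw.
have co : continuous (-%R : R -> R) by move=> x; exact: opp_continuous.
have hL (s : R) : - s = (- s) + - 0 by rewrite oppr0 addr0.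
split.
- exact: is_interval_opp.
- apply/subspace_continuousP => s /= hs B hB.
  move/subspace_continuousP: cc => /(_ _ hs B hB) /co; exact.
- by move=> s /= /hc.
- have E : (-%R @^-1` J)° = -%R @^-1` J° by apply/seteqP; split=> s; [exact: (proj1 (interior_opp J s))|exact: (proj2 (interior_opp J s))].
  rewrite E.
  exact: (@C2_on_affine R R 'rV[R]_4 R -%R -%R J° (phi \o c) co hL (open_interior J) C2).
- move=> s /interior_opp hs.
  rewrite derive1E; have [_ ->] := @affine_comp_derive R R 'rV[R]_4 R -%R -%R (phi \o c) s 1 co hL (proj1 (C2.1 _ hs)).
  rewrite deriveE ?linearN; last exact: (C2.1 _ hs).1.
  rewrite -deriveE; last exact: (C2.1 _ hs).1.
  rewrite -derive1E /enorm; have -> : dot (- (derive1 (phi \o c) (- s))) (- (derive1 (phi \o c) (- s)))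
    = dot (derive1 (phi \o c) (- s)) (derive1 (phi \o c) (- s)).
    by rewrite !dot4 !coordE; ring.
  exact: al.
move=> s t /= hs x0; have [U [Ust UJ lp]] := sw _ t hs x0.
exists (slide (-1) 0 0 @^-1` U); split.
- by rewrite /slide /= mulN1r !addr0.
- by move=> u /= /UJ; rewrite /slide /= mulN1r addr0.
have e1 : -1 * -1 = 1 :> R by rewrite mulrNN mulr1.
have := local_param_slide 0 0 e1 lp.
apply: local_param_eq => //.
- apply: (local_param_open (local_param_slide 0 0 e1 lp)).
- by move=> u hu /=; rewrite /slide /= mulN1r !addr0.
Qed.

Lemma generating_reverse J c : generating_curve phi rho J c ->
  generating_curve phi rho (-%R @^-1` J) (c \o -%R).
Proof.
case=> P mx cov; split; first exact: profile_reverse.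
- move=> J' c' sub ext P'.
  have E : -%R @^-1` J' = J.
    apply: (mx _ (c' \o -%R)) (profile_reverse P').
      by move=> s hs; apply: sub => /=; rewrite opprK.
    by move=> s hs /=; rewrite ext /= opprK.
  by rewrite -E; apply/seteqP; split=> s /=; rewrite opprK.
move=> m; have [s [t [hs ->]]] := cov m; exists (- s), t; rewrite /= opprK; by split.
Qed.

(** The chord between two points is at most the arc: the derivative of the scalar
    product with the unit vector along the chord is at most 1. *)
Lemma profile_lipschitz J c s t : profile_curve phi rho J c -> J° s -> J° t ->
  enorm (phi (c t) - phi (c s)) <= `|t - s|.
Proof.
move=> P; wlog st : s t / s <= t.
  move=> h hs ht; have [/h|/ltW/h hh] := leP s t; first exact.
  rewrite distrC; have := hh ht hs.
  by rewrite /enorm !dot4 !coordE; congr (Num.sqrt _ <= _); ring.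
move=> hs ht; rewrite ger0_norm ?subr_ge0//.
set e := phi (c t) - phi (c s).
have iJ := interior_interval (profile_interval P).
move: st; rewrite le_eqVlt => /orP[/eqP e0|st].
  by rewrite /e e0 !subrr /enorm dot4 x10 y10 x20 y20 !mulr0 !addr0 sqrtr0.
have [] := @derive_mvt R J° (fun u => dot (phi (c u)) e)
  (fun u => dot (derive1 (phi \o c) u) e) s t iJ _ hs ht st.
  by move=> u hu; apply: (is_derive_dot e); exact: profile_differentiable P hu.
move=> u /andP[su ut] E.
have hu : J° u by apply: (iJ s t hs ht); rewrite !ltW.
have : dot e e <= enorm e * (t - s).
  have -> : dot e e = dot (phi (c t)) e - dot (phi (c s)) e.
    by rewrite !dot4 /e !coordE; ring.
  rewrite E ler_pM2r ?subr_gt0//.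
  by have := dot_le_enorm (derive1 (phi \o c) u) e; rewrite (profile_arclength P hu) mul1r.
rewrite -enorm_sqr expr2.
have [->|en0] := eqVneq (enorm e) 0; first by move=> _; rewrite subr_ge0 ltW.
by rewrite ler_pM2l// lt_def en0 enorm_ge0.
Qed.

Lemma profile_continuous_at J c s : profile_curve phi rho J c -> J° s -> {for s, continuous c}.
Proof.
move=> P hs; move/subspace_continuousP: (profile_continuous P) => /(_ s (interior_subset hs)).
by rewrite within_interior.
Qed.

Lemma profile_joined J c s t (L : R) : profile_curve phi rho J c -> J° s -> J° t ->
  `|t - s| <= L -> joined phi (c s) (c t) L.
Proof.
move=> P hs ht hL.
have iJ := interior_interval (profile_interval P).
have inJ (u : R) : 0 <= u <= 1 -> J° (s + u * (t - s)).
  move=> /andP[u0 u1]; have [st|/ltW st] := leP s t.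
    by apply: (iJ s t) => //; nra.
  by apply: (iJ t s) => //; nra.
exists (fun u => c (s + u * (t - s))); split.
- apply: continuous_in_subspaceT => u /[!inE] /= /[!in_itv] /= hu.
  apply: (@cvg_comp _ _ _ (fun u => s + u * (t - s)) c _ (nbhs (s + u * (t - s)))).
    by apply: cvgD; [exact: cvg_cst|apply: cvgM; [exact: cvg_id|exact: cvg_cst]].
  exact: (profile_continuous_at P (inJ _ hu)).
- by rewrite mul0r addr0.
- by rewrite mul1r addrC subrK.
move=> n u u0 uS un.
have mono : {homo u : i j / (i <= j)%N >-> i <= j} by apply: homo_leq => //; exact: le_trans.
have hu i : (i <= n)%N -> 0 <= u i <= 1.
  move=> hi; apply/andP; split; first by apply: (le_trans u0); exact: mono.
  by apply: le_trans un; exact: mono.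
apply: (@le_trans _ _ (\sum_(0 <= i < n) (`|t - s| * (u i.+1 - u i)))).
  rewrite !big_nat; apply: ler_sum => i /= hi.
  have := @profile_lipschitz J c (s + u i * (t - s)) (s + u i.+1 * (t - s)) P.
  move=> /(_ (inJ _ (hu i (ltnW hi))) (inJ _ (hu _ hi))) /le_trans; apply.
  have -> : s + u i.+1 * (t - s) - (s + u i * (t - s)) = (t - s) * (u i.+1 - u i) by ring.
  by rewrite normrM (ger0_norm (x := u i.+1 - u i))// subr_ge0.
rewrite -big_distrr /= telescope_sumr//.
apply: le_trans hL; rewrite ler_piMr//.
have := hu n (leqnn n); lra.
Qed.

Section RightEnd.
Hypothesis hausM : hausdorff_space M.
Hypothesis complM : complete_surface phi.
Variables (J : set R) (c : R -> M) (a b : R).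
Hypothesis P : profile_curve phi rho J c.
Hypotheses (ab : a < b) (abJ : forall s, a < s < b -> J° s).

Lemma profile_cauchy (x : nat -> R) : (forall n, a < x n < b) -> x @ \oo --> b ->
  exists m : M, (c \o x) @ \oo --> m.
Proof.
move=> hx xb; apply: complM => e e0.
move/cvgrPdist_lt: xb => /(_ (e / 2)); rewrite divr_gt0// => /(_ isT) [n0 _ hn0].
exists n0 => n k hn hk.
apply: (profile_joined P); [exact: abJ|exact: abJ|].
have := hn0 n hn; have := hn0 k hk; rewrite /= !ltr_distl => /andP[h1 h2] /andP[h3 h4].
by rewrite ler_distl; lra.
Qed.

(** By [profile_lipschitz] a piece of the curve of length d joins its end points,
    so any sequence of parameters tending to a finite end gives a Cauchy sequence
    of the surface. Two such sequences have the same limit, because interleaving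
    them gives a third one. *)
Lemma profile_limit : exists m : M, c s @[s --> b^'-] --> m.
Proof.
pose sn (n : nat) : R := b - (b - a) / n.+2%:R.
have sn_lt n : b - (b - a) / n.+1%:R < b by rewrite ltrBlDr ltrDl divr_gt0 ?subr_gt0.
have sn_gt n : a <= b - (b - a) / n.+1%:R.
  by rewrite lerBrDr -lerBrDl ler_pdivrMr// ler_peMr ?ler1n// subr_ge0 ltW.
have cv (k : nat) : (fun n : nat => b - (b - a) / (n + k).+1%:R) @ \oo --> b.
  rewrite -[X in _ --> X]subr0; apply: cvgB; first exact: cvg_cst.
  rewrite -[X in _ --> X](mulr0 (b - a)); apply: cvgM; first exact: cvg_cst.
  have := @cvg_harmonic R; rewrite -(cvg_shiftn k); exact.
have hs n : a < sn n < b.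
  rewrite sn_lt andbT /sn ltrBrDr -ltrBrDl ltr_pdivrMr// ltr_pMr ?subr_gt0//.
  by rewrite ltr1n.
have csn : sn @ \oo --> b by have := cv 1%N; under eq_fun do rewrite addn1.
have [m hm] := profile_cauchy hs csn.
exists m => A mA; apply: contrapT => nA.
have ex (n : nat) : exists t, [/\ sn n < t, t < b & ~ A (c t)].
  apply: contrapT => nex; apply: nA; exists (b - sn n).
    by rewrite /= subr_gt0; have /andP[] := hs n.
  move=> t; rewrite /ball /= => h tb; apply: contrapT => nAt; apply: nex; exists t; split => //.
  by move: h; rewrite gtr0_norm ?subr_gt0//; lra.
have [t ht] := choice ex.
have tab n : a < t n < b.
  by have [h1 h2 _] := ht n; have /andP[h3 _] := hs n; rewrite h2 andbT (lt_trans h3).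
pose y (n : nat) := if odd n then t n./2 else sn n./2.
have hy n : a < y n < b by rewrite /y; case: ifP.
have half_cvg : (fun n : nat => n./2) @ \oo --> \oo.
  move=> B [n0 _ hB]; exists n0.*2 => // n /= hn; apply: hB => /=.
  by rewrite -(doubleK n0) half_leq.
have cy : y @ \oo --> b.
  apply: (@squeeze_cvgr _ _ _ _ (sn \o (fun n : nat => n./2)) (cst b)).
  - near=> n; rewrite /y /=; case: ifP => _.
      by have [h1 h2 _] := ht n./2; rewrite !ltW.
    by have /andP[h1 h2] := hs n./2; rewrite lexx ltW.
  - exact: (cvg_comp _ _ half_cvg csn).
  - exact: cvg_cst.
have [m' hm'] := profile_cauchy hy cy.
have dbl : (fun n : nat => n.*2) @ \oo --> \oo.
  move=> B [n0 _ hB]; exists n0 => // n /= hn; apply: hB => /=.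
  by apply: (leq_trans hn); rewrite -addnn leq_addr.
have dblS : (fun n : nat => n.*2.+1) @ \oo --> \oo.
  move=> B [n0 _ hB]; exists n0 => // n /= hn; apply: hB => /=.
  by apply: (leq_trans hn); rewrite -addnn -addnS leq_addr.
have e1 : (c \o y) \o (fun n : nat => n.*2) = c \o sn.
  by apply/funext => n; rewrite /= /y odd_double doubleK.
have e2 : (c \o y) \o (fun n : nat => n.*2.+1) = c \o t.
  by apply/funext => n; rewrite /= /y oddS odd_double /= uphalf_double.
have hm1 : (c \o sn) @ \oo --> m' by rewrite -e1; exact: (cvg_comp _ _ dbl hm').
have hm2 : (c \o t) @ \oo --> m' by rewrite -e2; exact: (cvg_comp _ _ dblS hm').
have mm' : m = m' by apply: (cvg_unique hausM hm hm1).
move: hm2; rewrite -mm' => /(_ A mA) [n0 _ /(_ n0 (leqnn _)) /=].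
by have [] := ht n0.
Unshelve. all: by end_near. Qed.

End RightEnd.

End ProfileCurves.

(** * Ends of the generating curve *)

Section Extension.
Context {R : realType} (M : topologicalType) (phi : M -> 'rV[R]_4) (rho : R -> M -> M).

Lemma rot_id (t : R) p : cos t = 1 -> sin t = 0 -> Defs.rot t p = p.
Proof. by move=> ht hs; apply: vec4P; rewrite /Defs.rot !vecE // ht hs; ring. Qed.

(** The meridian half-plane x2 > 0, y2 = 0 meets each orbit of the rotations only
    once, so the angle between two of its points is trivial. *)
Lemma rot_hemisphere (t : R) (p q : 'rV[R]_4) : hemisphere p -> hemisphere q -> 0 < x2 p ->
  p = Defs.rot t q -> cos t = 1 /\ sin t = 0.
Proof.
move=> [_ [p2 p3]] [_ [q2 q3]] p0 E.
move: (congr1 (@x2 R) E) (congr1 (@y2 R) E); rewrite /Defs.rot !vecE q3 p3 !mulr0 subr0 addr0 => h1 h2.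
have q0 : x2 q != 0 by apply: contraTneq p0 => q0; rewrite h1 q0 mulr0 ltxx.
have s0 : sin t = 0 by apply/eqP; move/esym/eqP: h2; rewrite mulf_eq0 (negPf q0) orbF.
split => //; have := cos2Dsin2 t; rewrite s0 => h.
have c0 : 0 < cos t.
  have qp : 0 < x2 q by rewrite lt_def q0.
  by move: p0; rewrite h1 pmulr_lgt0.
nra.
Qed.

Lemma surface_continuous : (forall m, exists U psi u, [/\ local_param phi U psi, U u & psi u = m]) ->
  continuous phi.
Proof.
move=> ch m; have [U [psi [u [[cp ip op [oU [C1 _] _]] hu <-]]]] := ch m.
move=> B hB.
have cX : {for u, continuous (phi \o psi)}.
  by apply: differentiable_continuous; have [] := C1 u hu.
have [A [[oA Au] AB]] : exists A, open_nbhs u A /\ A `<=` U `&` (phi \o psi) @^-1` B.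
  have : nbhs u (U `&` (phi \o psi) @^-1` B).
    by apply: filterI; [exact: open_nbhs_nbhs|exact: cX].
  by rewrite nbhsE => -[A oA AB]; exists A.
have oI : open (psi @` A) by apply: op => // y /AB [].
have : nbhs (psi u) (psi @` A) by apply: open_nbhs_nbhs; split => //; exists u.
by apply: filterS => _ [y /AB [_ hy] <-].
Qed.

(** Testing g = g o sg on the direction [e] gives a scalar identity in which the
    outer derivative is not zero; this makes [sg] differentiable. Testing it on
    [e0] then shows that the square of its slope is 1. *)
Lemma unit_speed_reparam (g : R -> 'rV[R]_4) (sg : R -> R) (s : R) (e0 e : 'rV[R]_4) :
  (forall f, is_derive s 1 (fun u => dot (g u) f) (dot e0 f)) ->
  (forall f, is_derive (sg s) 1 (fun u => dot (g u) f) (dot e f)) ->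
  {for s, continuous sg} -> dot e0 e0 = 1 -> dot e e = 1 ->
  (\forall y \near s, g y = g (sg y)) ->
  is_derive s 1 sg (dot e0 e) /\ dot e0 e ^+ 2 = 1.
Proof.
move=> d1 d2 csg n1 n2 E.
have Es : g s = g (sg s) by exact: nbhs_singleton E.
have /is_derive1_caratheodory [q2 [q2E cq2 q2s]] := d2 e.
have /is_derive1_caratheodory [q1 [q1E cq1 q1s]] := d1 e.
have q21 : q2 (sg s) = 1 by rewrite q2s.
have cq : {for s, continuous (q2 \o sg)} by apply: (cvg_comp sg q2 csg cq2).
have near0 : \forall y \near s, q2 (sg y) != 0.
  have : \forall y \near s, (q2 \o sg) y > 0.
    by apply: (cvgr_gt _ cq); rewrite /= q21 ltr01.
  by apply: filterS => y /= h; rewrite gt_eqF.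
have ds : is_derive s 1 sg (dot e0 e).
  apply: (@near_eq_is_derive _ _ _ (fun y => sg s + q1 y / q2 (sg y) * (y - s))); last first.
    apply/is_derive1_caratheodory; exists (fun y => q1 y / q2 (sg y)); split.
    - by move=> z; rewrite subrr mulr0 addr0 addrAC subrr add0r.
    - apply: cvgM; first exact: cq1.
      by apply: cvgV; [rewrite q21 oner_neq0|exact: cq].
    - by rewrite q1s q21 divr1.
  near=> y.
  have hy : g y = g (sg y) by near: y.
  have hq : q2 (sg y) != 0 by near: y.
  have := q1E y; rewrite /= hy Es q2E => h.
  by rewrite mulrAC -h [q2 _ * _]mulrC mulfK// addrC subrK.
split; first exact: ds.
have hC : is_derive s 1 ((fun u => dot (g u) e0) \o sg) (dot e e0 * dot e0 e).
  exact: is_derive1_comp (d2 e0) ds.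
have hD : is_derive s 1 (fun u => dot (g u) e0) (dot e e0 * dot e0 e).
  apply: (@near_eq_is_derive _ _ _ ((fun u => dot (g u) e0) \o sg)) hC.
  by apply: filterS E => y hy; rewrite /= -hy.
have h : dot e0 e0 = dot e e0 * dot e0 e.
  have h1 := @derive_val _ _ _ _ _ _ _ (d1 e0).
  by rewrite -h1; exact: (@derive_val _ _ _ _ _ _ _ hD).
have sym : dot e e0 = dot e0 e by rewrite !dot4; ring.
by rewrite expr2 -{1}sym -h.
Unshelve. all: by end_near. Qed.

Variables (J : set R) (c : R -> M).
Hypothesis surf : C2_complete_connected_surface phi.
Hypothesis inv : rotationally_invariant phi rho.
Hypothesis gen : generating_curve phi rho J c.

Let P := gen_profile gen.
Let cphi : continuous phi := surface_continuous (surf_charts surf).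

Lemma rotation_continuous t : continuous (rho t).
Proof.
move=> m.
have h1 : (fun _ : M => t) @ m --> t by exact: cvg_cst.
have h2 : (fun m' : M => m') @ m --> m by exact: cvg_id.
have h : (fun m' : M => (t, m')) @ m --> (t, m) by have := cvg_pair h1 h2; exact.
exact: (cvg_comp _ _ h (@rho_continuous _ _ _ _ inv (t, m))).
Qed.

(** A strip swept near such a point is parameterized by an open set of pairs
    (position, angle) whose positions belong to [J]. *)
Lemma profile_open s : J s -> 0 < x2 (phi (c s)) -> J° s.
Proof.
move=> hs h0; have [U [Us UJ lp]] := profile_sweeps P 0 hs h0.
have oU := local_param_open lp.
have : nbhs (s, 0) U by exact: open_nbhs_nbhs.
move=> [[A B] /= [hA hB] sAB].
apply: filterS hA => y hy; apply: (UJ (y, 0)); apply: sAB; split => //=.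
exact: nbhs_singleton hB.
Qed.

Section AtRightEnd.
Variables (a b : R).
Hypotheses (ab : a < b) (abJ : forall s, a < s < b -> J° s) (Jb : forall s, J s -> s <= b).

Lemma end_mem_on_axis : J b -> x2 (phi (c b)) = 0.
Proof.
move=> hb; apply/eqP; rewrite eq_le (proj1 (profile_hemisphere P hb).2) andbT leNgt; apply/negP => h0.
have [e e0 he] : exists2 e : R, 0 < e & forall u, `|u - b| < e -> J° u.
  by apply: open_interval_room; [exact: open_interior|exact: profile_open].
have : J (b + e / 2).
  by apply: interior_subset; apply: he; rewrite addrAC subrr add0r ger0_norm; lra.
by move/Jb; lra.
Qed.

Section Limit.
Variable m : M.
Hypotheses (nJb : ~ J b) (hm : c s @[s --> b^'-] --> m).

Let Jlt s : J s -> s < b.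
Proof. by move=> hs; rewrite lt_def (Jb hs) andbT; apply/eqP => e; apply: nJb; rewrite e. Qed.

Lemma end_limit_phi : (phi \o c) s @[s --> b^'-] --> phi m.
Proof. exact: (cvg_comp c phi hm (@cphi m)). Qed.

Let near_left (Q : R -> Prop) : (forall s, a < s < b -> Q s) -> \forall s \near b^'-, Q s.
Proof.
move=> h; exists (b - a); first by rewrite /= subr_gt0.
move=> s; rewrite /ball /= => hs sb; apply: h; rewrite sb andbT.
by move: hs; rewrite gtr0_norm ?subr_gt0//; lra.
Qed.

Lemma end_limit_hemisphere : hemisphere (phi m).
Proof.
split; first exact: (surf_S3 surf).
have hx := cvg_comp (phi \o c) (@x2 R) end_limit_phi (@continuous_x2 R (phi m)).
have hy := cvg_comp (phi \o c) (@y2 R) end_limit_phi (@continuous_y2 R (phi m)).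
split.
  apply: (cvgr_to_ge hx); apply: near_left => s /abJ/interior_subset hs /=.
  exact: (proj1 (profile_hemisphere P hs).2).
have h0 : (@y2 R) \o (phi \o c) @ b^'- --> (0 : R).
  apply: (@cvg_trans _ ((fun=> 0 : R) @ b^'-)); last exact: cvg_cst.
  apply: near_eq_cvg; apply: near_left => s /abJ/interior_subset hs /=.
  by rewrite (proj2 (profile_hemisphere P hs).2).
exact: (cvg_unique _ hy h0).
Qed.

(** If the limit at a missing end is on the axis, adding it to the curve gives a
    longer profile curve: nothing is required of an end point on the axis beyond
    continuity. This contradicts maximality. *)
Lemma axis_limit_absurd : x2 (phi m) = 0 -> False.
Proof.
move=> m0.
pose c' s := if s < b then c s else m.
pose J' := J `|` [set b].
have J'b s : J' s -> s <= b by case=> [/Jb //|/= ->].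
have J'lt s : J' s -> s < b -> J s by case=> //= -> ; rewrite ltxx.
have ccJ s : J s -> c' s = c s by move=> hs; rewrite /c' Jlt.
have intJ s : J'° s -> J° s.
  move=> hs; have sb : s < b.
    rewrite lt_def J'b ?andbT; last exact: interior_subset.
    apply/eqP => e; have [d d0 hd] := open_interval_room (open_interior J') hs.
    have : J' (s + d / 2) by apply: interior_subset; apply: hd; rewrite addrAC subrr add0r ger0_norm; lra.
    by move/J'b; rewrite e; lra.
  have : nbhs s (J' `&` [set u | u < b]) by apply: filterI => //; exact: lt_nbhsl.
  by apply: filterS => u [h1 h2]; exact: J'lt.
have eqI s : J'° s -> (phi \o c) s = (phi \o c') s.
  by move=> /intJ/interior_subset hs; rewrite /= ccJ.
have JJ' : J' = J.
  apply: (gen_maximal gen (c' := c')); [exact: subsetUl|exact: ccJ|].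
  split.
  - have key x : J x -> forall z, x <= z <= b -> J' z.
      move=> hx z /andP[xz]; rewrite le_eqVlt => /orP[/eqP ->|zb]; [by right|].
      left; have [xa|xa] := leP z a.
        have := (profile_interval P (x := x) (y := (a + b) / 2)) => /(_ hx) h.
        have h2 : a < (a + b) / 2 < b by have := ab; lra.
        by apply: h; [apply: interior_subset; apply: abJ|lra].
      by apply: interior_subset; apply: abJ; rewrite xa.
    move=> x y [hx|/= ->] hy z /andP[h1 h2].
      by apply: (key x hx); rewrite h1 (le_trans h2)// J'b.
    by right; apply/eqP; rewrite eq_le h1 (le_trans h2)// J'b.
  - apply/within_continuousE => s hs B hB.
    have [sb|bs] := ltP s b.
      have hJs := J'lt s hs sb.
      rewrite ccJ // in hB.
      move/within_continuousE: (profile_continuous P) => /(_ s hJs B hB) h.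
      have : nbhs s ([set y | J y -> B (c y)] `&` [set u | u < b]).
        by apply: filterI => //; exact: lt_nbhsl.
      apply: filterS => y [h1 h2] hy /=; rewrite /c' h2; apply: h1; exact: J'lt.
    have es : s = b by apply/eqP; rewrite eq_le bs J'b.
    have mB : nbhs m B by move: hB; rewrite /c' es ltxx.
    have h : nbhs b [set y | y < b -> B (c y)] := hm mB.
    rewrite es; apply: filterS h => y h hy; rewrite /= /c'; case: ifP => yb; last exact: nbhs_singleton mB.
    exact: h.
  - move=> s hs; rewrite /c'; case: ifP => sb; last exact: end_limit_hemisphere.
    by apply: (profile_hemisphere P); exact: J'lt.
  - apply: (C2_on_eq (open_interior _) eqI).
    exact: (C2_onS intJ (profile_C2 P)).
  - move=> s hs; rewrite -(profile_arclength P (intJ s hs)) !derive1E; congr enorm.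
    apply: near_eq_derive; have : \forall y \near s, J'° y.
      by apply: open_nbhs_nbhs; split => //; exact: open_interior.
    by apply: filterS => y /eqI.
  - move=> s t hs; rewrite /c'; case: ifP => sb; last by rewrite m0 ltxx.
    move=> h0; have hJs := J'lt s hs sb.
    have [U [Us UJ lp]] := profile_sweeps P t hJs h0.
    exists U; split; [exact: Us|by move=> u /UJ; left|].
    apply: (local_param_eq (local_param_open lp) _ _ lp) => // u /UJ hu.
    by rewrite /c' Jlt.
by apply: nJb; rewrite -JJ'; right.
Unshelve. all: by end_near. Qed.

(** If the end of the curve runs along another piece of the curve, up to a rotation
    which is trivial on the hemisphere, then following that piece beyond [b]
    prolongs the curve, against maximality. *)
Lemma prolongation_absurd (e s1 t0 d : R) : e * e = 1 -> 0 < d -> d <= b - a ->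
  cos t0 = 1 -> sin t0 = 0 ->
  (forall s, b - d < s < b -> c s = rho t0 (c (s1 + e * (s - b)))) ->
  (forall x, `|x - s1| < d -> J° x) -> False.
Proof.
move=> e1 d0 dba ct st hc hJ.
pose c' s := if s < b then c s else rho t0 (c (s1 + e * (s - b))).
pose J' := J `|` [set s | b <= s < b + d].
have normE s : `|s1 + e * (s - b) - s1| = `|s - b|.
  rewrite [s1 + _]addrC addrK normrM (_ : `|e| = 1) ?mul1r//.
  by apply/eqP; rewrite -sqrp_eq1 ?normr_ge0// real_normK ?num_real// expr2 e1.
have J'lt s : J' s -> s < b -> J s by case=> //= /andP[bs _]; rewrite ltNge bs.
have ccJ s : J s -> c' s = c s by move=> hs; rewrite /c' Jlt.
have F s : `|s - b| < d -> c' s = rho t0 (c (s1 + e * (s - b))) /\ J' s.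
  rewrite ltr_distl => /andP[h1 h2]; rewrite /c'; case: ltP => sb.
    split; first by rewrite -hc// h1 sb.
    by left; apply: interior_subset; apply: abJ; rewrite sb andbT; lra.
  by split => //; right; rewrite /= sb h2.
have near_b s : J' s -> b <= s -> `|s - b| < d.
  case=> [/Jlt h|/= /andP[_ h2]] bs; first by move: h; rewrite ltNge bs.
  by rewrite ger0_norm ?subr_ge0//; lra.
have oB : open [set s : R | `|s - b| < d].
  rewrite (_ : [set s : R | `|s - b| < d] = `]b - d, b + d[%classic); first exact: itv_open.
  by apply/seteqP; split=> s; rewrite /= in_itv /= ltr_distl.
have phiE s : `|s - b| < d -> phi (c' s) = phi (c (s1 + e * (s - b))).
  by move=> /F [-> _]; rewrite (rho_rot inv) rot_id.
have intJ s : J'° s -> s < b -> J° s.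
  move=> hs sb; have : nbhs s (J' `&` [set u | u < b]) by apply: filterI => //; exact: lt_nbhsl.
  by apply: filterS => u [h1 h2]; exact: J'lt.
pose A := J° `&` [set u : R | u < b].
have oA : open A by apply: openI; [exact: open_interior|exact: open_lt].
have AE u : A u -> phi (c' u) = phi (c u) by move=> [/interior_subset hu _]; rewrite ccJ.
pose L (s : R) := s1 + e * (s - b).
have hL s : L s = e *: s + L 0 by rewrite /L /GRing.scale /=; ring.
have cl : continuous ( *:%R e : R -> R) by move=> x; exact: scaler_continuous.
have LB u : `|u - b| < d -> J° (L u) by move=> hu; apply: hJ; rewrite normE.
have JJ' : J' = J.
  apply: (gen_maximal gen (c' := c')); [exact: subsetUl|exact: ccJ|].
  split.
  - move=> x y hx hy z /andP[xz zy].
    have [bz|zb] := leP b z.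
      have := near_b y hy (le_trans bz zy); rewrite ltr_distl => /andP[_ h].
      by right; rewrite /= bz (le_lt_trans zy).
    left; have hx' : J x by apply: J'lt => //; exact: le_lt_trans zb.
    have [az|za] := ltP a z; first by apply: interior_subset; apply: abJ; rewrite az.
    have h2 : a < (a + b) / 2 < b by have := ab; lra.
    apply: (profile_interval P (x := x) (y := (a + b) / 2)) => //; last by lra.
    by apply: interior_subset; exact: abJ.
  - apply/within_continuousE => s hs B hB.
    have [sb|bs] := ltP s b.
      have hJs := J'lt s hs sb.
      rewrite ccJ // in hB.
      move/within_continuousE: (profile_continuous P) => /(_ s hJs B hB) h.
      have : nbhs s ([set y | J y -> B (c y)] `&` [set u | u < b]).
        by apply: filterI => //; exact: lt_nbhsl.
      apply: filterS => y [h1 h2] hy /=; rewrite /c' h2; apply: h1; exact: J'lt.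
    have sB := near_b s hs bs.
    rewrite (F s sB).1 in hB.
    have nB : nbhs s [set y : R | `|y - b| < d] by apply: open_nbhs_nbhs.
    have cs : (rho t0 \o c \o L) y @[y --> s] --> (rho t0 \o c \o L) s.
      have cL : {for s, continuous L}.
        apply: cvgD; first exact: cvg_cst.
        by apply: cvgM; [exact: cvg_cst|apply: cvgB; [exact: cvg_id|exact: cvg_cst]].
      have cc := cvg_comp L c cL (profile_continuous_at P (LB s sB)).
      exact: (cvg_comp (c \o L) (rho t0) cc (@rotation_continuous t0 (c (L s)))).
    have h := cs B hB.
    have : nbhs s ([set y | B ((rho t0 \o c \o L) y)] `&` [set y : R | `|y - b| < d]).
      by apply: filterI => //; exact: h.
    by apply: filterS => y [h1 h2] _; rewrite (F y h2).1.
  - move=> s hs; have [sb|bs] := ltP s b.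
      by rewrite /c' sb; apply: (profile_hemisphere P); exact: J'lt.
    rewrite phiE; last exact: near_b.
    by apply: (profile_hemisphere P); apply: interior_subset; apply: LB; exact: near_b.
  - apply: C2_on_local => s hs; have [sb|bs] := ltP s b.
      exists A, (phi \o c); split; [exact: oA|by split=> //=; exact: intJ| |exact: AE].
      by apply: C2_onS (profile_C2 P) => u [].
    exists [set s : R | `|s - b| < d], ((phi \o c) \o L); split.
    + exact: oB.
    + by apply: near_b => //; exact: interior_subset.
    + apply: (@C2_onS _ _ _ (L @^-1` J°)); first by move=> u; exact: LB.
      exact: (@C2_on_affine R R 'rV[R]_4 R L ( *:%R e) J° (phi \o c) cl hL (open_interior J) (profile_C2 P)).
    + by move=> u /phiE.
  - move=> s hs; have [sb|bs] := ltP s b.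
      have hA : A s by split=> //=; exact: intJ.
      rewrite -(profile_arclength P hA.1) !derive1E; congr enorm.
      apply: near_eq_derive; have : \forall y \near s, A y by exact: open_nbhs_nbhs.
      by apply: filterS => y /AE.
    have hB : `|s - b| < d by apply: near_b => //; exact: interior_subset.
    rewrite derive1E (@near_eq_derive _ _ _ _ ((phi \o c) \o L)); last first.
      have : \forall y \near s, [set s : R | `|s - b| < d] y by exact: open_nbhs_nbhs.
      by apply: filterS => y /phiE.
    have [_ ->] := @affine_comp_derive R R 'rV[R]_4 R L ( *:%R e) (phi \o c) s 1 cl hL
      (profile_differentiable P (LB s hB)).
    have al := profile_arclength P (LB s hB).
    rewrite deriveE; last exact: (profile_differentiable P (LB s hB)).
    rewrite linearZ -deriveE; last exact: (profile_differentiable P (LB s hB)).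
    rewrite -derive1E; apply/enorm1; move/enorm1: al => <-.
    rewrite !dot4 !coordE; move: (derive1 _ _) => w.
    have -> : forall x y z t, e * x * (e * x) + e * y * (e * y) + e * z * (e * z) + e * t * (e * t)
      = (e * e) * (x * x + y * y + z * z + t * t) by move=> *; ring.
    by rewrite e1 mul1r.
  - move=> s t hs h0; have [sb|bs] := ltP s b.
      have hJs := J'lt s hs sb; rewrite ccJ// in h0.
      have [U [Us UJ lp]] := profile_sweeps P t hJs h0.
      exists U; split; [exact: Us|by move=> u /UJ; left|].
      apply: (local_param_eq (local_param_open lp) _ _ lp) => // u /UJ hu.
      by rewrite ccJ.
    have hB := near_b s hs bs.
    rewrite phiE // in h0.
    have [U [Us UJ lp]] := profile_sweeps P (t + t0) (interior_subset (LB s hB)) h0.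
    pose U' := slide e (s1 - e * b) t0 @^-1` U `&` [set u : R * R | `|u.1 - b| < d].
    have slE u : slide e (s1 - e * b) t0 u = (L u.1, u.2 + t0).
      by rewrite /slide /L; congr (_, _); ring.
    have lp' := local_param_slide (s1 - e * b) t0 e1 lp.
    exists U'; split.
    + by split => //=; rewrite slE.
    + by move=> u [_ /=] /F [].
    apply: (local_param_eq _ _ _ lp').
    + apply: openI; first exact: (local_param_open lp').
      have cf : continuous (fst : R * R -> R) by move=> u; exact: cvg_fst.
      by move/continuousP: cf => /(_ _ oB).
    + by move=> u [].
    + move=> u [_ /= /F [-> _]].
      by change (rho (u.2 + t0) (c (slide e (s1 - e * b) t0 u).1) = rho u.2 (rho t0 (c (L u.1)))); rewrite slE (rho_D inv).
by apply: nJb; rewrite -JJ'; right; rewrite /= lexx ltrDl.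
Qed.

(** If the limit [m] is off the axis, it is on the orbit of a point of the curve,
    and near [b] the curve lies in the strip swept by a piece around that point.
    There its position on the piece is a function of s with slope 1 or -1, so
    that [prolongation_absurd] applies. *)
Lemma regular_limit_absurd : 0 < x2 (phi m) -> False.
Proof.
move=> m0.
have hm' := end_limit_hemisphere.
have [s1 [t0 [hs1 mE]]] := gen_cover gen m.
have h1 := profile_hemisphere P hs1.
have mE' : phi m = Defs.rot t0 (phi (c s1)) by rewrite {1}mE (rho_rot inv).
have [ct st] := rot_hemisphere hm' h1 m0 mE'.
have h0 : 0 < x2 (phi (c s1)) by rewrite -(rot_id (phi (c s1)) ct st) -mE'.
have [U [Us UJ lp]] := profile_sweeps P t0 hs1 h0.
have oU := local_param_open lp; have [_ ip op _] := lp.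
pose psi (u : R * R) := rho u.2 (c u.1).
have Js1 := profile_open hs1 h0.
have [r [r0 r1 rU rJ]] : exists r, [/\ 0 < r, r <= 1,
    (forall u : R * R, `|u.1 - s1| < r -> `|u.2 - t0| < r -> U u) &
    forall x, `|x - s1| < r -> J° x /\ 0 < x2 (phi (c x))].
  have : nbhs (s1, t0) U by exact: open_nbhs_nbhs.
  move/nbhs_ballP => [r1 /= r10 hr1].
  have : nbhs s1 (J° `&` [set x | 0 < x2 (phi (c x))]).
    apply: filterI; first by apply: open_nbhs_nbhs; split => //; exact: open_interior.
    have cx := cvg_comp c phi (profile_continuous_at P Js1) (@cphi (c s1)).
    have := cvg_comp (phi \o c) (@x2 R) cx (@continuous_x2 R (phi (c s1))).
    by move=> /cvgr_gt; apply.
  move/nbhs_ballP => [r2 /= r20 hr2].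
  exists (Order.min (Order.min r1 r2) 1); split.
  - by rewrite !lt_min r10 r20 ltr01.
  - by rewrite ge_min lexx orbT.
  - move=> [u1 u2] /=; rewrite !lt_min => /andP[/andP[a1 a2] _] /andP[/andP[b1 b2] _].
    by apply: hr1; split; rewrite /ball /= distrC.
  - by move=> x; rewrite !lt_min => /andP[/andP[a1 a2] _]; apply: hr2; rewrite /ball /= distrC.
pose Bx (x0 : R) (eps : R) : set (R * R) := [set u | `|u.1 - x0| < eps /\ (`|u.1 - s1| < r /\ `|u.2 - t0| < r)].
have oBx x0 eps : open (Bx x0 eps).
  have ob (f : R * R -> R) (y z : R) : continuous f -> open [set u | `|f u - y| < z].
    move=> cf; have : open [set x : R | `|x - y| < z].
      rewrite (_ : [set x : R | `|x - y| < z] = `]y - z, y + z[%classic); first exact: itv_open.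
      by apply/seteqP; split=> x; rewrite /= in_itv /= ltr_distl.
    by move/continuousP: cf; exact.
  have cf : continuous (fst : R * R -> R) by move=> u; exact: cvg_fst.
  have cg : continuous (snd : R * R -> R) by move=> u; exact: cvg_snd.
  by apply: openI; [exact: ob|apply: openI; exact: ob].
have BU x0 eps : Bx x0 eps `<=` U by move=> u [_ [a1 a2]]; exact: rU.
have oim x0 eps : open (psi @` Bx x0 eps) by apply: op => //; exact: BU.
(* both the curve and the strip project to the same half of the meridian plane,
   so the angle can only be t0 *)
have mer s u : J s -> 0 < x2 (phi (c s)) -> `|u.1 - s1| < r -> `|u.2 - t0| < r ->
    psi u = c s -> u.2 = t0.
  move=> hs hs0 u1 u2 E.
  have [ju ju0] := rJ _ u1.
  have E' : phi (c s) = Defs.rot u.2 (phi (c u.1)) by rewrite -(rho_rot inv) -E.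
  have [cu su] := rot_hemisphere (profile_hemisphere P hs) (profile_hemisphere P (interior_subset ju)) hs0 E'.
  have [k hk] : exists k : int, u.2 = t0 + (k%:~R * 2) * pi by apply: cos_sin_eq; rewrite ?cu ?su.
  have k0 : k = 0.
    apply/eqP; apply: contraT => k0; move: u2; rewrite hk addrAC subrr add0r !normrM.
    have : 1 <= `|k%:~R| :> R by rewrite -intr_norm -[1]/(1%:~R) ler_int; case: k k0 {hk} => [[|n]|n].
    rewrite (ger0_norm (x := 2))// (ger0_norm (x := pi)) ?pi_ge0//.
    have := @pi_ge2 R; nra.
  by rewrite hk k0 !mul0r addr0.
have [d1 d10 hd1] : exists2 d, 0 < d & forall s, b - d < s < b ->
    [/\ a < s < b, 0 < x2 (phi (c s)) & (psi @` Bx s1 r) (c s)].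
  have n1 : \forall s \near b^'-, 0 < x2 (phi (c s)).
    have := cvg_comp (phi \o c) (@x2 R) end_limit_phi (@continuous_x2 R (phi m)).
    by move=> /cvgr_gt; apply.
  have n2 : \forall s \near b^'-, (psi @` Bx s1 r) (c s).
    have mU : nbhs m (psi @` Bx s1 r).
      apply: open_nbhs_nbhs; split; first exact: oim.
      by exists (s1, t0); [split; rewrite /= ?subrr ?normr0|rewrite /psi /= -mE].
    exact: hm mU.
  have n3 : \forall s \near b^'-, a < s < b by apply: near_left.
  have : \forall s \near b^'-, [/\ a < s < b, 0 < x2 (phi (c s)) & (psi @` Bx s1 r) (c s)].
    by near=> s; split; near: s.
  move=> [d /= d0 hd]; exists d => // s /andP[h2 h3]; apply: hd => //.
  by rewrite /ball /= gtr0_norm ?subr_gt0//; lra.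
have exs s : exists x, b - d1 < s < b -> `|x - s1| < r /\ c s = rho t0 (c x).
  have [hs|nhs] := pselect (b - d1 < s < b); last by exists 0.
  have [sab s0 [u [_ [u1 u2]] E]] := hd1 s hs.
  have ut := mer s u (interior_subset (abJ sab)) s0 u1 u2 E.
  by exists u.1 => _; split => //; rewrite -E /psi ut.
have [sg hsg] := choice exs.
have inj x x' : `|x - s1| < r -> `|x' - s1| < r -> rho t0 (c x) = rho t0 (c x') -> x = x'.
  move=> hx hx' E.
  have ux : U (x, t0) by apply: rU; rewrite //= subrr normr0.
  have ux' : U (x', t0) by apply: rU; rewrite //= subrr normr0.
  by have [] := ip (x, t0) (x', t0) ux ux' E.
have closeto s x0 eps : b - d1 < s < b -> (psi @` Bx x0 eps) (c s) -> `|sg s - x0| < eps.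
  move=> hs [u [u0 [u1 u2]] E]; have [sab s0 _] := hd1 s hs.
  have ut := mer s u (interior_subset (abJ sab)) s0 u1 u2 E.
  have [k1 k2] := hsg s hs.
  by rewrite (inj (sg s) u.1 k1 u1) // -k2 -E /psi ut.
have csg s : b - d1 < s < b -> {for s, continuous sg}.
  move=> hs; have [sab s0 _] := hd1 s hs; have [k1 k2] := hsg s hs.
  apply/cvgrPdist_lt => eps eps0.
  have h1' : nbhs (c s) (psi @` Bx (sg s) eps).
    apply: open_nbhs_nbhs; split; first exact: oim.
    by exists (sg s, t0); [split; rewrite /= ?subrr ?normr0|rewrite /psi /= -k2].
  have h2 := profile_continuous_at P (abJ sab) h1'.
  have h3 : nbhs s `]b - d1, b[%classic.
    by apply: open_nbhs_nbhs; split; [exact: itv_open|rewrite /= in_itv].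
  near=> y; rewrite distrC; apply: closeto; last by near: y; exact: h2.
  by have : y \in `]b - d1, b[ by [near: y]; rewrite in_itv.
have lsg : sg s @[s --> b^'-] --> s1.
  apply/cvgrPdist_lt => eps eps0.
  have h1' : nbhs m (psi @` Bx s1 eps).
    apply: open_nbhs_nbhs; split; first exact: oim.
    by exists (s1, t0); [split; rewrite /= ?subrr ?normr0|rewrite /psi /= -mE].
  have h2 := hm h1'.
  near=> y; rewrite distrC; apply: closeto; last by near: y; exact: h2.
  apply/andP; split; last by near: y; exact: nbhs_left_lt.
  by near: y; apply: nbhs_left_gt; lra.
pose g := phi \o c.
have gE s : b - d1 < s < b -> g s = g (sg s).
  move=> hs; have [k1 k2] := hsg s hs.
  by rewrite /g /= k2 (rho_rot inv) rot_id.
have dg s : J° s -> forall f, is_derive s 1 (fun u => dot (g u) f) (dot (derive1 g s) f).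
  by move=> hs f; apply: is_derive_dot; exact: profile_differentiable P hs.
pose D s := dot (derive1 g s) (derive1 g (sg s)).
have sgJ s : b - d1 < s < b -> J° s /\ J° (sg s).
  move=> hs; have [sab _ _] := hd1 s hs; have [k1 _] := hsg s hs.
  by split; [exact: abJ|have [] := rJ _ k1].
have sgD s : b - d1 < s < b -> is_derive s 1 sg (D s) /\ D s ^+ 2 = 1.
  move=> hs; have [j1 j2] := sgJ s hs.
  apply: (unit_speed_reparam (dg s j1) (dg _ j2) (csg s hs)).
  - by apply/enorm1; exact: (profile_arclength P j1).
  - by apply/enorm1; exact: (profile_arclength P j2).
  have h3 : nbhs s `]b - d1, b[%classic.
    by apply: open_nbhs_nbhs; split; [exact: itv_open|rewrite /= in_itv].
  by apply: filterS h3 => y; rewrite /= in_itv /=; exact: gE.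
have cD s : b - d1 < s < b -> {for s, continuous D}.
  move=> hs; have [j1 j2] := sgJ s hs.
  have c2 := cvg_comp sg (derive1 g) (csg s hs) (profile_velocity_continuous P j2).
  exact: cvg_dot (profile_velocity_continuous P j1) c2.
have [e [C [e1 sgE]]] : exists e C, e * e = 1 /\ forall s, b - d1 < s < b -> sg s = C + e * s.
  have hb : b - d1 < b by lra.
  apply: (@unit_slope_affine _ sg D _ _ hb _ _ cD).
    by move=> s hs; have [] := sgD s hs.
  by move=> s hs; have [] := sgD s hs.
have s1E : s1 = C + e * b.
  have l2 : sg s @[s --> b^'-] --> C + e * b.
    apply: (@cvg_trans _ ((fun s => C + e * s) @ b^'-)).
      apply: near_eq_cvg; near=> y; apply/esym/sgE; apply/andP; split.
        by near: y; apply: nbhs_left_gt; lra.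
      by near: y; exact: nbhs_left_lt.
    apply: cvgD; first exact: cvg_cst.
    apply: cvgM; first exact: cvg_cst.
    by apply: cvg_at_left_filter; exact: cvg_id.
  exact: (cvg_unique _ lsg l2).
pose d := Order.min (Order.min d1 r) (b - a).
apply: (@prolongation_absurd e s1 t0 d) => //.
- by rewrite !lt_min d10 r0 subr_gt0 ab.
- by rewrite ge_min lexx orbT.
- move=> s /andP[hs1' hs2].
  have hs : b - d1 < s < b.
    rewrite hs2 andbT; apply: le_lt_trans hs1'; rewrite lerD2l lerN2.
    by rewrite /d !ge_min lexx.
  have [_ ->] := hsg s hs; rewrite sgE // s1E; congr (rho t0 (c _)); ring.
- by move=> x; rewrite !lt_min => /andP[/andP[_ h] _]; have [] := rJ x h.
Unshelve. all: by end_near. Qed.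

End Limit.

(** A finite end is a limit point of the surface, by completeness. Both ways of not
    belonging to the curve are excluded by maximality, and an end which belongs to
    it is on the axis because of [profile_open]. *)
Lemma right_end_on_axis : J b /\ x2 (phi (c b)) = 0.
Proof.
have [hb|nb] := pselect (J b); first by split => //; exact: end_mem_on_axis.
exfalso.
have [m hm] := profile_limit (surf_hausdorff surf) (surf_complete surf) P ab abJ.
have [_ [x0 _]] := end_limit_hemisphere hm.
move: x0; rewrite le_eqVlt => /orP[/eqP/esym|].
  exact: axis_limit_absurd nb hm.
exact: regular_limit_absurd nb hm.
Qed.

End AtRightEnd.
End Extension.

(** * Scalar form of the geometric hypotheses *)

Section LeftEnd.
Context {R : realType} (M : topologicalType) (phi : M -> 'rV[R]_4) (rho : R -> M -> M).
Variables (J : set R) (c : R -> M).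
Hypothesis surf : C2_complete_connected_surface phi.
Hypothesis inv : rotationally_invariant phi rho.
Hypothesis gen : generating_curve phi rho J c.

Lemma left_end_on_axis (a b : R) : a < b -> (forall s, a < s < b -> J° s) ->
  (forall s, J s -> a <= s) -> J a /\ x2 (phi (c a)) = 0.
Proof.
move=> ab abJ aJ.
have h := @right_end_on_axis _ _ _ _ _ _ surf inv (generating_reverse gen) (- b) (- a).
rewrite /= opprK in h; apply: h; first lra.
  by move=> s hs; apply/interior_opp; apply: abJ; lra.
by move=> s /aJ; lra.
Qed.

End LeftEnd.

Section Directional.
Context {R : realType} {V W : normedModType R}.

Lemma derive_line (F : V -> W) (u v : V) (d : W) :
  is_derive (0 : R) 1 (fun h : R => F (h *: v + u)) d -> 'D_v F u = d.
Proof.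
move=> [_ <-]; rewrite /derive; apply: (congr1 (fun f : R -> W => lim (f @ 0^'))).
by apply/funext => h; rewrite /= addr0 [h *: 1]mulr1 scale0r add0r.
Qed.
End Directional.

Section ScalarData.
Context {R : realType}.

(** What the differential equations need from the geometry: [a], [b], [r] are
    the nonzero coordinates of the curve, [a1], [b1], [r1] and [a2], [b2] their
    first and second derivatives, and [I] is the interior of the domain. *)
Record profile_data (I : set R) (H E : R) (a b r a1 b1 r1 a2 b2 : R -> R) : Prop := {
  pd_open : open I;
  pd_itv : is_interval I;
  pd_a : forall s, I s -> is_derive s 1 a (a1 s);
  pd_b : forall s, I s -> is_derive s 1 b (b1 s);
  pd_r : forall s, I s -> is_derive s 1 r (r1 s);
  pd_a1 : forall s, I s -> is_derive s 1 a1 (a2 s);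
  pd_b1 : forall s, I s -> is_derive s 1 b1 (b2 s);
  pd_r1 : forall s, I s -> {for s, continuous r1};
  pd_a2 : forall s, I s -> {for s, continuous a2};
  pd_b2 : forall s, I s -> {for s, continuous b2};
  pd_sphere : forall s, I s -> a s ^+ 2 + b s ^+ 2 + r s ^+ 2 = 1;
  pd_unit : forall s, I s -> a1 s ^+ 2 + b1 s ^+ 2 + r1 s ^+ 2 = 1;
  pd_ge0 : forall s, I s -> 0 <= r s;
  pd_energy : forall s, I s -> 0 < r s < 1 ->
    r s * (a s * b1 s - b s * a1 s) = (E + H * r s ^+ 2) * Num.sqrt (a1 s ^+ 2 + b1 s ^+ 2);
  pd_cmc : forall s, I s -> 0 < r s -> (\forall y \near s, r1 y = 0) ->
    r s * (a1 s * b2 s - b1 s * a2 s) - (a s * b1 s - b s * a1 s) / r s = - 2 * H }.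

End ScalarData.

Section CurveData.
Context {R : realType} (M : topologicalType) (phi : M -> 'rV[R]_4) (rho : R -> M -> M).
Variables (N : M -> 'rV[R]_4) (J : set R) (c : R -> M) (H E : R).
Hypothesis surf : C2_complete_connected_surface phi.
Hypothesis inv : rotationally_invariant phi rho.
Hypothesis gen : generating_curve phi rho J c.
Hypothesis nrm_along : normal_along phi N rho J c.
Hypothesis cmc : constant_mean_curvature phi N H.
Hypothesis energy : has_energy J (phi \o c) H E.

Let P := gen_profile gen.
Local Notation g := (phi \o c).
Local Notation g1 := (derive1 (phi \o c)).
Local Notation g2 := (derive1 (derive1 (phi \o c))).

Lemma velocity_differentiable s : J° s -> differentiable g1 s.
Proof.
move=> hs; have -> : g1 = 'D_1 g by apply/funext => y; rewrite derive1E.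
by have [_ C2] := profile_C2 P; have [] := C2 1 s hs.
Qed.

Lemma acceleration_continuous s : J° s -> {for s, continuous g2}.
Proof.
move=> hs; have -> : g2 = 'D_1 ('D_1 g).
  by apply/funext => y; rewrite derive1E; congr ('D_1 _ y); apply/funext => z; rewrite derive1E.
by have [_ C2] := profile_C2 P; have [_ /(_ 1)] := C2 1 s hs.
Qed.

Lemma curve_is_derive s : J° s -> is_derive s 1 g (g1 s).
Proof.
move=> hs; have d : derivable g s 1 := diff_derivable (profile_differentiable P hs).
by rewrite derive1E; exact: derivableP.
Qed.

Lemma velocity_is_derive s : J° s -> is_derive s 1 g1 (g2 s).
Proof.
move=> hs; have d : derivable g1 s 1 := diff_derivable (velocity_differentiable hs).
by rewrite derive1E; exact: derivableP.
Qed.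

Lemma is_derive_components (F : R -> 'rV[R]_4) (s : R) d : is_derive s 1 F d ->
  [/\ is_derive s 1 (fun u => x1 (F u)) (x1 d), is_derive s 1 (fun u => y1 (F u)) (y1 d),
      is_derive s 1 (fun u => x2 (F u)) (x2 d) & is_derive s 1 (fun u => y2 (F u)) (y2 d)].
Proof.
move=> [h <-]; split.
- exact: is_derive_x1.
- exact: is_derive_y1.
- exact: is_derive_x2.
- exact: is_derive_y2.
Qed.

Lemma curve_y2 s : J s -> y2 (g s) = 0.
Proof. by move=> /(profile_hemisphere P) [_ []]. Qed.

Lemma near_interior s : J° s -> \forall y \near s, J° y.
Proof. by move=> hs; apply: open_nbhs_nbhs; split => //; exact: open_interior. Qed.

Lemma velocity_y2 s : J° s -> y2 (g1 s) = 0.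
Proof.
move=> hs; have [_ _ _ [d <-]] := is_derive_components (curve_is_derive hs).
rewrite (@near_eq_derive _ _ _ _ (cst 0)) ?derive_cst//.
by apply: filterS (near_interior hs) => y /interior_subset /curve_y2.
Qed.

Lemma curve_sphere s : J s -> x1 (g s) ^+ 2 + y1 (g s) ^+ 2 + x2 (g s) ^+ 2 = 1.
Proof.
move=> hs; have [/S3E <- _] := profile_hemisphere P hs.
by rewrite -[y2 (phi _)]/(y2 (g s)) curve_y2// expr0n addr0.
Qed.

Lemma curve_unit s : J° s -> x1 (g1 s) ^+ 2 + y1 (g1 s) ^+ 2 + x2 (g1 s) ^+ 2 = 1.
Proof.
move=> hs; have /enorm1 := profile_arclength P hs.
by rewrite dot4 velocity_y2// mulr0 addr0 !expr2.
Qed.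

Lemma curve_orth s : J° s -> x1 (g s) * x1 (g1 s) + y1 (g s) * y1 (g1 s) + x2 (g s) * x2 (g1 s) = 0.
Proof.
move=> hs; have [h1 h2 h3 _] := is_derive_components (curve_is_derive hs).
have D : is_derive s 1 (fun u => x1 (g u) * x1 (g u) + y1 (g u) * y1 (g u) + x2 (g u) * x2 (g u))
  (2 * (x1 (g s) * x1 (g1 s) + y1 (g s) * y1 (g1 s) + x2 (g s) * x2 (g1 s))).
  by apply: is_derive_eq; rewrite /GRing.scale /=; ring.
have h := near_const_derive (k := 1) D.
have : 2 * (x1 (g s) * x1 (g1 s) + y1 (g s) * y1 (g1 s) + x2 (g s) * x2 (g1 s)) = 0.
  apply: h; apply: filterS (near_interior hs) => y /interior_subset /curve_sphere.
  by rewrite !expr2.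
lra.
Qed.

(** In the coordinates (omega, tau) the two components of the velocity are
    cos sigma and sin sigma; replacing them by the Cartesian ones removes all
    angles from the energy. *)
Lemma energy_equation s : J° s -> 0 < x2 (g s) < 1 ->
  x2 (g s) * (x1 (g s) * y1 (g1 s) - y1 (g s) * x1 (g1 s)) =
  (E + H * x2 (g s) ^+ 2) * Num.sqrt (x1 (g1 s) ^+ 2 + y1 (g1 s) ^+ 2).
Proof.
move=> hs /andP[r0 r1].
have [[S U] O] := (curve_sphere (interior_subset hs), curve_unit hs, curve_orth hs).
have gy := curve_y2 (interior_subset hs); have g1y := velocity_y2 hs.
have En := energy hs; rewrite -/(g s) in En.
move: S U O gy g1y En r0 r1.
rewrite [g s]vec4_eta [g1 s]vec4_eta !vecE.
move: (x1 (g s)) (y1 (g s)) (x2 (g s)) (y2 (g s)) (x1 (g1 s)) (y1 (g1 s)) (x2 (g1 s)) (y2 (g1 s)).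
move=> a b r z a1 b1 r1 z1 S U O -> -> En r0 r1'.
have rr : -1 <= r <= 1 by lra.
pose om := asin r.
have so : sin om = r by apply: asinK; rewrite in_itv.
have co2 : cos om ^+ 2 = 1 - r ^+ 2 by rewrite cos2sin2 so.
have omr : 0 < om < pi / 2.
  apply/andP; split; last by apply: asin_ltpi2; lra.
  rewrite ltNge; apply/negP => om0.
  have : sin om <= 0.
    have := @asin_geNpi2 _ r rr; rewrite -/om => h.
    rewrite -oppr_ge0 -sinN; apply: sin_ge0_pi; have := @pi_gt0 R; lra.
  by rewrite so leNgt r0.
have co : 0 < cos om by apply: cos_gt0_pihalf; have := @pi_gt0 R; lra.
have [ta [ha hb]] := polar a b.
have nE : Num.sqrt (a ^+ 2 + b ^+ 2) = cos om.
  by rewrite -[RHS]ger0_norm ?ltW// -sqrtr_sqr co2; congr Num.sqrt; lra.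
rewrite nE in ha hb.
pose C := r1 / cos om; pose K := (a * b1 - b * a1) / cos om.
have ctst := cos2Dsin2 ta.
have j2 : (a * b1 - b * a1) ^+ 2 = 1 - r ^+ 2 - r1 ^+ 2.
  have e1 : (a * b1 - b * a1) ^+ 2 = (a ^+ 2 + b ^+ 2) * (a1 ^+ 2 + b1 ^+ 2) - (a * a1 + b * b1) ^+ 2 by ring.
  rewrite e1 (_ : a ^+ 2 + b ^+ 2 = 1 - r ^+ 2); last lra.
  rewrite (_ : a1 ^+ 2 + b1 ^+ 2 = 1 - r1 ^+ 2); last lra.
  by rewrite (_ : a * a1 + b * b1 = - (r * r1)); [ring|lra].
have CK : C ^+ 2 + K ^+ 2 = 1.
  rewrite /C /K !expr_div_n -mulrDl j2 co2 addrC subrK divff//.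
  by rewrite -co2 expf_neq0// gt_eqF.
have [sg [hC hK]] := angle CK.
have cn0 : cos om != 0 by rewrite gt_eqF.
have vE : vec4 a b r 0 = spherical om ta by rewrite /spherical -ha -hb so.
have Kco : K * cos om = a * b1 - b * a1 by rewrite /K divfK.
have Cco : C * cos om = r1 by rewrite /C divfK.
have v1E : vec4 a1 b1 r1 0 = cos sg *: d_om om ta + (sin sg / cos om) *: d_ta om ta.
  rewrite -hC -hK; apply: vec4P; rewrite /d_om /d_ta !coordE ?so.
  - have e1 : C * (- r * cos ta) + K / cos om * (- cos om * sin ta) = - (C * r * cos ta) - K * sin ta.
      by field.
    apply: (mulIf cn0); apply: (mulIf cn0); rewrite e1.
    have -> : (- (C * r * cos ta) - K * sin ta) * cos om * cos om =
       - (C * cos om) * r * (cos om * cos ta) - (K * cos om) * (cos om * sin ta) by ring.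
    rewrite Cco Kco -ha -hb -mulrA -expr2 co2.
    have -> : - r1 * r * a - (a * b1 - b * a1) * b = - (r * r1) * a - b1 * b * a + a1 * b ^+ 2 by ring.
    have -> : - (r * r1) = a * a1 + b * b1 by lra.
    have -> : 1 - r ^+ 2 = a ^+ 2 + b ^+ 2 by lra.
    by ring.
  - have e1 : C * (- r * sin ta) + K / cos om * (cos om * cos ta) = - (C * r * sin ta) + K * cos ta.
      by field.
    apply: (mulIf cn0); apply: (mulIf cn0); rewrite e1.
    have -> : (- (C * r * sin ta) + K * cos ta) * cos om * cos om =
       - (C * cos om) * r * (cos om * sin ta) + (K * cos om) * (cos om * cos ta) by ring.
    rewrite Cco Kco -ha -hb -mulrA -expr2 co2.
    have -> : - r1 * r * b + (a * b1 - b * a1) * a = - (r * r1) * b - a1 * b * a + b1 * a ^+ 2 by ring.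
    have -> : - (r * r1) = a * a1 + b * b1 by lra.
    have -> : 1 - r ^+ 2 = a ^+ 2 + b ^+ 2 by lra.
    by ring.
  - by rewrite mulr0 addr0 Cco.
  - by rewrite !mulr0 addr0.
have := En om ta sg omr vE v1E; rewrite so -hC -hK.
have -> : r ^+ 2 * C ^+ 2 + K ^+ 2 = a1 ^+ 2 + b1 ^+ 2.
  have -> : K ^+ 2 = 1 - C ^+ 2 by lra.
  have -> : a1 ^+ 2 + b1 ^+ 2 = 1 - C ^+ 2 * cos om ^+ 2 by rewrite -exprMn Cco; lra.
  by rewrite co2; ring.
have -> : r * cos om * K = r * (a * b1 - b * a1) by rewrite -Kco; ring.
set v := Num.sqrt _ => e.
have v0 : v != 0.
  rewrite gt_eqF// sqrtr_gt0.
  have : r1 ^+ 2 < 1.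
    rewrite -Cco exprMn co2; have := sqr_ge0 K; nra.
  lra.
have : r * (a * b1 - b * a1) / v = E + H * r ^+ 2 by lra.
by move=> <-; rewrite divfK.
Qed.

(** Where r' = 0 the unit normal of the surface is horizontal, so that nu_h = N
    and the divergence can be evaluated on the basis formed by the profile and
    the rotation; on such a stretch the equation of motion cannot be obtained
    by differentiating the energy, and this identity replaces it. *)
Lemma constant_height_cmc s : J° s -> 0 < x2 (g s) -> (\forall y \near s, x2 (g1 y) = 0) ->
  x2 (g s) * (x1 (g1 s) * y1 (g2 s) - y1 (g1 s) * x1 (g2 s))
    - (x1 (g s) * y1 (g1 s) - y1 (g s) * x1 (g1 s)) / x2 (g s) = - 2 * H.
Proof.
move=> hs r0 nr.
have [U [Us UJ lp]] := profile_sweeps P 0 (interior_subset hs) r0.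
have oU := local_param_open lp.
pose psi (u : R * R) := rho u.2 (c u.1).
pose X u := phi (psi u).
pose k y := x1 (g1 y) * y1 (g y) - x1 (g y) * y1 (g1 y).
pose nu0 (u : R * R) := vec4 (x2 (g u.1) * y1 (g1 u.1)) (- (x2 (g u.1) * x1 (g1 u.1)))
  (k u.1 * cos u.2) (k u.1 * sin u.2).
pose nu u := horizontal_normal (phi (psi u)) (N (psi u)).
have XE u : X u = Defs.rot u.2 (g u.1) by rewrite /X /psi (rho_rot inv).
(* on the stretch r' = 0 the profile normal is itself unit and horizontal *)
have key u : U u -> 0 < x2 (g u.1) -> J° u.1 -> x2 (g1 u.1) = 0 ->
    horizontal_part (phi (psi u)) (N (psi u)) = nu0 u /\ dot (nu0 u) (nu0 u) = 1.
  case: u => y t /= hU ry jy ry0.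
  have -> : N (psi (y, t)) = nu0 (y, t).
    rewrite /psi /= (nrm_along t (interior_subset jy) ry) /profile_normal /nu0 /k /= ry0.
    by congr vec4; ring.
  have [[Sp Un] Or] := (curve_sphere (interior_subset jy), curve_unit jy, curve_orth jy).
  have gy := curve_y2 (interior_subset jy).
  rewrite -[phi _]/(X (y, t)) XE /= ry0 in Un Or *.
  have ct := cos2Dsin2 t.
  have d0 : dot (nu0 (y, t)) (fV (Defs.rot t (g y))) = 0.
    rewrite dot4 /nu0 /fV /qmul /qi /Defs.rot !vecE gy /= /k.
    rewrite !mul0r !mul1r !sub0r !addr0 !mulr0 !subr0.
    transitivity (- x2 (g y) * (x1 (g y) * x1 (g1 y) + y1 (g y) * y1 (g1 y))); first by ring.
    by rewrite (_ : _ + _ = 0); [rewrite mulr0|lra].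
  split; first by rewrite /horizontal_part d0 scale0r subr0.
  rewrite dot4 /nu0 !vecE /= /k.
  move: Sp Un Or; move: (x1 (g y)) (y1 (g y)) (x2 (g y)) (x1 (g1 y)) (y1 (g1 y)) => a b r a1 b1 Sp Un Or.
  have j2 : (a1 * b - a * b1) ^+ 2 = 1 - r ^+ 2.
    transitivity ((a ^+ 2 + b ^+ 2) * (a1 ^+ 2 + b1 ^+ 2) - (a * a1 + b * b1) ^+ 2); first by ring.
    rewrite (_ : a * a1 + b * b1 = 0); last lra.
    by rewrite (_ : a1 ^+ 2 + b1 ^+ 2 = 1); [rewrite expr0n subr0 mulr1|]; lra.
  transitivity (r ^+ 2 * (a1 ^+ 2 + b1 ^+ 2) + (a1 * b - a * b1) ^+ 2 * (cos t ^+ 2 + sin t ^+ 2)); first by ring.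
  rewrite ct j2 (_ : a1 ^+ 2 + b1 ^+ 2 = 1); last lra.
  by ring.
have rc : {for s, continuous (fun y => x2 (g y))}.
  exact: (cvg_comp g (@x2 R) (differentiable_continuous (profile_differentiable P hs)) (@continuous_x2 R (g s))).
have nearU : \forall u \near (s, 0 : R), [/\ U u, 0 < x2 (g u.1), J° u.1 & x2 (g1 u.1) = 0].
  have : \forall y \near s, [/\ 0 < x2 (g y), J° y & x2 (g1 y) = 0].
    have h1 : \forall y \near s, 0 < x2 (g y) by apply: (cvgr_gt _ rc).
    have h2 := near_interior hs.
    by near=> y; split; near: y.
  move=> h.
  have h' : \forall u \near (s, 0 : R), [/\ 0 < x2 (g u.1), J° u.1 & x2 (g1 u.1) = 0].
    by apply: (@cvg_fst _ _ (nbhs s) (nbhs (0 : R)) _ _ h).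
  have hU : \forall u \near (s, 0 : R), U u by exact: open_nbhs_nbhs.
  near=> u; have [a1 a2 a3] : [/\ 0 < x2 (g u.1), J° u.1 & x2 (g1 u.1) = 0] by near: u.
  by split => //; near: u.
have r1s : x2 (g1 s) = 0 by exact: nbhs_singleton nr.
have [hp nu1] := key (s, 0) Us r0 hs r1s.
have hne : horizontal_part (phi (psi (s, 0))) (N (psi (s, 0))) != 0.
  apply: contra_eq_neq nu1 => h; rewrite -hp h dot4 !coordE !mulr0 !addr0 eq_sym; exact: oner_neq0.
have := cmc lp Us hne.
have nuE u : U u -> 0 < x2 (g u.1) -> J° u.1 -> x2 (g1 u.1) = 0 -> nu u = nu0 u.
  move=> h1 h2 h3 h4; have [e1 e2] := key u h1 h2 h3 h4.
  by rewrite /nu /horizontal_normal e1 /enorm e2 sqrtr1 invr1 scale1r.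
have Dnu v : 'D_v nu (s, 0) = 'D_v nu0 (s, 0).
  by apply: near_eq_derive; apply: filterS nearU => u [h1 h2 h3 h4]; exact: nuE.
have [ga gb gr _] := is_derive_components (curve_is_derive hs).
have [ga1 gb1 gr1 _] := is_derive_components (velocity_is_derive hs).
have hl : is_derive (0 : R) 1 (fun h : R => h *: 1 + s) (1 : R).
  by apply: is_derive_eq; rewrite /GRing.scale /= ?mulr1 ?addr0 ?mulr0 ?add0r.
have sh (f : R -> R) d : is_derive s 1 f d -> is_derive (0 : R) 1 (fun h => f (h *: 1 + s)) d.
  move=> hf.
  by apply: (chain_rule _ hf hl); rewrite ?mulr1// scale0r add0r.
have r2s : x2 (g2 s) = 0 by exact: (near_const_derive gr1 nr).
set r := x2 (g s) in r0 *.
have rn0 : r != 0 by rewrite gt_eqF.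
have gy : y2 (g s) = 0 := curve_y2 (interior_subset hs).
have DX1 : 'D_(1, 0) X (s, 0) = vec4 (x1 (g1 s)) (y1 (g1 s)) 0 0.
  apply: derive_line.
  apply: (@near_eq_is_derive _ _ _ (fun h : R => vec4 (x1 (g (h *: 1 + s))) (y1 (g (h *: 1 + s))) (x2 (g (h *: 1 + s))) 0)).
    have nj : \forall h \near (0 : R), J° (h *: 1 + s).
      have cl : {for (0 : R), continuous (fun h : R => h *: 1 + s)}.
        exact: is_derive_continuous hl.
      by apply: cl; rewrite /= scale0r add0r; exact: near_interior.
    apply: filterS nj => h hj.
    rewrite XE /= scaler0 addr0; apply: vec4P; rewrite /Defs.rot !vecE // cos0 sin0.
      by rewrite mul1r mul0r subr0.
    by rewrite mul0r mul1r add0r (curve_y2 (interior_subset hj)).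
  have er := sh _ _ gr; rewrite r1s in er.
  have ea := sh _ _ ga; have eb := sh _ _ gb.
  exact: is_derive_vec4.
have Dn1 : 'D_(1, 0) nu0 (s, 0) = vec4 (r * y1 (g2 s)) (- (r * x1 (g2 s)))
   (x1 (g2 s) * y1 (g s) - x1 (g s) * y1 (g2 s)) 0.
  apply: derive_line.
  have -> : (fun h : R => nu0 (h *: (1, 0) + (s, 0))) = (fun h : R =>
    vec4 ((fun y => x2 (g y) * y1 (g1 y)) (h *: 1 + s)) ((fun y => - (x2 (g y) * x1 (g1 y))) (h *: 1 + s))
      (k (h *: 1 + s)) 0).
    by apply/funext => h; rewrite /nu0 /= scaler0 addr0 cos0 sin0 mulr1 mulr0.
  have e1 : is_derive s 1 (fun y => x2 (g y) * y1 (g1 y)) (r * y1 (g2 s)).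
    by apply: is_derive_eq; rewrite r1s /GRing.scale /= mulr0 addr0.
  have e2 : is_derive s 1 (fun y => - (x2 (g y) * x1 (g1 y))) (- (r * x1 (g2 s))).
    by apply: is_derive_eq; rewrite r1s /GRing.scale /= mulr0 addr0.
  have e3 : is_derive s 1 k (x1 (g2 s) * y1 (g s) - x1 (g s) * y1 (g2 s)).
    by apply: is_derive_eq; rewrite /GRing.scale /=; ring.
  have f1 := sh _ _ e1; have f2 := sh _ _ e2; have f3 := sh _ _ e3.
  exact: is_derive_vec4.
have dl : is_derive (0 : R) 1 (fun h : R => h *: r^-1) r^-1.
  by apply: is_derive_eq; rewrite /GRing.scale /= ?mulr1 ?mul1r ?addr0 ?mulr0 ?add0r.
have dc : is_derive (0 : R) 1 (fun h : R => cos (h *: r^-1)) (0 : R).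
  by apply: (chain_rule (y := 0) _ (is_derive_cos 0) dl); rewrite ?scale0r// sin0 oppr0 mul0r.
have ds : is_derive (0 : R) 1 (fun h : R => sin (h *: r^-1)) r^-1.
  by apply: (chain_rule (y := 0) _ (is_derive_sin 0) dl); rewrite ?scale0r// cos0 mul1r.
have DX2 : 'D_(0, r^-1) X (s, 0) = vec4 0 0 0 1.
  apply: derive_line.
  have -> : (fun h : R => X (h *: (0, r^-1) + (s, 0))) = (fun h : R =>
    vec4 (x1 (g s)) (y1 (g s)) (cos (h *: r^-1) * r) (sin (h *: r^-1) * r)).
    apply/funext => h; rewrite XE /= scaler0 add0r addr0 /Defs.rot.
    by rewrite gy !mulr0 subr0 addr0.
  apply: is_derive_vec4.
    by apply: is_derive_eq; rewrite /GRing.scale /= !mulr0 addr0.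
  by apply: is_derive_eq; rewrite /GRing.scale /= mulr0 add0r mulfV.
have Dn2 : 'D_(0, r^-1) nu0 (s, 0) = vec4 0 0 0 (k s / r).
  apply: derive_line.
  have -> : (fun h : R => nu0 (h *: (0, r^-1) + (s, 0))) = (fun h : R =>
    vec4 (r * y1 (g1 s)) (- (r * x1 (g1 s))) (k s * cos (h *: r^-1)) (k s * sin (h *: r^-1))).
    by apply/funext => h; rewrite /nu0 /= scaler0 add0r addr0.
  apply: is_derive_vec4.
    by apply: is_derive_eq; rewrite /GRing.scale /= ?mulr0 ?addr0.
have Un := curve_unit hs; rewrite r1s expr0n addr0 in Un.
move=> sd.
have h : orthonormal2 ('D_(1, 0) X (s, 0)) ('D_(0, r^-1) X (s, 0)) ->
    - 2 * H = dot ('D_(1, 0) nu (s, 0)) ('D_(1, 0) X (s, 0))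
      + dot ('D_(0, r^-1) nu (s, 0)) ('D_(0, r^-1) X (s, 0)) := sd (1, 0) (0, r^-1).
rewrite !Dnu DX1 DX2 Dn1 Dn2 in h; rewrite h; last first.
  by split; rewrite dot4 !vecE ?mulr0 ?mul0r ?addr0 ?add0r ?mulr1 -?expr2.
rewrite !dot4 !vecE /k; field.
exact: rn0.
Unshelve. all: by end_near. Qed.

End CurveData.

(** * The equation of motion *)

Section ProfileData.
Context {R : realType} (M : topologicalType) (phi : M -> 'rV[R]_4) (rho : R -> M -> M).
Variables (N : M -> 'rV[R]_4) (J : set R) (c : R -> M) (H E : R).
Hypothesis surf : C2_complete_connected_surface phi.
Hypothesis inv : rotationally_invariant phi rho.
Hypothesis gen : generating_curve phi rho J c.
Hypothesis nrm_along : normal_along phi N rho J c.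
Hypothesis cmc : constant_mean_curvature phi N H.
Hypothesis energy : has_energy J (phi \o c) H E.

Let P := gen_profile gen.
Local Notation g := (phi \o c).
Local Notation g1 := (derive1 (phi \o c)).
Local Notation g2 := (derive1 (derive1 (phi \o c))).

Lemma profile_data_holds : profile_data J° H E (fun s => x1 (g s)) (fun s => y1 (g s))
  (fun s => x2 (g s)) (fun s => x1 (g1 s)) (fun s => y1 (g1 s)) (fun s => x2 (g1 s))
  (fun s => x1 (g2 s)) (fun s => y1 (g2 s)).
Proof.
split.
- exact: open_interior.
- exact: interior_interval (profile_interval P).
- by move=> s /(curve_is_derive gen) /is_derive_components [].
- by move=> s /(curve_is_derive gen) /is_derive_components [].
- by move=> s /(curve_is_derive gen) /is_derive_components [].
- by move=> s /(velocity_is_derive gen) /is_derive_components [].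
- by move=> s /(velocity_is_derive gen) /is_derive_components [].
- move=> s hs; exact: (cvg_comp g1 (@x2 R) (profile_velocity_continuous P hs) (@continuous_x2 R (g1 s))).
- move=> s hs; exact: (cvg_comp g2 (@x1 R) (acceleration_continuous gen hs) (@continuous_x1 R (g2 s))).
- move=> s hs; exact: (cvg_comp g2 (@y1 R) (acceleration_continuous gen hs) (@continuous_y1 R (g2 s))).
- by move=> s /interior_subset; exact: curve_sphere gen _.
- by move=> s; exact: curve_unit gen _.
- by move=> s /interior_subset /(profile_hemisphere P) [_ []].
- by move=> s; exact: energy_equation gen energy _.
- by move=> s; exact: constant_height_cmc inv gen nrm_along cmc _.
Qed.

(** Otherwise the differential of a chart would have rank at most 1. *)
Lemma surface_not_in_axis : ~ forall m, x2 (phi m) = 0 /\ y2 (phi m) = 0.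
Proof.
move=> h; have [U [psi [u [[_ _ _ [oU [C1 _] imm]] Uu _]]]] := surf_charts surf (c 0).
have [dX _] := C1 u Uu.
set X := phi \o psi in C1 imm dX *.
have D v : [/\ x2 ('D_v X u) = 0, y2 ('D_v X u) = 0 &
    x1 (X u) * x1 ('D_v X u) + y1 (X u) * y1 ('D_v X u) = 0].
  have d : derivable X u v := diff_derivable dX.
  have hx := is_derive_x1 d; have hy := is_derive_y1 d.
  split.
  - rewrite -(@derive_val _ _ _ _ _ _ _ (is_derive_x2 d)).
    rewrite (_ : (fun x => x2 (X x)) = cst 0) ?derive_cst//.
    by apply/funext => x; rewrite /X /= (h _).1.
  - rewrite -(@derive_val _ _ _ _ _ _ _ (is_derive_y2 d)).
    rewrite (_ : (fun x => y2 (X x)) = cst 0) ?derive_cst//.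
    by apply/funext => x; rewrite /X /= (h _).2.
  have K : is_derive u v (fun x => x1 (X x) * x1 (X x) + y1 (X x) * y1 (X x))
      (2 * (x1 (X u) * x1 ('D_v X u) + y1 (X u) * y1 ('D_v X u))).
    by apply: is_derive_eq; rewrite /GRing.scale /=; ring.
  have : 'D_v (fun x => x1 (X x) * x1 (X x) + y1 (X x) * y1 (X x)) u = 0.
    rewrite (_ : (fun x => _) = cst (1 : R)) ?derive_cst//.
    apply/funext => x; have /S3E := surf_S3 surf (psi x).
    by rewrite (h _).1 (h _).2 /X /= => <-; ring.
  by rewrite (@derive_val _ _ _ _ _ _ _ K) => K0; lra.
have [Xx Xy] := h (psi u).
have Sp : x1 (X u) ^+ 2 + y1 (X u) ^+ 2 = 1.
  by have /S3E := surf_S3 surf (psi u); rewrite Xx Xy /X /= => <-; ring.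
pose k v := x1 (X u) * y1 ('D_v X u) - y1 (X u) * x1 ('D_v X u).
have Dk v : 'D_v X u = k v *: vec4 (- y1 (X u)) (x1 (X u)) 0 0.
  have [d3 d4 d0] := D v.
  move: d0 d3 d4 Sp; rewrite /k ['D_v X u]vec4_eta !vecE.
  move: (x1 ('D_v X u)) (y1 ('D_v X u)) (x2 ('D_v X u)) (y2 ('D_v X u)) (x1 (X u)) (y1 (X u)).
  move=> p q r s x y d0 -> -> Sp; apply: vec4P; rewrite !coordE ?mulr0//.
    rewrite -[LHS]mulr1 -Sp; transitivity (x * (x * p + y * q) - (x * q - y * p) * y); first by ring.
    by rewrite d0; ring.
  rewrite -[LHS]mulr1 -Sp; transitivity (y * (x * p + y * q) + (x * q - y * p) * x); first by ring.
  by rewrite d0; ring.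
have L (x y : R) v w : 'D_(x *: v + y *: w) X u = x *: 'D_v X u + y *: 'D_w X u.
  by rewrite !deriveE// linearD !linearZ.
pose e1 : R * R := (1, 0); pose e2 : R * R := (0, 1).
have h1 : 'D_(k e2 *: e1 + (- k e1) *: e2) X u = 0.
  by rewrite L (Dk e1) (Dk e2) !scalerA -scalerDl mulrC mulNr subrr scale0r.
have := imm u _ Uu h1; rewrite /e1 /e2 => -[] /=.
rewrite -/e1 -/e2 !scaler0 addr0 add0r => /eqP.
rewrite [_ *: 1]mulr1 => /eqP k2 /eqP; rewrite [_ *: 1]mulr1 oppr_eq0 => /eqP k1.
have h2 : 'D_e1 X u = 0 by rewrite Dk k1 scale0r.
have := imm u _ Uu h2; rewrite /e1 => -[] /eqP; by rewrite oner_eq0.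
Qed.

End ProfileData.

Section ScalarODE.
Context {R : realType}.
Variables (I : set R) (H E : R) (a b r a1 b1 r1 a2 b2 : R -> R).
Hypothesis D : profile_data I H E a b r a1 b1 r1 a2 b2.

Let oI := pd_open D.
Let iI := pd_itv D.

Let nearI s : I s -> \forall y \near s, I y.
Proof. by move=> hs; exact: open_nbhs_nbhs. Qed.

Lemma pd_orth s : I s -> a s * a1 s + b s * b1 s + r s * r1 s = 0.
Proof.
move=> hs; have [[ha hb] hr] := (pd_a D hs, pd_b D hs, pd_r D hs).
have K : is_derive s 1 (fun u => a u * a u + b u * b u + r u * r u)
  (2 * (a s * a1 s + b s * b1 s + r s * r1 s)).
  by apply: is_derive_eq; rewrite /GRing.scale /=; ring.
have h := near_const_derive (k := 1) K.
have : 2 * (a s * a1 s + b s * b1 s + r s * r1 s) = 0.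
  by apply: h; apply: filterS (nearI hs) => y /(pd_sphere D); rewrite !expr2.
lra.
Qed.

Local Notation j := (fun s => a s * b1 s - b s * a1 s).
Local Notation v2 := (fun s => a1 s ^+ 2 + b1 s ^+ 2).

Lemma pd_j2 s : I s -> j s ^+ 2 = v2 s - r s ^+ 2.
Proof.
move=> hs; have [[h1 h2] h3] := (pd_sphere D hs, pd_unit D hs, pd_orth hs).
transitivity ((a s ^+ 2 + b s ^+ 2) * v2 s - (a s * a1 s + b s * b1 s) ^+ 2); first by ring.
rewrite (_ : a s * a1 s + b s * b1 s = - (r s * r1 s)); last lra.
rewrite (_ : v2 s = 1 - r1 s ^+ 2); last lra.
by rewrite (_ : a s ^+ 2 + b s ^+ 2 = 1 - r s ^+ 2); [ring|lra].
Qed.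

Lemma pd_r_le1 s : I s -> r s <= 1.
Proof.
move=> hs; have h := pd_sphere D hs; have h0 := pd_ge0 D hs.
have := (sqr_ge0 (a s), sqr_ge0 (b s)); nra.
Qed.

Lemma pd_v2_gt0 s : I s -> 0 < r s -> 0 < v2 s.
Proof.
move=> hs h0; have h := pd_j2 hs; have := sqr_ge0 (j s); nra.
Qed.

Lemma pd_continuous s : I s -> [/\ {for s, continuous a}, {for s, continuous b},
  {for s, continuous r}, {for s, continuous a1} & {for s, continuous b1}].
Proof.
move=> hs; split; apply: is_derive_continuous.
- exact: (pd_a D hs).
- exact: (pd_b D hs).
- exact: (pd_r D hs).
- exact: (pd_a1 D hs).
- exact: (pd_b1 D hs).
Qed.

Lemma cvg_sqr (f : R -> R) (s : R) : {for s, continuous f} -> {for s, continuous (fun x => f x ^+ 2)}.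
Proof. by move=> h; apply: cvgM. Qed.

Lemma v_continuous s : I s -> {for s, continuous (fun x => Num.sqrt (v2 x))}.
Proof.
move=> hs; have [_ _ _ ca cb] := pd_continuous hs.
apply: (cvg_comp v2 Num.sqrt _ (@sqrt_continuous R (v2 s))).
by apply: cvgD; exact: cvg_sqr.
Qed.

(** The energy is only prescribed off the north pole. Where the curve passes
    through the pole its velocity is horizontal in the disc, so the pole is
    isolated on the curve and the identity extends by continuity. *)
Lemma pd_energy_all s : I s -> 0 < r s ->
  r s * j s = (E + H * r s ^+ 2) * Num.sqrt (v2 s).
Proof.
move=> hs h0; apply: contrapT => ne.
pose f x := r x * j x - (E + H * r x ^+ 2) * Num.sqrt (v2 x).
have [ca cb cr ca1 cb1] := pd_continuous hs.
have cf : {for s, continuous f}.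
  apply: cvgB; apply: cvgM => //.
  - by apply: cvgB; apply: cvgM.
  - apply: cvgD; first exact: cvg_cst.
    by apply: cvgM; [exact: cvg_cst|exact: cvg_sqr].
  - exact: v_continuous.
have fn : f s != 0 by rewrite subr_eq0; apply/eqP.
have n1 : \forall y \near s, f y != 0.
  by apply: (cvgr_neq0 _ cf).
have n2 : \forall y \near s, 0 < r y by apply: (cvgr_gt _ cr).
have n3 := nearI hs.
have n4 : \forall y \near s, a y = 0 /\ b y = 0.
  near=> y.
  have hy : I y by near: y.
  have ry : 0 < r y by near: y.
  have fy : f y != 0 by near: y.
  have r1y : r y = 1.
    have := pd_r_le1 hy; rewrite le_eqVlt => /orP[/eqP //|ry1].
    by move: fy; rewrite /f (pd_energy D hy) ?ry// subrr eqxx.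
  have := pd_sphere D hy; rewrite r1y expr1n => S.
  by have := (sqr_ge0 (a y), sqr_ge0 (b y)) => -[q1 q2]; split; apply/eqP; rewrite -sqrf_eq0; apply/eqP; lra.
have a10 : a1 s = 0 by apply: (near_const_derive (k := 0) (pd_a D hs)); apply: filterS n4 => y [].
have b10 : b1 s = 0 by apply: (near_const_derive (k := 0) (pd_b D hs)); apply: filterS n4 => y [].
by have := pd_v2_gt0 hs h0; rewrite /= a10 b10 expr0n addr0 ltxx.
Unshelve. all: by end_near. Qed.

Lemma pd_energy_sqr s : I s -> 0 < r s -> (E + H * r s ^+ 2) ^+ 2 * v2 s = r s ^+ 2 * (v2 s - r s ^+ 2).
Proof.
move=> hs h0; have h := pd_energy_all hs h0; rewrite -pd_j2// -exprMn h exprMn sqr_sqrtr//.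
by rewrite ltW// pd_v2_gt0.
Qed.

(** At an interior point on the axis the height, which is nonnegative, has a
    minimum, so r' = 0 there. But close to the axis the energy identity forces
    the velocity to be vertical (E = 0) or bounds the height from below
    (E <> 0); so the height has to vanish on a neighbourhood. *)
Lemma height_isolated s : I s -> r s = 0 -> \forall y \near s, r y = 0.
Proof.
move=> hs r0; have [ca cb cr ca1 cb1] := pd_continuous hs.
have r10 : r1 s = 0.
  have [d d0 hd] := open_interval_room oI hs.
  have : is_derive s 1 r 0.
    apply: (@derive1_at_min R r (s - d) (s + d) s).
    - lra.
    - move=> t /[!in_itv] /= ht; have It : I t by apply: hd; rewrite ltr_distl.
      by have [] := pd_r D It.
    - by rewrite in_itv /=; lra.
    - move=> t /[!in_itv] /= ht; rewrite r0; apply: (pd_ge0 D); apply: hd.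
      by rewrite ltr_distl.
  by case: (pd_r D hs) => [_ <-] [_ <-].
have v21 : v2 s = 1 by have := pd_unit D hs; rewrite r10; lra.
have cv : {for s, continuous v2} by apply: cvgD; exact: cvg_sqr.
have cr2 := cvg_sqr cr.
have cHr (k : R) : {for s, continuous (fun y => E + k * r y ^+ 2)}.
  by apply: cvgD; [exact: cvg_cst|apply: cvgM; [exact: cvg_cst|exact: cr2]].
have n3 := nearI hs.
have [E0|E0] := eqVneq E 0.
  pose f y := v2 y * (1 - H ^+ 2 * r y ^+ 2) - r y ^+ 2.
  have cf : {for s, continuous f}.
    apply: cvgB; last exact: cr2.
    apply: cvgM; first exact: cv.
    by apply: cvgB; [exact: cvg_cst|apply: cvgM; [exact: cvg_cst|exact: cr2]].
  have n1 : \forall y \near s, 0 < f y.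
    by apply: (cvgr_gt _ cf); rewrite /f r0 expr0n v21 /= mulr0 !subr0 mulr1 ltr01.
  near=> y; have hy : I y by near: y.
  have := pd_ge0 D hy; rewrite le_eqVlt => /orP[/eqP //|ry].
  have fy : 0 < f y by near: y.
  have := pd_energy_sqr hy ry; rewrite E0 add0r => e.
  exfalso; move: fy; rewrite /f; have r2 : r y ^+ 2 != 0 by rewrite sqrf_eq0 gt_eqF.
  suff -> : v2 y * (1 - H ^+ 2 * r y ^+ 2) - r y ^+ 2 = 0 by rewrite ltxx.
  apply: (mulfI r2); rewrite mulr0.
  have -> : r y ^+ 2 * (v2 y * (1 - H ^+ 2 * r y ^+ 2) - r y ^+ 2) =
     r y ^+ 2 * (v2 y - r y ^+ 2) - (H * r y ^+ 2) ^+ 2 * v2 y by ring.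
  by rewrite -e subrr.
pose f y := (E + H * r y ^+ 2) ^+ 2 - r y ^+ 2.
have cE := cvg_sqr (cHr H).
have cf : {for s, continuous f} by apply: cvgB; [exact: cE|exact: cr2].
have n1 : \forall y \near s, 0 < f y.
  by apply: (cvgr_gt _ cf); rewrite /f r0 expr0n /= mulr0 subr0 addr0 exprn_even_gt0.
near=> y; have hy : I y by near: y.
have := pd_ge0 D hy; rewrite le_eqVlt => /orP[/eqP //|ry].
have fy : 0 < f y by near: y.
have e := pd_energy_sqr hy ry; have v0 := pd_v2_gt0 hy ry.
exfalso; move: fy; rewrite /f subr_gt0 ltNge => /negP; apply.
rewrite -(ler_pM2r v0) e mulrBr; have := sqr_ge0 (r y); nra.
Unshelve. all: by end_near. Qed.

(** The zeros of the height form a set which is closed, and open by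
    [height_isolated]. *)
Lemma height_dichotomy : (forall s, I s -> r s = 0) \/ (forall s, I s -> 0 < r s).
Proof.
have [[s0 hs0]|nI] := pselect (exists s, I s); last by left => s hs; case: nI; exists s.
pose f y : R := if r y == 0 then 0 else 1.
have df s : I s -> is_derive s 1 f 0.
  move=> hs; have [_ _ cr _ _] := pd_continuous hs.
  have [k nk] : exists k : R, \forall y \near s, f y = k.
    have [r0|r0] := eqVneq (r s) 0.
      by exists 0; apply: filterS (height_isolated hs r0) => y; rewrite /f => ->; rewrite eqxx.
    exists 1; have : \forall y \near s, r y != 0 by apply: (cvgr_neq0 _ cr).
    by apply: filterS => y; rewrite /f => /negPf ->.
  have hc : is_derive s 1 (cst k) (0 : R) := is_derive_cst k s 1.
  by apply: near_eq_is_derive hc; apply: filterS nk => y ->.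
have fc s : I s -> f s = f s0 by move=> hs; exact: (derive0_const iI df).
have [r0|r0] := eqVneq (r s0) 0.
  by left => s /fc; rewrite /f r0 eqxx; case: eqP => // _ /eqP; rewrite oner_eq0.
right => s hs; have := fc s hs; rewrite /f (negPf r0) lt_def (pd_ge0 D hs) andbT.
by case: eqP => // _ /eqP; rewrite eq_sym oner_eq0.
Qed.

Section PositiveHeight.
Hypothesis pos : forall s, I s -> 0 < r s.

(** The projection (a, b) of the curve to the disc is traversed in a new time
    with speed r; [pd_w] is the derivative of this time with respect to
    arc-length and (p1, p2) the velocity of the projection in it. *)
Definition pd_v s := Num.sqrt (v2 s).
Definition pd_w s := pd_v s / r s.
Definition pd_p1 s := r s * a1 s / pd_v s.
Definition pd_p2 s := r s * b1 s / pd_v s.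

Lemma pd_vE s : I s -> pd_v s ^+ 2 = v2 s.
Proof. by move=> hs; rewrite sqr_sqrtr// ltW// pd_v2_gt0// pos. Qed.

Lemma pd_v_gt0 s : I s -> 0 < pd_v s.
Proof. by move=> hs; rewrite sqrtr_gt0 pd_v2_gt0// pos. Qed.

(** The square of the angular momentum of the unit velocity about the vertical is
    v2 - r^2, which gives |z'| >= r; hence the new time runs at least as fast as
    arc-length and is onto as soon as the curve is unbounded. *)
Lemma pd_w_ge1 s : I s -> 1 <= pd_w s.
Proof.
move=> hs; rewrite ler_pdivlMr ?pos// mul1r -(@ler_pXn2r _ 2) ?nnegrE ?(ltW (pd_v_gt0 hs)) ?(ltW (pos hs))//.
by rewrite pd_vE//; have := pd_j2 hs; have := sqr_ge0 (j s) => /=; lra.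
Qed.

Lemma pd_w_continuous s : I s -> {for s, continuous pd_w}.
Proof.
move=> hs; have [_ _ cr _ _] := pd_continuous hs.
apply: cvgM; first exact: v_continuous.
by apply: cvgV => //; rewrite gt_eqF// pos.
Qed.

Let vn s : I s -> pd_v s != 0. Proof. by move=> /pd_v_gt0 h; rewrite gt_eqF. Qed.
Let rn s : I s -> r s != 0. Proof. by move=> /pos h; rewrite gt_eqF. Qed.

Lemma pd_aw s : I s -> a1 s = pd_w s * pd_p1 s.
Proof. by move=> hs; rewrite /pd_w /pd_p1; field; rewrite vn ?rn. Qed.
Lemma pd_bw s : I s -> b1 s = pd_w s * pd_p2 s.
Proof. by move=> hs; rewrite /pd_w /pd_p2; field; rewrite vn ?rn. Qed.

Lemma pd_p_sqr s : I s -> pd_p1 s ^+ 2 + pd_p2 s ^+ 2 = r s ^+ 2.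
Proof.
move=> hs; rewrite /pd_p1 /pd_p2 !expr_div_n -mulrDl !exprMn -mulrDr.
have e : a1 s ^+ 2 + b1 s ^+ 2 = pd_v s ^+ 2 by rewrite pd_vE.
by rewrite e mulfK// sqrf_eq0 vn.
Qed.

Lemma pd_momentum s : I s -> a s * pd_p2 s - b s * pd_p1 s = E + H * r s ^+ 2.
Proof.
move=> hs; transitivity (r s * (a s * b1 s - b s * a1 s) / pd_v s).
  by rewrite /pd_p1 /pd_p2; ring.
have e : r s * (a s * b1 s - b s * a1 s) = (E + H * r s ^+ 2) * pd_v s by exact: pd_energy_all (pos hs).
by rewrite e mulfK// vn.
Qed.

Lemma pd_v_derive s : I s -> is_derive s 1 pd_v ((a1 s * a2 s + b1 s * b2 s) / pd_v s).
Proof.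
move=> hs; have [ha hb] := (pd_a1 D hs, pd_b1 D hs).
have hv : is_derive s 1 v2 (2 * (a1 s * a2 s + b1 s * b2 s)).
  rewrite (_ : v2 = (fun s => a1 s * a1 s + b1 s * b1 s)); last by apply/funext => u; rewrite !expr2.
  by apply: is_derive_eq; rewrite /GRing.scale /=; ring.
have hq := is_derive1_sqrt (pd_v2_gt0 hs (pos hs)).
apply: (chain_rule _ hq hv) => //; rewrite -/(pd_v s); field.
exact: vn.
Qed.

Definition pd_q1 s := (r1 s * a1 s + r s * a2 s) / pd_v s
  - r s * a1 s * ((a1 s * a2 s + b1 s * b2 s) / pd_v s) / pd_v s ^+ 2.
Definition pd_q2 s := (r1 s * b1 s + r s * b2 s) / pd_v s
  - r s * b1 s * ((a1 s * a2 s + b1 s * b2 s) / pd_v s) / pd_v s ^+ 2.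

Lemma pd_p1_derive s : I s -> is_derive s 1 pd_p1 (pd_q1 s).
Proof.
move=> hs; have hv := pd_v_derive hs; have hV := is_deriveV (vn hs) hv.
have [hr ha] := (pd_r D hs, pd_a1 D hs).
rewrite /pd_p1; apply: is_derive_eq; rewrite /GRing.scale /= /pd_q1; field; exact: vn.
Qed.

Lemma pd_p2_derive s : I s -> is_derive s 1 pd_p2 (pd_q2 s).
Proof.
move=> hs; have hv := pd_v_derive hs; have hV := is_deriveV (vn hs) hv.
have [hr ha] := (pd_r D hs, pd_b1 D hs).
rewrite /pd_p2; apply: is_derive_eq; rewrite /GRing.scale /= /pd_q2; field; exact: vn.
Qed.

Let X1 s := pd_q1 s + pd_w s * (a s - 2 * H * pd_p2 s).
Let X2 s := pd_q2 s + pd_w s * (b s + 2 * H * pd_p1 s).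

Lemma X_continuous s : I s -> {for s, continuous X1} /\ {for s, continuous X2}.
Proof.
move=> hs; have [ca cb cr ca1 cb1] := pd_continuous hs.
have cr1 := pd_r1 D hs; have ca2 := pd_a2 D hs; have cb2 := pd_b2 D hs.
have cv : {for s, continuous pd_v} by exact: v_continuous.
have cV : {for s, continuous (fun x => (pd_v x)^-1)} by apply: cvgV; [exact: vn|exact: cv].
have cw := pd_w_continuous hs.
have cp1 := is_derive_continuous (pd_p1_derive hs).
have cp2 := is_derive_continuous (pd_p2_derive hs).
have cV2 : {for s, continuous (fun x => (pd_v x ^+ 2)^-1)}.
  by apply: cvgV; [rewrite sqrf_eq0; exact: vn|exact: cvg_sqr].
have cS : {for s, continuous (fun x => (a1 x * a2 x + b1 x * b2 x) / pd_v x)}.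
  by apply: cvgM => //; apply: cvgD; apply: cvgM.
have c2H (f : R -> R) : {for s, continuous f} -> {for s, continuous (fun x => 2 * H * f x)}.
  by move=> cf; apply: cvgM; [exact: cvg_cst|exact: cf].
split; apply: cvgD.
- by apply: cvgB; apply: cvgM => //; [apply: cvgD; apply: cvgM|apply: cvgM => //; apply: cvgM].
- by apply: cvgM => //; apply: cvgB => //; exact: c2H.
- by apply: cvgB; apply: cvgM => //; [apply: cvgD; apply: cvgM|apply: cvgM => //; apply: cvgM].
- by apply: cvgM => //; apply: cvgD => //; exact: c2H.
Qed.

(** The derivatives of |p|^2 + |z|^2 = 1 and of a p2 - b p1 + H |z|^2 = E + H. *)
Lemma X_relations s : I s -> pd_p1 s * X1 s + pd_p2 s * X2 s = 0 /\ a s * X2 s - b s * X1 s = 0.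
Proof.
move=> hs.
have [[ha hb] [hp1 hp2]] := ((pd_a D hs, pd_b D hs), (pd_p1_derive hs, pd_p2_derive hs)).
have K1 : is_derive s 1 (fun u => pd_p1 u * pd_p1 u + pd_p2 u * pd_p2 u + a u * a u + b u * b u)
  (2 * (pd_p1 s * pd_q1 s + pd_p2 s * pd_q2 s + a s * a1 s + b s * b1 s)).
  by apply: is_derive_eq; rewrite /GRing.scale /=; ring.
have k1 : 2 * (pd_p1 s * pd_q1 s + pd_p2 s * pd_q2 s + a s * a1 s + b s * b1 s) = 0.
  apply: (near_const_derive (k := 1) K1); apply: filterS (nearI hs) => y hy.
  by rewrite -!expr2 pd_p_sqr// -(pd_sphere D hy); ring.
have K2 : is_derive s 1 (fun u => a u * pd_p2 u - b u * pd_p1 u + H * (a u * a u + b u * b u))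
  (a1 s * pd_p2 s + a s * pd_q2 s - b1 s * pd_p1 s - b s * pd_q1 s + 2 * H * (a s * a1 s + b s * b1 s)).
  by apply: is_derive_eq; rewrite /GRing.scale /=; ring.
have k2 : a1 s * pd_p2 s + a s * pd_q2 s - b1 s * pd_p1 s - b s * pd_q1 s + 2 * H * (a s * a1 s + b s * b1 s) = 0.
  apply: (near_const_derive (k := E + H) K2); apply: filterS (nearI hs) => y hy.
  rewrite pd_momentum// -!expr2; have -> : a y ^+ 2 + b y ^+ 2 = 1 - r y ^+ 2 by have := pd_sphere D hy; lra.
  by ring.
rewrite /X1 /X2; rewrite (pd_aw hs) (pd_bw hs) in k1 k2; split.
- transitivity (2^-1 * (2 * (pd_p1 s * pd_q1 s + pd_p2 s * pd_q2 s + a s * (pd_w s * pd_p1 s) + b s * (pd_w s * pd_p2 s)))).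
    by field.
  by rewrite k1 mulr0.
- by rewrite -[RHS]k2; ring.
Qed.

(** The determinant of the two relations is a multiple of r'. *)
Lemma X_generic s : I s -> r1 s != 0 -> X1 s = 0 /\ X2 s = 0.
Proof.
move=> hs r10; have [e1 e2] := X_relations hs.
have dn : a s * pd_p1 s + b s * pd_p2 s != 0.
  have -> : a s * pd_p1 s + b s * pd_p2 s = - (r s * r s * r1 s / pd_v s).
    rewrite /pd_p1 /pd_p2; transitivity (r s / pd_v s * (a s * a1 s + b s * b1 s)); first by ring.
    by rewrite (_ : a s * a1 s + b s * b1 s = - (r s * r1 s)); [ring|have := pd_orth hs; lra].
  by rewrite oppr_eq0 !mulf_neq0 ?invr_neq0 ?rn ?vn.
split; apply: (mulfI dn); rewrite mulr0.
  transitivity (a s * (pd_p1 s * X1 s + pd_p2 s * X2 s) - pd_p2 s * (a s * X2 s - b s * X1 s)); first by ring.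
  by rewrite e1 e2 !mulr0 subr0.
transitivity (b s * (pd_p1 s * X1 s + pd_p2 s * X2 s) + pd_p1 s * (a s * X2 s - b s * X1 s)); first by ring.
by rewrite e1 e2 !mulr0 addr0.
Qed.

(** Here z is orthogonal to p and the two relations of [X_relations] coincide; the
    remaining component of the defect vanishes by the mean curvature equation. *)
Lemma X_stationary s : I s -> (\forall y \near s, r1 y = 0) -> X1 s = 0 /\ X2 s = 0.
Proof.
move=> hs n0; have c := pd_cmc D hs (pos hs) n0.
have r10 : r1 s = 0 by exact: nbhs_singleton n0.
have [ha hb] := (pd_a1 D hs, pd_b1 D hs).
have U := pd_unit D hs; have O := pd_orth hs; rewrite r10 in U O.
have K : is_derive s 1 (fun u => a1 u * a1 u + b1 u * b1 u) (2 * (a1 s * a2 s + b1 s * b2 s)).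
  by apply: is_derive_eq; rewrite /GRing.scale /=; ring.
have k : 2 * (a1 s * a2 s + b1 s * b2 s) = 0.
  apply: (near_const_derive (k := 1) K).
  near=> y; have hy : I y by near: y; exact: nearI.
  have r1y : r1 y = 0 by near: y.
  by have := pd_unit D hy; rewrite r1y !expr2; lra.
have vs : pd_v s = 1.
  by rewrite /pd_v (_ : v2 s = 1) ?sqrtr1//; lra.
have aa : a s = j s * b1 s.
  transitivity (a s * (a1 s ^+ 2 + b1 s ^+ 2) - a1 s * (a s * a1 s + b s * b1 s)); last by ring.
  rewrite (_ : a1 s ^+ 2 + b1 s ^+ 2 = 1); last lra.
  by rewrite (_ : a s * a1 s + b s * b1 s = 0); [ring|lra].
have bb : b s = - (j s * a1 s).
  transitivity (b s * (a1 s ^+ 2 + b1 s ^+ 2) - b1 s * (a s * a1 s + b s * b1 s)); last by ring.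
  rewrite (_ : a1 s ^+ 2 + b1 s ^+ 2 = 1); last lra.
  by rewrite (_ : a s * a1 s + b s * b1 s = 0); [ring|lra].
pose mu := a1 s * b2 s - b1 s * a2 s.
have a2E : a2 s = - (mu * b1 s).
  transitivity (a2 s * (a1 s ^+ 2 + b1 s ^+ 2) - a1 s * (a1 s * a2 s + b1 s * b2 s)); last by rewrite /mu; ring.
  rewrite (_ : a1 s ^+ 2 + b1 s ^+ 2 = 1); last lra.
  by rewrite (_ : a1 s * a2 s + b1 s * b2 s = 0); [ring|lra].
have b2E : b2 s = mu * a1 s.
  transitivity (b2 s * (a1 s ^+ 2 + b1 s ^+ 2) - b1 s * (a1 s * a2 s + b1 s * b2 s)); last by rewrite /mu; ring.
  rewrite (_ : a1 s ^+ 2 + b1 s ^+ 2 = 1); last lra.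
  by rewrite (_ : a1 s * a2 s + b1 s * b2 s = 0); [ring|lra].
have c' : r s ^+ 2 * mu = j s - 2 * H * r s.
  have := congr1 (fun x => x * r s) c; rewrite -/mu /= mulrBl divfK ?rn// => e.
  by rewrite expr2 -mulrA [r s * mu]mulrC mulrA; lra.
have S0 : a1 s * a2 s + b1 s * b2 s = 0 by lra.
have rs := rn hs.
rewrite /X1 /X2 /pd_q1 /pd_q2 /pd_w /pd_p1 /pd_p2 vs r10 S0.
split; apply: (mulfI rs).
  rewrite {1}a2E [a s]aa.
  transitivity (- b1 s * (r s ^+ 2 * mu) + (j s - 2 * H * r s) * b1 s); last by rewrite c'; ring.
  by field.
rewrite {1}b2E [b s]bb.
transitivity (a1 s * (r s ^+ 2 * mu) - (j s - 2 * H * r s) * a1 s); last by rewrite c'; ring.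
by field.
Unshelve. all: by end_near. Qed.

(** With z = a + i b and p = p1 + i p2 this reads p' = - w (2 i H p + z). The
    defect X of this equation is annihilated by two linear relations, which
    come from |p| = r and from the energy; they are independent where r' <> 0.
    Points where r' <> 0 are dense off the open set where r is locally
    constant, which is covered by the mean curvature equation, and X is
    continuous. *)
Theorem pd_system s : I s -> is_derive s 1 pd_p1 (- (pd_w s * (a s - 2 * H * pd_p2 s))) /\
  is_derive s 1 pd_p2 (- (pd_w s * (b s + 2 * H * pd_p1 s))).
Proof.
move=> hs.
suff [x1 x2] : X1 s = 0 /\ X2 s = 0.
  have := (pd_p1_derive hs, pd_p2_derive hs).
  rewrite (_ : pd_q1 s = - (pd_w s * (a s - 2 * H * pd_p2 s))); last first.
    by apply/eqP; rewrite -addr_eq0; apply/eqP.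
  rewrite (_ : pd_q2 s = - (pd_w s * (b s + 2 * H * pd_p1 s))) => [[]//|].
  by apply/eqP; rewrite -addr_eq0; apply/eqP.
have [c1 c2] := X_continuous hs.
have main (X : R -> R) : {for s, continuous X} ->
    (forall y, I y -> r1 y != 0 -> X y = 0) -> X s != 0 -> \forall y \near s, r1 y = 0.
  move=> cX hX X0; have n1 : \forall y \near s, X y != 0 by apply: (cvgr_neq0 _ cX).
  near=> y; have hy : I y by near: y; exact: nearI.
  have Xy : X y != 0 by near: y.
  by apply/eqP; apply: contraNT Xy => r1y; rewrite hX.
split; apply/eqP; apply: contraT => X0.
  have n := main X1 c1 (fun y hy r => (X_generic hy r).1) X0.
  by rewrite (X_stationary hs n).1 eqxx in X0.
have n := main X2 c2 (fun y hy r => (X_generic hy r).2) X0.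
by rewrite (X_stationary hs n).2 eqxx in X0.
Unshelve. all: by end_near. Qed.

End PositiveHeight.
End ScalarODE.

(** * Integration of the equation of motion *)

Section Model.
Context {R : realType}.
Implicit Types H E P Q ph t : R.

Definition lam H := Num.sqrt (1 + H ^+ 2).
(** Up to sign, the heights at the ends of the minor axis and of the major axis of
    the ellipse. *)
Definition coefA H P Q := lam H * P - H * Q.
Definition coefB H P Q := lam H * Q - H * P.
(** The components of z = e^(i (ph - H t)) (P cos (lam t) + i Q sin (lam t)). *)
Definition model_x H P Q ph t :=
  P * cos (lam H * t) * cos (ph - H * t) - Q * sin (lam H * t) * sin (ph - H * t).
Definition model_y H P Q ph t :=
  P * cos (lam H * t) * sin (ph - H * t) + Q * sin (lam H * t) * cos (ph - H * t).
Definition model_height2 H P Q t :=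
  coefA H P Q ^+ 2 * sin (lam H * t) ^+ 2 + coefB H P Q ^+ 2 * cos (lam H * t) ^+ 2.
Definition model_height H P Q t := Num.sqrt (model_height2 H P Q t).

(** The constants of motion of the model. The semi-axes satisfy P >= |Q|, and A and
    B are the largest and the smallest height up to sign; the last two identities
    express the mean curvature and the energy by the semi-axes. *)
Record shape H E P Q : Prop := {
  shape_P : 0 < P;
  shape_Q : `|Q| <= P;
  shape_PB : P ^+ 2 + coefB H P Q ^+ 2 = 1;
  shape_QA : Q ^+ 2 + coefA H P Q ^+ 2 = 1;
  shape_PQ : lam H * P * Q = E + H;
  shape_AB : lam H * coefA H P Q * coefB H P Q = E }.

Lemma lam_sqr H : lam H ^+ 2 = 1 + H ^+ 2.
Proof. by rewrite sqr_sqrtr// addr_ge0 ?sqr_ge0. Qed.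

Lemma lam_gt0 H : 0 < lam H.
Proof. by rewrite sqrtr_gt0 ltr_pwDl ?sqr_ge0. Qed.

Lemma lam_gt H : `|H| < lam H.
Proof.
rewrite -(@ltr_pXn2r _ 2) ?nnegrE ?(ltW (lam_gt0 H))//.
by rewrite lam_sqr real_normK ?num_real// ltrDr.
Qed.

Lemma lam0 : lam 0 = 1 :> R.
Proof. by rewrite /lam expr0n addr0 sqrtr1. Qed.

Lemma quadratic_angle (c s : R) : exists u, 0 <= c * cos (u *+ 2) + s * sin (u *+ 2) /\
  - c * sin (u *+ 2) + s * cos (u *+ 2) = 0.
Proof.
have [t [hc hs]] := polar c s; set n := Num.sqrt _ in hc hs.
exists (t / 2); have -> : t / 2 *+ 2 = t by rewrite -mulr_natr divfK.
rewrite hc hs; split; last by ring.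
have -> : n * cos t * cos t + n * sin t * sin t = n * (cos t ^+ 2 + sin t ^+ 2) by ring.
by rewrite cos2Dsin2 mulr1 sqrtr_ge0.
Qed.

(** The curve al cos u + be sin u in the plane is an ellipse; choosing the
    origin of u at a vertex makes it P cos u + i Q sin u up to a rotation. *)
Lemma ellipse_axes (al1 al2 be1 be2 : R) : exists u0 ph P Q,
  [/\ 0 <= P, `|Q| <= P & forall u,
    al1 * cos (u + u0) + be1 * sin (u + u0) = P * cos u * cos ph - Q * sin u * sin ph /\
    al2 * cos (u + u0) + be2 * sin (u + u0) = P * cos u * sin ph + Q * sin u * cos ph].
Proof.
have [u0 [h1 h2]] := quadratic_angle (al1 ^+ 2 + al2 ^+ 2 - be1 ^+ 2 - be2 ^+ 2)
  (2 * (al1 * be1 + al2 * be2)).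
rewrite cos_mulr2n sin_mulr2n !mulr2n in h1 h2.
have cs := cos2Dsin2 u0.
pose Y1 := al1 * cos u0 + be1 * sin u0; pose Y2 := al2 * cos u0 + be2 * sin u0.
pose Z1 := - al1 * sin u0 + be1 * cos u0; pose Z2 := - al2 * sin u0 + be2 * cos u0.
have YZ : Y1 * Z1 + Y2 * Z2 = 0.
  apply: (mulfI (x := 2)); first by rewrite pnatr_eq0.
  rewrite mulr0 -[RHS]h2.
  have -> : cos u0 ^+ 2 + cos u0 ^+ 2 - 1 = cos u0 ^+ 2 - sin u0 ^+ 2 by lra.
  by rewrite /Y1 /Y2 /Z1 /Z2; ring.
have YgeZ : Z1 ^+ 2 + Z2 ^+ 2 <= Y1 ^+ 2 + Y2 ^+ 2.
  rewrite -subr_ge0; suff -> : Y1 ^+ 2 + Y2 ^+ 2 - (Z1 ^+ 2 + Z2 ^+ 2) =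
    (al1 ^+ 2 + al2 ^+ 2 - be1 ^+ 2 - be2 ^+ 2) * (cos u0 ^+ 2 + cos u0 ^+ 2 - 1) +
    2 * (al1 * be1 + al2 * be2) * (cos u0 * sin u0 + cos u0 * sin u0) by [].
  have -> : cos u0 ^+ 2 + cos u0 ^+ 2 - 1 = cos u0 ^+ 2 - sin u0 ^+ 2 by lra.
  by rewrite /Y1 /Y2 /Z1 /Z2; ring.
have [ph [y1E y2E]] := polar Y1 Y2; set P := Num.sqrt _ in y1E y2E.
have cp := cos2Dsin2 ph.
have P0 : 0 <= P by exact: sqrtr_ge0.
have P2 : P ^+ 2 = Y1 ^+ 2 + Y2 ^+ 2 by rewrite sqr_sqrtr// addr_ge0 ?sqr_ge0.
pose Q := - Z1 * sin ph + Z2 * cos ph.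
have Zperp : Z1 * cos ph + Z2 * sin ph = 0.
  have [P00|Pn0] := eqVneq P 0.
    have q := YgeZ; rewrite -P2 P00 expr0n /= in q.
    have := (sqr_ge0 Z1, sqr_ge0 Z2) => -[q1 q2].
    have -> : Z1 = 0 by apply/eqP; rewrite -sqrf_eq0; apply/eqP; lra.
    have -> : Z2 = 0 by apply/eqP; rewrite -sqrf_eq0; apply/eqP; lra.
    by rewrite !mul0r addr0.
  apply: (mulfI Pn0); rewrite mulr0 -[RHS]YZ y1E y2E; ring.
have Z1E : Z1 = - Q * sin ph.
  transitivity (Z1 * (cos ph ^+ 2 + sin ph ^+ 2) - cos ph * (Z1 * cos ph + Z2 * sin ph)).
    by rewrite cp Zperp; ring.
  by rewrite /Q; ring.
have Z2E : Z2 = Q * cos ph.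
  transitivity (Z2 * (cos ph ^+ 2 + sin ph ^+ 2) - sin ph * (Z1 * cos ph + Z2 * sin ph)).
    by rewrite cp Zperp; ring.
  by rewrite /Q; ring.
exists u0, ph, P, Q; split => //.
  rewrite -(@ler_pXn2r _ 2) ?nnegrE// real_normK ?num_real// P2; apply: le_trans YgeZ.
  rewrite Z1E Z2E; have -> : (- Q * sin ph) ^+ 2 + (Q * cos ph) ^+ 2 = Q ^+ 2 * (cos ph ^+ 2 + sin ph ^+ 2) by ring.
  by rewrite cp mulr1.
move=> u; rewrite cosD sinD; split.
  transitivity (cos u * Y1 + sin u * Z1); first by rewrite /Y1 /Z1; ring.
  by rewrite y1E Z1E; ring.
transitivity (cos u * Y2 + sin u * Z2); first by rewrite /Y2 /Z2; ring.
by rewrite y2E Z2E; ring.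
Qed.

End Model.

Section NormalForm.
Context {R : realType}.
Variables (I : set R) (H E : R) (a b r a1 b1 r1 a2 b2 : R -> R) (s0 : R).
Hypothesis D : profile_data I H E a b r a1 b1 r1 a2 b2.
Hypothesis pos : forall s, I s -> 0 < r s.
Hypothesis Is0 : I s0.

Local Notation w := (pd_w r a1 b1).
Local Notation p1 := (pd_p1 r a1 b1).
Local Notation p2 := (pd_p2 r a1 b1).
Local Notation L := (lam H).

(** In the frame rotating with angular velocity - H, y = e^(i H t) z satisfies
    y'' = - L^2 y in the new time t, hence describes an ellipse. The relations
    in [shape] are the identities |z|^2 + r^2 = 1, |p| = r and the energy, read
    off at the vertices. *)
Theorem normal_form : exists ph P Q xi, shape H E P Q /\ forall s, I s ->
  [/\ is_derive s 1 xi (w s), a s = model_x H P Q ph (xi s), b s = model_y H P Q ph (xi s) &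
      r s = model_height H P Q (xi s)].
Proof.
have [X hX] := antiderivative (pd_open D) (pd_itv D) Is0 (pd_w_continuous D pos).
have L0 := lam_gt0 H; have L2 := lam_sqr H; have Ln : L != 0 by rewrite gt_eqF.
pose y1 s := a s * cos (H * X s) - b s * sin (H * X s).
pose y2 s := a s * sin (H * X s) + b s * cos (H * X s).
pose q1 s := (p1 s - H * b s) * cos (H * X s) - (p2 s + H * a s) * sin (H * X s).
pose q2 s := (p1 s - H * b s) * sin (H * X s) + (p2 s + H * a s) * cos (H * X s).
have dcos k s : I s -> is_derive s 1 (fun u => cos (k * X u)) (- sin (k * X s) * (k * w s)).
  move=> hs; have hk : is_derive s 1 (fun u => k * X u) (k * w s).
    by have := hX s hs => ?; apply: is_derive_eq; rewrite /GRing.scale /= ?mulr0 ?addr0.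
  exact: (chain_rule (erefl _) (is_derive_cos _) hk).
have dsin k s : I s -> is_derive s 1 (fun u => sin (k * X u)) (cos (k * X s) * (k * w s)).
  move=> hs; have hk : is_derive s 1 (fun u => k * X u) (k * w s).
    by have := hX s hs => ?; apply: is_derive_eq; rewrite /GRing.scale /= ?mulr0 ?addr0.
  exact: (chain_rule (erefl _) (is_derive_sin _) hk).
have D0 s : I s -> [/\ is_derive s 1 a (w s * p1 s), is_derive s 1 b (w s * p2 s),
    is_derive s 1 p1 (- (w s * (a s - 2 * H * p2 s))) & is_derive s 1 p2 (- (w s * (b s + 2 * H * p1 s)))].
  move=> hs; have [e1 e2] := pd_system D pos hs; split => //.
    by have := pd_a D hs; rewrite (pd_aw D pos hs).
  by have := pd_b D hs; rewrite (pd_bw D pos hs).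
have Dy s : I s -> [/\ is_derive s 1 y1 (w s * q1 s), is_derive s 1 y2 (w s * q2 s),
    is_derive s 1 q1 (- (w s * L ^+ 2 * y1 s)) & is_derive s 1 q2 (- (w s * L ^+ 2 * y2 s))].
  move=> hs; have [ha hb hp1 hp2] := D0 s hs; have hc := dcos H s hs; have hsn := dsin H s hs.
  rewrite L2; split.
  - by apply: is_derive_eq; rewrite /GRing.scale /= /q1; ring.
  - by apply: is_derive_eq; rewrite /GRing.scale /= /q2; ring.
  - by apply: is_derive_eq; rewrite /GRing.scale /= /y1; ring.
  - by apply: is_derive_eq; rewrite /GRing.scale /= /y2; ring.
pose al (y q : R -> R) s := y s * cos (L * X s) - q s / L * sin (L * X s).
pose be (y q : R -> R) s := y s * sin (L * X s) + q s / L * cos (L * X s).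
have cst (y q : R -> R) : (forall s, I s -> is_derive s 1 y (w s * q s)) ->
    (forall s, I s -> is_derive s 1 q (- (w s * L ^+ 2 * y s))) ->
    forall s, I s -> y s = al y q s0 * cos (L * X s) + be y q s0 * sin (L * X s) /\
      q s = L * (- al y q s0 * sin (L * X s) + be y q s0 * cos (L * X s)).
  move=> hy hq s hs.
  have ca : al y q s = al y q s0.
    apply: (derive0_const (pd_itv D) _ hs Is0) => u hu.
    have [hyu hqu] := (hy u hu, hq u hu); have hc := dcos L u hu; have hsn := dsin L u hu.
    by rewrite /al; apply: is_derive_eq; rewrite /GRing.scale /=; field.
  have cb : be y q s = be y q s0.
    apply: (derive0_const (pd_itv D) _ hs Is0) => u hu.
    have [hyu hqu] := (hy u hu, hq u hu); have hc := dcos L u hu; have hsn := dsin L u hu.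
    by rewrite /be; apply: is_derive_eq; rewrite /GRing.scale /=; field.
  have cs := cos2Dsin2 (L * X s).
  rewrite -ca -cb /al /be; split.
    by rewrite -[LHS]mulr1 -cs; ring.
  rewrite -[LHS]mulr1 -cs; field; exact: Ln.
have [c1 c2] : (forall s, I s -> y1 s = al y1 q1 s0 * cos (L * X s) + be y1 q1 s0 * sin (L * X s) /\
      q1 s = L * (- al y1 q1 s0 * sin (L * X s) + be y1 q1 s0 * cos (L * X s))) /\
    (forall s, I s -> y2 s = al y2 q2 s0 * cos (L * X s) + be y2 q2 s0 * sin (L * X s) /\
      q2 s = L * (- al y2 q2 s0 * sin (L * X s) + be y2 q2 s0 * cos (L * X s))).
  by split; apply: cst => s /Dy [].
move: c1 c2; move: (al y1 q1 s0) (be y1 q1 s0) (al y2 q2 s0) (be y2 q2 s0).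
move=> al1 be1 al2 be2 c1 c2.
have [u0 [ph0 [P [Q [P0 QP ell]]]]] := ellipse_axes al1 al2 be1 be2.
have ell' u : - al1 * sin (u + u0) + be1 * cos (u + u0) = - P * sin u * cos ph0 - Q * cos u * sin ph0 /\
    - al2 * sin (u + u0) + be2 * cos (u + u0) = - P * sin u * sin ph0 + Q * cos u * cos ph0.
  have [e1 e2] := ell (u + pi / 2).
  have hc x : cos (x + pi / 2) = - sin x by exact: cosDpihalf.
  have hs x : sin (x + pi / 2) = cos x by exact: sinDpihalf.
  rewrite [u + pi / 2 + u0]addrAC !hc !hs in e1 e2.
  by split; [rewrite -[RHS]mulr1; lra|lra].
pose xi s := X s - u0 / L; pose ph := ph0 - H * (u0 / L).
have LX s : L * X s = L * xi s + u0 by rewrite /xi; field.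
have HX s : H * X s = ph0 - (ph - H * xi s) by rewrite /xi /ph; field.
have form s : I s -> [/\ a s = model_x H P Q ph (xi s), b s = model_y H P Q ph (xi s),
    p1 s = - coefA H P Q * sin (L * xi s) * cos (ph - H * xi s) - coefB H P Q * cos (L * xi s) * sin (ph - H * xi s) &
    p2 s = - coefA H P Q * sin (L * xi s) * sin (ph - H * xi s) + coefB H P Q * cos (L * xi s) * cos (ph - H * xi s)].
  move=> hs; have [e1 f1] := c1 s hs; have [e2 f2] := c2 s hs.
  rewrite LX in e1 f1 e2 f2; have [g1 g2] := ell (L * xi s); have [k1 k2] := ell' (L * xi s).
  rewrite g1 in e1; rewrite g2 in e2; rewrite k1 in f1; rewrite k2 in f2.
  have cs := cos2Dsin2 (H * X s).
  have aE : a s = y1 s * cos (H * X s) + y2 s * sin (H * X s).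
    by rewrite -[LHS]mulr1 -cs /y1 /y2; ring.
  have bE : b s = - y1 s * sin (H * X s) + y2 s * cos (H * X s).
    by rewrite -[LHS]mulr1 -cs /y1 /y2; ring.
  have pE1 : p1 s = q1 s * cos (H * X s) + q2 s * sin (H * X s) + H * b s.
    transitivity ((p1 s - H * b s) * (cos (H * X s) ^+ 2 + sin (H * X s) ^+ 2) + H * b s); first by rewrite cs; ring.
    by rewrite /q1 /q2; ring.
  have pE2 : p2 s = - q1 s * sin (H * X s) + q2 s * cos (H * X s) - H * a s.
    transitivity ((p2 s + H * a s) * (cos (H * X s) ^+ 2 + sin (H * X s) ^+ 2) - H * a s); first by rewrite cs; ring.
    by rewrite /q1 /q2; ring.
  have cph := cos2Dsin2 ph0.
  have aF : a s = model_x H P Q ph (xi s).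
    rewrite aE e1 e2 HX (cosB ph0) (sinB ph0) /model_x.
    transitivity ((P * cos (L * xi s) * cos (ph - H * xi s) - Q * sin (L * xi s) * sin (ph - H * xi s))
      * (cos ph0 ^+ 2 + sin ph0 ^+ 2)); [by ring|by rewrite cph mulr1].
  have bF : b s = model_y H P Q ph (xi s).
    rewrite bE e1 e2 HX (cosB ph0) (sinB ph0) /model_y.
    transitivity ((P * cos (L * xi s) * sin (ph - H * xi s) + Q * sin (L * xi s) * cos (ph - H * xi s))
      * (cos ph0 ^+ 2 + sin ph0 ^+ 2)); [by ring|by rewrite cph mulr1].
  split => //.
  - rewrite pE1 f1 f2 bF HX (cosB ph0) (sinB ph0) /model_y /coefA /coefB.
    transitivity (L * (- P * sin (L * xi s) * cos (ph - H * xi s) - Q * cos (L * xi s) * sin (ph - H * xi s))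
      * (cos ph0 ^+ 2 + sin ph0 ^+ 2) + H * (P * cos (L * xi s) * sin (ph - H * xi s) + Q * sin (L * xi s) * cos (ph - H * xi s))); [by ring|].
    by rewrite cph; ring.
  - rewrite pE2 f1 f2 aF HX (cosB ph0) (sinB ph0) /model_x /coefA /coefB.
    transitivity (L * (- P * sin (L * xi s) * sin (ph - H * xi s) + Q * cos (L * xi s) * cos (ph - H * xi s))
      * (cos ph0 ^+ 2 + sin ph0 ^+ 2) - H * (P * cos (L * xi s) * cos (ph - H * xi s) - Q * sin (L * xi s) * sin (ph - H * xi s))); [by ring|].
    by rewrite cph; ring.
have [fa fb fp1 fp2] := form s0 Is0.
have S := pd_sphere D Is0; have pr := pd_p_sqr D pos Is0; have mo := pd_momentum D pos Is0.
have cs := cos2Dsin2 (L * xi s0); have cq := cos2Dsin2 (ph - H * xi s0).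
set C := cos (L * xi s0) in cs fa fb fp1 fp2 *; set Sn := sin (L * xi s0) in cs fa fb fp1 fp2 *.
set A := coefA H P Q in fp1 fp2 form *; set B := coefB H P Q in fp1 fp2 form *.
have zz : a s0 ^+ 2 + b s0 ^+ 2 = P ^+ 2 * C ^+ 2 + Q ^+ 2 * Sn ^+ 2.
  rewrite fa fb /model_x /model_y -/C -/Sn.
  transitivity ((P ^+ 2 * C ^+ 2 + Q ^+ 2 * Sn ^+ 2) * (cos (ph - H * xi s0) ^+ 2 + sin (ph - H * xi s0) ^+ 2)); first by ring.
  by rewrite cq mulr1.
have rrE s : I s -> r s ^+ 2 = model_height2 H P Q (xi s).
  move=> hs; rewrite -(pd_p_sqr D pos hs); have [_ _ -> ->] := form s hs.
  rewrite /model_height2 -/A -/B; have cq' := cos2Dsin2 (ph - H * xi s).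
  transitivity ((A ^+ 2 * sin (L * xi s) ^+ 2 + B ^+ 2 * cos (L * xi s) ^+ 2) * (cos (ph - H * xi s) ^+ 2 + sin (ph - H * xi s) ^+ 2)); first by ring.
  by rewrite cq' mulr1.
have rr := rrE s0 Is0; rewrite /model_height2 -/A -/B -/C -/Sn in rr.
have PBQA : P ^+ 2 + B ^+ 2 = Q ^+ 2 + A ^+ 2.
  rewrite /A /B /coefA /coefB.
  transitivity (P ^+ 2 + L ^+ 2 * Q ^+ 2 - 2 * H * L * P * Q + H ^+ 2 * P ^+ 2); first by ring.
  rewrite L2; transitivity (Q ^+ 2 + L ^+ 2 * P ^+ 2 - 2 * H * L * P * Q + H ^+ 2 * Q ^+ 2); last by ring.
  by rewrite L2; ring.
have one : P ^+ 2 + B ^+ 2 = 1.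
  transitivity ((P ^+ 2 + B ^+ 2) * C ^+ 2 + (P ^+ 2 + B ^+ 2) * Sn ^+ 2); first by rewrite -mulrDr cs mulr1.
  by rewrite {2}PBQA -[RHS]S zz rr; ring.
have Pn : P != 0.
  apply/eqP => P00; have Q00 : Q = 0 by move: QP; rewrite P00 normr_le0 => /eqP.
  by move/eqP: one; rewrite /B /coefB P00 Q00 !mulr0 subr0 expr0n addr0 eq_sym oner_eq0.
have EAB : L * A * B = E.
  have e1 : P * B - H * B ^+ 2 = L * A * B.
    rewrite /A /coefA; transitivity (B * (P - H * (L * Q) + H ^+ 2 * P)).
      by rewrite /B /coefB; ring.
    transitivity (B * (L ^+ 2 * P - H * L * Q)); last by ring.
    by rewrite L2; ring.
  have e2 : Q * A - H * A ^+ 2 = L * A * B.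
    rewrite /B /coefB; transitivity (A * (Q - H * (L * P) + H ^+ 2 * Q)).
      by rewrite /A /coefA; ring.
    transitivity (A * (L ^+ 2 * Q - H * L * P)); last by ring.
    by rewrite L2; ring.
  have zp : a s0 * p2 s0 - b s0 * p1 s0 = P * B * C ^+ 2 + Q * A * Sn ^+ 2.
    rewrite fp1 fp2 fa fb /model_x /model_y -/C -/Sn.
    transitivity ((P * B * C ^+ 2 + Q * A * Sn ^+ 2) * (cos (ph - H * xi s0) ^+ 2 + sin (ph - H * xi s0) ^+ 2)); first by ring.
    by rewrite cq mulr1.
  have : E = (P * B - H * B ^+ 2) * C ^+ 2 + (Q * A - H * A ^+ 2) * Sn ^+ 2.
    have : E = a s0 * p2 s0 - b s0 * p1 s0 - H * r s0 ^+ 2 by rewrite mo; ring.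
    by rewrite zp rr => ->; ring.
  by rewrite e1 e2 -mulrDr cs mulr1.
have PQE : L * P * Q = E + H.
  rewrite -EAB.
  have e : L * P * Q - L * A * B = H * (P ^+ 2 + B ^+ 2).
    have X2 : P ^+ 2 + B ^+ 2 = L ^+ 2 * (P ^+ 2 + Q ^+ 2) - 2 * H * L * P * Q.
      rewrite /B /coefB; transitivity (P ^+ 2 + L ^+ 2 * Q ^+ 2 - 2 * H * L * P * Q + H ^+ 2 * P ^+ 2); first by ring.
      by rewrite L2; ring.
    rewrite X2 /A /B /coefA /coefB.
    transitivity (L * (P * Q * (1 - L ^+ 2 - H ^+ 2) + L * H * (P ^+ 2 + Q ^+ 2))); first by ring.
    have -> : 1 - L ^+ 2 - H ^+ 2 = - 2 * H ^+ 2 by rewrite L2; ring.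
    by ring.
  by rewrite one in e; lra.
exists ph, P, Q, xi; split.
  split => //; [by rewrite lt_def Pn|by rewrite -PBQA].
move=> s hs; have [h1 h2 _ _] := form s hs; split => //.
  have := hX s hs => h; rewrite /xi.
  by apply: is_derive_eq; rewrite subr0.
by rewrite /model_height -rrE// sqrtr_sqr gtr0_norm// pos.
Qed.

End NormalForm.

(** * Global structure of the generating curve *)

Section ModelGeometry.
Context {R : realType}.
Variables (H E P Q : R).
Local Notation L := (lam H).
Local Notation A := (coefA H P Q).
Local Notation B := (coefB H P Q).

Definition model ph t : 'rV[R]_4 := vec4 (model_x H P Q ph t) (model_y H P Q ph t) (model_height H P Q t) 0.

Lemma sin_intpi (n : int) : sin (n%:~R * pi : R) = 0.
Proof.
have hn (k : nat) : sin (k%:R * pi : R) = 0.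
  elim: k => [|k IH]; first by rewrite mul0r sin0.
  by rewrite -natr1 mulrDl mul1r sinDpi IH oppr0.
case: n => k; first exact: hn.
by rewrite NegzE mulrNz mulNr sinN -pmulrn hn oppr0.
Qed.

Lemma cos_intpi_sqr (n : int) : cos (n%:~R * pi : R) ^+ 2 = 1.
Proof. by rewrite cos2sin2 sin_intpi expr0n subr0. Qed.

(** After the time pi / L the factor P cos + i Q sin has changed its sign, and
    the frame has turned by - H pi / L. *)
Lemma model_shift (n : int) ph t :
  model ph (t + n%:~R * (pi / L)) = model (ph + n%:~R * (pi - H * (pi / L))) t.
Proof.
have Ln : L != 0 by rewrite gt_eqF// lam_gt0.
have e1 : L * (t + n%:~R * (pi / L)) = L * t + n%:~R * pi by field.
have e2 : ph + n%:~R * (pi - H * (pi / L)) - H * t =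
  (ph - H * (t + n%:~R * (pi / L))) + n%:~R * pi by ring.
have s0 := sin_intpi n; have c1 := cos_intpi_sqr n.
rewrite /model /model_x /model_y /model_height /model_height2 e1 e2 !(cosD, sinD) s0 !mulr0 ?subr0 ?addr0.
set k := cos (n%:~R * pi) in c1 *.
rewrite !exprMn c1 !mulr1.
by congr vec4; (rewrite [in RHS]mulrCA ?[in RHS]mulrA ?mulrA); ring.
Qed.

Hypothesis S : shape H E P Q.

(** Because |H| < L and |Q| <= P. *)
Lemma shape_AP : 0 < A.
Proof.
have := shape_P S; have := shape_Q S; have := lam_gt H; rewrite /coefA => h1 h2 h3.
rewrite subr_gt0; apply: (@le_lt_trans _ _ (`|H| * P)).
  by apply: (le_trans (ler_norm _)); rewrite normrM ler_wpM2l.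
by rewrite ltr_pM2r.
Qed.

Lemma shape_BA : B ^+ 2 <= A ^+ 2.
Proof.
have h1 := shape_PB S; have h2 := shape_QA S.
have : Q ^+ 2 <= P ^+ 2.
  by rewrite -[Q ^+ 2]real_normK ?num_real// ler_pXn2r ?nnegrE ?(ltW (shape_P S))// (shape_Q S).
lra.
Qed.

Lemma height2_ge t : B ^+ 2 <= model_height2 H P Q t.
Proof.
have cs := cos2Dsin2 (L * t); have := shape_BA; rewrite /model_height2 => h.
have -> : A ^+ 2 * sin (L * t) ^+ 2 + B ^+ 2 * cos (L * t) ^+ 2 =
  B ^+ 2 + (A ^+ 2 - B ^+ 2) * sin (L * t) ^+ 2.
  by rewrite -[X in _ = X + _]mulr1 -cs; ring.
by rewrite lerDl mulr_ge0 ?sqr_ge0// subr_ge0.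
Qed.

Lemma height2_ge0 t : 0 <= model_height2 H P Q t.
Proof. exact: le_trans (sqr_ge0 _) (height2_ge t). Qed.

Lemma height_sqr t : model_height H P Q t ^+ 2 = model_height2 H P Q t.
Proof. by rewrite sqr_sqrtr// height2_ge0. Qed.

Lemma height_ge t : `|B| <= model_height H P Q t.
Proof. by rewrite -sqrtr_sqr ler_wsqrtr// height2_ge. Qed.

Lemma shape_E0 : (E == 0) = (B == 0).
Proof.
rewrite -(shape_AB S) mulf_eq0 [L * A == 0]mulf_eq0.
by rewrite (gt_eqF (lam_gt0 H)) (gt_eqF shape_AP).
Qed.

Lemma projection_sqr ph t : model_x H P Q ph t ^+ 2 + model_y H P Q ph t ^+ 2 =
  P ^+ 2 * cos (L * t) ^+ 2 + Q ^+ 2 * sin (L * t) ^+ 2.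
Proof.
rewrite /model_x /model_y; have cq := cos2Dsin2 (ph - H * t).
transitivity ((P ^+ 2 * cos (L * t) ^+ 2 + Q ^+ 2 * sin (L * t) ^+ 2) *
  (cos (ph - H * t) ^+ 2 + sin (ph - H * t) ^+ 2)); first by ring.
by rewrite cq mulr1.
Qed.

Lemma projection_height ph t : model_x H P Q ph t ^+ 2 + model_y H P Q ph t ^+ 2 + model_height2 H P Q t = 1.
Proof.
rewrite projection_sqr /model_height2; have cs := cos2Dsin2 (L * t).
transitivity ((P ^+ 2 + B ^+ 2) * cos (L * t) ^+ 2 + (Q ^+ 2 + A ^+ 2) * sin (L * t) ^+ 2); first by ring.
by rewrite (shape_PB S) (shape_QA S) !mul1r.
Qed.

Lemma model_S3 ph t : S3 (model ph t).
Proof. by apply/S3E; rewrite !vecE expr0n addr0 height_sqr projection_height. Qed.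

Lemma continuous_linear (k l : R) : continuous (fun t : R => k + l * t).
Proof. by move=> t; apply: cvgD; [exact: cvg_cst|apply: cvgM; [exact: cvg_cst|exact: cvg_id]]. Qed.

Lemma continuous_cos_lin (k l : R) : continuous (fun t : R => cos (k + l * t)).
Proof. by move=> t; apply: (cvg_comp (fun t => k + l * t) cos (@continuous_linear k l t)); exact: continuous_cos. Qed.
Lemma continuous_sin_lin (k l : R) : continuous (fun t : R => sin (k + l * t)).
Proof. by move=> t; apply: (cvg_comp (fun t => k + l * t) sin (@continuous_linear k l t)); exact: continuous_sin. Qed.

Lemma continuous_mxy ph : continuous (model_x H P Q ph) /\ continuous (model_y H P Q ph).
Proof.
have e t : L * t = 0 + L * t by rewrite add0r.
have e' t : ph - H * t = ph + (- H) * t by rewrite mulNr.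
by split=> t; rewrite /model_x /model_y; under eq_fun do rewrite e e';
  [apply: cvgB|apply: cvgD]; (apply: cvgM; first (apply: cvgM; first exact: cvg_cst));
  (exact: continuous_cos_lin || exact: continuous_sin_lin).
Qed.

Lemma continuous_mh : continuous (model_height H P Q).
Proof.
move=> t; apply: (cvg_comp (model_height2 H P Q) Num.sqrt _ (@sqrt_continuous R _)).
have -> : model_height2 H P Q = (fun t => A ^+ 2 * (sin (0 + L * t) * sin (0 + L * t)) +
    B ^+ 2 * (cos (0 + L * t) * cos (0 + L * t))).
  by apply/funext => x; rewrite /model_height2 add0r !expr2.
by apply: cvgD; (apply: cvgM; first exact: cvg_cst);
  apply: cvgM; (exact: continuous_cos_lin || exact: continuous_sin_lin).
Qed.

Lemma continuous_mG ph : continuous (model ph).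
Proof.
have [c1 c2] := continuous_mxy ph.
by move=> t; apply: cvg_vec4; [exact: c1|exact: c2|exact: continuous_mh|exact: cvg_cst].
Qed.

End ModelGeometry.

Section Closures.
Context {R : realType}.

(** Used at the ends of the curve, where the differential equation says nothing. *)
Lemma segment_closure (T : topologicalType) (f : R -> T) (a b : R) (C : set T) : a < b ->
  {within `[a, b], continuous f} -> closed C -> (forall t, a < t < b -> C (f t)) ->
  forall t, a <= t <= b -> C (f t).
Proof.
move=> ab cf clC hC t ht; apply: contrapT => nC.
have oC : nbhs (f t) (~` C) by apply: open_nbhs_nbhs; split => //; exact: closed_openC.
have tab : `[a, b]%classic t by rewrite /= in_itv.
move/within_continuousE: cf => /(_ t tab _ oC) /nbhs_ballP [e /= e0 he].
pose k := Order.min 1 (e / (2 * (b - a))).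
have k0 : 0 < k by rewrite lt_min ltr01 divr_gt0// mulr_gt0// subr_gt0.
have k1 : k <= 1 by rewrite ge_min lexx.
have ke : k * (b - a) <= e / 2.
  apply: (@le_trans _ _ (e / (2 * (b - a)) * (b - a))).
    by rewrite ler_pM2r ?subr_gt0// ge_min lexx orbT.
  by rewrite invfM mulrA divfK// gt_eqF// subr_gt0.
pose y := t + k * ((a + b) / 2 - t).
have yab : a < y < b by rewrite /y; apply/andP; split; nra.
have : ~ C (f y).
  apply: he; last by rewrite /= in_itv /=; lra.
  rewrite /ball /= /y opprD addrA subrr add0r normrN normrM (ger0_norm (ltW k0)).
  have : `|(a + b) / 2 - t| <= b - a by rewrite ler_norml; lra.
  move=> h; apply: (@le_lt_trans _ _ (k * (b - a))); first by rewrite ler_wpM2l// ltW.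
  by apply: (le_lt_trans ke); lra.
by apply; exact: hC.
Qed.

Lemma closed_image_compact (T : topologicalType) n (f : T -> 'rV[R]_n) (K : set T) : compact K ->
  {within K, continuous f} -> closed (f @` K).
Proof.
move=> cK cf; apply: compact_closed; first exact: norm_hausdorff.
exact: continuous_compact.
Qed.

End Closures.

Section Structure.
Context {R : realType} (M : topologicalType) (phi : M -> 'rV[R]_4) (rho : R -> M -> M).
Variables (N : M -> 'rV[R]_4) (J : set R) (c : R -> M) (H E : R).
Hypothesis surf : C2_complete_connected_surface phi.
Hypothesis inv : rotationally_invariant phi rho.
Hypothesis gen : generating_curve phi rho J c.
Hypothesis nrm_along : normal_along phi N rho J c.
Hypothesis cmc : constant_mean_curvature phi N H.
Hypothesis energy : has_energy J (phi \o c) H E.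

Let P := gen_profile gen.
Local Notation g := (phi \o c).
Let D := profile_data_holds inv gen nrm_along cmc energy.

Lemma sigma_rot p : range phi p <-> exists s t, J s /\ p = Defs.rot t (g s).
Proof.
split=> [[m _ <-]|[s [t [hs ->]]]].
  by have [s [t [hs ->]]] := gen_cover gen m; exists s, t; rewrite (rho_rot inv).
by exists (rho t (c s)) => //; rewrite (rho_rot inv).
Qed.

Lemma rot_axis (t : R) (p : 'rV[R]_4) : x2 p = 0 -> y2 p = 0 -> Defs.rot t p = p.
Proof. by move=> h1 h2; apply: vec4P; rewrite /Defs.rot !vecE ?h1 ?h2//; ring. Qed.

Lemma exists_off_axis : exists2 s, J° s & 0 < x2 (g s).
Proof.
apply: contrapT => no; apply: (surface_not_in_axis c surf) => m.
have [s [t [hs ->]]] := gen_cover gen m; rewrite (rho_rot inv).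
have h := profile_hemisphere P hs; have [_ [h1 h2]] := h.
have x0 : x2 (phi (c s)) = 0.
  move: h1; rewrite le_eqVlt => /orP[/eqP //|h1].
  by exfalso; apply: no; exists s; [exact: (profile_open gen hs h1)|exact: h1].
by rewrite rot_axis.
Qed.

Lemma interior_off_axis s : J° s -> 0 < x2 (g s).
Proof.
have [s0 hs0 h0] := exists_off_axis.
have [z|] := height_dichotomy D; last by apply.
by have := z s0 hs0 => e; move: h0; rewrite e ltxx.
Qed.

Lemma interior_right (s0 s : R) : J° s0 -> has_sup J -> s0 < s < sup J -> J° s.
Proof.
move=> hs0 hsup /andP[h1 h2].
have [s' hs' ss'] : exists2 s', J s' & s < s'.
  have e0 : 0 < sup J - s by rewrite subr_gt0.
  by have [x Jx] := sup_adherent e0 hsup; rewrite opprB addrC subrK => ?; exists x.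
have sub : `]s0, s'[ `<=` J.
  move=> u /=; rewrite in_itv /= => hu.
  by apply: (profile_interval P (interior_subset hs0) hs'); lra.
rewrite /interior; apply: filterS sub _; apply: open_nbhs_nbhs; split; first exact: itv_open.
by rewrite /= in_itv /= h1 ss'.
Qed.

Lemma interior_left (s0 s : R) : J° s0 -> has_inf J -> inf J < s < s0 -> J° s.
Proof.
move=> hs0 hinf /andP[h1 h2].
have [s' hs' ss'] : exists2 s', J s' & s' < s.
  have e0 : 0 < s - inf J by rewrite subr_gt0.
  by have [x Jx] := inf_adherent e0 hinf; rewrite addrC subrK => ?; exists x.
have sub : `]s', s0[ `<=` J.
  move=> u /=; rewrite in_itv /= => hu.
  by apply: (profile_interval P hs' (interior_subset hs0)); lra.
rewrite /interior; apply: filterS sub _; apply: open_nbhs_nbhs; split; first exact: itv_open.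
by rewrite /= in_itv /= h2 ss'.
Qed.

Lemma upper_end : has_ubound J -> exists b, [/\ J b, x2 (g b) = 0, (forall s, J s -> s <= b) &
  forall s0 s, J° s0 -> s0 < s < b -> J° s].
Proof.
move=> ub; have [s0 hs0 _] := exists_off_axis.
have hsup : has_sup J by split => //; exists s0; exact: interior_subset.
have le_sup s : J s -> s <= sup J by move=> hs; exact: sup_ubound.
have lt0 : s0 < sup J.
  have [d d0 hd] := open_interval_room (open_interior J) hs0.
  have : J (s0 + d / 2) by apply: interior_subset; apply: hd; rewrite addrAC subrr add0r ger0_norm; lra.
  by move/le_sup; lra.
have [h1 h2] := right_end_on_axis surf inv gen lt0 (fun s => @interior_right s0 s hs0 hsup) le_sup.
by exists (sup J); split => // s1 s hs1; exact: interior_right.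
Qed.

Lemma lower_end : has_lbound J -> exists a, [/\ J a, x2 (g a) = 0, (forall s, J s -> a <= s) &
  forall s0 s, J° s0 -> a < s < s0 -> J° s].
Proof.
move=> lb; have [s0 hs0 _] := exists_off_axis.
have hinf : has_inf J by split => //; exists s0; exact: interior_subset.
have ge_inf s : J s -> inf J <= s by move=> hs; exact: inf_lbound.
have lt0 : inf J < s0.
  have [d d0 hd] := open_interval_room (open_interior J) hs0.
  have : J (s0 - d / 2) by apply: interior_subset; apply: hd; rewrite addrAC subrr add0r normrN ger0_norm; lra.
  by move/ge_inf; lra.
have [h1 h2] := left_end_on_axis surf inv gen lt0 (fun s => @interior_left s0 s hs0 hinf) ge_inf.
by exists (inf J); split => // s1 s hs1; exact: interior_left.
Qed.

Lemma curve_is_model : exists (ph a b : R) (xi w : R -> R), [/\ shape H E a b,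
  (forall s, J° s -> is_derive s 1 xi (w s) /\ 1 <= w s) &
  forall s, J° s -> g s = model H a b ph (xi s)].
Proof.
have [s0 hs0 _] := exists_off_axis.
have [ph [a [b [xi [Sh F]]]]] := normal_form D interior_off_axis hs0.
exists ph, a, b, xi, (pd_w (fun s => x2 (g s)) (fun s => x1 (derive1 g s)) (fun s => y1 (derive1 g s))).
split => // s hs; have [d e1 e2 e3] := F s hs.
  by split => //; apply: (pd_w_ge1 D interior_off_axis hs).
by apply: vec4P; rewrite /model !vecE; [exact: e1|exact: e2|exact: e3|exact: (curve_y2 gen (interior_subset hs))].
Qed.

Lemma generating_continuous : {within J, continuous g}.
Proof.
have := profile_continuous P; rewrite !within_continuousE => h s hs B hB.
exact: (h s hs _ (@surface_continuous _ _ _ (surf_charts surf) _ _ hB)).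
Qed.

Lemma generating_segment (a b : R) : J a -> J b -> {within `[a, b], continuous g}.
Proof.
move=> ha hb; apply: continuous_subspaceW generating_continuous => x /=.
by rewrite in_itv /= => hx; apply: (profile_interval P ha hb).
Qed.

Lemma closed_x2_ge (m : R) : closed [set p : 'rV[R]_4 | m <= x2 p].
Proof.
apply: (preimage_closed (f := x2 : 'rV[R]_4 -> R) (D := [set y : R | m <= y])); last exact: closed_ge.
by move=> p _; exact: continuous_x2.
Qed.

Lemma end_height (a b m : R) : a < b -> J a -> J b ->
  (forall s, a < s < b -> m <= x2 (g s)) -> m <= x2 (g a) /\ m <= x2 (g b).
Proof.
move=> ab ha hb hm.
by split; apply: (segment_closure ab (generating_segment ha hb) (@closed_x2_ge m) hm);
  rewrite lexx ltW.
Qed.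

Section Model.
Variables (ph a b : R) (xi w : R -> R).
Hypothesis Sh : shape H E a b.
Hypothesis dxi : forall s, J° s -> is_derive s 1 xi (w s) /\ 1 <= w s.
Hypothesis gE : forall s, J° s -> g s = model H a b ph (xi s).

Let interior_itv : is_interval J°.
Proof. exact: interior_interval (profile_interval P). Qed.

Lemma time_speed (s t : R) : J° s -> J° t -> s <= t -> t - s <= xi t - xi s.
Proof. by apply: (derive_ge1_le (f' := w)) => // u /dxi []. Qed.

Lemma time_ivt (s t v : R) : J° s -> J° t -> xi s <= v <= xi t -> exists2 u, J° u & xi u = v.
Proof.
apply: ivt_interval => // u /dxi [d _]; exact: is_derive_continuous d.
Qed.

(** For E <> 0 the height is at least |B| > 0, so by [upper_end] and [lower_end] the
    domain has no finite end. *)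
Lemma domain_unbounded : E != 0 -> J = setT.
Proof.
move=> En; have Bn : 0 < `|coefB H a b| by rewrite normr_gt0 -(shape_E0 Sh).
have [s0 hs0 _] := exists_off_axis.
have low s : J° s -> `|coefB H a b| <= x2 (g s) by move=> hs; rewrite (gE hs) /model vecE; exact: (height_ge Sh).
have nu : ~ has_ubound J.
  move=> ub; have [e [h1 h2 h3 h4]] := upper_end ub.
  have s0e : s0 < e.
    rewrite lt_neqAle (h3 _ (interior_subset hs0)) andbT; apply/eqP => e0.
    by have := interior_off_axis hs0; rewrite e0 h2 ltxx.
  have [_] := end_height s0e (interior_subset hs0) h1 (fun s hs => low s (h4 _ _ hs0 hs)).
  by rewrite h2 leNgt Bn.
have nl : ~ has_lbound J.
  move=> lb; have [e [h1 h2 h3 h4]] := lower_end lb.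
  have s0e : e < s0.
    rewrite lt_neqAle (h3 _ (interior_subset hs0)) andbT; apply/eqP => e0.
    by have := interior_off_axis hs0; rewrite -e0 h2 ltxx.
  have [] := end_height s0e h1 (interior_subset hs0) (fun s hs => low s (h4 _ _ hs0 hs)).
  by rewrite h2 leNgt Bn.
apply/seteqP; split=> // s _.
have [x Jx xs] : exists2 x, J x & x < s.
  apply: contrapT => no; apply: nl; exists s => x Jx; rewrite leNgt; apply/negP => h.
  by apply: no; exists x.
have [y Jy sy] : exists2 y, J y & s < y.
  apply: contrapT => no; apply: nu; exists s => y Jy; rewrite leNgt; apply/negP => h.
  by apply: no; exists y.
by apply: (profile_interval P Jx Jy); rewrite !ltW.
Qed.

Lemma time_onto : E != 0 -> forall t, exists s, xi s = t.
Proof.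
move=> En t; have JT := domain_unbounded En; have hI s : J° s by rewrite JT interiorT.
have h1 : xi (- `|t - xi 0|) <= t.
  have := @time_speed (- `|t - xi 0|) 0 (hI _) (hI _).
  rewrite oppr_le0 normr_ge0 => /(_ isT); have := ler_norm (xi 0 - t); rewrite distrC; lra.
have h2 : t <= xi `|t - xi 0|.
  have := @time_speed 0 `|t - xi 0| (hI _) (hI _).
  rewrite normr_ge0 => /(_ isT); have := ler_norm (t - xi 0); lra.
have := @time_ivt (- `|t - xi 0|) `|t - xi 0| t (hI _) (hI _).
by rewrite h1 h2 => /(_ isT) [u _ <-]; exists u.
Qed.

Lemma image_unbounded : E != 0 -> g @` J = range (model H a b ph).
Proof.
move=> En; have JT := domain_unbounded En; have hI s : J° s by rewrite JT interiorT.
apply/seteqP; split=> [_ [s _ <-]|_ [t _ <-]]; first by exists (xi s); rewrite -?gE.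
by have [s <-] := time_onto En t; exists s; rewrite ?JT// gE.
Qed.

End Model.

(** Here the height is |sin (L t)| / L, so the time stays between two consecutive
    zeros; a time that avoided values near such a zero would leave the end of
    the curve at positive height, which [upper_end] and [lower_end] exclude. *)
Lemma bounded_structure : E = 0 -> exists (ph a b al be : R) (xi w : R -> R),
  [/\ shape H E a b /\ al < be, J = [set` `[al, be]] /\ x2 (g al) = 0 /\ x2 (g be) = 0,
   (forall s, al < s < be -> is_derive s 1 xi (w s) /\ 1 <= w s),
   (forall s, al < s < be -> g s = model H a b ph (xi s) /\ 0 < xi s < pi / lam H) &
   g @` J = model H a b ph @` `[0, pi / lam H]].
Proof.
move=> E0; have [ph0 [a [b [xi0 [w [Sh dxi0 gE0]]]]]] := curve_is_model.
have B0 : coefB H a b = 0 by apply/eqP; rewrite -(shape_E0 Sh) E0.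
have L0 := lam_gt0 H; set L := lam H in L0 *; have A0 := shape_AP Sh.
have p0 : 0 < pi / L by rewrite divr_gt0// pi_gt0.
have mhE t : model_height H a b t = coefA H a b * `|sin (L * t)|.
  by rewrite /model_height /model_height2 B0 expr0n mul0r addr0 -exprMn sqrtr_sqr normrM (gtr0_norm A0).
have [s0 hs0 h0] := exists_off_axis.
pose n := Num.floor (xi0 s0 / (pi / L)).
pose xi s := xi0 s - n%:~R * (pi / L); pose ph := ph0 + n%:~R * (pi - H * (pi / L)).
have dxi s : J° s -> is_derive s 1 xi (w s) /\ 1 <= w s.
  move=> hs; have [d hw] := dxi0 s hs; split=> //.
  by rewrite -[w s]subr0; apply: is_deriveB.
have gE s : J° s -> g s = model H a b ph (xi s).
  by move=> hs; rewrite gE0// -model_shift /xi subrK.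
have nz s : J° s -> sin (L * xi s) != 0.
  move=> hs; have := interior_off_axis hs; rewrite gE// /model vecE mhE.
  by rewrite pmulr_rgt0// normr_gt0.
have x00 : 0 <= xi s0 < pi / L.
  rewrite /xi subr_ge0 -ler_pdivlMr// ge_floor /= ltrBlDl -{2}[pi / L]mul1r -mulrDl.
  rewrite -ltr_pdivrMr//; have := floorD1_gt (xi0 s0 / (pi / L)).
  by rewrite intrD.
have bad (s v : R) : J° s -> v = 0 \/ v = pi / L -> xi s != v.
  move=> hs hv; apply/eqP => e; move: (nz s hs); rewrite e.
  case: hv => ->; first by rewrite mulr0 sin0 eqxx.
  have Ln : L != 0 by rewrite gt_eqF.
  have -> : L * (pi / L) = pi by field.
  by rewrite sinpi eqxx.
have hx s : J° s -> 0 < xi s < pi / L.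
  move=> hs; apply/andP; split.
    rewrite ltNge; apply/negP => h; have [|u hu e] := time_ivt dxi hs hs0 (v := 0); first lra.
    by have := bad u 0 hu (or_introl erefl); rewrite e eqxx.
  rewrite ltNge; apply/negP => h; have [|u hu e] := time_ivt dxi hs0 hs (v := pi / L); first lra.
  by have := bad u _ hu (or_intror erefl); rewrite e eqxx.
have room s : J s -> s != s0 -> J° ((s + s0) / 2).
  move=> hs ne; have sub : [set` `]Num.min s s0, Num.max s s0[] `<=` J.
    have hs0' := interior_subset hs0.
    move=> u /=; rewrite in_itv /= => /andP[u1 u2].
    by case: (ltgtP s s0) ne u1 u2 => // h _ u1 u2; [apply: (profile_interval P hs hs0')|apply: (profile_interval P hs0' hs)]; lra.
  rewrite /interior; apply: filterS sub _; apply: open_nbhs_nbhs; split; first exact: itv_open.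
  by rewrite /= in_itv /=; case: (ltgtP s s0) ne => // h _; lra.
have ub : has_ubound J.
  exists (s0 + 2 * (pi / L)) => s hs; rewrite leNgt; apply/negP => h.
  have hm : J° ((s + s0) / 2) by apply: room => //; rewrite gt_eqF//; lra.
  have := time_speed dxi hs0 hm; have := hx _ hm; have := hx _ hs0; lra.
have lb : has_lbound J.
  exists (s0 - 2 * (pi / L)) => s hs; rewrite leNgt; apply/negP => h.
  have hm : J° ((s + s0) / 2) by apply: room => //; rewrite lt_eqF//; lra.
  have := time_speed dxi hm hs0; have := hx _ hm; have := hx _ hs0; lra.
have [be [be1 be2 be3 be4]] := upper_end ub; have [al [al1 al2 al3 al4]] := lower_end lb.
have s0be : s0 < be.
  rewrite lt_neqAle (be3 _ (interior_subset hs0)) andbT; apply/eqP => e0.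
  by have := interior_off_axis hs0; rewrite e0 be2 ltxx.
have als0 : al < s0.
  rewrite lt_neqAle (al3 _ (interior_subset hs0)) andbT; apply/eqP => e0.
  by have := interior_off_axis hs0; rewrite -e0 al2 ltxx.
have JE : J = [set` `[al, be]].
  apply/seteqP; split=> s /=; rewrite in_itv /=; first by move=> hs; rewrite al3// be3.
  by move=> hs; apply: (profile_interval P al1 be1).
have JI s : al < s < be -> J° s.
  move=> hs; case: (ltgtP s s0) => [h|h|-> //]; first by apply: al4 hs0 _; lra.
  by apply: be4 hs0 _; lra.
have IJ s : J° s -> al < s < be.
  move=> hs; have hs' := interior_subset hs; have p := interior_off_axis hs.
  rewrite !lt_neqAle al3// be3// !andbT; apply/andP; split; apply/eqP => e.
    by move: p; rewrite -e al2 ltxx.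
  by move: p; rewrite e be2 ltxx.
have low (u v : R) : 0 < u -> u <= v -> v < pi / L ->
    exists2 m, 0 < m & forall t, u <= t <= v -> m <= model_height H a b t.
  move=> u0 uv v1; have [k kuv hk] := EVT_min uv (continuous_subspaceT (@continuous_mh R H a b)).
  exists (model_height H a b k) => [|t ht]; last by apply: hk; rewrite in_itv.
  move: kuv; rewrite in_itv /= => kuv; rewrite mhE pmulr_rgt0// normr_gt0 gt_eqF// sin_gt0_pi//.
  by rewrite mulr_gt0 /=; [rewrite mulrC -ltr_pdivlMr//; lra|done|lra].
have onto t : 0 < t < pi / L -> exists2 s, J° s & xi s = t.
  move=> ht; have hx0 := hx _ hs0; apply: contrapT => no.
  have [lt|le] := ltP (xi s0) t.
    have [m m0 hm] : exists2 m, 0 < m & forall t', xi s0 <= t' <= t -> m <= model_height H a b t'.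
      by apply: low; lra.
    have [_] : m <= x2 (g s0) /\ m <= x2 (g be).
      apply: end_height => //; first exact: interior_subset.
      move=> s hs; have hs' : J° s by apply: JI; lra.
      rewrite gE// /model vecE; apply: hm; have := time_speed dxi hs0 hs'.
      move=> h; apply/andP; split; first by lra.
      rewrite leNgt; apply/negP => h'; apply: no; apply: (time_ivt dxi hs0 hs'); lra.
    by rewrite be2 leNgt m0.
  have [m m0 hm] : exists2 m, 0 < m & forall t', t <= t' <= xi s0 -> m <= model_height H a b t'.
    by apply: low; lra.
  have [] : m <= x2 (g al) /\ m <= x2 (g s0).
    apply: end_height => //; first exact: interior_subset.
    move=> s hs; have hs' : J° s by apply: JI; lra.
    rewrite gE// /model vecE; apply: hm; have := time_speed dxi hs' hs0.
    move=> h; apply/andP; split; last by lra.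
    rewrite leNgt; apply/negP => h'; apply: no; apply: (time_ivt dxi hs' hs0); lra.
  by rewrite al2 leNgt m0.
exists ph, a, b, al, be, xi, w; split => //; first by split => //; lra.
- by move=> s /JI /dxi.
- by move=> s /JI hs; split; [exact: gE|exact: hx].
have cg : {within `[al, be], continuous g} by rewrite -JE; exact: generating_continuous.
have cm : {within `[0, pi / L], continuous (model H a b ph)}.
  by apply: continuous_subspaceT; exact: continuous_mG.
have clg : closed (g @` J) by rewrite JE; apply: closed_image_compact => //; exact: segment_compact.
have clm : closed (model H a b ph @` `[0, pi / L]) by apply: closed_image_compact => //; exact: segment_compact.
apply/seteqP; split=> [_ [s hs <-]|_ [t ht <-]].
  move: hs; rewrite JE /= in_itv /=.
  apply: (segment_closure _ cg clm); first lra.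
  move=> u hu; have hu' := JI _ hu; exists (xi u); last by rewrite gE.
  by rewrite /= in_itv /=; have := hx _ hu'; lra.
move: ht; rewrite /= in_itv /=.
apply: (segment_closure p0 cm clg) => u hu; have [s hs <-] := onto u hu.
by exists s; [exact: interior_subset|rewrite gE].
Qed.

End Structure.

(** * Spherical coordinates along the model curve *)

Section ModelCalculus.
Context {R : realType}.
Implicit Types (H E P Q ph t : R).

Lemma lamN H : lam (- H) = lam H.
Proof. by rewrite /lam sqrrN. Qed.

(** The constants of the same curve traversed backwards. *)
Lemma shapeN H E P Q : shape H E P Q -> shape (- H) (- E) P (- Q).
Proof.
move=> [p q pb qa pq ab]; have eA : coefA (- H) P (- Q) = coefA H P Q by rewrite /coefA lamN; ring.
have eB : coefB (- H) P (- Q) = - coefB H P Q by rewrite /coefB lamN; ring.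
split; rewrite ?eA ?eB ?normrN ?lamN ?sqrrN //; first by rewrite mulrN pq opprD.
by rewrite mulrN ab.
Qed.

Lemma mGN H P Q ph t : model (- H) P (- Q) ph t = model H P Q ph (- t).
Proof.
rewrite /model /model_x /model_y /model_height /model_height2 /coefA /coefB lamN !mulrN !sinN !cosN !mulNr !opprK.
congr vec4; [by ring|by ring|congr Num.sqrt; ring].
Qed.

Lemma is_derive_cos_lin (k l t : R) : is_derive t 1 (fun u => cos (k + l * u)) (- (l * sin (k + l * t))).
Proof.
have h : is_derive t 1 (fun u : R => k + l * u) l.
  by apply: is_derive_eq; rewrite /GRing.scale /=; ring.
by apply: (chain_rule (f := cos) erefl (is_derive_cos _) h); ring.
Qed.

Lemma is_derive_sin_lin (k l t : R) : is_derive t 1 (fun u => sin (k + l * u)) (l * cos (k + l * t)).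
Proof.
have h : is_derive t 1 (fun u : R => k + l * u) l.
  by apply: is_derive_eq; rewrite /GRing.scale /=; ring.
by apply: (chain_rule (f := sin) erefl (is_derive_sin _) h); ring.
Qed.

Lemma is_derive_cosM (l t : R) : is_derive t 1 (fun u => cos (l * u)) (- (l * sin (l * t))).
Proof. by have := is_derive_cos_lin 0 l t; rewrite add0r; under eq_fun do rewrite add0r. Qed.

Lemma is_derive_sinM (l t : R) : is_derive t 1 (fun u => sin (l * u)) (l * cos (l * t)).
Proof. by have := is_derive_sin_lin 0 l t; rewrite add0r; under eq_fun do rewrite add0r. Qed.

Lemma is_derive_cosB (k l t : R) : is_derive t 1 (fun u => cos (k - l * u)) (l * sin (k - l * t)).
Proof.
have := is_derive_cos_lin k (- l) t; rewrite !mulNr opprK.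
by under eq_fun do rewrite mulNr.
Qed.

Lemma is_derive_sinB (k l t : R) : is_derive t 1 (fun u => sin (k - l * u)) (- (l * cos (k - l * t))).
Proof.
have := is_derive_sin_lin k (- l) t; rewrite !mulNr.
by under eq_fun do rewrite mulNr.
Qed.

Section Fixed.
Variables (H E P Q : R).
Local Notation L := (lam H).
Local Notation A := (coefA H P Q).
Local Notation B := (coefB H P Q).
Local Notation c t := (cos (L * t)).
Local Notation s t := (sin (L * t)).

(** Half the derivative of the squared height, the angular momentum of the
    complex coordinate z, and |z|^2. *)
Definition drift t := L * (A ^+ 2 - B ^+ 2) * (s t * c t).
Definition momentum t := P * B * c t ^+ 2 + Q * A * s t ^+ 2.
Definition modulus2 t := P ^+ 2 * c t ^+ 2 + Q ^+ 2 * s t ^+ 2.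

Lemma is_derive_model_x ph t : is_derive t 1 (model_x H P Q ph)
  (- (A * s t * cos (ph - H * t)) - B * c t * sin (ph - H * t)).
Proof.
rewrite /model_x; have h1 := is_derive_cosM L t; have h2 := is_derive_sinM L t.
have h3 := is_derive_cosB ph H t; have h4 := is_derive_sinB ph H t.
by apply: is_derive_eq; rewrite /GRing.scale /= /coefA /coefB; ring.
Qed.

Lemma is_derive_model_y ph t : is_derive t 1 (model_y H P Q ph)
  (- (A * s t * sin (ph - H * t)) + B * c t * cos (ph - H * t)).
Proof.
rewrite /model_y; have h1 := is_derive_cosM L t; have h2 := is_derive_sinM L t.
have h3 := is_derive_cosB ph H t; have h4 := is_derive_sinB ph H t.
by apply: is_derive_eq; rewrite /GRing.scale /= /coefA /coefB; ring.
Qed.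

Lemma is_derive_height2 t : is_derive t 1 (model_height2 H P Q) (2 * drift t).
Proof.
rewrite /model_height2; have h1 := is_derive_cosM L t; have h2 := is_derive_sinM L t.
by apply: is_derive_eq; rewrite /GRing.scale /= /drift; ring.
Qed.

Hypothesis Sh : shape H E P Q.

Lemma modulus2E t : modulus2 t = 1 - model_height2 H P Q t.
Proof. by have := projection_height Sh 0 t; rewrite projection_sqr /modulus2 => <-; ring. Qed.

Lemma momentumE t : momentum t = E + H * model_height2 H P Q t.
Proof.
have cs := cos2Dsin2 (L * t); have pq := shape_PQ Sh; have e := modulus2E t.
have -> : model_height2 H P Q t = 1 - modulus2 t by rewrite e; ring.
transitivity (L * P * Q * (c t ^+ 2 + s t ^+ 2) - H * modulus2 t); first by rewrite /momentum /modulus2 /coefA /coefB; ring.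
by rewrite cs pq; ring.
Qed.

Lemma shape_AB2 : A ^+ 2 - B ^+ 2 = P ^+ 2 - Q ^+ 2.
Proof. by have := shape_PB Sh; have := shape_QA Sh; lra. Qed.

Lemma drift_mk t : drift t ^+ 2 + momentum t ^+ 2 = model_height2 H P Q t * modulus2 t.
Proof.
have e : L * (A ^+ 2 - B ^+ 2) = A * P - B * Q by rewrite shape_AB2 /coefA /coefB; ring.
by rewrite /drift /momentum /modulus2 e /model_height2; ring.
Qed.

Lemma height2_ends t : model_height2 H P Q t = B ^+ 2 + (A ^+ 2 - B ^+ 2) * s t ^+ 2.
Proof. by have cs := cos2sin2 (L * t); rewrite /model_height2 cs; ring. Qed.

Lemma modulus2_ends t : modulus2 t = Q ^+ 2 + (P ^+ 2 - Q ^+ 2) * c t ^+ 2.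
Proof. by have cs := sin2cos2 (L * t); rewrite /modulus2 cs; ring. Qed.

Lemma model_momentum ph t : model_x H P Q ph t * (- (A * s t * sin (ph - H * t)) + B * c t * cos (ph - H * t))
  - model_y H P Q ph t * (- (A * s t * cos (ph - H * t)) - B * c t * sin (ph - H * t)) = momentum t.
Proof.
have cs := cos2Dsin2 (ph - H * t).
transitivity (momentum t * (cos (ph - H * t) ^+ 2 + sin (ph - H * t) ^+ 2)).
  by rewrite /model_x /model_y /momentum; ring.
by rewrite cs mulr1.
Qed.

Lemma half_period_sin t : s (t + pi / L) = - s t.
Proof.
have Ln : L != 0 by rewrite gt_eqF// lam_gt0.
have -> : L * (t + pi / L) = L * t + pi by field.
exact: sinDpi.
Qed.

Lemma half_period_cos t : c (t + pi / L) = - c t.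
Proof.
have Ln : L != 0 by rewrite gt_eqF// lam_gt0.
have -> : L * (t + pi / L) = L * t + pi by field.
exact: cosDpi.
Qed.

Lemma height_gt0 t : B != 0 -> 0 < model_height H P Q t.
Proof. by move=> Bn; apply: lt_le_trans (height_ge Sh t); rewrite normr_gt0. Qed.

Lemma is_derive_height t : 0 < model_height H P Q t -> is_derive t 1 (model_height H P Q) (drift t / model_height H P Q t).
Proof.
move=> h0; have h2 : 0 < model_height2 H P Q t by rewrite -(height_sqr Sh) exprn_gt0.
apply: (chain_rule (f := Num.sqrt) erefl (is_derive1_sqrt h2) (is_derive_height2 t)).
by rewrite -/(model_height H P Q t); field; rewrite gt_eqF.
Qed.

Section Spherical.
Hypothesis Q0 : 0 < Q.

(** A continuous argument of z, for Q > 0. *)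
Definition model_tau ph t := ph - H * t + (L * t + atan ((Q - P) * (s t * c t) / (P * c t ^+ 2 + Q * s t ^+ 2))).
Definition model_om t := asin (model_height H P Q t).

Lemma modulus2_gt0 t : 0 < modulus2 t.
Proof.
have h := shape_Q Sh; rewrite (gtr0_norm Q0) in h.
rewrite modulus2_ends; apply: ltr_wpDr; last by rewrite exprn_gt0.
by rewrite mulr_ge0 ?sqr_ge0// subr_ge0 ler_pXn2r ?nnegrE// ltW// (shape_P Sh).
Qed.

Lemma turn_denominator_gt0 t : 0 < P * c t ^+ 2 + Q * s t ^+ 2.
Proof.
have P0 := shape_P Sh; have cs := cos2Dsin2 (L * t).
have h1 := sqr_ge0 (c t); have h2 := sqr_ge0 (s t).
have [z|nz] := eqVneq (c t ^+ 2) 0; first by move: cs; rewrite z add0r => ->; rewrite mulr0 add0r mulr1.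
by apply: ltr_pwDl; [rewrite mulr_gt0// lt_neqAle eq_sym nz|rewrite mulr_ge0// ltW].
Qed.

Lemma height_lt1 t : model_height H P Q t < 1.
Proof.
have := modulus2_gt0 t; rewrite modulus2E -(height_sqr Sh) subr_gt0.
by rewrite expr_lt1// sqrtr_ge0.
Qed.

Lemma om_bounds t : 0 <= model_om t < pi / 2.
Proof.
have h1 := height_lt1 t; have h0 : 0 <= model_height H P Q t by rewrite sqrtr_ge0.
rewrite /model_om asin_ltpi2 ?andbT; last by rewrite h1 andbT; lra.
have := @asin_gtNpi2 R (model_height H P Q t); have := @asinK R (model_height H P Q t).
rewrite in_itv /= => k1 k2; rewrite leNgt; apply/negP => neg.
have : 0 < sin (- asin (model_height H P Q t)).
  by apply: sin_gt0_pi; have := @pi_gt0 R; have := k2 ltac:(lra); lra.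
by rewrite sinN k1; lra.
Qed.

Lemma sin_mom t : sin (model_om t) = model_height H P Q t.
Proof. by rewrite /model_om asinK// in_itv /=; have := height_lt1 t; have : 0 <= model_height H P Q t := sqrtr_ge0 _; lra. Qed.

Lemma cos_mom t : cos (model_om t) = Num.sqrt (modulus2 t).
Proof.
rewrite /model_om cos_asin; first by rewrite (height_sqr Sh) modulus2E.
by have := height_lt1 t; have : 0 <= model_height H P Q t := sqrtr_ge0 _; lra.
Qed.

(** The argument of P cos x + i Q sin x is x plus the angle between this vector and
    e^(i x), which is less than a right angle and so given by the arc tangent. *)
Lemma tau_turn t : Num.sqrt (modulus2 t) * cos (L * t + atan ((Q - P) * (s t * c t) / (P * c t ^+ 2 + Q * s t ^+ 2))) = P * c t /\
  Num.sqrt (modulus2 t) * sin (L * t + atan ((Q - P) * (s t * c t) / (P * c t ^+ 2 + Q * s t ^+ 2))) = Q * s t.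
Proof.
have d0 := turn_denominator_gt0 t; set d := _ + _ in d0 *; set n := (Q - P) * _.
have z0 := modulus2_gt0 t; have cs := cos2Dsin2 (L * t).
have e : d ^+ 2 + n ^+ 2 = modulus2 t.
  by rewrite -[RHS]mulr1 -cs /d /n /modulus2; ring.
have cE : cos (atan (n / d)) = d / Num.sqrt (modulus2 t).
  rewrite cos_atan; have -> : 1 + (n / d) ^+ 2 = modulus2 t / d ^+ 2.
    by rewrite -e; field; rewrite gt_eqF.
  rewrite sqrtrM ?(ltW z0)// sqrtrV ?sqr_ge0// sqrtr_sqr gtr0_norm// invfM invrK mulrC //.
have r0 : 0 < Num.sqrt (modulus2 t) by rewrite sqrtr_gt0.
have sE : sin (atan (n / d)) = n / Num.sqrt (modulus2 t).
  have c0 : cos (atan (n / d)) != 0 by rewrite cE mulf_neq0 ?invr_eq0 ?gt_eqF.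
  have := @atanK R (n / d); rewrite /tan => /(congr1 (fun x => x * cos (atan (n / d)))).
  by rewrite divfK// cE => ->; field; rewrite !gt_eqF.
rewrite cosD sinD cE sE; split.
  transitivity (c t * d - s t * n); first by field; rewrite gt_eqF.
  by rewrite -[RHS]mulr1 -cs /d /n; ring.
transitivity (s t * d + c t * n); first by field; rewrite gt_eqF.
by rewrite -[RHS]mulr1 -cs /d /n; ring.
Qed.

Lemma model_spherical ph t : model H P Q ph t = spherical (model_om t) (model_tau ph t).
Proof.
have [h1 h2] := tau_turn t.
rewrite /spherical cos_mom sin_mom /model_tau /model /model_x /model_y -h1 -h2.
set f := ph - H * t; set X := L * t + _; rewrite (cosD f X) (sinD f X).
by congr vec4; ring.
Qed.

(** The formula momentum / |z|^2 is the usual one for the polar angle. *)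
Lemma is_derive_tau ph t : is_derive t 1 (model_tau ph) (momentum t / modulus2 t).
Proof.
have d0 := turn_denominator_gt0 t; have z0 := modulus2_gt0 t; have cs := cos2Dsin2 (L * t).
have h1 := is_derive_cosM L t; have h2 := is_derive_sinM L t.
pose n u := (Q - P) * (s u * c u); pose d u := P * c u ^+ 2 + Q * s u ^+ 2.
pose n1 := (Q - P) * L * (c t ^+ 2 - s t ^+ 2); pose d1 := 2 * L * (s t * c t) * (Q - P).
have dn : is_derive t 1 n n1.
  by rewrite /n; apply: is_derive_eq; rewrite /GRing.scale /= /n1; ring.
have dd : is_derive t 1 d d1.
  by rewrite /d; apply: is_derive_eq; rewrite /GRing.scale /= /d1; ring.
have dV : is_derive t 1 (fun u => (d u)^-1) (- d t ^- 2 * d1).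
  by apply: is_derive_eq; first apply: is_deriveV; rewrite ?gt_eqF// /GRing.scale.
have dq : is_derive t 1 (fun u => n u / d u) ((n1 * d t - n t * d1) / d t ^+ 2).
  apply: is_derive_eq; rewrite /GRing.scale /=.
  by field; rewrite gt_eqF.
have dat : is_derive t 1 (fun u => atan (n u / d u)) ((n1 * d t - n t * d1) / modulus2 t).
  apply: (chain_rule (f := atan) erefl (is_derive1_atan _) dq).
  have e : d t ^+ 2 + n t ^+ 2 = modulus2 t.
    by rewrite -[RHS]mulr1 -cs /d /n /modulus2; ring.
  by rewrite -e; field; rewrite !gt_eqF// e.
rewrite /model_tau -/(d _) -/(n _).
have -> : momentum t / modulus2 t = - H + (L + (n1 * d t - n t * d1) / modulus2 t).
  have -> : n1 * d t - n t * d1 = (Q - P) * L * (P * c t ^+ 2 - Q * s t ^+ 2).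
    by rewrite -[RHS]mulr1 -cs /n1 /d1 /n /d; ring.
  rewrite momentumE; have e := modulus2E t.
  have -> : model_height2 H P Q t = 1 - modulus2 t by rewrite e; ring.
  have pq := shape_PQ Sh; have -> : E = L * P * Q - H by rewrite pq; ring.
  have zn : modulus2 t != 0 by rewrite gt_eqF.
  have e2 : modulus2 t + (Q - P) * (P * c t ^+ 2 - Q * s t ^+ 2) = P * Q.
    by rewrite -[RHS]mulr1 -cs /modulus2; ring.
  rewrite -[L * P * Q]mulrA -e2; field.
  exact: zn.
by apply: is_derive_eq; rewrite /GRing.scale /=; ring.
Qed.

Lemma is_derive_om t : 0 < model_height H P Q t ->
  is_derive t 1 model_om (drift t / (model_height H P Q t * Num.sqrt (modulus2 t))).
Proof.
move=> h0; have h1 := height_lt1 t; have z0 : 0 < Num.sqrt (modulus2 t) by rewrite sqrtr_gt0 modulus2_gt0.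
have b : -1 < model_height H P Q t < 1 by lra.
have := chain_rule (f := @asin R) erefl (is_derive1_asin b) (is_derive_height h0); apply.
by rewrite (height_sqr Sh) -modulus2E; field; rewrite !gt_eqF.
Qed.

Lemma tau_shift ph t : model_tau ph (t + pi / L) = model_tau ph t + pi * (1 - H / L).
Proof.
have Ln : L != 0 by rewrite gt_eqF// lam_gt0.
rewrite /model_tau half_period_cos half_period_sin mulrNN !sqrrN.
set X := atan _; field; exact: Ln.
Qed.

(** Reflections in the multiples of a quarter period are symmetries of the ellipse. *)
Lemma half_turn_reflect (n : int) (u : R) : exists k, [/\ k * k = 1,
  c (n%:~R * (pi / (2 * L)) - u) = k * c (n%:~R * (pi / (2 * L)) + u) &
  s (n%:~R * (pi / (2 * L)) - u) = - (k * s (n%:~R * (pi / (2 * L)) + u))].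
Proof.
have Ln : L != 0 by rewrite gt_eqF// lam_gt0.
exists (cos (n%:~R * pi)); rewrite -expr2 cos_intpi_sqr; set t2 := _ + u.
have -> : L * (n%:~R * (pi / (2 * L)) - u) = n%:~R * pi - L * t2 by rewrite /t2; field.
by rewrite cosB sinB sin_intpi; split=> //; ring.
Qed.

Lemma tau_reflect ph (n : int) (u : R) :
  model_tau ph (n%:~R * (pi / (2 * L)) - u) + model_tau ph (n%:~R * (pi / (2 * L)) + u) =
  2 * model_tau ph (n%:~R * (pi / (2 * L))).
Proof.
have [k [k1 e1 e2]] := half_turn_reflect n u; have [k0 [k01 e3 e4]] := half_turn_reflect n 0.
rewrite /model_tau e1 e2; rewrite subr0 addr0 in e3 e4; set t0 := n%:~R * _ in e3 e4 *.
have z : s t0 * c t0 = 0.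
  have : s t0 * c t0 = - (k0 * k0 * (s t0 * c t0)) by rewrite {1}e4 {1}e3; ring.
  by rewrite k01 mul1r; lra.
have -> : - (k * s (t0 + u)) * (k * c (t0 + u)) = - (s (t0 + u) * c (t0 + u)).
  by rewrite -[s (t0 + u) * c (t0 + u)]mul1r -k1; ring.
have ksq : k ^+ 2 = 1 by rewrite expr2.
rewrite sqrrN !exprMn ksq !mul1r mulrN mulNr atanN z mulr0 mul0r atan0.
by ring.
Qed.

Lemma height_reflect (n : int) (u : R) :
  model_height H P Q (n%:~R * (pi / (2 * L)) - u) = model_height H P Q (n%:~R * (pi / (2 * L)) + u).
Proof.
have [k [k1 e1 e2]] := half_turn_reflect n u; have ksq : k ^+ 2 = 1 by rewrite expr2.
by rewrite /model_height /model_height2 e1 e2 sqrrN !exprMn ksq !mul1r.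
Qed.

End Spherical.

End Fixed.
End ModelCalculus.

(** * Unduloids and nodoids *)

Section MoreAnalysis.
Context {R : realType}.

(** A derivative bounded below by [m] > 0 also gives surjectivity. *)
Lemma increasing_inverse (f f' : R -> R) (m : R) : 0 < m ->
  (forall t : R, is_derive t 1 f (f' t)) -> (forall t, m <= f' t) ->
  exists h : R -> R, [/\ cancel f h, cancel h f, (forall s t, s < t -> f s < f t) &
                forall t : R, is_derive (f t) 1 h (f' t)^-1].
Proof.
move=> m0 df fm.
have iT : is_interval (@setT R) by [].
have lt s t : s < t -> f s < f t.
  by apply: (derive_gt0_lt iT (fun u _ => df u)) => // u _; apply: lt_le_trans (fm u).
have inj : injective f.
  by move=> s t e; case: (ltgtP s t) => // /lt; rewrite e ltxx.
have grow s t : s <= t -> m * (t - s) <= f t - f s.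
  rewrite le_eqVlt => /orP[/eqP ->|st]; first by rewrite !subrr mulr0.
  have [u _ ->] := derive_mvt iT (fun u _ => df u) I I st.
  by rewrite ler_wpM2r ?fm// subr_ge0 ltW.
have onto v : exists t, f t = v.
  pose d := `|v - f 0| / m; have d0 : 0 <= d by rewrite divr_ge0// ltW.
  have md : m * d = `|v - f 0| by rewrite mulrC divfK// gt_eqF.
  have h1 : f (- d) <= v.
    have := grow (- d) 0; rewrite sub0r opprK md oppr_le0 => /(_ d0).
    have := ler_norm (f 0 - v); rewrite distrC; lra.
  have h2 : v <= f d.
    have := grow 0 d d0; rewrite subr0 md; have := ler_norm (v - f 0); lra.
  have [||u _ <-] := @ivt_interval _ setT f (- d) d v iT _ I I; last by exists u.
    by move=> u _; exact: is_derive_continuous (df u).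
  by rewrite h1.
have [h hK] := choice onto.
have fK : cancel f h by move=> t; apply: inj; rewrite hK.
exists h; split => // t; apply: (@is_derive_inverse R f h).
- by near=> u; exact: fK.
- by near=> u; exact: is_derive_continuous (df u).

- by rewrite gt_eqF// (lt_le_trans m0).
Unshelve. all: by end_near. Qed.

Lemma asin_le (x y : R) : -1 <= x -> x <= y -> y <= 1 -> asin x <= asin y.
Proof.
move=> x1 xy y1; have hx : -1 <= x <= 1 by lra. have hy : -1 <= y <= 1 by lra.
have bx := (asin_geNpi2 hx, asin_lepi2 hx); have by_ := (asin_geNpi2 hy, asin_lepi2 hy).
rewrite leNgt; apply/negP => h; move: h.
rewrite -ltr_sin ?in_itv /= ?bx ?by_// !asinK ?in_itv//; lra.
Qed.

Lemma sin0_int (x : R) : sin x = 0 -> exists n : int, x = n%:~R * pi.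
Proof.
move=> h; have [||m e] := @cos_sin_eq R (x + x) 0.
- by rewrite cosD h cos0 mulr0 subr0 -expr2 cos2sin2 h expr0n subr0.
- by rewrite sinD h sin0 mul0r mulr0 addr0.
by exists m; lra.
Qed.

Lemma is_derive_inv (f : R -> R) (t a : R) : is_derive t 1 f a -> f t != 0 ->
  is_derive t 1 (fun u => (f u)^-1) (- a / f t ^+ 2).
Proof.
move=> df nz; apply: (is_derive_eq (is_deriveV nz df)).
by rewrite /GRing.scale /=; field.
Qed.

(** A primitive of [K] with the right initial value is an angle of (V1, V2) at every
    time, since the component of the normalized vector along (cos, sin) of this
    primitive has derivative zero. *)
Lemma angle_lift (V1 V2 D1 D2 K : R -> R) :
  (forall t : R, is_derive t 1 V1 (D1 t)) -> (forall t : R, is_derive t 1 V2 (D2 t)) ->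
  (forall t, 0 < V1 t ^+ 2 + V2 t ^+ 2) ->
  (forall t, K t * (V1 t ^+ 2 + V2 t ^+ 2) = V1 t * D2 t - V2 t * D1 t) ->
  (forall t, {for t, continuous K}) ->
  exists sg : R -> R, forall t : R, [/\ is_derive t 1 sg (K t),
    V1 t = Num.sqrt (V1 t ^+ 2 + V2 t ^+ 2) * cos (sg t) &
    V2 t = Num.sqrt (V1 t ^+ 2 + V2 t ^+ 2) * sin (sg t)].
Proof.
move=> d1 d2 n0 hK cK; have iT : is_interval (@setT R) by [].
have [F dF] := antiderivative openT iT (I : setT 0) (fun t _ => cK t).
have [th [h1 h2]] := polar (V1 0) (V2 0).
pose n t := Num.sqrt (V1 t ^+ 2 + V2 t ^+ 2).
have n1 t : 0 < n t by rewrite sqrtr_gt0.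
have nn t : n t ^+ 2 = V1 t ^+ 2 + V2 t ^+ 2 by rewrite sqr_sqrtr// ltW.
pose sg t := th + (F t - F 0).
have dsg (t : R) : is_derive t 1 sg (K t).
  by have := dF t I => dFt; rewrite /sg; apply: is_derive_eq; rewrite /GRing.scale /=; ring.
have dn (t : R) : is_derive t 1 n ((V1 t * D1 t + V2 t * D2 t) / n t).
  have dn2 : is_derive t 1 (fun u => V1 u ^+ 2 + V2 u ^+ 2) (2 * (V1 t * D1 t + V2 t * D2 t)).
    have d1t := d1 t; have d2t := d2 t.
    by apply: is_derive_eq; rewrite /GRing.scale /=; ring.
  rewrite /n; apply: (chain_rule (f := Num.sqrt) (g := fun u => V1 u ^+ 2 + V2 u ^+ 2) erefl (is_derive1_sqrt (n0 t)) dn2).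
  by rewrite -/(n t); field; rewrite gt_eqF.
have dcos (t : R) : is_derive t 1 (fun u => cos (sg u)) (- (K t * sin (sg t))).
  by apply: (chain_rule (f := cos) erefl (is_derive_cos _) (dsg t)); ring.
have dsin (t : R) : is_derive t 1 (fun u => sin (sg u)) (K t * cos (sg t)).
  by apply: (chain_rule (f := sin) erefl (is_derive_sin _) (dsg t)); ring.
(* the component of the unit vector along the candidate direction is constant,
   and 1 at the origin *)
pose G t := (V1 t * cos (sg t) + V2 t * sin (sg t)) / n t.
have dG (t : R) : setT t -> is_derive t 1 G 0.
  move=> _; have d1t := d1 t; have d2t := d2 t; have dnt := dn t.
  have dct := dcos t; have dst := dsin t; have nz : n t != 0 by rewrite gt_eqF.
  have dV := is_derive_inv dnt nz.
  rewrite /G; apply: is_derive_eq; rewrite /GRing.scale /=.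
  have k := hK t; rewrite -nn in k.
  set c := cos (sg t); set s := sin (sg t).
  transitivity (((- (V1 t * s) + V2 t * c) * (K t * n t ^+ 2) +
     (D1 t * c + D2 t * s) * n t ^+ 2 - (V1 t * c + V2 t * s) * (V1 t * D1 t + V2 t * D2 t)) / n t ^+ 3).
    by field.
  rewrite k nn; set X := _ + _ - _; suff -> : X = 0 by rewrite mul0r.
  by rewrite /X; ring.
have G1 t : G t = 1.
  have e1 : V1 0 = n 0 * cos th := h1. have e2 : V2 0 = n 0 * sin th := h2.
  have cs := cos2Dsin2 th; have nz : n 0 != 0 by rewrite gt_eqF.
  rewrite (derive0_const iT dG (t := 0) I I) /G /sg subrr addr0 e1 e2 -[RHS]cs.
  by field.
exists sg => t; split; first exact: dsg.
all: have g1 : V1 t * cos (sg t) + V2 t * sin (sg t) = n t by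
  move/(congr1 (fun x => x * n t)): (G1 t); rewrite /G divfK ?mul1r// gt_eqF.
all: have cs := cos2Dsin2 (sg t); have nt := nn t; rewrite -/(n t).
all: have z : (V1 t - n t * cos (sg t)) ^+ 2 + (V2 t - n t * sin (sg t)) ^+ 2 = 0.
1,3: transitivity (V1 t ^+ 2 + V2 t ^+ 2 - 2 * n t * (V1 t * cos (sg t) + V2 t * sin (sg t)) +
    n t ^+ 2 * (cos (sg t) ^+ 2 + sin (sg t) ^+ 2)); [ring|rewrite g1 cs -nt; ring].
all: have q1 := sqr_ge0 (V1 t - n t * cos (sg t)); have q2 := sqr_ge0 (V2 t - n t * sin (sg t)).
all: apply/eqP; rewrite -subr_eq0 -sqrf_eq0; apply/eqP; lra.
Qed.

End MoreAnalysis.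

Section Graphs.
Context {R : realType}.
Variables (H E P Q ph : R).
Local Notation L := (lam H).
Local Notation A := (coefA H P Q).
Local Notation B := (coefB H P Q).
Local Notation c t := (cos (L * t)).
Local Notation s t := (sin (L * t)).
Local Notation mh := (model_height H P Q).
Local Notation mz2 := (modulus2 H P Q).
Local Notation mk := (momentum H P Q).
Local Notation ma := (drift H P Q).
Local Notation mom := (model_om H P Q).
Local Notation mtau := (model_tau H P Q ph).
Hypothesis Sh : shape H E P Q.
Hypothesis Q0 : 0 < Q.
Hypothesis QP : Q < P.
Hypothesis Bn : B != 0.

Let d := pi / (2 * L).

Lemma quarter_gt0 : 0 < d.
Proof. by rewrite /d divr_gt0 ?pi_gt0// mulr_gt0// lam_gt0. Qed.

Lemma quarter_mul (n : int) : L * (n%:~R * d) *+ 2 = n%:~R * pi.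
Proof.
have Ln : L != 0 by rewrite gt_eqF// lam_gt0.
by rewrite /d mulr2n; field.
Qed.

Lemma AB2_gt0 : 0 < A ^+ 2 - B ^+ 2.
Proof. by rewrite (shape_AB2 Sh) subr_gt0 ltr_pXn2r ?nnegrE ?ltW// (shape_P Sh). Qed.

Lemma drift_eq0 t : ma t = 0 -> exists n : int, t = n%:~R * d.
Proof.
have Ln : L != 0 by rewrite gt_eqF// lam_gt0.
move/eqP; rewrite /drift !mulf_eq0 (negbTE Ln) (gt_eqF AB2_gt0) /= => z.
have : sin (L * t + L * t) = 0.
  by rewrite sinD; case/orP: z => /eqP ->; rewrite ?mulr0 ?mul0r ?addr0.
move/sin0_int => [n e]; exists n; rewrite /d.
have : t = n%:~R * pi / (2 * L) by rewrite -e; field.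
by move=> {1}->; rewrite mulrA.
Qed.

Lemma drift_quarter (n : int) : ma (n%:~R * d) = 0.
Proof.
have : sin (L * (n%:~R * d) *+ 2) = 0 by rewrite quarter_mul sin_intpi.
rewrite mulr2n sinD /drift => h.
have -> : s (n%:~R * d) * c (n%:~R * d) = 0 by lra.
by rewrite mulr0.
Qed.

(** The drift is a multiple of sin (2 L t), whose sign on the n-th quarter is
    the one of cos (n pi). *)
Lemma drift_sign (n : int) : exists k, k * k = 1 /\
  forall t, n%:~R * d < t < (n%:~R + 1) * d -> 0 < k * ma t.
Proof.
have L0 := lam_gt0 H; have Ln : L != 0 by rewrite gt_eqF.
exists (cos (n%:~R * pi)); rewrite -expr2 cos_intpi_sqr; split=> // t ht.
have e : L * t + L * t = n%:~R * pi + 2 * L * (t - n%:~R * d).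
  by rewrite -quarter_mul mulr2n; ring.
have sn : 0 < sin (2 * L * (t - n%:~R * d)).
  have dE : 2 * L * d = pi by rewrite /d; field.
  apply: sin_gt0_pi; apply/andP; split; first by rewrite !mulr_gt0//; lra.
  by rewrite -dE ltr_pM2l ?mulr_gt0//; lra.
have h : 2 * (s t * c t) = cos (n%:~R * pi) * sin (2 * L * (t - n%:~R * d)).
  by rewrite -[RHS]addr0 -[X in _ + X](mul0r (cos (2 * L * (t - n%:~R * d)))) -(@sin_intpi R n) addrC -sinD -e sinD; ring.
have -> : cos (n%:~R * pi) * ma t = L * (A ^+ 2 - B ^+ 2) * (cos (n%:~R * pi) * (2 * (s t * c t)) / 2).
  by rewrite /drift; field.
rewrite h mulrA -expr2 cos_intpi_sqr mul1r mulr_gt0 ?divr_gt0// mulr_gt0//; exact: AB2_gt0.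
Qed.

(** For B > 0 the momentum P B cos^2 + Q A sin^2 is a convex combination of two positive
    numbers, and |z| <= 1. *)
Lemma momentum_ge : 0 < B -> exists2 m, 0 < m & forall t, m <= mk t / mz2 t.
Proof.
move=> B0; have A0 := shape_AP Sh; have P0 := shape_P Sh.
exists (Num.min (P * B) (Q * A)); first by rewrite lt_min !mulr_gt0.
move=> t; set m := Num.min _ _; have m0 : 0 < m by rewrite lt_min !mulr_gt0.
have [m1 m2] : m <= P * B /\ m <= Q * A by rewrite !ge_min !lexx orbT.
have z0 := modulus2_gt0 Sh Q0 t; have z1 : mz2 t <= 1.
  by rewrite (modulus2E Sh) gerBl; exact: (height2_ge0 Sh).
rewrite ler_pdivlMr//; apply: (@le_trans _ _ m); first by rewrite ler_piMr// ltW.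
have cs := cos2Dsin2 (L * t); rewrite -[m]mulr1 -cs mulrDr /momentum.
by apply: lerD; rewrite ler_wpM2r ?sqr_ge0.
Qed.

Lemma om_derive (t : R) : is_derive t 1 mom (ma t / (mh t * Num.sqrt (mz2 t))).
Proof. exact: (is_derive_om Sh Q0 (height_gt0 Sh t Bn)). Qed.

Lemma om_denominator_gt0 t : 0 < mh t * Num.sqrt (mz2 t).
Proof. by rewrite mulr_gt0 ?(height_gt0 Sh)// sqrtr_gt0 (modulus2_gt0 Sh Q0). Qed.

Lemma om_continuous : continuous mom.
Proof. by move=> t; exact: is_derive_continuous (om_derive t). Qed.

Lemma tau_continuous : continuous mtau.
Proof. by move=> t; exact: is_derive_continuous (is_derive_tau Sh Q0 ph t). Qed.

Lemma height_le t : mh t <= A.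
Proof.
have A0 := shape_AP Sh; rewrite -(@ler_pXn2r _ 2) ?nnegrE ?sqrtr_ge0 ?(ltW A0)//.
rewrite (height_sqr Sh) (height2_ends H P Q t) -lerBrDl; apply: ler_piMr; first exact: ltW AB2_gt0.
by rewrite sin2cos2 gerBl sqr_ge0.
Qed.

Lemma height_at0 : mh 0 = `|B|.
Proof. by rewrite /model_height (height2_ends H P Q 0) mulr0 sin0 expr0n mulr0 addr0 sqrtr_sqr. Qed.

Lemma height_quarter : mh d = A.
Proof.
have Ln : L != 0 by rewrite gt_eqF// lam_gt0.
have e : L * d = pi / 2 by rewrite /d; field.
by rewrite /model_height (height2_ends H P Q d) e sin_pihalf expr1n mulr1 addrC subrK sqrtr_sqr gtr0_norm// (shape_AP Sh).
Qed.

(** The height runs between its values |B| and A at the vertices of the ellipse. *)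
Lemma om_range : [set mom t | t in [set: R]] = [set` `[asin `|B|, asin A]] :> set R /\
  [/\ 0 < asin `|B|, asin `|B| < asin A & asin A < pi / 2].
Proof.
have A0 := shape_AP Sh; have B0 : 0 < `|B| by rewrite normr_gt0.
have A1 : A < 1 by rewrite -height_quarter (height_lt1 Sh Q0).
have BA : `|B| < A.
  rewrite -(@ltr_pXn2r _ 2) ?nnegrE ?(ltW A0)// real_normK ?num_real//.
  by have := AB2_gt0; lra.
split; last split.
- apply/seteqP; split=> [_ [t _ <-]|y].
    rewrite /= in_itv /=; have h1 := height_ge Sh t; have h2 := height_le t.
    by rewrite /model_om !asin_le//; lra.
  rewrite /= in_itv /= => hy.
  have [] := @ivt_interval R setT mom 0 d y _ _ I I => //.
    by move=> u _; exact: om_continuous.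
  + by rewrite /model_om height_at0 height_quarter.
  by move=> u _ <-; exists u.
- rewrite -height_at0 -/(mom 0); have := om_bounds Sh Q0 0; rewrite le_eqVlt => /andP[/orP[/eqP e|//] _].
  by have := sin_mom Sh Q0 0; rewrite -e sin0 height_at0 => e'; rewrite -e' ltxx in B0.
- have hb : -1 <= `|B| <= 1 by lra. have ha : -1 <= A <= 1 by lra.
  rewrite -ltr_sin ?in_itv /= ?asin_geNpi2 ?asin_lepi2// !asinK ?in_itv//.
- by rewrite asin_ltpi2// A1; lra.
Qed.

Let kap := 1 - H / L.

Lemma shift_gt0 : 0 < pi * kap.
Proof.
rewrite mulr_gt0 ?pi_gt0// /kap subr_gt0 ltr_pdivrMr ?lam_gt0// mul1r.
exact: le_lt_trans (ler_norm _) (lam_gt H).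
Qed.

Lemma om_shift t : mom (t + pi / L) = mom t.
Proof. by rewrite /model_om /model_height /model_height2 half_period_cos half_period_sin !sqrrN. Qed.

Lemma om_reflect (n : int) (u : R) : mom (n%:~R * d - u) = mom (n%:~R * d + u).
Proof. by rewrite /model_om height_reflect. Qed.

(** The key identity is L^2 (A^2 + B^2) = 1 - 2 H E, obtained by adding the two
    equations of the sphere in [shape] with P and Q expressed by A and B. *)
Lemma drift_derive (t : R) : is_derive t 1 ma (1 - 2 * model_height2 H P Q t - 2 * H * mk t).
Proof.
have h1 := is_derive_cosM L t; have h2 := is_derive_sinM L t.
have PE : P = L * A + H * B by have := lam_sqr H; rewrite /coefA /coefB => l2;
  transitivity (P * (L ^+ 2 - H ^+ 2)); [rewrite l2; ring|ring].
have QE : Q = L * B + H * A by have := lam_sqr H; rewrite /coefA /coefB => l2;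
  transitivity (Q * (L ^+ 2 - H ^+ 2)); [rewrite l2; ring|ring].
have key : L ^+ 2 * (A ^+ 2 + B ^+ 2) = 1 - 2 * H * E.
  have l2 := lam_sqr H.
  have : (L * A + H * B) ^+ 2 + B ^+ 2 + ((L * B + H * A) ^+ 2 + A ^+ 2) = 1 + 1.
    by rewrite -PE -QE (shape_PB Sh) (shape_QA Sh).
  have -> : (L * A + H * B) ^+ 2 + B ^+ 2 + ((L * B + H * A) ^+ 2 + A ^+ 2) =
    (L ^+ 2 + (1 + H ^+ 2)) * (A ^+ 2 + B ^+ 2) + 4 * H * (L * A * B) by ring.
  by rewrite -l2 (shape_AB Sh) mulrDl; lra.
rewrite /drift; apply: is_derive_eq; rewrite /GRing.scale /=.
rewrite (momentumE Sh) (height2_ends H P Q t).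
have l2 := lam_sqr H; have cs := cos2sin2 (L * t).
transitivity (L ^+ 2 * (A ^+ 2 + B ^+ 2) - 2 * L ^+ 2 * (B ^+ 2 + (A ^+ 2 - B ^+ 2) * s t ^+ 2)).
  transitivity (L ^+ 2 * (A ^+ 2 - B ^+ 2) * (c t ^+ 2 - s t ^+ 2)); first by ring.
  by rewrite cs; ring.
by rewrite key l2; ring.
Qed.

Lemma momentum_derive (t : R) : is_derive t 1 mk (2 * H * ma t).
Proof.
have -> : mk = (fun t => E + H * model_height2 H P Q t) by apply/funext => u; exact: (momentumE Sh).
by have h := is_derive_height2 H P Q t; apply: is_derive_eq; rewrite /GRing.scale /=; ring.
Qed.

(** Up to a positive factor, the derivative of the angle sigma of the tangent,
    in terms of the momentum k and of the squared height x. *)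
Definition turning (k x : R) := k * x ^+ 2 - k ^+ 3 + 2 * H * x ^+ 2 * (1 - x).

(** The drift vanishes only at the vertices of the ellipse, where the momentum is
    P B or Q A. *)
Lemma tangent_norm_gt0 t : 0 < ma t ^+ 2 + (mh t * mk t) ^+ 2.
Proof.
have A0 := shape_AP Sh; have P0 := shape_P Sh; have r0 := height_gt0 Sh t Bn.
have g1 := sqr_ge0 (ma t); have g2 := sqr_ge0 (mh t * mk t).
rewrite lt_neqAle addr_ge0// andbT; apply/negP => /eqP z.
have z1 : ma t = 0 by apply/eqP; rewrite -sqrf_eq0; apply/eqP; lra.
have z2 : mk t = 0.
  have : (mh t * mk t) ^+ 2 = 0 by lra.
  by move/eqP; rewrite sqrf_eq0 mulf_eq0 (gt_eqF r0) => /eqP.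
have cs := cos2Dsin2 (L * t).
have : s t * c t = 0.
  move/eqP: z1; rewrite /drift mulf_eq0 => /orP[|/eqP //].
  by rewrite mulf_eq0 (gt_eqF (lam_gt0 H)) (gt_eqF AB2_gt0).
move/eqP; rewrite mulf_eq0 => /orP[] /eqP y; move: z2 cs; rewrite /momentum y expr0n mulr0 ?addr0 ?add0r => z2 cs.
  by move/eqP: z2; rewrite cs mulr1 mulf_eq0 (gt_eqF P0) (negbTE Bn).
by move/eqP: z2; rewrite cs mulr1 mulf_eq0 (gt_eqF Q0) (gt_eqF A0).
Qed.

Lemma height2_continuous : continuous (model_height2 H P Q).
Proof. by move=> u; exact: is_derive_continuous (is_derive_height2 H P Q u). Qed.

(** Multiplying the tangent (omega', cos omega tau') by r |z| gives the vector
    (drift, r momentum), which has no denominators. *)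
Lemma tangent_angle : exists sg : R -> R, forall t : R,
  [/\ is_derive t 1 sg (turning (mk t) (model_height2 H P Q t) / (mh t * (ma t ^+ 2 + (mh t * mk t) ^+ 2))),
   ma t = Num.sqrt (ma t ^+ 2 + (mh t * mk t) ^+ 2) * cos (sg t) &
   mh t * mk t = Num.sqrt (ma t ^+ 2 + (mh t * mk t) ^+ 2) * sin (sg t)].
Proof.
have dV2 (t : R) : is_derive t 1 (fun u => mh u * mk u) (ma t / mh t * mk t + mh t * (2 * H * ma t)).
  have h1 := momentum_derive t; have h2 := is_derive_height Sh (height_gt0 Sh t Bn).
  by apply: is_derive_eq; rewrite /GRing.scale /=; ring.
apply: (angle_lift drift_derive dV2 tangent_norm_gt0) => t.
  have r0 := height_gt0 Sh t Bn; have n0 := tangent_norm_gt0 t; have rE := height_sqr Sh t.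
  have am := drift_mk Sh t; have zE := modulus2E Sh t.
  rewrite /turning -rE; rewrite -rE in am zE.
  have m2 : ma t ^+ 2 = mh t ^+ 2 * (1 - mh t ^+ 2) - mk t ^+ 2 by rewrite -zE -am; ring.
  set k := mk t in m2 n0 *; set r := mh t in r0 m2 n0 *; set a := ma t in m2 n0 *.
  transitivity ((k * (r ^+ 2) ^+ 2 - k ^+ 3 + 2 * H * (r ^+ 2) ^+ 2 * (1 - r ^+ 2)) / r).
    by field; rewrite !gt_eqF.
  transitivity ((a ^+ 2 * k + 2 * H * r ^+ 2 * a ^+ 2 - r ^+ 2 * k * (1 - 2 * r ^+ 2 - 2 * H * k)) / r).
    by rewrite m2; congr (_ / _); ring.
  by field; rewrite gt_eqF.
have cm u : {for u, continuous ma} := is_derive_continuous (drift_derive u).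
have ck u : {for u, continuous mk} := is_derive_continuous (momentum_derive u).
have ch u : {for u, continuous mh} := is_derive_continuous (is_derive_height Sh (height_gt0 Sh u Bn)).
have c2 : {for t, continuous (model_height2 H P Q)} by exact: height2_continuous.
have sq (f : R -> R) : {for t, continuous f} -> {for t, continuous (fun u => f u ^+ 2)} by exact: cvg_sqr.
apply: cvgM; last first.
  apply: cvgV; first by rewrite gt_eqF// mulr_gt0// ?tangent_norm_gt0// (height_gt0 Sh).
  apply: cvgM; first exact: ch.
  apply: cvgD; first exact: sq.
  by apply: sq; apply: cvgM; [exact: ch|exact: ck].
rewrite /turning; apply: cvgD; first apply: cvgB.
- by apply: cvgM; [exact: ck|exact: sq].
- have -> : (fun u => mk u ^+ 3) = (fun u => mk u * mk u ^+ 2) by apply/funext => u; rewrite exprS.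
  by apply: cvgM; [exact: ck|apply: sq; exact: ck].
- apply: cvgM; first by apply: cvgM; [exact: cvg_cst|exact: sq].
  by apply: cvgB; [exact: cvg_cst|exact: c2].
Qed.

(** For k >= 0 the cube is controlled by k^2 <= x (1 - x) and by k < H x, as E < 0;
    for k < 0 the last term dominates because - k < H (1 - x), as E + H > 0. *)
Lemma turning_gt0 (k x : R) : 0 < H -> E < 0 -> 0 < E + H -> 0 < x < 1 -> k = E + H * x ->
  k ^+ 2 <= x * (1 - x) -> 0 < turning k x.
Proof.
move=> H0 E0 EH hx kE kx; rewrite /turning.
have [k0|k0] := leP 0 k.
  have h1 : k ^+ 3 <= k * (x * (1 - x)) by rewrite exprS ler_wpM2l.
  have h2 : k < H * x by lra.
  have h5 : 0 < 2 * H * x ^+ 2 * (1 - x) by rewrite !mulr_gt0 ?exprn_gt0//; lra.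
  have [x2|x2] := leP (2^-1) x.
    have : 0 <= k * (x * (2 * x - 1)) by rewrite !mulr_ge0//; lra.
    by lra.
  have h3 : k * (1 - 2 * x) <= H * x * (1 - 2 * x) by rewrite ler_wpM2r; lra.
  have h4 : 0 < H * x * (1 - 2 * x) by nra.
  nra.
have h1 : - k < H * (1 - x) by lra.
have h2 : - k ^+ 3 = - k * k ^+ 2 by ring.
have h3 : 0 <= - k * k ^+ 2 by rewrite mulr_ge0 ?sqr_ge0//; lra.
have x2 : 0 < x ^+ 2 by rewrite exprn_gt0//; lra.
have h4 : - k * x ^+ 2 < H * (1 - x) * x ^+ 2 by rewrite ltr_pM2r.
have h5 : 0 < H * (1 - x) * x ^+ 2 by rewrite !mulr_gt0//; lra.
lra.
Qed.

Section Curve.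
Variables (J : set R) (g : R -> 'rV[R]_4) (e : R) (xi w : R -> R).
Hypothesis JT : J = setT.
Hypothesis e1 : e * e = 1.
Hypothesis dxi : forall s : R, is_derive s 1 xi (e * w s) /\ 1 <= w s.
Hypothesis onto : forall t, exists s, xi s = t.
Hypothesis gE : forall s, g s = model H P Q ph (xi s).

Lemma time_continuous : continuous xi.
Proof. by move=> v; exact: is_derive_continuous (dxi v).1. Qed.

Lemma model_lift : spherical_lift J g (mom \o xi) (mtau \o xi).
Proof.
have cx := time_continuous.
split; [apply: continuous_subspaceT|apply: continuous_subspaceT|].
- by move=> v; apply: continuous_comp; [exact: cx|exact: om_continuous].
- by move=> v; apply: continuous_comp; [exact: cx|exact: tau_continuous].
- by move=> v _; rewrite gE (model_spherical Sh Q0); split=> //; exact: (om_bounds Sh Q0).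
Qed.

Lemma model_trace : plane_trace J (mom \o xi) (mtau \o xi) = [set (mtau t, mom t) | t in setT].
Proof.
rewrite JT; apply/seteqP; split=> [_ [v _ <-]|_ [t _ <-]]; first by exists (xi v).
by have [v <-] := onto t; exists v.
Qed.

(** For B > 0 the momentum is positive, so tau is a diffeomorphism of the line, and
    the function omega(tau) inherits the period and the symmetries of the height. *)
Lemma model_unduloidal : 0 < B -> unduloidal J g.
Proof.
move=> B0; have [m m0 hm] := momentum_ge B0; have [r1 [r2 r3 r4]] := om_range.
have [h [fK hK lt dh]] := increasing_inverse m0 (is_derive_tau Sh Q0 ph) hm.
pose W v := mom (h v).
have dW (t : R) : is_derive (mtau t) 1 W (ma t / (mh t * Num.sqrt (mz2 t)) * (mk t / mz2 t)^-1).
  exact: (chain_rule (f := mom) (fK t) (om_derive t) (dh t)).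
have W1 t : derive1 W (mtau t) = ma t / (mh t * Num.sqrt (mz2 t)) * (mk t / mz2 t)^-1.
  by rewrite derive1E; case: (dW t).
have pos t : 0 < (mh t * Num.sqrt (mz2 t))^-1 * (mk t / mz2 t)^-1.
  by rewrite mulr_gt0// invr_gt0 ?om_denominator_gt0// (lt_le_trans m0).
have W10 t : derive1 W (mtau t) = ma t * ((mh t * Num.sqrt (mz2 t))^-1 * (mk t / mz2 t)^-1).
  by rewrite W1 mulrA.
have d0 := quarter_gt0.
exists (mom \o xi), (mtau \o xi), W; split.
- exact: model_lift.
- rewrite model_trace; apply/seteqP; split=> [_ [t _ <-]|_ [v _ <-]].
    by exists (mtau t) => //; rewrite /W fK.
  by exists (h v) => //; rewrite hK.
- split; first by move=> v; rewrite -(hK v); case: (dW (h v)).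
  exists (pi * kap); split; first exact: shift_gt0.
  by move=> v; rewrite /W -{1}(hK v) -tau_shift fK om_shift.
- exists (asin `|B|), (asin A); split => //.
  rewrite -r1; apply/seteqP; split=> [_ [v _ <-]|_ [t _ <-]]; first by exists (h v).
  by exists (mtau t) => //; rewrite /W fK.
move=> v0; rewrite -(hK v0) W10 => /eqP; rewrite mulf_eq0 [X in _ || X]gt_eqF// orbF => /eqP.
move=> /drift_eq0 [n ->]; split.
  move=> v; pose u := h (mtau (n%:~R * d) + v) - n%:~R * d.
  have e2 : mtau (n%:~R * d + u) = mtau (n%:~R * d) + v by rewrite /u addrC subrK hK.
  have e3 : mtau (n%:~R * d - u) = mtau (n%:~R * d) - v.
    by have := tau_reflect H P Q ph n u; rewrite e2 -/d; lra.
  by rewrite /W -e2 -e3 !fK om_reflect.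
have [q [q1 hq]] := drift_sign n.
have inner t : mtau (n%:~R * d) < t < mtau ((n%:~R + 1) * d) -> n%:~R * d < h t < (n%:~R + 1) * d.
  move=> /andP[h1 h2]; apply/andP; split; rewrite ltNge; apply/negP.
    rewrite le_eqVlt => /orP[/eqP e2|/lt]; rewrite ?hK; last by lra.
    by rewrite -e2 hK ltxx in h1.
  rewrite le_eqVlt => /orP[/eqP e2|/lt]; rewrite ?hK; last by lra.
  by rewrite e2 hK ltxx in h2.
have sgn t : mtau (n%:~R * d) < t < mtau ((n%:~R + 1) * d) -> 0 < q * derive1 W t.
  move=> /inner ht; rewrite -(hK t) W10 mulrA mulr_gt0//; exact: hq.
exists (mtau ((n%:~R + 1) * d)); split.
- by apply: lt; lra.
- by rewrite W10; have := drift_quarter (n + 1); rewrite intrD => ->; rewrite mul0r.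
- by move=> t /sgn; apply: contraTneq => ->; rewrite mulr0 ltxx.
have mono x y : mtau (n%:~R * d) <= x -> y <= mtau ((n%:~R + 1) * d) -> x < y -> 0 < q * (W y - W x).
  move=> h1 h2 xy.
  have dW' (u : R) : setT u -> is_derive u 1 W (derive1 W u).
    by move=> _; rewrite -(hK u) W1; exact: dW.
  have iT : is_interval (@setT R) by [].
  have [u hu ->] := derive_mvt iT dW' I I xy.
  by rewrite mulrA mulr_gt0 ?subr_gt0// sgn//; lra.
have /orP[/eqP qe|/eqP qe] : (q == 1) || (q == -1) by rewrite -eqf_sqr expr2 q1 expr1n.
  by left=> x y; rewrite /= !in_itv /= => h1 h2 xy; have := mono x y; rewrite qe; lra.
by right=> x y; rewrite /= !in_itv /= => h1 h2 xy; have := mono x y; rewrite qe; lra.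
Qed.

Hypothesis speed : forall s : R, dot (derive1 g s) (derive1 g s) = 1.

Lemma model_velocity (v : R) : is_derive v 1 (g : R -> 'rV[R]_4) (vec4
   (e * w v * (- (A * s (xi v) * cos (ph - H * xi v)) - B * c (xi v) * sin (ph - H * xi v)))
   (e * w v * (- (A * s (xi v) * sin (ph - H * xi v)) + B * c (xi v) * cos (ph - H * xi v)))
   (e * w v * (ma (xi v) / mh (xi v))) 0).
Proof.
have -> : g = (fun v => model H P Q ph (xi v)) by apply/funext.
have [dx _] := dxi v; rewrite /model.
have i1 := chain_rule erefl (is_derive_model_x H P Q ph (xi v)) dx (mulrC _ _).
have i2 := chain_rule erefl (is_derive_model_y H P Q ph (xi v)) dx (mulrC _ _).
have i3 := chain_rule erefl (is_derive_height Sh (height_gt0 Sh (xi v) Bn)) dx (mulrC _ _).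
exact: is_derive_vec4.
Qed.

(** Unit speed of the curve determines the derivative of the time. *)
Lemma model_speed (v : R) :
  w v ^+ 2 * (ma (xi v) ^+ 2 + (mh (xi v) * mk (xi v)) ^+ 2) = model_height2 H P Q (xi v) * mz2 (xi v).
Proof.
have := speed v; rewrite derive1E; have [_ ->] := model_velocity v.
set t := xi v; rewrite dot4 !vecE -!expr2 expr0n addr0 => h.
have cs := cos2Dsin2 (ph - H * t); have r0 := height_gt0 Sh t Bn.
have am := drift_mk Sh t; have zE := modulus2E Sh t; have rE := height_sqr Sh t.
have h' : w v ^+ 2 * (model_height2 H P Q t + ma t ^+ 2 / model_height2 H P Q t) = 1.
  rewrite -[RHS]h; set a := ma t.
  transitivity (e * e * w v ^+ 2 * ((A ^+ 2 * s t ^+ 2 + B ^+ 2 * c t ^+ 2) * (cos (ph - H * t) ^+ 2 + sin (ph - H * t) ^+ 2) + a ^+ 2 / mh t ^+ 2)).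
    by rewrite e1 cs mul1r mulr1 rE.
  by field; rewrite gt_eqF.
have x0 : 0 < model_height2 H P Q t by rewrite -rE exprn_gt0.
have h2 : w v ^+ 2 * (model_height2 H P Q t ^+ 2 + ma t ^+ 2) = model_height2 H P Q t.
  by rewrite -[RHS]mulr1 -h'; field; rewrite gt_eqF.
rewrite [X in _ + X]exprMn rE.
have kE : mk t ^+ 2 = model_height2 H P Q t * mz2 t - ma t ^+ 2 by rewrite -am; ring.
by rewrite -[X in _ = X * _]h2 kE zE; ring.
Qed.

Section Nodoid.
Hypothesis B0 : B < 0.

(** B < 0 means H P > L Q, and E = L A B, E + H = L P Q. *)
Lemma nodoid_signs : [/\ 0 < H, E < 0 & 0 < E + H].
Proof.
have A0 := shape_AP Sh; have P0 := shape_P Sh; have L0 := lam_gt0 H.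
split.
- by move: B0; rewrite /coefB subr_lt0 => h; have : 0 < H * P by [apply: lt_trans h; rewrite mulr_gt0]; rewrite pmulr_lgt0.
- by rewrite -(shape_AB Sh) pmulr_rlt0// mulr_gt0.
- by rewrite -(shape_PQ Sh) !mulr_gt0.
Qed.

Lemma turning_pos t : 0 < turning (mk t) (model_height2 H P Q t).
Proof.
have [H0 E0 EH] := nodoid_signs; apply: turning_gt0 => //.
- have r0 := height_gt0 Sh t Bn; have := modulus2_gt0 Sh Q0 t; rewrite (modulus2E Sh) -(height_sqr Sh).
  by have : 0 < mh t ^+ 2 by [rewrite exprn_gt0]; lra.
- exact: (momentumE Sh).
- by rewrite -(modulus2E Sh) -(drift_mk Sh) lerDr sqr_ge0.
Qed.

(** The angle tau decreases as long as the momentum is negative, but over a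
    quarter of the rotation it gains half of the positive shift pi (1 - H / L);
    in between it takes its initial value again, with positive momentum. *)
Lemma nodoid_loop : exists t, [/\ 0 < t < d, mtau t = mtau 0, 0 < mk t & ma t != 0].
Proof.
have A0 := shape_AP Sh; have P0 := shape_P Sh; have L0 := lam_gt0 H; have d0 := quarter_gt0.
have Ln : L != 0 by rewrite gt_eqF.
have AB := AB2_gt0.
have mk0 : mk 0 < 0.
  by rewrite /momentum mulr0 cos0 sin0 expr1n expr0n !mulr0 mulr1 addr0 pmulr_rlt0.
have iT : is_interval (@setT R) by [].
have dm (u : R) : setT u -> is_derive u 1 mtau (mk u / mz2 u) by move=> _; exact: (is_derive_tau Sh Q0).
have end_gt : mtau 0 < mtau d.
  have ed : mtau d = mtau 0 + pi * kap / 2.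
    have := tau_reflect H P Q ph 1 d; rewrite mul1r -/d subrr.
    have -> : d + d = 0 + pi / L by rewrite /d add0r; field.
    by rewrite tau_shift -/kap; lra.
  by rewrite ed ltrDl divr_gt0// shift_gt0.
have ckk := is_derive_continuous (momentum_derive 0).
have [r r0 hr] : exists2 r : R, 0 < r & forall u, `|u - 0| < r -> mk u < 0.
  have oN : open [set y : R | y < 0] by exact: open_lt.
  have /nbhs_ballP [r /= r0 hr] := ckk _ (open_nbhs_nbhs (conj oN mk0)).
  by exists r => // u hu; apply: hr; rewrite /ball /= distrC.
pose v := Num.min (r / 2) (d / 2).
have v0 : 0 < v by rewrite lt_min; apply/andP; split; lra.
have [v1 v2] : v <= r / 2 /\ v <= d / 2 by rewrite !ge_min !lexx orbT.
have start_lt : mtau v < mtau 0.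
  have [u hu eu] := derive_mvt iT dm I I v0.
  have : mk u < 0 by apply: hr; rewrite subr0 gtr0_norm; lra.
  move=> h; rewrite -subr_lt0 eu subr0 pmulr_llt0// pmulr_llt0// invr_gt0; exact: (modulus2_gt0 Sh Q0).
have [|||t ht et] := @IVT R mtau v d (mtau 0).
- lra.
- by apply: continuous_subspaceT; exact: tau_continuous.
- by rewrite ge_min le_max (ltW start_lt) (ltW end_gt) orbT.
move: ht; rewrite in_itv /= => ht.
have td : t < d by rewrite lt_neqAle; have /andP[_ ->] := ht; rewrite andbT; apply/eqP => te; move: end_gt; rewrite -te et ltxx.
have ht0 : 0 < t < d by lra.
exists t; split => //.
  have [u hu] := derive_mvt iT dm I I (andP ht0).1.
  rewrite et subrr => /esym/eqP; rewrite mulf_eq0 subr0 (gt_eqF (andP ht0).1) orbF.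
  rewrite mulf_eq0 invr_eq0 (gt_eqF (modulus2_gt0 Sh Q0 u)) orbF => /eqP ku.
  rewrite -ku !(momentumE Sh) !(height2_ends H P Q) ltrD2l.
  have [H0 _ _] := nodoid_signs; rewrite ltr_pM2l// ltrD2l ltr_pM2l//.
  have dE : L * d = pi / 2 by rewrite /d; field.
  have pi0 := @pi_gt0 R; have b x : 0 < x < d -> 0 < L * x < pi / 2.
    by move=> hx; rewrite -dE mulr_gt0 ?ltr_pM2l//; lra.
  have bu : 0 < L * u < pi / 2 by apply: b; lra. have bt := b t ht0.
  rewrite ltr_pXn2r ?nnegrE ?sin_ge0_pi//; [|lra|lra].
  rewrite ltr_sin ?in_itv /=; [|lra|lra].
  by rewrite ltr_pM2l//; lra.
apply/eqP => /drift_eq0 [n te]; have : 0 < (n%:~R : R) < 1.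
  by move: ht0; rewrite te pmulr_lgt0// gtr_pMl.
by rewrite -[1]/(1%:~R) ltr0z ltr_int => /andP[]; case: n {te} => // -[].
Qed.

(** The tangent angle is strictly monotone by [turning_pos]; when the time runs
    backwards the tangent is reversed, which adds pi to the angle. *)
Lemma model_nodoidal : nodoidal J g.
Proof.
have [r1 [r2 r3 r4]] := om_range; have [sg0 hsg] := tangent_angle.
have Te := model_trace; exists (mom \o xi), (mtau \o xi).
have dom (v : R) : is_derive v 1 (mom \o xi) (e * w v * (ma (xi v) / (mh (xi v) * Num.sqrt (mz2 (xi v))))).
  exact: (chain_rule (f := mom) erefl (om_derive (xi v)) (dxi v).1 (mulrC _ _)).
have dta (v : R) : is_derive v 1 (mtau \o xi) (e * w v * (mk (xi v) / mz2 (xi v))).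
  exact: (chain_rule (f := mtau) erefl (is_derive_tau Sh Q0 ph (xi v)) (dxi v).1 (mulrC _ _)).
have e0 : e != 0 by apply/eqP => z; move: e1; rewrite z mul0r => /esym/eqP; rewrite oner_eq0.
split.
- exact: model_lift.
- exists (pi * kap); split; first by rewrite gt_eqF// shift_gt0.
  rewrite Te; apply/seteqP; split=> [_ [_ [t _ <-] <-]|_ [t _ <-]] /=.
    by exists (t + pi / L) => //; rewrite om_shift tau_shift.
  exists (mtau (t - pi / L), mom (t - pi / L)); first by exists (t - pi / L).
  by rewrite /= -tau_shift -om_shift subrK.
- exists (asin `|B|), (asin A); split => //.
  rewrite -r1 JT; apply/seteqP; split=> [_ [v _ <-]|_ [t _ <-]]; first by exists (xi v).
  by have [v <-] := onto t; exists v.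
- move=> v0 _; rewrite derive1E; have [_ ->] := dom v0.
  have w0 : w v0 != 0 by rewrite gt_eqF// (lt_le_trans ltr01)// (dxi v0).2.
  have q0 := om_denominator_gt0 (xi v0).
  have canc a x : 0 < x -> e * w v0 * (a / x) = 0 -> a = 0.
    move=> x0 /eqP; rewrite mulf_eq0 mulf_eq0 (negbTE e0) (negbTE w0) /= mulf_eq0 invr_eq0.
    by rewrite (gt_eqF x0) orbF => /eqP.
  move/(canc _ _ q0)/drift_eq0 => [n en]; rewrite /= en Te.
  have refl u : (2 * mtau (n%:~R * d) - mtau u, mom u) = (mtau (2 * (n%:~R * d) - u), mom (2 * (n%:~R * d) - u)).
    pose x := u - n%:~R * d; have -> : u = n%:~R * d + x by rewrite /x addrC subrK.
    have -> : 2 * (n%:~R * d) - (n%:~R * d + x) = n%:~R * d - x by ring.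
    rewrite om_reflect; congr (_, _).
    by have := tau_reflect H P Q ph n x; rewrite -/d; lra.
  apply/seteqP; split=> [_ [_ [t _ <-] <-]|_ [t _ <-]] /=; first by rewrite refl; eexists.
  exists (mtau (2 * (n%:~R * d) - t), mom (2 * (n%:~R * d) - t)); first by eexists.
  by rewrite /= refl; congr (mtau _, mom _); ring.
- split; last first.
    have [t [ht et _ _]] := nodoid_loop; case=> W hW.
    have tr u : plane_trace J (mom \o xi) (mtau \o xi) (mtau u, mom u) by rewrite Te; exists u.
    have em : mom t = mom 0 by have := hW _ (tr t); have := hW _ (tr 0); rewrite /= et => -> ->.
    have := sin_mom Sh Q0 t; rewrite em (sin_mom Sh Q0) height_at0 => /(congr1 (fun x => x ^+ 2)).
    rewrite (height_sqr Sh) real_normK ?num_real// (height2_ends H P Q t) => /eqP.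
    rewrite addrC -subr_eq subrr eq_sym mulf_eq0 (gt_eqF AB2_gt0) sqrf_eq0 gt_eqF//.
    have Ln : L != 0 by rewrite gt_eqF// lam_gt0.
    have dE : L * d = pi / 2 by rewrite /d; field.
    have pi0 := @pi_gt0 R; apply: sin_gt0_pi; apply/andP; split; first by rewrite mulr_gt0 ?lam_gt0//; lra.
    have : L * t < L * d by rewrite ltr_pM2l ?lam_gt0//; lra.
    lra.
  exists (fun v => sg0 (xi v) + (1 - e) / 2 * pi).
  have [ee|ee] : e = 1 \/ e = -1.
    have : (e == 1) || (e == -1) by rewrite -eqf_sqr expr2 e1 expr1n.
    by case/orP=> /eqP; [left|right].
  all: have cs v : cos (sg0 (xi v) + (1 - e) / 2 * pi) = e * cos (sg0 (xi v)) /\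
     sin (sg0 (xi v) + (1 - e) / 2 * pi) = e * sin (sg0 (xi v)).
  1: by rewrite ee subrr !mul0r addr0 !mul1r.
  2: have -> : (1 - e) / 2 = 1 by [rewrite ee; field]; by rewrite ee mul1r sinDpi cosDpi !mulN1r.
  all: have dsg (v : R) : is_derive v 1 (fun v => sg0 (xi v) + (1 - e) / 2 * pi)
     (e * w v * (turning (mk (xi v)) (model_height2 H P Q (xi v)) / (mh (xi v) * (ma (xi v) ^+ 2 + (mh (xi v) * mk (xi v)) ^+ 2))))
    by [have [i1 _ _] := hsg (xi v); have i2 := chain_rule (f := sg0) erefl i1 (dxi v).1 (mulrC _ _);
        apply: is_derive_eq; rewrite /GRing.scale /=; ring].
  all: split.
  1,3: move=> v _; have [c1 c2] := cs v; have [_ m1 m2] := hsg (xi v).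
  1,2: have r0 := height_gt0 Sh (xi v) Bn; have z0 : 0 < Num.sqrt (mz2 (xi v)) by [rewrite sqrtr_gt0 (modulus2_gt0 Sh Q0)].
  1,2: have n0 := tangent_norm_gt0 (xi v); have w0 : 0 < w v by [apply: (lt_le_trans ltr01); exact: (dxi v).2].
  1,2: have zz : Num.sqrt (mz2 (xi v)) ^+ 2 = mz2 (xi v) by [rewrite sqr_sqrtr// ltW// (modulus2_gt0 Sh Q0)].
  1,2: have wN : w v * Num.sqrt (ma (xi v) ^+ 2 + (mh (xi v) * mk (xi v)) ^+ 2) = mh (xi v) * Num.sqrt (mz2 (xi v)) by
    [apply/eqP; rewrite -(@eqrXn2 _ 2) ?mulr_ge0 ?sqrtr_ge0 ?ltW//; apply/eqP;
     rewrite [LHS]exprMn [RHS]exprMn (height_sqr Sh) zz (sqr_sqrtr (ltW n0)); exact: model_speed].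
  1,2: rewrite c1 c2 [(mom \o xi) v]/= (cos_mom Sh Q0); split.
  1,3: apply: (is_derive_eq (dom v)); rewrite {1}m1.
  1,2: transitivity (e * cos (sg0 (xi v)) * (w v * Num.sqrt (ma (xi v) ^+ 2 + (mh (xi v) * mk (xi v)) ^+ 2)) / (mh (xi v) * Num.sqrt (mz2 (xi v))));
    [by ring|by rewrite wN; field; rewrite !gt_eqF].
  1,2: apply: (is_derive_eq (dta v)); rewrite -{1}zz.
  1,2: transitivity (e * w v * (mh (xi v) * mk (xi v)) / (mh (xi v) * Num.sqrt (mz2 (xi v)) ^+ 2)); first by [field; rewrite !gt_eqF].
  1,2: rewrite {1}m2; transitivity (e * sin (sg0 (xi v)) * (w v * Num.sqrt (ma (xi v) ^+ 2 + (mh (xi v) * mk (xi v)) ^+ 2)) / (mh (xi v) * Num.sqrt (mz2 (xi v)) ^+ 2));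
    [by ring|by rewrite wN; field; rewrite !gt_eqF].
  all: split; first by apply: continuous_subspaceT => v; exact: is_derive_continuous (dsg v).
  all: have iT : is_interval (@setT R) by [].
  all: have pos v : 0 < w v * (turning (mk (xi v)) (model_height2 H P Q (xi v)) / (mh (xi v) * (ma (xi v) ^+ 2 + (mh (xi v) * mk (xi v)) ^+ 2)))
    by [rewrite mulr_gt0 ?divr_gt0 ?turning_pos ?(lt_le_trans ltr01 (dxi v).2)// mulr_gt0 ?tangent_norm_gt0 ?(height_gt0 Sh)].
  1: left. 2: right.
  all: move=> x y _ _ xy; rewrite -subr_gt0; have [u _ eu] := derive_mvt iT (fun u _ => dsg u) I I xy.
  1: by rewrite eu -[e * w u * _]mulrA ee mul1r; apply: mulr_gt0; [exact: pos|rewrite subr_gt0].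
  by rewrite -opprB eu -[e * w u * _]mulrA ee mulN1r mulNr opprK; apply: mulr_gt0; [exact: pos|rewrite subr_gt0].
Qed.

(** At the time t of [nodoid_loop] and at - t the curve is at the same point, by
    symmetry; there the heights move in opposite directions while the angular
    momenta agree, so the tangents are transverse. *)
Lemma model_self_intersecting : self_intersecting J g.
Proof.
have [t [ht et kt at_]] := nodoid_loop.
have [u eu] := onto t; have [v ev] := onto (- t).
have e0 : e != 0 by apply/eqP => z; move: e1; rewrite z mul0r => /esym/eqP; rewrite oner_eq0.
have r0 := height_gt0 Sh t Bn.
have rN : mh (- t) = mh t by have := height_reflect H P Q 0 t; rewrite mulr0z mul0r !add0r.
have mN : mom (- t) = mom t by rewrite /model_om rN.
have tN : mtau (- t) = mtau t by have := tau_reflect H P Q ph 0 t; rewrite mulr0z !mul0r !add0r; lra.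
have aN : ma (- t) = - ma t by rewrite /drift !mulrN sinN cosN; ring.
have kN : mk (- t) = mk t by rewrite /momentum !mulrN sinN cosN sqrrN.
have gg : g u = g v by rewrite !gE eu ev !(model_spherical Sh Q0) mN tN.
have [_ du] := model_velocity u; have [_ dv] := model_velocity v.
have wu : 0 < w u by apply: (lt_le_trans ltr01); exact: (dxi u).2.
have wv : 0 < w v by apply: (lt_le_trans ltr01); exact: (dxi v).2.
have hu : x2 (derive1 g u) = e * w u * (ma t / mh t) by rewrite derive1E du vecE eu.
have hv : x2 (derive1 g v) = - (e * w v * (ma t / mh t)) by rewrite derive1E dv vecE ev aN rN; ring.
have ju : x1 (g u) * y1 (derive1 g u) - y1 (g u) * x1 (derive1 g u) = e * w u * mk t.
  by rewrite derive1E du gE /model !vecE eu -(model_momentum H P Q ph t); ring.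
have jv : x1 (g v) * y1 (derive1 g v) - y1 (g v) * x1 (derive1 g v) = e * w v * mk t.
  by rewrite derive1E dv gE /model !vecE ev -kN -(model_momentum H P Q ph (- t)); ring.
exists u, v; rewrite JT interiorT; split=> //; apply/eqP => eq.
  move: hv; rewrite -eq hu; set X := ma t / mh t => z.
  have : (w u + w v) * (e * X) = 0.
    have -> : (w u + w v) * (e * X) = e * w u * X + e * w v * X by ring.
    by rewrite z addNr.
  move/eqP; rewrite mulf_eq0 (gt_eqF (addr_gt0 wu wv)) mulf_eq0 (negbTE e0) /=.
  by rewrite mulf_eq0 invr_eq0 (negbTE at_) (gt_eqF r0).
have : e * w u * mk t = - (e * w v * mk t) by rewrite -ju -jv -gg eq !coordE; ring.
move=> z; have : (w u + w v) * (e * mk t) = 0.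
  have -> : (w u + w v) * (e * mk t) = e * w u * mk t + e * w v * mk t by ring.
  by rewrite z addNr.
by move/eqP; rewrite mulf_eq0 (gt_eqF (addr_gt0 wu wv)) mulf_eq0 (negbTE e0) (gt_eqF kt).
Qed.

End Nodoid.
End Curve.
End Graphs.

(** * Compactness and rational rotation numbers *)

Section Swept.
Context {R : realType}.

(** The subgroup generated by k and 2 is not cyclic, so it has arbitrarily small
    positive elements; a multiple of such an element is close to 1. *)
Lemma irrational_dense (k : R) : ~ is_rational k -> forall d, 0 < d ->
  exists n m : int, `|n%:~R * k + m%:~R * 2 - 1| < d.
Proof.
move=> irr d d0.
pose G (x : R) := exists n m : int, x = n%:~R * k + m%:~R * 2.
have GB x y : G x -> G y -> G (x - y).
  by move=> [n [m ->]] [n' [m' ->]]; exists (n - n'), (m - m'); rewrite !intrB; ring.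
have GM (a : int) x : G x -> G (a%:~R * x).
  by move=> [n [m ->]]; exists (a * n), (a * m); rewrite !intrM; ring.
pose S : set R := [set x | G x /\ 0 < x].
have G2 : G 2 by exists 0, 1; rewrite mul0r add0r mul1r.
have Gk : G k by exists 1, 0; rewrite mul0r addr0 mul1r.
have hS : has_inf S.
  by split; [exists 2; split|exists 0 => x [_ /ltW]].
have i0 : 0 <= inf S by apply: lb_le_inf; [case: hS|move=> x [_ /ltW]].
have lo x : S x -> inf S <= x by move=> Sx; apply: inf_lbound => //; case: hS.
have near1 g : S g -> g < d -> exists n m : int, `|n%:~R * k + m%:~R * 2 - 1| < d.
  move=> [Gg g0] gd; have [n [m e]] := GM (Num.floor (1 / g)) g Gg.
  exists n, m; rewrite -e; have f1 := floor_le_tmp (1 / g).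
  have := floorD1_gt (1 / g); rewrite intrD ltr_pdivrMr// => f2.
  move: f1; rewrite ler_pdivlMr// => f1.
  by rewrite ler0_norm; lra.
move: i0; rewrite le_eqVlt => /orP[/eqP i0|i0].
  have [g Sg] := inf_adherent d0 hS; rewrite -i0 add0r => gd; exact: near1 Sg gd.
have [x Sx] := inf_adherent i0 hS => x2.
have xE : x = inf S.
  have := lo x Sx; rewrite le_eqVlt => /orP[/eqP //|lt].
  have e0 : 0 < x - inf S by rewrite subr_gt0.
  have [y Sy] := inf_adherent e0 hS; rewrite addrC subrK => yx.
  have : inf S <= x - y by apply: lo; split; [apply: GB; [case: Sx|case: Sy]|rewrite subr_gt0].
  by have := lo y Sy; lra.
have mult z : G z -> exists a : int, z = a%:~R * x.
  move=> Gz; have x0 : 0 < x by case: Sx.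
  exists (Num.floor (z / x)); set a := Num.floor _.
  have f1 : a%:~R <= z / x := floor_le_tmp _.
  have := floorD1_gt (z / x); rewrite intrD -/a ltr_pdivrMr// => f2.
  move: f1; rewrite ler_pdivlMr// => f1.
  have Gr : G (z - a%:~R * x) by apply: GB => //; apply: GM; case: Sx.
  apply/eqP; rewrite -subr_eq0 eq_le subr_ge0 f1 andbT leNgt; apply/negP => r0.
  have : inf S <= z - a%:~R * x by apply: lo; split.
  by rewrite -xE; lra.
have [p hp] := mult _ G2; have [q hq] := mult _ Gk.
exfalso; apply: irr; exists (2 * q%:~R / p%:~R).
have p0 : (p%:~R : R) != 0 by apply/eqP => z; move: hp; rewrite z mul0r => /eqP; rewrite pnatr_eq0.
rewrite !rmorphM fmorphV /= !ratr_int ratr_nat {1}hp hq.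
by field.
Qed.

Definition swept (H P Q ph : R) : set 'rV[R]_4 :=
  [set p | exists t th, p = Defs.rot th (model H P Q ph t)].

Variables (H E P Q ph : R).
Local Notation L := (lam H).
Local Notation A := (coefA H P Q).
Local Notation B := (coefB H P Q).
Hypothesis Sh : shape H E P Q.

Lemma model_phase (m : int) ph' t : model H P Q (ph' + m%:~R * 2 * pi) t = model H P Q ph' t.
Proof.
rewrite /model /model_x /model_y; have -> : ph' + m%:~R * 2 * pi - H * t = ph' - H * t + m%:~R * 2 * pi by ring.
by rewrite cos_periodz sin_periodz.
Qed.

Lemma swept_continuous : continuous (fun u : R * R => Defs.rot u.2 (model H P Q ph u.1)).
Proof.
have [c1 c2] := continuous_mxy H P Q ph; have c3 := @continuous_mh R H P Q.
have f (h : R -> R) (u : R * R) : continuous h -> (fun v : R * R => h v.1) @ u --> h u.1.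
  by move=> ch; apply: (cvg_comp fst h _ (ch u.1)); exact: cvg_fst.
have s (h : R -> R) (u : R * R) : continuous h -> (fun v : R * R => h v.2) @ u --> h u.2.
  by move=> ch; apply: (cvg_comp snd h _ (ch u.2)); exact: cvg_snd.
have cc := @continuous_cos R; have cs := @continuous_sin R.
move=> u; rewrite /Defs.rot /model; under eq_fun do rewrite !vecE.
apply: cvg_vec4; [exact: f|exact: f| |].
- by apply: cvgB; apply: cvgM; [exact: s|exact: f|exact: s|exact: cvg_cst].
- by apply: cvgD; apply: cvgM; [exact: s|exact: f|exact: s|exact: cvg_cst].
Qed.

Lemma rot_period (m : int) (th : R) (p : 'rV[R]_4) : Defs.rot (th + m%:~R * 2 * pi) p = Defs.rot th p.
Proof. by rewrite /Defs.rot cos_periodz sin_periodz. Qed.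

Lemma period_reduce (T x : R) : 0 < T -> exists2 n : int, 0 <= x - n%:~R * T & x - n%:~R * T <= T.
Proof.
move=> T0; exists (Num.floor (x / T)).
  by rewrite subr_ge0 -ler_pdivlMr// floor_le_tmp.
have := floorD1_gt (x / T); rewrite intrD ltr_pdivrMr// => h; lra.
Qed.

(** As a continuous image of a rectangle, the angle being taken modulo 2 pi. *)
Lemma swept_box (a b : R) : a <= b ->
  compact [set p | exists2 t, a <= t <= b & exists th, p = Defs.rot th (model H P Q ph t)].
Proof.
move=> ab; have pi0 := @pi_gt0 R.
have -> : [set p | exists2 t, a <= t <= b & exists th, p = Defs.rot th (model H P Q ph t)] =
    (fun u : R * R => Defs.rot u.2 (model H P Q ph u.1)) @` (`[a, b] `*` `[0, 2 * pi]).
  apply/seteqP; split=> [_ [t ht [th ->]]|_ [[t th] /= [ht _] <-]]; last first.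
    by exists t; [move: ht; rewrite in_itv|exists th].
  have T0 : 0 < 2 * (pi : R) by lra.
  have [n n1 n2] := period_reduce th T0.
  exists (t, th - n%:~R * (2 * pi)); first by split; rewrite /= in_itv /= ?n1.
  by rewrite /= -[X in X = _](rot_period n) -mulrA subrK.
apply: continuous_compact.
  by apply: continuous_subspaceT; exact: swept_continuous.
by apply: compact_setX; exact: segment_compact.
Qed.

(** If H / L is rational, some number of half periods turns the frame by a multiple
    of 2 pi, and the model is periodic. *)
Lemma swept_compact : is_rational (H / L) -> compact (swept H P Q ph).
Proof.
move=> [q hq]; have L0 := lam_gt0 H; have Ln : L != 0 by rewrite gt_eqF.
have dn : ((denq q)%:~R : R) != 0 by rewrite intr_eq0 denq_neq0.
have d0 : 0 < ((denq q)%:~R : R) by rewrite ltr0z denq_gt0.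
have hH : H = L * ((numq q)%:~R / (denq q)%:~R).
  by rewrite -[LHS](divfK Ln) hq mulrC; congr (_ * _); rewrite /ratr.
pose T := (2 * denq q)%:~R * (pi / L).
have T0 : 0 < T by rewrite /T intrM !mulr_gt0 ?invr_gt0 ?pi_gt0//.
have per (n : int) t : model H P Q ph (t + n%:~R * T) = model H P Q ph t.
  have -> : n%:~R * T = (n * (2 * denq q))%:~R * (pi / L) by rewrite /T intrM; ring.
  rewrite model_shift; rewrite -[RHS](model_phase (n * (denq q - numq q))); congr (model _ _ _ (_ + _) _).
  rewrite !intrM intrB.
  have -> : H * (pi / L) = (numq q)%:~R / (denq q)%:~R * pi by rewrite {1}hH; field; rewrite Ln dn.
  by field.
have -> : swept H P Q ph = [set p | exists2 t, 0 <= t <= T & exists th, p = Defs.rot th (model H P Q ph t)].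
  apply/seteqP; split=> [_ [t [th ->]]|_ [t _ [th ->]]]; last by exists t, th.
  have [n n1 n2] := period_reduce t T0.
  by exists (t - n%:~R * T); rewrite ?n1//; exists th; rewrite -(per n (t - n%:~R * T)) subrK.
by apply: swept_box; exact: ltW.
Qed.

(** The points at which |z| is largest; their phases advance by pi (1 - H / L). *)
Lemma model_top (n : int) : model H P Q ph (n%:~R * (pi / L)) =
  vec4 (P * cos (ph + n%:~R * (1 - H / L) * pi)) (P * sin (ph + n%:~R * (1 - H / L) * pi)) `|B| 0.
Proof.
have L0 := lam_gt0 H; have Ln : L != 0 by rewrite gt_eqF.
have := model_shift H P Q n ph 0; rewrite add0r => ->.
rewrite /model /model_x /model_y /model_height /model_height2 !mulr0 cos0 sin0 !subr0 expr0n /= !mulr0 !mul0r subr0 addr0 expr1n add0r !mulr1 sqrtr_sqr.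
have -> : n%:~R * (pi - H * (pi / L)) = n%:~R * (1 - H / L) * pi by field.
by [].
Qed.

(** If H / L is irrational the phases of the points with |z| = P are dense modulo
    2 pi, so the one opposite to the initial phase is a limit of them; it is not
    attained, since that would make 1 - H / L rational. The points with |z| = P
    are only the vertices because |Q| < P. *)
Lemma swept_not_closed : `|Q| < P -> ~ is_rational (H / L) -> ~ closed (swept H P Q ph).
Proof.
move=> QP irr cl; have L0 := lam_gt0 H; have Ln : L != 0 by rewrite gt_eqF.
have P0 := shape_P Sh; have pi0 := @pi_gt0 R.
have irr' : ~ is_rational (1 - H / L).
  move=> [q e]; apply: irr; exists (1 - q); rewrite rmorphB /= rmorph1 -e; ring.
pose F u := vec4 (P * cos u) (P * sin u) `|B| 0.
have cF : continuous F.
  move=> u; apply: cvg_vec4; [| |exact: cvg_cst|exact: cvg_cst];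
  (apply: cvgM; [exact: cvg_cst|(exact: continuous_cos || exact: continuous_sin)]).
have : swept H P Q ph (F (ph + pi)).
  apply: contrapT => no; have oC : nbhs (F (ph + pi)) (~` swept H P Q ph).
    by apply: open_nbhs_nbhs; split => //; exact: closed_openC.
  have /nbhs_ballP [d /= d0 hd] := cF _ _ oC.
  have [n [m hnm]] := irrational_dense irr' (divr_gt0 d0 pi0).
  have : ~ swept H P Q ph (F (ph + (n%:~R * (1 - H / L) + m%:~R * 2) * pi)).
    apply: hd; rewrite /ball /= opprD addrACA subrr add0r -[X in X - _]mul1r -mulrBl normrM.
    by rewrite (gtr0_norm pi0) -ltr_pdivlMr// distrC.
  apply; exists (n%:~R * (pi / L)), 0; rewrite rot_id ?cos0 ?sin0// model_top /F.
  by rewrite mulrDl addrA cos_periodz sin_periodz.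
move=> [t [th e]].
have ex : model_x H P Q ph t = P * cos (ph + pi) by have := congr1 x1 e; rewrite /F /Defs.rot /model !vecE.
have ey : model_y H P Q ph t = P * sin (ph + pi) by have := congr1 y1 e; rewrite /F /Defs.rot /model !vecE.
have s0 : sin (L * t) = 0.
  have := projection_sqr H P Q ph t; rewrite ex ey.
  have -> : (P * cos (ph + pi)) ^+ 2 + (P * sin (ph + pi)) ^+ 2 = P ^+ 2 * (cos (ph + pi) ^+ 2 + sin (ph + pi) ^+ 2) by ring.
  rewrite cos2Dsin2 cos2sin2 mulr1 => h.
  have : (P ^+ 2 - Q ^+ 2) * sin (L * t) ^+ 2 = 0 by lra.
  move/eqP; rewrite mulf_eq0 sqrf_eq0 subr_eq0 => /orP[/eqP z|/eqP //].
  by have := QP; rewrite -(@ltr_pXn2r _ 2) ?nnegrE ?(ltW P0)// real_normK ?num_real// z ltxx.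
have [n en] := sin0_int s0.
have et : t = n%:~R * (pi / L) by rewrite mulrA -en; field.
have [c1 c2] : cos (ph + n%:~R * (1 - H / L) * pi) = cos (ph + pi) /\ sin (ph + n%:~R * (1 - H / L) * pi) = sin (ph + pi).
  have := model_top n; rewrite -et /model ex ey => h.
  by split; apply: (mulfI (lt0r_neq0 P0)); [have := congr1 x1 h|have := congr1 y1 h]; rewrite !vecE => ->.
have [m em] := cos_sin_eq c1 c2.
have e1 : n%:~R * (1 - H / L) = 1 + m%:~R * 2.
  apply: (mulIf (lt0r_neq0 pi0)); rewrite mulrDl mul1r.
  by move: em; rewrite -!addrA => /addrI.
have [n0|nn] := eqVneq n 0.
  have m2 : m%:~R = - 2^-1 :> R by move: e1; rewrite n0 mul0r; lra.
  have : (-1)%:~R < (m%:~R : R) < 0%:~R by rewrite m2; lra.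
  by rewrite !ltr_int; case: (m) => // -[].
apply: irr'; exists ((1 + m%:~R * 2) / n%:~R).
have nn' : (n%:~R : R) != 0 by rewrite intr_eq0.
rewrite rmorphM fmorphV rmorphD rmorphM /= !ratr_int rmorph1 ratr_nat -e1.
by field; rewrite nn' Ln.
Qed.

Lemma swept_compact_rational : `|Q| < P -> compact (swept H P Q ph) <-> is_rational (H / L).
Proof.
move=> QP; split=> [c|]; last exact: swept_compact.
apply: contrapT => irr; apply: (swept_not_closed QP irr).
by apply: compact_closed => //; exact: norm_hausdorff.
Qed.

End Swept.

(** * Embeddedness for zero mean curvature *)

Section Smooth.
Context {R : realType} {V : normedModType R}.
Implicit Types (f g : V -> R).

Lemma C1_on_intro (W : normedModType R) (f : V -> W) (F : V -> V -> W) :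
  (forall u, differentiable f u) -> (forall v u, 'D_v f u = F v u) ->
  (forall v, continuous (F v)) -> C1_on setT f.
Proof.
move=> df dF cF u _; split=> // v.
have -> : (fun u' => 'D_v f u') = F v by apply/funext => y; exact: dF.
exact: cF.
Qed.

(** It is enough to know all directional derivatives by a formula which is C^1. *)
Lemma C2_on_intro (W : normedModType R) (f : V -> W) (F : V -> V -> W) :
  (forall u, differentiable f u) -> (forall v u, 'D_v f u = F v u) ->
  (forall v, C1_on setT (F v)) -> C2_on setT f.
Proof.
move=> df dF CF; split.
  apply: (C1_on_intro df dF) => v u; have [d _] := CF v u I.
  exact: differentiable_continuous.
move=> v; have -> : (fun u' => 'D_v f u') = F v by apply/funext => y; exact: dF.
exact: CF.
Qed.

Lemma C1_on_diff (W : normedModType R) (f : V -> W) : C1_on setT f ->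
  (forall u, differentiable f u) /\ (forall v, continuous ('D_v f)).
Proof. by move=> Cf; split=> [u|v u]; have [h k] := Cf u I; [exact: h|exact: k]. Qed.

Lemma C1_onD f g : C1_on setT f -> C1_on setT g -> C1_on setT (fun u => f u + g u).
Proof.
move=> /C1_on_diff[df cf] /C1_on_diff[dg cg].
apply: (C1_on_intro (F := fun v u => 'D_v f u + 'D_v g u)).
- by move=> u; exact: differentiableD.
- by move=> v u; apply: deriveD; exact: diff_derivable.
- by move=> v u; apply: cvgD; [exact: cf|exact: cg].
Qed.

Lemma derive_mul f g (u v : V) : differentiable f u -> differentiable g u ->
  'D_v (fun u => f u * g u) u = f u * 'D_v g u + g u * 'D_v f u.
Proof. by move=> df dg; have := deriveM (diff_derivable df (v := v)) (diff_derivable dg (v := v)). Qed.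

Lemma C1_onM f g : C1_on setT f -> C1_on setT g -> C1_on setT (fun u => f u * g u).
Proof.
move=> /C1_on_diff[df cf] /C1_on_diff[dg cg].
apply: (C1_on_intro (F := fun v u => f u * 'D_v g u + g u * 'D_v f u)).
- by move=> u; exact: differentiableM.
- by move=> v u; exact: derive_mul.
- move=> v u; apply: cvgD; apply: cvgM.
  + exact: differentiable_continuous (df u).
  + exact: cg.
  + exact: differentiable_continuous (dg u).
  + exact: cf.
Qed.

Lemma C2_onM f g : C2_on setT f -> C2_on setT g -> C2_on setT (fun u => f u * g u).
Proof.
move=> [Cf Cf2] [Cg Cg2]; have [df _] := C1_on_diff Cf; have [dg _] := C1_on_diff Cg.
apply: (C2_on_intro (F := fun v u => f u * 'D_v g u + g u * 'D_v f u)).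
- by move=> u; exact: differentiableM.
- by move=> v u; exact: derive_mul.
- by move=> v; exact: (C1_onD (C1_onM Cf (Cg2 v)) (C1_onM Cg (Cf2 v))).
Qed.

Lemma derive_vec4 (f1 f2 f3 f4 : V -> R) (u v : V) : differentiable f1 u -> differentiable f2 u ->
  differentiable f3 u -> differentiable f4 u ->
  'D_v (fun x => vec4 (f1 x) (f2 x) (f3 x) (f4 x)) u = vec4 ('D_v f1 u) ('D_v f2 u) ('D_v f3 u) ('D_v f4 u).
Proof.
move=> d1 d2 d3 d4.
by have [_ ->] := is_derive_vec4 (derivableP (diff_derivable d1 (v := v))) (derivableP (diff_derivable d2 (v := v)))
  (derivableP (diff_derivable d3 (v := v))) (derivableP (diff_derivable d4 (v := v))).
Qed.

Lemma C1_on_vec4 (f1 f2 f3 f4 : V -> R) : C1_on setT f1 -> C1_on setT f2 -> C1_on setT f3 ->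
  C1_on setT f4 -> C1_on setT (fun x => vec4 (f1 x) (f2 x) (f3 x) (f4 x)).
Proof.
move=> /C1_on_diff[d1 c1] /C1_on_diff[d2 c2] /C1_on_diff[d3 c3] /C1_on_diff[d4 c4].
apply: (C1_on_intro (F := fun v u => vec4 ('D_v f1 u) ('D_v f2 u) ('D_v f3 u) ('D_v f4 u))).
- by move=> u; exact: differentiable_vec4.
- by move=> v u; exact: derive_vec4.
- by move=> v u; apply: cvg_vec4; [exact: c1|exact: c2|exact: c3|exact: c4].
Qed.

Lemma C2_on_vec4 (f1 f2 f3 f4 : V -> R) : C2_on setT f1 -> C2_on setT f2 -> C2_on setT f3 ->
  C2_on setT f4 -> C2_on setT (fun x => vec4 (f1 x) (f2 x) (f3 x) (f4 x)).
Proof.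
move=> [C1 D1] [C2 D2] [C3 D3] [C4 D4].
have [d1 _] := C1_on_diff C1; have [d2 _] := C1_on_diff C2.
have [d3 _] := C1_on_diff C3; have [d4 _] := C1_on_diff C4.
apply: (C2_on_intro (F := fun v u => vec4 ('D_v f1 u) ('D_v f2 u) ('D_v f3 u) ('D_v f4 u))).
- by move=> u; exact: differentiable_vec4.
- by move=> v u; exact: derive_vec4.
- by move=> v; exact: (C1_on_vec4 (D1 v) (D2 v) (D3 v) (D4 v)).
Qed.

End Smooth.

Section SmoothPlane.
Context {R : realType}.

Lemma derive_scale (f : R -> R) (x d a : R) : is_derive x 1 f d -> differentiable f x /\ 'D_a f x = a * d.
Proof.
move=> [df <-]; have dff : differentiable f x by apply/derivable1_diffP.
by split; [exact: dff|rewrite deriveE// diff1E// derive1E].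
Qed.

Lemma C1_real (f f' : R -> R) : (forall t : R, is_derive t 1 f (f' t)) -> continuous f' ->
  C1_on setT f.
Proof.
move=> d1 c1; apply: (@C1_on_intro R R R f (fun v u => v * f' u)).
- by move=> u; have [] := derive_scale 1 (d1 u).
- by move=> v u; have [_] := derive_scale v (d1 u).
- by move=> v u; apply: cvgM; [exact: cvg_cst|exact: c1].
Qed.

Lemma C2_real (f f' f'' : R -> R) : (forall t : R, is_derive t 1 f (f' t)) ->
  (forall t : R, is_derive t 1 f' (f'' t)) -> continuous f'' -> C2_on setT f.
Proof.
move=> d1 d2 c2; apply: (@C2_on_intro R R R f (fun v u => v * f' u)).
- by move=> u; have [] := derive_scale 1 (d1 u).
- by move=> v u; have [_] := derive_scale v (d1 u).
- move=> v; apply: (@C1_real (fun u : R => v * f' u) (fun t => v * f'' t)).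
  by move=> t; apply: cvgM; [exact: cvg_cst|exact: c2].
Qed.

Lemma C2_on_fst (f : R -> R) : C2_on setT f -> C2_on setT (fun u : R * R => f u.1).
Proof.
move=> Cf; have := @C2_on_affine R R R (R * R)%type fst (fst : {linear (R * R)%type -> R}) setT f.
by apply => //; [move=> u; exact: cvg_fst|move=> u; rewrite addr0|exact: openT].
Qed.

Lemma C2_on_snd (f : R -> R) : C2_on setT f -> C2_on setT (fun u : R * R => f u.2).
Proof.
move=> Cf; have := @C2_on_affine R R R (R * R)%type snd (snd : {linear (R * R)%type -> R}) setT f.
by apply => //; [move=> u; exact: cvg_snd|move=> u; rewrite addr0|exact: openT].
Qed.

Lemma derive_fst (f : R -> R) (d : R) (u v : R * R) : is_derive u.1 1 f d ->
  differentiable (fun w : R * R => f w.1) u /\ 'D_v (fun w : R * R => f w.1) u = v.1 * d.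
Proof.
move=> df; have [h1 h2] := derive_scale v.1 df.
have := @affine_comp_derive R R R (R * R)%type fst (fst : {linear (R * R)%type -> R}) f u v.
by rewrite -h2; apply => //; [move=> w; exact: cvg_fst|move=> w; rewrite addr0].
Qed.

Lemma derive_snd (f : R -> R) (d : R) (u v : R * R) : is_derive u.2 1 f d ->
  differentiable (fun w : R * R => f w.2) u /\ 'D_v (fun w : R * R => f w.2) u = v.2 * d.
Proof.
move=> df; have [h1 h2] := derive_scale v.2 df.
have := @affine_comp_derive R R R (R * R)%type snd (snd : {linear (R * R)%type -> R}) f u v.
by rewrite -h2; apply => //; [move=> w; exact: cvg_snd|move=> w; rewrite addr0].
Qed.

Lemma C2_on_trig (a b : R) : C2_on setT (fun t : R => a * cos t + b * sin t).
Proof.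
apply: (@C2_real (fun t : R => a * cos t + b * sin t) (fun t => - (a * sin t) + b * cos t) (fun t => - (a * cos t) - b * sin t)).
- by move=> t; have h := is_derive_cos t; have h' := is_derive_sin t; apply: is_derive_eq; rewrite /GRing.scale /=; ring.
- by move=> t; have h := is_derive_cos t; have h' := is_derive_sin t; apply: is_derive_eq; rewrite /GRing.scale /=; ring.
- move=> t; apply: cvgB; first apply: cvgN; apply: cvgM; [exact: cvg_cst|exact: continuous_cos|exact: cvg_cst|exact: continuous_sin].
Qed.

End SmoothPlane.

Section ContinuousOps.
Context {R : realType} {T : topologicalType}.
Implicit Types (f g : T -> R).

Lemma continuous_lin2 f g (a b : R) : continuous f -> continuous g ->
  continuous (fun p => f p * a + g p * b).
Proof.
by move=> cf cg p; apply: cvgD; apply: cvgM; [exact: cf|exact: cvg_cst|exact: cg|exact: cvg_cst].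
Qed.

Lemma continuous_atan_ratio f g (k : R) (p : T) : continuous f -> continuous g -> g p != 0 ->
  (fun p => k + atan (f p / g p)) @ p --> k + atan (f p / g p).
Proof.
move=> cf cg gp; apply: cvgD; first exact: cvg_cst.
apply: (@cvg_comp _ _ _ (fun p => f p / g p) (@atan R)); last exact: continuous_atan.
by apply: cvgM; [exact: cf|apply: cvgV; [exact: gp|exact: cg]].
Qed.

End ContinuousOps.

Section TorusChart.
Context {R : realType}.
Variables (P Q E ph : R).
Hypothesis Sh : shape 0 E P Q.
Hypothesis Q0 : 0 < Q.
Local Notation hh := (model_height 0 P Q).

Lemma mA_minimal : coefA 0 P Q = P. Proof. by rewrite /coefA lam0; ring. Qed.
Lemma mB_minimal : coefB 0 P Q = Q. Proof. by rewrite /coefB lam0; ring. Qed.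

Lemma model_minimal t : model 0 P Q ph t = vec4 (P * cos ph * cos t - Q * sin ph * sin t)
  (P * sin ph * cos t + Q * cos ph * sin t) (Num.sqrt (P ^+ 2 * sin t ^+ 2 + Q ^+ 2 * cos t ^+ 2)) 0.
Proof.
rewrite /model /model_x /model_y /model_height /model_height2 mA_minimal mB_minimal lam0 !mul1r mul0r subr0.
by congr vec4; ring.
Qed.

Lemma C2_on_height : C2_on setT hh.
Proof.
have Bn : coefB 0 P Q != 0 by rewrite mB_minimal gt_eqF.
have h0 t : 0 < hh t by exact: (height_gt0 Sh).
have d1 (t : R) : is_derive t 1 hh (drift 0 P Q t / hh t) by exact: (is_derive_height Sh).
pose D t := 1 - 2 * model_height2 0 P Q t - 2 * 0 * momentum 0 P Q t.
have d2 (t : R) : is_derive t 1 (drift 0 P Q) (D t) by exact: (drift_derive Sh).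
have cD : continuous D.
  move=> t; have c1 := is_derive_continuous (is_derive_height2 0 P Q t); have c2 := is_derive_continuous (momentum_derive Sh t).
  by apply: cvgB; [apply: cvgB; [exact: cvg_cst|]|]; (apply: cvgM; [exact: cvg_cst|]); [exact: c1|exact: c2].
have ch t : {for t, continuous hh} := is_derive_continuous (d1 t).
have ca t : {for t, continuous (drift 0 P Q)} := is_derive_continuous (d2 t).
apply: (@C2_real R hh (fun t => drift 0 P Q t / hh t)
  (fun t => D t / hh t - drift 0 P Q t * (drift 0 P Q t / hh t / hh t ^+ 2)) d1).
- move=> t; have h1 := d2 t; have h2 := is_derive_inv (d1 t) (lt0r_neq0 (h0 t)).
  by apply: is_derive_eq; rewrite /GRing.scale /=; ring.
- have cV t : {for t, continuous (fun u => (hh u)^-1)}.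
    by apply: cvgV; [rewrite gt_eqF|exact: ch].
  move=> t; apply: cvgB; first by apply: cvgM; [exact: cD|exact: cV].
  apply: cvgM; first exact: ca.
  apply: cvgM; first by apply: cvgM; [exact: ca|exact: cV].
  apply: cvgV; first by rewrite gt_eqF// exprn_gt0.
  exact: cvg_sqr.
Qed.

(** For H = 0 the model is an ellipse in a fixed frame and has period 2 pi; rotating
    it gives a doubly periodic parameterization. *)
Definition chart (u : R * R) : 'rV[R]_4 := Defs.rot u.2 (model 0 P Q ph u.1).

Lemma chartE u : chart u = vec4 (model_x 0 P Q ph u.1) (model_y 0 P Q ph u.1) (cos u.2 * hh u.1) (sin u.2 * hh u.1).
Proof. by rewrite /chart /Defs.rot /model !vecE; congr vec4; ring. Qed.

Lemma C2_on_mxy : C2_on setT (model_x 0 P Q ph) /\ C2_on setT (model_y 0 P Q ph).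
Proof.
split.
  have -> : model_x 0 P Q ph = (fun t => P * cos ph * cos t + - (Q * sin ph) * sin t); last exact: C2_on_trig.
  by apply/funext => t; rewrite /model_x lam0 !mul1r mul0r subr0; ring.
have -> : model_y 0 P Q ph = (fun t => P * sin ph * cos t + Q * cos ph * sin t); last exact: C2_on_trig.
by apply/funext => t; rewrite /model_y lam0 !mul1r mul0r subr0; ring.
Qed.

Lemma C2_on_chart : C2_on setT chart.
Proof.
have [cx cy] := C2_on_mxy.
have -> : chart = (fun u => vec4 (model_x 0 P Q ph u.1) (model_y 0 P Q ph u.1) (cos u.2 * hh u.1) (sin u.2 * hh u.1)).
  by apply/funext => u; exact: chartE.
have ct : C2_on setT (fun t : R => cos t).
  have -> : (fun t : R => cos t) = (fun t => 1 * cos t + 0 * sin t) by apply/funext => t; ring.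
  exact: C2_on_trig.
have st : C2_on setT (fun t : R => sin t).
  have -> : (fun t : R => sin t) = (fun t => 0 * cos t + 1 * sin t) by apply/funext => t; ring.
  exact: C2_on_trig.
exact: (C2_on_vec4 (C2_on_fst cx) (C2_on_fst cy) (C2_onM (C2_on_snd ct) (C2_on_fst C2_on_height))
  (C2_onM (C2_on_snd st) (C2_on_fst C2_on_height))).
Qed.

(** The projection of the profile has speed r > 0 and is not moved by the rotations,
    so the first component vanishes, and then the second. *)
Lemma chart_immersion u v : 'D_v chart u = 0 -> v = 0.
Proof.
have Bn : coefB 0 P Q != 0 by rewrite mB_minimal gt_eqF.
have h0 := height_gt0 Sh u.1 Bn; have [cx cy] := C2_on_mxy.
have dh (t : R) : is_derive t 1 hh (drift 0 P Q t / hh t) by apply: (is_derive_height Sh); exact: (height_gt0 Sh).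
have [dx ex] := derive_fst v (is_derive_model_x 0 P Q ph u.1).
have [dy ey] := derive_fst v (is_derive_model_y 0 P Q ph u.1).
have [dH eH] := derive_fst v (dh u.1).
have [dc ec] := derive_snd v (is_derive_cos u.2).
have [ds es] := derive_snd v (is_derive_sin u.2).
rewrite (_ : chart = (fun u => vec4 (model_x 0 P Q ph u.1) (model_y 0 P Q ph u.1) (cos u.2 * hh u.1) (sin u.2 * hh u.1))); last first.
  by apply/funext => y; exact: chartE.
rewrite derive_vec4 //; [|exact: differentiableM|exact: differentiableM].
rewrite ex ey (derive_mul _ dc dH) (derive_mul _ ds dH) ec es eH mul0r subr0 => e.
have := congr1 x1 e; have := congr1 y1 e; have := congr1 x2 e; have := congr1 y2 e.
rewrite !vecE !coordE {e ex ey eH ec es}.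
set r := hh u.1 in h0 *; set D := drift 0 P Q u.1 / r; set C := cos u.2; set T := sin u.2.
set S1 := coefA 0 P Q * _; set S2 := coefB 0 P Q * _ => e4 e3 e2 e1.
have cs := cos2Dsin2 ph; have cs2 : C ^+ 2 + T ^+ 2 = 1 := cos2Dsin2 u.2.
have r2 : S1 ^+ 2 + S2 ^+ 2 = r ^+ 2 by rewrite /r (height_sqr Sh) /model_height2 /S1 /S2; ring.
have v1 : v.1 = 0.
  apply/eqP; rewrite -sqrf_eq0; apply/eqP; apply: (mulIf (lt0r_neq0 (exprn_gt0 2 h0))); rewrite mul0r -r2.
  transitivity (v.1 ^+ 2 * (S1 ^+ 2 + S2 ^+ 2) * (cos ph ^+ 2 + sin ph ^+ 2)); first by rewrite cs mulr1.
  transitivity ((v.1 * (- (S1 * cos ph) - S2 * sin ph)) ^+ 2 + (v.1 * (- (S1 * sin ph) + S2 * cos ph)) ^+ 2).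
    by ring.
  by rewrite e1 e2; ring.
have v2 : v.2 = 0.
  apply: (mulIf (lt0r_neq0 h0)); rewrite mul0r.
  move: e3 e4; rewrite v1 !mul0r !mulr0 !add0r => e3 e4.
  transitivity (v.2 * r * (C ^+ 2 + T ^+ 2)); first by rewrite cs2 mulr1.
  transitivity (C * (r * (v.2 * C)) - T * (r * (v.2 * - T))); first by ring.
  by rewrite e3 e4; ring.
by case: v v1 v2 {e1 e2 e3 e4 dx dy dH dc ds} => a b /= -> ->.
Qed.

(** On a half-plane the angle is the arc tangent of the ratio of the coordinates. *)
Lemma atan_turn (x : R) : 0 < cos x -> cos (atan (sin x / cos x)) = cos x /\
  sin (atan (sin x / cos x)) = sin x.
Proof.
move=> c0; have cn : cos x != 0 by rewrite gt_eqF.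
have e : 1 + (sin x / cos x) ^+ 2 = (cos x)^-1 ^+ 2.
  transitivity ((cos x ^+ 2 + sin x ^+ 2) / cos x ^+ 2); first by field.
  by rewrite cos2Dsin2 exprVn mul1r.
have hc : cos (atan (sin x / cos x)) = cos x.
  by rewrite cos_atan e sqrtr_sqr ger0_norm ?invrK// invr_ge0 ltW.
split=> //; have := @atanK R (sin x / cos x); rewrite {1}/tan hc => /(congr1 (fun y => y * cos x)).
by rewrite !divfK.
Qed.

Section Around.
Variables (t0 th0 : R).
Let u1 (p : 'rV[R]_4) := (x1 p * cos ph + y1 p * sin ph) / P.
Let u2 (p : 'rV[R]_4) := (y1 p * cos ph - x1 p * sin ph) / Q.
Let C1 p := u1 p * cos t0 + u2 p * sin t0.
Let S1 p := u2 p * cos t0 - u1 p * sin t0.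
Let C2 (p : 'rV[R]_4) := x2 p * cos th0 + y2 p * sin th0.
Let S2 (p : 'rV[R]_4) := y2 p * cos th0 - x2 p * sin th0.

Lemma chart_angles u : [/\ C1 (chart u) = cos (u.1 - t0), S1 (chart u) = sin (u.1 - t0),
  C2 (chart u) = hh u.1 * cos (u.2 - th0) & S2 (chart u) = hh u.1 * sin (u.2 - th0)].
Proof.
have P0 : P != 0 by rewrite gt_eqF// (shape_P Sh). have Qn : Q != 0 by rewrite gt_eqF.
have cs := cos2Dsin2 ph.
have e1 : u1 (chart u) = cos u.1.
  rewrite /u1 chartE !vecE /model_x /model_y lam0 !mul1r mul0r subr0.
  transitivity (cos u.1 * (cos ph ^+ 2 + sin ph ^+ 2)); last by rewrite cs mulr1.
  by field.
have e2 : u2 (chart u) = sin u.1.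
  rewrite /u2 chartE !vecE /model_x /model_y lam0 !mul1r mul0r subr0.
  transitivity (sin u.1 * (cos ph ^+ 2 + sin ph ^+ 2)); last by rewrite cs mulr1.
  by field.
rewrite /C1 /S1 /C2 /S2 e1 e2 chartE !vecE !cosB !sinB; split=> //; ring.
Qed.

Lemma continuous_functionals : [/\ continuous C1, continuous S1, continuous C2 & continuous S2].
Proof.
have lin := @continuous_lin2 R 'rV[R]_4.
have cx1 := @continuous_x1 R; have cy1 := @continuous_y1 R.
have cx2 := @continuous_x2 R; have cy2 := @continuous_y2 R.
have cu1 : continuous u1.
  have -> : u1 = (fun p => x1 p * (cos ph / P) + y1 p * (sin ph / P)) by apply/funext => p; rewrite /u1; ring.
  exact: lin.
have cu2 : continuous u2.
  have -> : u2 = (fun p => y1 p * (cos ph / Q) + x1 p * (- sin ph / Q)) by apply/funext => p; rewrite /u2; ring.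
  exact: lin.
split; [exact: lin| |exact: lin|].
  have -> : S1 = (fun p => u2 p * cos t0 + u1 p * (- sin t0)) by apply/funext => p; rewrite /S1; ring.
  exact: lin.
have -> : S2 = (fun p => y2 p * cos th0 + x2 p * (- sin th0)) by apply/funext => p; rewrite /S2; ring.
exact: lin.
Qed.

Let W : set 'rV[R]_4 := [set p | 0 < C1 p /\ 0 < C2 p].
Let U : set (R * R) := [set u | - (pi / 2) < u.1 - t0 < pi / 2 /\ - (pi / 2) < u.2 - th0 < pi / 2].
Let Y p := (t0 + atan (S1 p / C1 p), th0 + atan (S2 p / C2 p)).

(** The inverse of the parameterization is built from linear functionals: on the
    intersection of two half-spaces they are the cosine and the sine of t - t0, and
    r times those of th - th0. *)
Lemma chart_around : [/\ immersion_on U chart, open W /\ W (chart (t0, th0)),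
  chart @` U = swept 0 P Q ph `&` W, (forall u, U u -> Y (chart u) = u) &
  {within swept 0 P Q ph `&` W, continuous Y}].
Proof.
have Bn : coefB 0 P Q != 0 by rewrite mB_minimal gt_eqF.
have h0 t : 0 < hh t by exact: (height_gt0 Sh).
have [c1 s1 c2 s2] := continuous_functionals; have pi0 := @pi_gt0 R.
have WE u : W (chart u) <-> 0 < cos (u.1 - t0) /\ 0 < cos (u.2 - th0).
  by have [e1 _ e3 _] := chart_angles u; rewrite /W /= e1 e3 pmulr_rgt0.
have oU : open U.
  have -> : U = ((fun u : R * R => u.1 - t0) @^-1` `]- (pi / 2), pi / 2[) `&` ((fun u : R * R => u.2 - th0) @^-1` `]- (pi / 2), pi / 2[).
    by apply/seteqP; split=> u; rewrite /U /= !in_itv.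
  apply: openI; apply: open_comp; [|exact: itv_open| |exact: itv_open] => u _.
  - by apply: cvgB; [exact: cvg_fst|exact: cvg_cst].
  - by apply: cvgB; [exact: cvg_snd|exact: cvg_cst].
split.
- split; [exact: oU| |by move=> u v _; exact: chart_immersion].
  exact: C2_onS (@subsetT _ U) C2_on_chart.
- split; last by apply/WE => /=; rewrite !subrr cos0.
  have -> : W = (C1 @^-1` [set y | 0 < y]) `&` (C2 @^-1` [set y | 0 < y]) by [].
  by apply: openI; apply: open_comp; [move=> p _; exact: c1|exact: open_gt|move=> p _; exact: c2|exact: open_gt].
- apply/seteqP; split=> [_ [u [b1 b2] <-]|p [[t [th ->]]]].
    split; first by exists u.1, u.2.
    by apply/WE; split; exact: cos_gt0_pihalf.
  rewrite -[Defs.rot _ _]/(chart (t, th)) => /WE /= [k1 k2].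
  have [e1 e2] := atan_turn k1; have [e3 e4] := atan_turn k2.
  set a := atan _ in e1 e2; set b := atan _ in e3 e4.
  exists (t0 + a, th0 + b).
    by rewrite /U /= addrAC subrr add0r [th0 + b - th0]addrAC subrr add0r atan_gtNpi2 atan_ltpi2 atan_gtNpi2 atan_ltpi2.
  have et : cos (t0 + a) = cos t /\ sin (t0 + a) = sin t.
    by rewrite cosD sinD e1 e2 -cosD -sinD addrC subrK.
  have eth : cos (th0 + b) = cos th /\ sin (th0 + b) = sin th.
    by rewrite cosD sinD e3 e4 -cosD -sinD addrC subrK.
  by rewrite /chart /= /Defs.rot !model_minimal et.1 et.2 eth.1 eth.2.
- move=> u [b1 b2]; have [e1 e2 e3 e4] := chart_angles u.
  have k1 := cos_gt0_pihalf b1; have k2 := cos_gt0_pihalf b2.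
  rewrite /Y e1 e2 e3 e4 -[_ * _ / _]mulf_div divff ?mul1r ?gt_eqF//.
  rewrite -/(tan (u.1 - t0)) -/(tan (u.2 - th0)) !tanK ?in_itv//.
  by rewrite [t0 + _]addrC [th0 + _]addrC !subrK; case: (u).
- apply: continuous_in_subspaceT => p /[!inE] -[_ [k1 k2]].
  by apply: cvg_pair_at; apply: continuous_atan_ratio => //; rewrite gt_eqF.
Qed.

End Around.

Lemma rot_S3 (th : R) (p : 'rV[R]_4) : S3 p -> S3 (Defs.rot th p).
Proof.
move/S3E => h; apply/S3E; rewrite /Defs.rot !vecE -[RHS]h -[x2 p ^+ 2 in RHS]mul1r -[y2 p ^+ 2 in RHS]mul1r.
by rewrite -(cos2Dsin2 th); ring.
Qed.

Lemma swept_embedded : embedded_surface (swept 0 P Q ph).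
Proof.
split=> [_ [t [th ->]]|_ [t [th ->]]]; first by apply: rot_S3; exact: (model_S3 Sh).
by do 4 eexists; exact: (chart_around t th).
Qed.

End TorusChart.

(** * Surfaces of zero energy *)

Section ZeroEnergyShape.
Context {R : realType}.
Variables (H P Q : R).
Hypothesis Sh : shape H 0 P Q.
Local Notation L := (lam H).

(** If E = 0 then B = 0, and the other constants follow. *)
Lemma shape0 : [/\ P = 1, Q = H / L, coefA H P Q = 1 / L & coefB H P Q = 0].
Proof.
have L0 := lam_gt0 H; have Ln : L != 0 by rewrite gt_eqF.
have B0 : coefB H P Q = 0 by apply/eqP; rewrite -(shape_E0 Sh).
have P1 : P = 1.
  have := shape_PB Sh; rewrite B0 expr0n addr0 => h; have P0 := shape_P Sh.
  by apply/eqP; rewrite -(@eqrXn2 _ 2) ?expr1n ?h// ltW.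
have QE : Q = H / L.
  by have := shape_PQ Sh; rewrite P1 mulr1 add0r => h; apply: (mulIf Ln); rewrite divfK// mulrC.
split=> //; rewrite /coefA P1 QE; have l2 := lam_sqr H.
have -> : 1 / L = (L ^+ 2 - H ^+ 2) / L by rewrite l2 addrK.
by field.
Qed.

Lemma height0 t : 0 <= t <= pi / L -> model_height H P Q t = sin (L * t) / L.
Proof.
have [P1 QE A1 B0] := shape0; have L0 := lam_gt0 H; have Ln : L != 0 by rewrite gt_eqF.
move=> ht; rewrite /model_height /model_height2 B0 A1 expr0n mul0r addr0 -exprMn sqrtr_sqr ger0_norm; first by field.
have s0 : 0 <= sin (L * t).
  apply: sin_ge0_pi; case/andP: ht => h1; rewrite ler_pdivlMr// mulrC => ->.
  by rewrite mulr_ge0// ltW.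
by rewrite mulr_ge0// divr_ge0// ltW.
Qed.

End ZeroEnergyShape.

Section Geodesics.
Context {R : realType}.
Variable (lm : R).
Local Notation L := (lam lm).
Local Notation gsin s := (sin (L * s)).
Local Notation gcos s := (cos (L * s)).

(** The solutions of the geodesic equation with the initial data of [sphere_geodesic]:
    z1 = e^(- i lm s) (cos (L s) + i (lm / L) sin (L s)) and
    z2 = e^(i (th - lm s)) sin (L s) / L. The next two are their derivatives. *)
Definition geo th s : 'rV[R]_4 :=
  vec4 (cos (lm * s) * gcos s + lm / L * (sin (lm * s) * gsin s))
       (- (sin (lm * s) * gcos s) + lm / L * (cos (lm * s) * gsin s))
       (cos (th - lm * s) * gsin s / L) (sin (th - lm * s) * gsin s / L).
Definition geo1 th s : 'rV[R]_4 :=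
  vec4 (- (cos (lm * s) * gsin s / L)) (sin (lm * s) * gsin s / L)
       (cos (th - lm * s) * gcos s + lm / L * (sin (th - lm * s) * gsin s))
       (sin (th - lm * s) * gcos s - lm / L * (cos (th - lm * s) * gsin s)).
Definition geo2 th s : 'rV[R]_4 :=
  vec4 (lm / L * (sin (lm * s) * gsin s) - cos (lm * s) * gcos s)
       (lm / L * (cos (lm * s) * gsin s) + sin (lm * s) * gcos s)
       (2 * lm * (sin (th - lm * s) * gcos s) - (2 * L - 1 / L) * (cos (th - lm * s) * gsin s))
       (- (2 * lm * (cos (th - lm * s) * gcos s)) - (2 * L - 1 / L) * (sin (th - lm * s) * gsin s)).

Lemma geo_derive th (s : R) : is_derive s 1 (geo th : R -> 'rV[R]_4) (geo1 th s).
Proof.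
have Ln : L != 0 by rewrite gt_eqF// lam_gt0. have l2 := lam_sqr lm.
have h1 := is_derive_cosM L s; have h2 := is_derive_sinM L s.
have h3 := is_derive_cosM lm s; have h4 := is_derive_sinM lm s.
have h5 := is_derive_cosB th lm s; have h6 := is_derive_sinB th lm s.
have key : L - lm ^+ 2 / L = 1 / L.
  by have -> : 1 / L = (L ^+ 2 - lm ^+ 2) / L by [rewrite l2 addrK]; field.
apply: is_derive_vec4; apply: is_derive_eq; rewrite /GRing.scale /=.
- transitivity (- (cos (lm * s) * gsin s * (L - lm ^+ 2 / L))); first by field.
  by rewrite key; ring.
- transitivity (sin (lm * s) * gsin s * (L - lm ^+ 2 / L)); first by field.
  by rewrite key; ring.
- by field.
- by field.
Qed.

Lemma geo1_derive th (s : R) : is_derive s 1 (geo1 th : R -> 'rV[R]_4) (geo2 th s).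
Proof.
have Ln : L != 0 by rewrite gt_eqF// lam_gt0. have l2 := lam_sqr lm.
have h1 := is_derive_cosM L s; have h2 := is_derive_sinM L s.
have h3 := is_derive_cosM lm s; have h4 := is_derive_sinM lm s.
have h5 := is_derive_cosB th lm s; have h6 := is_derive_sinB th lm s.
have key : L + lm ^+ 2 / L = 2 * L - 1 / L.
  by have -> : lm ^+ 2 = L ^+ 2 - 1 by [rewrite l2; ring]; field.
apply: is_derive_vec4; apply: is_derive_eq; rewrite /GRing.scale /=.
- by field.
- by field.
- by rewrite -key; field.
- by rewrite -key; field.
Qed.

Lemma geo_ode th s : geo2 th s = - geo th s - (2 * lm) *: qmul qi (geo1 th s).
Proof.
have Ln : L != 0 by rewrite gt_eqF// lam_gt0. have l2 := lam_sqr lm.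
have key : lm ^+ 2 = L ^+ 2 - 1 by rewrite l2; ring.
apply: vec4P; rewrite /geo2 /geo /geo1 /qmul /qi !coordE ?vecE.
- by field.
- by field.
- transitivity (2 * lm * (sin (th - lm * s) * gcos s) - (1 / L + 2 * lm ^+ 2 / L) * (cos (th - lm * s) * gsin s)); last by field.
  by rewrite key; field.
- transitivity (- (2 * lm * (cos (th - lm * s) * gcos s)) - (1 / L + 2 * lm ^+ 2 / L) * (sin (th - lm * s) * gsin s)); last by field.
  by rewrite key; field.
Qed.

Lemma geo_sphere th s : dot (geo th s) (geo th s) = 1.
Proof.
have Ln : L != 0 by rewrite gt_eqF// lam_gt0. have l2 := lam_sqr lm.
rewrite dot4 /geo !vecE.
have k1 := cos2Dsin2 (lm * s); have k2 := cos2Dsin2 (th - lm * s); have k3 := cos2Dsin2 (L * s).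
transitivity ((gcos s ^+ 2 + (lm / L) ^+ 2 * gsin s ^+ 2) * (cos (lm * s) ^+ 2 + sin (lm * s) ^+ 2)
  + gsin s ^+ 2 / L ^+ 2 * (cos (th - lm * s) ^+ 2 + sin (th - lm * s) ^+ 2)); first by field.
rewrite k1 k2 !mulr1.
transitivity (gcos s ^+ 2 + gsin s ^+ 2 * ((1 + lm ^+ 2) / L ^+ 2)); first by field.
by rewrite -l2 divff ?mulr1// sqrf_eq0.
Qed.

Lemma geo_speed th s : dot (geo1 th s) (geo1 th s) = 1.
Proof.
have Ln : L != 0 by rewrite gt_eqF// lam_gt0. have l2 := lam_sqr lm.
rewrite dot4 /geo1 !vecE.
have k1 := cos2Dsin2 (lm * s); have k2 := cos2Dsin2 (th - lm * s); have k3 := cos2Dsin2 (L * s).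
transitivity ((gcos s ^+ 2 + (lm / L) ^+ 2 * gsin s ^+ 2) * (cos (th - lm * s) ^+ 2 + sin (th - lm * s) ^+ 2)
  + gsin s ^+ 2 / L ^+ 2 * (cos (lm * s) ^+ 2 + sin (lm * s) ^+ 2)); first by field.
rewrite k1 k2 !mulr1.
transitivity (gcos s ^+ 2 + gsin s ^+ 2 * ((1 + lm ^+ 2) / L ^+ 2)); first by field.
by rewrite -l2 divff ?mulr1// sqrf_eq0.
Qed.

(** The vectors p, V(p), E1(p), E2(p) are an orthonormal basis. *)
Lemma horizontalP (p v : 'rV[R]_4) : dot p p = 1 -> dot v p = 0 -> dot v (fV p) = 0 -> horizontal p v.
Proof.
move=> pp vp vV; exists (dot v (fE1 p)), (dot v (fE2 p)).
have d0 : v = dot p p *: v by rewrite pp scale1r.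
rewrite {1}d0; move: pp vp vV; rewrite !dot4 /fV /fE1 /fE2 /qmul /qi /qj /qk !vecE => pp vp vV.
set a := x1 p in pp vp vV *; set b := y1 p in pp vp vV *; set c := x2 p in pp vp vV *; set d := y2 p in pp vp vV *.
set v1 := x1 v in vp vV *; set v2 := y1 v in vp vV *; set v3 := x2 v in vp vV *; set v4 := y2 v in vp vV *.
have z1 : v1 * a + v2 * b + v3 * c + v4 * d = 0 by rewrite -[RHS]vp; ring.
have z2 : - v1 * b + v2 * a - v3 * d + v4 * c = 0 by rewrite -[RHS]vV; ring.
apply: vec4P; rewrite !coordE -/a -/b -/c -/d -/v1 -/v2 -/v3 -/v4.
- apply/eqP; rewrite -subr_eq0; apply/eqP.
  transitivity (a * (v1 * a + v2 * b + v3 * c + v4 * d) - b * (- v1 * b + v2 * a - v3 * d + v4 * c)); first by ring.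
  by rewrite z1 z2; ring.
- apply/eqP; rewrite -subr_eq0; apply/eqP.
  transitivity (b * (v1 * a + v2 * b + v3 * c + v4 * d) + a * (- v1 * b + v2 * a - v3 * d + v4 * c)); first by ring.
  by rewrite z1 z2; ring.
- apply/eqP; rewrite -subr_eq0; apply/eqP.
  transitivity (c * (v1 * a + v2 * b + v3 * c + v4 * d) - d * (- v1 * b + v2 * a - v3 * d + v4 * c)); first by ring.
  by rewrite z1 z2; ring.
- apply/eqP; rewrite -subr_eq0; apply/eqP.
  transitivity (d * (v1 * a + v2 * b + v3 * c + v4 * d) + c * (- v1 * b + v2 * a - v3 * d + v4 * c)); first by ring.
  by rewrite z1 z2; ring.
Qed.

Lemma geo_tangent th s : dot (geo1 th s) (geo th s) = 0 /\ dot (geo1 th s) (fV (geo th s)) = 0.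
Proof.
have Ln : L != 0 by rewrite gt_eqF// lam_gt0.
have k1 := cos2Dsin2 (lm * s); have k2 := cos2Dsin2 (th - lm * s).
split.
  rewrite dot4 /geo1 /geo !vecE.
  transitivity (gcos s * gsin s / L * ((cos (th - lm * s) ^+ 2 + sin (th - lm * s) ^+ 2) - (cos (lm * s) ^+ 2 + sin (lm * s) ^+ 2))).
    by field.
  by rewrite k1 k2 subrr mulr0.
rewrite dot4 /geo1 /geo /fV /qmul /qi !vecE.
transitivity (lm / L * gsin s ^+ 2 / L * ((cos (lm * s) ^+ 2 + sin (lm * s) ^+ 2) - (cos (th - lm * s) ^+ 2 + sin (th - lm * s) ^+ 2))).
  by field.
by rewrite k1 k2 subrr mulr0.
Qed.

Lemma C1_curve (f f' : R -> 'rV[R]_4) : (forall s : R, is_derive s 1 f (f' s)) -> continuous f' -> C1_on setT f.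
Proof.
move=> df cf; have d u : differentiable f u by have [h _] := df u; apply/derivable1_diffP.
apply: (@C1_on_intro R R _ f (fun v u => v *: f' u)) => //.
  move=> v u; have [_ <-] := df u; rewrite !deriveE//.
  by rewrite -{1}[v]mulr1 -[v * 1]/(v *: (1 : R)) linearZ.
by move=> v u; apply: cvgZr; exact: cf.
Qed.

Lemma geo2_continuous th : continuous (geo2 th).
Proof.
have cg : continuous (geo th : R -> 'rV[R]_4).
  move=> s; have [h _] := geo_derive th s; apply: differentiable_continuous; exact/derivable1_diffP.
have cg1 : continuous (geo1 th : R -> 'rV[R]_4).
  move=> s; have [h _] := geo1_derive th s; apply: differentiable_continuous; exact/derivable1_diffP.
have -> : geo2 th = (fun s => - geo th s - (2 * lm) *: qmul qi (geo1 th s)) by apply/funext => s; exact: geo_ode.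
move=> s; apply: cvgB; first by apply: cvgN; exact: cg.
apply: cvgZr; rewrite /qmul.
have cx1 : (fun u => x1 (geo1 th u)) @ s --> x1 (geo1 th s) by apply: (cvg_comp (geo1 th) x1 (cg1 s)); exact: continuous_x1.
have cy1 : (fun u => y1 (geo1 th u)) @ s --> y1 (geo1 th s) by apply: (cvg_comp (geo1 th) y1 (cg1 s)); exact: continuous_y1.
have cx2 : (fun u => x2 (geo1 th u)) @ s --> x2 (geo1 th s) by apply: (cvg_comp (geo1 th) x2 (cg1 s)); exact: continuous_x2.
have cy2 : (fun u => y2 (geo1 th u)) @ s --> y2 (geo1 th s) by apply: (cvg_comp (geo1 th) y2 (cg1 s)); exact: continuous_y2.
have cc (k : R) : (fun _ : R => k) @ s --> k by exact: cvg_cst.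
apply: cvg_vec4.
- exact: cvgB (cvgB (cvgB (cvgM (cc _) cx1) (cvgM (cc _) cy1)) (cvgM (cc _) cx2)) (cvgM (cc _) cy2).
- exact: cvgB (cvgD (cvgD (cvgM (cc _) cy1) (cvgM (cc _) cx1)) (cvgM (cc _) cy2)) (cvgM (cc _) cx2).
- exact: cvgD (cvgD (cvgB (cvgM (cc _) cx2) (cvgM (cc _) cy2)) (cvgM (cc _) cx1)) (cvgM (cc _) cy1).
- exact: cvgD (cvgB (cvgD (cvgM (cc _) cy2) (cvgM (cc _) cx2)) (cvgM (cc _) cy1)) (cvgM (cc _) cx1).
Qed.

Lemma geo_derive1 th : derive1 (geo th) = geo1 th.
Proof. by apply/funext => s; rewrite derive1E; have [_ ->] := geo_derive th s. Qed.

Lemma geo1_derive1 th : derive1 (geo1 th) = geo2 th.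
Proof. by apply/funext => s; rewrite derive1E; have [_ ->] := geo1_derive th s. Qed.

(** The left multiplication by i is skew-symmetric. *)
Lemma ode_acceleration (p v : 'rV[R]_4) : dot p p = 1 -> dot v (fV p) = 0 ->
  dot (- p - (2 * lm) *: qmul qi v) p = -1.
Proof.
move=> pp vV; transitivity (- dot p p + 2 * lm * dot v (fV p)); last by rewrite pp vV mulr0 addr0.
by rewrite !dot4 /fV /qmul /qi !coordE; ring.
Qed.

Lemma geo_acceleration th s : dot (geo2 th s) (geo th s) = -1.
Proof.
by rewrite geo_ode; apply: ode_acceleration; [exact: geo_sphere|have [] := geo_tangent th s].
Qed.

Lemma geo_geodesic th : sphere_geodesic lm th (geo th).
Proof.
have d1 u : differentiable (geo th) u by have [h _] := geo_derive th u; apply/derivable1_diffP.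
split.
- apply: (@C2_on_intro R R _ (geo th) (fun v u => v *: geo1 th u)) => //.
    move=> v u; have [_ <-] := geo_derive th u; rewrite !deriveE//.
    by rewrite -{1}[v]mulr1 -[v * 1]/(v *: (1 : R)) linearZ.
  move=> v; apply: (@C1_curve (fun u => v *: geo1 th u) (fun u => v *: geo2 th u)).
    by move=> s; have h := geo1_derive th s; apply: is_deriveZ.
  by move=> u; apply: cvgZr; exact: geo2_continuous.
- by move=> s; exact: geo_sphere.
- move=> s; rewrite geo_derive1; have [k1 k2] := geo_tangent th s.
  by apply: horizontalP => //; exact: geo_sphere.
- by move=> s; rewrite geo_derive1; apply/enorm1; exact: geo_speed.
- move=> s; rewrite /covariant_acceleration geo_derive1 geo1_derive1 geo_acceleration geo_ode.
  by rewrite scaleN1r opprK; apply: vec4P; rewrite !coordE; ring.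
- rewrite /geo /pole !mulr0 sin0 cos0; apply: vec4P; rewrite !vecE; ring.
- rewrite geo_derive1 /geo1 /pole /fE1 /fE2 /qmul /qj /qk !mulr0 sin0 cos0 subr0.
  by apply: vec4P; rewrite !coordE ?vecE; ring.
Qed.

Section Uniqueness.
Variables (th : R) (g : R -> 'rV[R]_4).
Hypothesis G : sphere_geodesic lm th g.

Lemma geodesic_derive (s : R) : is_derive s 1 g (derive1 g s) /\ is_derive s 1 (derive1 g) (derive1 (derive1 g) s).
Proof.
have [[C1 _] C2] := (geo_C2 G, geo_C2 G); move: C2 => [_ C2].
have [d1 _] := C1 s I; have [d2 _] := C2 1 s I.
split; first by rewrite derive1E; apply: derivableP; exact: diff_derivable.
have -> : derive1 g = (fun u => 'D_1 g u) by apply/funext => u; rewrite derive1E.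
by rewrite derive1E; apply: derivableP; exact: diff_derivable.
Qed.

(** On a unit-speed curve in the sphere the component of the acceleration along the
    position is -1, so the covariant equation is the linear one satisfied by [geo]. *)
Lemma geodesic_ode s : derive1 (derive1 g) s = - g s - (2 * lm) *: qmul qi (derive1 g s).
Proof.
have comp (u : R) : [/\ is_derive u 1 (fun v => x1 (g v)) (x1 (derive1 g u)),
    is_derive u 1 (fun v => y1 (g v)) (y1 (derive1 g u)),
    is_derive u 1 (fun v => x2 (g v)) (x2 (derive1 g u)) &
    is_derive u 1 (fun v => y2 (g v)) (y2 (derive1 g u))].
  by apply: is_derive_components; have [] := geodesic_derive u.
have comp1 (u : R) : [/\ is_derive u 1 (fun v => x1 (derive1 g v)) (x1 (derive1 (derive1 g) u)),
    is_derive u 1 (fun v => y1 (derive1 g v)) (y1 (derive1 (derive1 g) u)),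
    is_derive u 1 (fun v => x2 (derive1 g v)) (x2 (derive1 (derive1 g) u)) &
    is_derive u 1 (fun v => y2 (derive1 g v)) (y2 (derive1 (derive1 g) u))].
  by apply: is_derive_components; have [] := geodesic_derive u.
have orth u : dot (derive1 g u) (g u) = 0.
  have [h1 h2 h3 h4] := comp u.
  have d : is_derive u 1 (fun v : R => x1 (g v) ^+ 2 + y1 (g v) ^+ 2 + x2 (g v) ^+ 2 + y2 (g v) ^+ 2) (2 * dot (derive1 g u) (g u)).
    by apply: is_derive_eq; rewrite /GRing.scale /= dot4; ring.
  have : 2 * dot (derive1 g u) (g u) = 0.
    by apply: (near_const_derive (k := 1) d); near=> v; apply/S3E; exact: (geo_S3 G).
  by lra.
have acc u : dot (derive1 (derive1 g) u) (g u) = -1.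
  have [h1 h2 h3 h4] := comp u; have [k1 k2 k3 k4] := comp1 u.
  have d : is_derive u 1 (fun v => dot (derive1 g v) (g v)) (dot (derive1 (derive1 g) u) (g u) + dot (derive1 g u) (derive1 g u)).
    under eq_fun do rewrite dot4; apply: is_derive_eq; rewrite /GRing.scale /= !dot4.
    by move: (derive1 (derive1 g) u) (derive1 g u) (g u) => p q r; ring.
  have : dot (derive1 (derive1 g) u) (g u) + dot (derive1 g u) (derive1 g u) = 0.
    by apply: (near_const_derive (k := 0) d); near=> v; exact: orth.
  by have /enorm1 -> := geo_arclength G u; lra.
have := geo_eq G s; rewrite /covariant_acceleration acc scaleN1r opprK => e.
apply/eqP; rewrite -subr_eq0; apply/eqP; rewrite -[RHS]e.
by rewrite opprD !opprK addrA.
Unshelve. all: by end_near. Qed.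

(** The difference d of two solutions satisfies d'' = - d - 2 lm i d'; as i d' is
    orthogonal to d', the energy |d|^2 + |d'|^2 is constant, hence zero. *)
Lemma geodesic_unique s : g s = geo th s.
Proof.
pose a (i : 'rV[R]_4 -> R) v := i (g v) - i (geo th v).
pose b (i : 'rV[R]_4 -> R) v := i (derive1 g v) - i (geo1 th v).
pose En v := a x1 v ^+ 2 + a y1 v ^+ 2 + a x2 v ^+ 2 + a y2 v ^+ 2 +
   (b x1 v ^+ 2 + b y1 v ^+ 2 + b x2 v ^+ 2 + b y2 v ^+ 2).
have dEn (u : R) : setT u -> is_derive u 1 En 0.
  move=> _; have [g1 g2] := geodesic_derive u.
  have [p1 p2 p3 p4] := is_derive_components g1; have [q1 q2 q3 q4] := is_derive_components g2.
  have [r1 r2 r3 r4] := is_derive_components (geo_derive th u).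
  have [s1 s2 s3 s4] := is_derive_components (geo1_derive th u).
  rewrite /En /a /b; apply: is_derive_eq; rewrite /GRing.scale /=.
  rewrite geodesic_ode geo_ode; move: (g u) (derive1 g u) (geo th u) (geo1 th u) => p q p' q'.
  by rewrite /qmul /qi !coordE; ring.
have E0 : En 0 = 0.
  have e1 := geo_velocity (geo_geodesic th); rewrite geo_derive1 in e1.
  rewrite /En /a /b (geo_start G) (geo_velocity G) e1 (geo_start (geo_geodesic th)) !subrr; ring.
have iT : is_interval (@setT R) by [].
have := derive0_const iT dEn (s := s) (t := 0) I I; rewrite E0 /En => e.
have n1 := sqr_ge0 (a x1 s); have n2 := sqr_ge0 (a y1 s); have n3 := sqr_ge0 (a x2 s); have n4 := sqr_ge0 (a y2 s).
have m1 := sqr_ge0 (b x1 s); have m2 := sqr_ge0 (b y1 s); have m3 := sqr_ge0 (b x2 s); have m4 := sqr_ge0 (b y2 s).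
have z (x : R) : x ^+ 2 = 0 -> x = 0 by move/eqP; rewrite sqrf_eq0 => /eqP.
apply: vec4P; apply/eqP; rewrite -subr_eq0; apply/eqP; apply: z; rewrite -/(a _ s).
- rewrite -[LHS]/(a x1 s ^+ 2); lra.
- rewrite -[LHS]/(a y1 s ^+ 2); lra.
- rewrite -[LHS]/(a x2 s ^+ 2); lra.
- rewrite -[LHS]/(a y2 s ^+ 2); lra.
Qed.

End Uniqueness.

Lemma sphere_SE : sphere_S lm = [set geo u.1 u.2 | u in `[0, 2 * pi] `*` `[0, pi / L]].
Proof.
apply/seteqP; split=> [q [th [s [g [h1 h2 h3 ->]]]]|_ [[th s] [/= h1 h2] <-]].
  by exists (th, s); [split; rewrite /= in_itv|rewrite /= -(geodesic_unique h3)].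
by exists th, s, (geo th); split; [move: h1; rewrite in_itv|move: h2; rewrite in_itv|exact: geo_geodesic|].
Qed.

End Geodesics.

Section Congruence.
Context {R : realType}.
Variable (a : R).

(** This multiplies z1 by e^(- i a); it commutes with the left multiplication
    by i, hence preserves the horizontal distribution. *)
Definition turn (p : 'rV[R]_4) : 'rV[R]_4 :=
  vec4 (x1 p * cos a + y1 p * sin a) (y1 p * cos a - x1 p * sin a) (x2 p) (y2 p).

Fact turn_is_linear : linear turn.
Proof. by move=> k u v; apply: vec4P; rewrite /turn !coordE; ring. Qed.
HB.instance Definition _ := GRing.isLinear.Build R 'rV[R]_4 'rV[R]_4 _ turn turn_is_linear.

Lemma turn_continuous : continuous turn.
Proof.
have cx1 := @continuous_x1 R; have cy1 := @continuous_y1 R.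
have h1 := @continuous_lin2 R _ _ _ (cos a) (sin a) cx1 cy1.
have h2 := @continuous_lin2 R _ _ _ (cos a) (- sin a) cy1 cx1.
have -> : turn = (fun p => vec4 (x1 p * cos a + y1 p * sin a) (y1 p * cos a + x1 p * - sin a) (x2 p) (y2 p)).
  by apply/funext => p; rewrite /turn mulrN.
by move=> p; exact: (cvg_vec4 (h1 p) (h2 p) (@continuous_x2 R p) (@continuous_y2 R p)).
Qed.

Lemma turn_diff p : differentiable turn p /\ 'd turn p = turn :> (_ -> _).
Proof.
split; first by apply: linear_differentiable; exact: turn_continuous.
by apply: diff_lin; exact: turn_continuous.
Qed.

Lemma turn_dot (p q : 'rV[R]_4) : dot (turn p) (turn q) = dot p q.
Proof.
have cs := cos2Dsin2 a; rewrite !dot4 /turn !vecE.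
transitivity ((x1 p * x1 q + y1 p * y1 q) * (cos a ^+ 2 + sin a ^+ 2) + x2 p * x2 q + y2 p * y2 q); first by ring.
by rewrite cs mulr1.
Qed.

Lemma turn_V p : turn (fV p) = fV (turn p).
Proof. by apply: vec4P; rewrite /turn /fV /qmul /qi !coordE; ring. Qed.

Lemma horizontal_orth (p v : 'rV[R]_4) : horizontal p v -> dot v p = 0 /\ dot v (fV p) = 0.
Proof.
by move=> [k [l ->]]; rewrite !dot4 /fV /fE1 /fE2 /qmul /qi /qj /qk !coordE; split; ring.
Qed.

Lemma turn_isometry : S3_isometry turn.
Proof.
have cs := cos2Dsin2 a.
split.
- split.
  + by move=> p hp; rewrite /S3 /usphere /= turn_dot.
  + move=> p q _ _ e; have := congr1 x1 e; have := congr1 y1 e; have := congr1 x2 e; have := congr1 y2 e.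
    rewrite /turn !vecE => h4 h3 h2 h1; apply: vec4P => //.
      transitivity ((x1 p * cos a + y1 p * sin a) * cos a - (y1 p * cos a - x1 p * sin a) * sin a).
        by transitivity (x1 p * (cos a ^+ 2 + sin a ^+ 2)); [rewrite cs mulr1|ring].
      rewrite h1 h2; transitivity (x1 q * (cos a ^+ 2 + sin a ^+ 2)); [ring|by rewrite cs mulr1].
    transitivity ((x1 p * cos a + y1 p * sin a) * sin a + (y1 p * cos a - x1 p * sin a) * cos a).
      by transitivity (y1 p * (cos a ^+ 2 + sin a ^+ 2)); [rewrite cs mulr1|ring].
    rewrite h1 h2; transitivity (y1 q * (cos a ^+ 2 + sin a ^+ 2)); [ring|by rewrite cs mulr1].
  + move=> p hp; pose q := vec4 (x1 p * cos a - y1 p * sin a) (y1 p * cos a + x1 p * sin a) (x2 p) (y2 p).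
    have tq : turn q = p.
      apply: vec4P; rewrite /turn /q !vecE //.
        by transitivity (x1 p * (cos a ^+ 2 + sin a ^+ 2)); [ring|rewrite cs mulr1].
      by transitivity (y1 p * (cos a ^+ 2 + sin a ^+ 2)); [ring|rewrite cs mulr1].
    by exists q => //; rewrite /S3 /usphere /= -turn_dot tq.
- by move=> p _; have [] := turn_diff p.
- by move=> p v w _ _ _; have [_ ->] := turn_diff p; exact: turn_dot.
Qed.

Lemma turn_horizontal p v : S3 p -> horizontal p v -> horizontal (turn p) ('d turn p v).
Proof.
move=> hp /horizontal_orth [h1 h2]; have [_ ->] := turn_diff p.
by apply: horizontalP; rewrite -?turn_V turn_dot.
Qed.

End Congruence.

Section ContinuousRows.
Context {R : realType} {T : topologicalType}.

Lemma continuous_row n (f : T -> 'rV[R]_n) : (forall i, continuous (fun x => f x 0 i)) -> continuous f.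
Proof.
move=> h p; rewrite (funext (fun x => row_sum_delta (f x))).
apply: cvg_big => [|i _]; first exact: add_continuous.
by apply: cvgZr_tmp; exact: h.
Qed.

Lemma continuous_vec4 (f1 f2 f3 f4 : T -> R) : continuous f1 -> continuous f2 -> continuous f3 ->
  continuous f4 -> continuous (fun x => vec4 (f1 x) (f2 x) (f3 x) (f4 x)).
Proof. by move=> h1 h2 h3 h4 p; apply: cvg_vec4; [exact: h1|exact: h2|exact: h3|exact: h4]. Qed.

End ContinuousRows.

Section ZeroEnergySurface.
Context {R : realType}.

(** The surface swept by one half period, between two zeros of the height. *)
Definition half_swept (H P Q ph : R) : set 'rV[R]_4 :=
  [set p | exists2 t, 0 <= t <= pi / lam H & exists th, p = Defs.rot th (model H P Q ph t)].

Lemma geo_period (lm th s : R) (m : int) : geo lm (th + m%:~R * 2 * pi) s = geo lm th s.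
Proof.
rewrite /geo; have -> : th + m%:~R * 2 * pi - lm * s = th - lm * s + m%:~R * 2 * pi by ring.
by rewrite cos_periodz sin_periodz.
Qed.

(** Undoing the phase ph puts the starting point of the model at the pole; the
    rotation angle th then becomes the initial direction, up to the turning H t of
    the frame. *)
Lemma turn_model (H P Q ph t th : R) : shape H 0 P Q -> 0 <= t <= pi / lam H ->
  turn ph (Defs.rot th (model H P Q ph t)) = geo H (th + H * t) t.
Proof.
move=> Sh ht; have [P1 QE _ _] := shape0 Sh; have cs := cos2Dsin2 ph.
rewrite /turn /geo /Defs.rot /model !vecE (height0 Sh ht) addrK /model_x /model_y P1 QE !mul1r cosB sinB.
set c := cos (lam H * t); set s := sin (lam H * t); set u := cos (H * t); set v := sin (H * t).
set k := H / lam H.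
congr vec4.
- transitivity ((u * c + k * (v * s)) * (cos ph ^+ 2 + sin ph ^+ 2)); [ring|by rewrite cs mulr1].
- transitivity ((- (v * c) + k * (u * s)) * (cos ph ^+ 2 + sin ph ^+ 2)); [ring|by rewrite cs mulr1].
- by ring.
- by ring.
Qed.

Lemma half_swept_congruent (H P Q ph : R) : shape H 0 P Q -> congruent (half_swept H P Q ph) (sphere_S H).
Proof.
move=> Sh; have pi0 := @pi_gt0 R; exists (turn ph); split.
- exact: turn_isometry.
- exact: turn_horizontal.
rewrite sphere_SE; apply/seteqP; split=> [_ [_ [t ht [th ->]] <-]|_ [[th t] [/= h1 h2] <-]].
  have T0 : 0 < 2 * (pi : R) by lra.
  have [n n1 n2] := period_reduce (th + H * t) T0.
  exists (th + H * t - n%:~R * (2 * pi), t); first by split; rewrite /= in_itv /= ?n1.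
  by rewrite (turn_model _ _ Sh ht) /= -[LHS](geo_period H _ t n) -mulrA subrK.
exists (Defs.rot (th - H * t) (model H P Q ph t)); last first.
  by rewrite (turn_model _ _ Sh) ?subrK//; move: h2; rewrite in_itv.
by exists t; [move: h2; rewrite in_itv|exists (th - H * t)].
Qed.

Lemma half_swept_compact (H P Q ph : R) : compact (half_swept H P Q ph).
Proof. by apply: swept_box; rewrite divr_ge0 ?pi_ge0// ltW// lam_gt0. Qed.

Section Minimal.
Variables (P Q ph : R).
Hypothesis Sh : shape 0 0 P Q.

(** For H = E = 0 the frame does not rotate and the ellipse degenerates to a diameter. *)
Lemma half_great_circle t : 0 <= t <= pi -> model 0 P Q ph t = vec4 (cos t * cos ph) (cos t * sin ph) (sin t) 0.
Proof.
move=> ht; have [P1 QE _ _] := shape0 Sh; rewrite mul0r in QE.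
rewrite /model (height0 Sh) ?lam0 ?divr1// /model_x /model_y P1 QE lam0 !mul1r !mul0r subr0 subr0 addr0.
by [].
Qed.

Lemma half_circle_meridian : half_meridian (model 0 P Q ph @` `[0, pi / lam 0]).
Proof.
exists ph; rewrite lam0 divr1; apply/seteqP; split=> [_ [t /= ht <-]|_ [t /= ht <-]]; exists t => //;
  by rewrite half_great_circle//; move: ht; rewrite in_itv.
Qed.

Let f (p : 'rV[R]_4) : 'rV[R]_3 := \row_(i < 3) [:: x1 p * cos ph + y1 p * sin ph; x2 p; y2 p]`_i.
Let h (q : 'rV[R]_3) : 'rV[R]_4 := vec4 (q 0 ord0 * cos ph) (q 0 ord0 * sin ph) (q 0 (lift ord0 ord0)) (q 0 ord_max).

(** The surface is the intersection of the sphere with the hyperplane orthogonal to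
    (- sin ph, cos ph, 0, 0). *)
Lemma half_swept_sphere : homeomorphic_sets (half_swept 0 P Q ph) (@usphere R 3).
Proof.
have cs := cos2Dsin2 ph; have L1 := @lam0 R; have pi0 := @pi_gt0 R.
have fE p : [/\ f p 0 ord0 = x1 p * cos ph + y1 p * sin ph, f p 0 (lift ord0 ord0) = x2 p & f p 0 ord_max = y2 p].
  by rewrite !mxE.
have dot3 (q q' : 'rV[R]_3) : dot q q' = q 0 ord0 * q' 0 ord0 + q 0 (lift ord0 ord0) * q' 0 (lift ord0 ord0) + q 0 ord_max * q' 0 ord_max.
  rewrite /dot !big_ord_recr big_ord0 /= add0r.
  by congr (_ * _ + _ * _ + _ * _); congr (_ 0 _); apply/val_inj.
have row3 (q q' : 'rV[R]_3) : q 0 ord0 = q' 0 ord0 -> q 0 (lift ord0 ord0) = q' 0 (lift ord0 ord0) -> q 0 ord_max = q' 0 ord_max -> q = q'.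
  move=> h1 h2 h3; apply/rowP => -[[|[|[|//]]] hi].
  - by have -> : Ordinal hi = ord0 by exact/val_inj.
  - by have -> : Ordinal hi = lift ord0 ord0 by exact/val_inj.
  - by have -> : Ordinal hi = ord_max by exact/val_inj.
have cf : continuous f.
  have cx := @continuous_lin2 R _ _ _ (cos ph) (sin ph) (@continuous_x1 R) (@continuous_y1 R).
  apply: continuous_row => i.
  have -> : (fun x => f x 0 i) = (fun x => [:: x1 x * cos ph + y1 x * sin ph; x2 x; y2 x]`_i).
    by apply/funext => x; rewrite mxE.
  case: i => -[|[|[|//]]] hi /=; [exact: cx|exact: continuous_x2|exact: continuous_y2].
have ch : continuous h.
  have c i : continuous (fun q : 'rV[R]_3 => q 0 i) by exact: coord_continuous.
  have cM i (k : R) : continuous (fun q : 'rV[R]_3 => q 0 i * k).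
    have -> : (fun q : 'rV[R]_3 => q 0 i * k) = (fun q => q 0 i * k + q 0 i * 0) by apply/funext => q; rewrite mulr0 addr0.
    exact: continuous_lin2.
  exact: continuous_vec4.
have paramE p : half_swept 0 P Q ph p <-> exists2 t, 0 <= t <= pi & exists th,
    p = vec4 (cos t * cos ph) (cos t * sin ph) (cos th * sin t) (sin th * sin t).
  have e t th : 0 <= t <= pi -> Defs.rot th (model 0 P Q ph t) = vec4 (cos t * cos ph) (cos t * sin ph) (cos th * sin t) (sin th * sin t).
    by move=> ht; rewrite half_great_circle// /Defs.rot !vecE; congr vec4; ring.
  split=> -[t ht [th ->]]; exists t => //; first by move: ht; rewrite L1 divr1.
  - by exists th; rewrite e//; move: ht; rewrite L1 divr1.
  - by move: ht; rewrite L1 divr1.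
  - by exists th; rewrite e.
exists f, h; split.
- exact: continuous_subspaceT.
- exact: continuous_subspaceT.
- move=> p /paramE [t ht [th ->]]; have [f1 f2 f3] := fE (vec4 (cos t * cos ph) (cos t * sin ph) (cos th * sin t) (sin th * sin t)).
  rewrite !vecE in f1 f2 f3.
  have f1' : f (vec4 (cos t * cos ph) (cos t * sin ph) (cos th * sin t) (sin th * sin t)) 0 ord0 = cos t.
    rewrite f1; transitivity (cos t * (cos ph ^+ 2 + sin ph ^+ 2)); [ring|by rewrite cs mulr1].
  split; last by rewrite /h f1' f2 f3.
  rewrite /usphere /= dot3 f1' f2 f3; have c2 := cos2Dsin2 th.
  transitivity (cos t ^+ 2 + sin t ^+ 2 * (cos th ^+ 2 + sin th ^+ 2)); first by ring.
  by rewrite c2 mulr1 cos2Dsin2.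
- move=> q; rewrite /usphere /= dot3 => hq.
  set q0 := q 0 ord0 in hq; set q1 := q 0 (lift _ _) in hq; set q2 := q 0 ord_max in hq.
  have g0 := sqr_ge0 q0; have g1 := sqr_ge0 q1; have g2 := sqr_ge0 q2.
  have qb : -1 <= q0 <= 1 by rewrite -ler_norml -(@ler_pXn2r _ 2) ?nnegrE// real_normK ?num_real// expr1n; lra.
  have [th [e1 e2]] := polar q1 q2.
  have ca : cos (acos q0) = q0 by rewrite acosK// in_itv.
  have sa : sin (acos q0) = Num.sqrt (q1 ^+ 2 + q2 ^+ 2) by rewrite sin_acos//; congr Num.sqrt; lra.
  split; last first.
    have [f1 f2 f3] := fE (h q); apply: row3; rewrite ?f1 ?f2 ?f3 /h !vecE -/q0 -/q1 -/q2 //.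
    transitivity (q0 * (cos ph ^+ 2 + sin ph ^+ 2)); [ring|by rewrite cs mulr1].
  apply/paramE; exists (acos q0); first by rewrite acos_ge0// acos_lepi.
  exists th; rewrite ca sa /h -/q0 -/q1 -/q2.
  by congr vec4; rewrite [RHS]mulrC; [exact: e1|exact: e2].
Qed.

End Minimal.
End ZeroEnergySurface.

(** * Circles through the north pole *)

Section Quotients.
Context {R : realType}.

(** Both sets are quotients of the compact set [K] by the same equivalence relation,
    and continuous maps from a compact to a Hausdorff space are closed. *)
Lemma homeomorphic_quotients (S T : pseudoMetricType R) (K : set R) (a : R -> S) (b : R -> T) :
  hausdorff_space S -> hausdorff_space T -> compact K -> continuous a -> continuous b ->
  (forall t t', K t -> K t' -> a t = a t' <-> b t = b t') ->
  homeomorphic_sets (a @` K) (b @` K).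
Proof.
move=> hS hT cK ca cb fib.
have half (S' T' : pseudoMetricType R) (a' : R -> S') (b' : R -> T') (f : S' -> T') :
    hausdorff_space S' -> continuous a' -> continuous b' ->
    (forall t, K t -> f (a' t) = b' t) -> {within a' @` K, continuous f}.
  move=> hS' ca' cb' fE; apply/within_continuousE => _ [t Kt <-] B.
  rewrite fE// => /nbhs_interior oB.
  pose C := a' @` (K `&` (b' @^-1` (~` B°))).
  have clC : closed C.
    apply: compact_closed => //; apply: continuous_compact; first exact: continuous_subspaceT.
    apply: compact_closedI => //; apply: preimage_closed; first by move=> u _; exact: cb'.
    by apply: open_closedC; exact: open_interior.
  have : nbhs (a' t) (~` C).
    apply: open_nbhs_nbhs; split; first exact: closed_openC.
    move=> [u [Ku nB] e]; apply: nB; rewrite -(fE u Ku) e fE//; exact: nbhs_singleton oB.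
  apply: filterS => y nC [u Ku e]; rewrite -e fE//; apply: contrapT => nB; apply: nC.
  by exists u => //; split=> // /interior_subset.
pose f x := b (xget 0 [set t | K t /\ a t = x]); pose g y := a (xget 0 [set t | K t /\ b t = y]).
have fE t : K t -> f (a t) = b t.
  move=> Kt; rewrite /f; case: xgetP => [u _ [Ku e]|no]; first by apply/fib.
  by have := no t; case.
have gE t : K t -> g (b t) = a t.
  move=> Kt; rewrite /g; case: xgetP => [u _ [Ku e]|no]; first by apply/fib.
  by have := no t; case.
exists f, g; split.
- exact: (half _ _ a b).
- exact: (half _ _ b a).
- by move=> _ [t Kt <-]; rewrite fE// gE//; split => //; exists t.
- by move=> _ [t Kt <-]; rewrite gE// fE//; split => //; exists t.
Qed.

End Quotients.

Section Loops.
Context {R : realType}.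
Variables (H P : R).
Hypothesis Hn : H != 0.
Hypothesis Sh : shape H (- H) P 0.
Local Notation L := (lam H).
Let d := pi / (2 * L).

Let L0 : 0 < L. Proof. exact: lam_gt0. Qed.
Let d0 : 0 < d. Proof. by rewrite /d divr_gt0 ?pi_gt0// mulr_gt0. Qed.
Let dE : L * d = pi / 2. Proof. by rewrite /d; field; rewrite gt_eqF. Qed.

Lemma loop_coords ph t : model H P 0 ph t =
  vec4 (P * cos (L * t) * cos (ph - H * t)) (P * cos (L * t) * sin (ph - H * t)) (model_height H P 0 t) 0.
Proof. by rewrite /model /model_x /model_y !mul0r subr0 addr0. Qed.

Lemma loop_end ph t : cos (L * t) = 0 -> model H P 0 ph t = north.
Proof.
move=> c0; rewrite loop_coords c0 !mulr0 !mul0r; congr vec4.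
have s1 : sin (L * t) ^+ 2 = 1 by rewrite sin2cos2 c0 expr0n subr0.
have A1 : coefA H P 0 ^+ 2 = 1 by have := shape_QA Sh; rewrite expr0n add0r.
by rewrite /model_height /model_height2 c0 s1 A1 expr0n mulr0 addr0 mulr1 sqrtr1.
Qed.

Definition loop ph := model H P 0 ph @` `[- d, d].

Lemma cos_quarter t : - d <= t <= d -> 0 <= cos (L * t).
Proof.
move=> ht; apply: cos_ge0_pihalf; rewrite -dE -mulrN !ler_pM2l//.
Qed.

(** On the interval cos (L t) >= 0, and |z| determines it, hence t up to its sign. For
    t and - t the arguments of z differ by 2 H t, which is less than pi in absolute
    value; so they only agree at t = 0, or at the ends, where z = 0. *)
Lemma loop_fibres ph t t' : - d <= t <= d -> - d <= t' <= d ->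
  model H P 0 ph t = model H P 0 ph t' -> [\/ t = t', t = - t' /\ t = d | t = - t' /\ t = - d].
Proof.
move=> ht ht' e; have P0 := shape_P Sh; have pi0 := @pi_gt0 R.
have ez := projection_sqr H P 0 ph t; have ez' := projection_sqr H P 0 ph t'.
have ex : model_x H P 0 ph t = model_x H P 0 ph t' by have := congr1 x1 e; rewrite /model !vecE.
have ey : model_y H P 0 ph t = model_y H P 0 ph t' by have := congr1 y1 e; rewrite /model !vecE.
have cc : cos (L * t) = cos (L * t').
  rewrite ex ey ez' expr0n !mul0r !addr0 in ez.
  have P2 : P ^+ 2 != 0 by rewrite sqrf_eq0 gt_eqF.
  move/(mulfI P2)/eqP: ez; rewrite eqrXn2 ?cos_quarter// => /eqP ->.
  by [].
have bnd u : - d <= u <= d -> - (pi / 2) <= L * u <= pi / 2.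
  by move=> hu; rewrite -dE -mulrN !ler_pM2l.
have absE u : cos `|L * u| = cos (L * u) by case: (ger0P (L * u)) => // _; rewrite cosN.
have ab : `|L * t| = `|L * t'|.
  apply: cos_inj; rewrite ?absE// in_itv /= normr_ge0 /=.
    by have := bnd t ht; rewrite -ler_norml; lra.
  by have := bnd t' ht'; rewrite -ler_norml; lra.
have : t = t' \/ t = - t'.
  move: ab; rewrite !normrM (gtr0_norm L0) => /(mulfI (lt0r_neq0 L0)) /eqP.
  by rewrite eqr_norm2 => /orP[] /eqP; [left|right].
case=> [->|tt]; first by apply: Or31.
have [c0|cn] := eqVneq (cos (L * t)) 0.
  have : `|L * t| = pi / 2.
    apply: cos_inj; rewrite ?absE ?cos_pihalf// in_itv /=; last by lra.
    by rewrite normr_ge0 /=; have := bnd t ht; rewrite -ler_norml; lra.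
  rewrite -dE normrM (gtr0_norm L0) => /(mulfI (lt0r_neq0 L0)).
  case: (ger0P t) => _ h; first by apply: Or32.
  by apply: Or33; split=> //; lra.
apply: Or31.
have k0 : P * cos (L * t) != 0 by rewrite mulf_neq0// gt_eqF.
have e1 := congr1 x1 e; have e2 := congr1 y1 e; rewrite !loop_coords !vecE -cc in e1 e2.
have [m em] := cos_sin_eq (mulfI k0 e1) (mulfI k0 e2).
have em' : H * t' = m%:~R * pi by move: em; rewrite tt; lra.
have small : `|H * t'| < pi / 2.
  rewrite normrM -dE; have h1 := lam_gt H; have h2 : `|t'| <= d by rewrite ler_norml.
  apply: (@le_lt_trans _ _ (`|H| * d)); first by rewrite ler_wpM2l.
  by rewrite ltr_pM2r.
have m0 : m = 0.
  move: small; rewrite em' normrM (gtr0_norm pi0) => small.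
  have : `|m%:~R| < (1 : R) by nra.
  rewrite -intr_norm -[1]/(1%:~R) ltr_int; case: (m) => [[|k]|k] //.
have t0 : t' = 0 by move: em'; rewrite m0 mul0r => /eqP; rewrite mulf_eq0 (negbTE Hn) => /eqP.
by rewrite tt t0 oppr0.
Qed.

(** The circle and the loop are the same quotient of a half period of time, whose
    end points are identified. *)
Lemma loop_circle ph : topological_circle (loop ph) /\ loop ph north.
Proof.
have pi0 := @pi_gt0 R; have Ln : L != 0 by rewrite gt_eqF.
split; last first.
  exists d; first by rewrite /= in_itv /= lexx andbT (@le_trans _ _ 0) ?oppr_le0 ?ltW.
  by apply: loop_end; rewrite dE cos_pihalf.
pose a (t : R) : 'rV[R]_2 := \row_(i < 2) [:: cos (2 * L * t); sin (2 * L * t)]`_i.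
have ca : continuous a.
  apply: continuous_row => i.
  have -> : (fun x => a x 0 i) = (fun t => [:: cos (2 * L * t); sin (2 * L * t)]`_i).
    by apply/funext => t; rewrite mxE.
  case: i => -[|[|//]] hi /= t.
    exact: is_derive_continuous (is_derive_cosM (2 * L) t).
  exact: is_derive_continuous (is_derive_sinM (2 * L) t).
have aE t : a t 0 ord0 = cos (2 * L * t) /\ a t 0 ord_max = sin (2 * L * t) by rewrite !mxE.
have dot2 (q q' : 'rV[R]_2) : dot q q' = q 0 ord0 * q' 0 ord0 + q 0 ord_max * q' 0 ord_max.
  rewrite /dot !big_ord_recr big_ord0 /= add0r.
  by congr (_ * _ + _ * _); congr (_ 0 _); apply/val_inj.
have row2 (q q' : 'rV[R]_2) : q 0 ord0 = q' 0 ord0 -> q 0 ord_max = q' 0 ord_max -> q = q'.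
  move=> h1 h2; apply/rowP => -[[|[|//]] hi].
  - by have -> : Ordinal hi = ord0 by exact/val_inj.
  - by have -> : Ordinal hi = ord_max by exact/val_inj.
have dpi : 2 * L * d = pi by rewrite -mulrA dE; field.
have sphE : @usphere R 2 = a @` `[- d, d].
  apply/seteqP; split=> [q|_ [t _ <-]]; last first.
    by have [h1 h2] := aE t; rewrite /usphere /= dot2 h1 h2 -!expr2 cos2Dsin2.
  rewrite /usphere /= dot2 -!expr2 => /angle [x [h1 h2]].
  have T0 : 0 < 2 * (pi : R) by lra.
  have [n n1 n2] := period_reduce (x + pi) T0.
  pose t := (x - n%:~R * (2 * pi)) / (2 * L).
  have et : 2 * L * t = x - n%:~R * (2 * pi) by rewrite /t; field.
  exists t.
    have k0 : 0 < 2 * L by rewrite mulr_gt0.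
    by rewrite /= in_itv /=; apply/andP; split; rewrite -(ler_pM2l k0) et ?mulrN dpi; lra.
  have [k1 k2] := aE t; apply: row2; rewrite ?k1 ?k2 et ?h1 ?h2.
    by rewrite -(cos_periodz n) -mulrA subrK.
  by rewrite -(sin_periodz n) -mulrA subrK.
rewrite /topological_circle sphE; apply: homeomorphic_quotients => //.
- exact: segment_compact.
- exact: continuous_mG.
move=> t t' /=; rewrite !in_itv /= => ht ht'; have [k1 k2] := aE t; have [k1' k2'] := aE t'.
split=> e.
  have e1 : cos (2 * L * t) = cos (2 * L * t') by rewrite -k1 -k1' e.
  have e2 : sin (2 * L * t) = sin (2 * L * t') by rewrite -k2 -k2' e.
  have [m em] := cos_sin_eq e1 e2.
  have et : t = t' + m%:~R * (2 * d).
    apply: (mulfI (mulf_neq0 (lt0r_neq0 (ltr0n R 2)) Ln)); rewrite mulrDr em -dpi; ring.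
  have dd : 0 < 2 * d by rewrite mulr_gt0.
  have [m1 m2] : -1 <= (m%:~R : R) /\ (m%:~R : R) <= 1.
    by split; rewrite -(ler_pM2r dd); lra.
  have mm : m = 0 \/ m = 1 \/ m = -1.
    move: m1 m2; rewrite -[-1]/((-1)%:~R) -[1]/(1%:~R) !ler_int.
    by case: (m) => [[|[|k]]|[|k]] //; [left|right; left|right; right].
  case: mm => [m0|[m0|m0]]; first by rewrite et m0 mul0r addr0.
    have [-> ->] : t = d /\ t' = - d by move: et; rewrite m0 mul1r; lra.
    by rewrite !loop_end// ?mulrN ?cosN dE cos_pihalf.
  have [-> ->] : t = - d /\ t' = d by move: et; rewrite m0 mulN1r; lra.
  by rewrite !loop_end// ?mulrN ?cosN dE cos_pihalf.
have ends : a d = a (- d).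
  have [h1 h2] := aE d; have [h1' h2'] := aE (- d).
  by apply: row2; rewrite ?h1 ?h2 ?h1' ?h2' mulrN ?cosN ?sinN dpi ?sinpi ?oppr0.
have [-> //|[tt td]|[tt td]] := loop_fibres ht ht' e.
  by have -> : t' = - d by [rewrite -td tt opprK]; rewrite td.
by have -> : t' = d by [rewrite -[d]opprK -td tt opprK]; rewrite td.
Qed.

Lemma loops_at_north ph : circles_at_north (range (model H P 0 ph)).
Proof.
have Ln : L != 0 by rewrite gt_eqF.
exists (fun n => loop (ph + n%:~R * (pi - H * (pi / L)))); split; first by move=> n; exact: loop_circle.
apply/seteqP; split=> [_ [t _ <-]|_ [n _ [t _ <-]]]; last by exists (t + n%:~R * (pi / L)); rewrite ?model_shift.
have T0 : 0 < pi / L by rewrite divr_gt0 ?pi_gt0.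
have [n n1 n2] := period_reduce (t + d) T0.
exists n => //; exists (t - n%:~R * (pi / L)); last by rewrite -model_shift subrK.
have e : pi / L = 2 * d by rewrite /d; field.
by rewrite /= in_itv /=; rewrite e in n1 n2 *; lra.
Qed.

End Loops.

(** * Totally geodesic spheres *)

Section TotallyGeodesic.
Context {R : realType}.

Lemma derive_dot_cst (V : normedModType R) (F : V -> 'rV[R]_4) (n : 'rV[R]_4) (u v : V) : derivable F u v ->
  is_derive u v (fun x => dot (F x) n) (dot ('D_v F u) n).
Proof.
move=> dF; have h1 := is_derive_x1 dF; have h2 := is_derive_y1 dF; have h3 := is_derive_x2 dF; have h4 := is_derive_y2 dF.
rewrite (_ : (fun x => _) = (fun x => x1 (F x) * x1 n + y1 (F x) * y1 n + x2 (F x) * x2 n + y2 (F x) * y2 n)); last first.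
  by apply/funext => x; rewrite dot4.
by apply: is_derive_eq; rewrite /GRing.scale /= dot4; ring.
Qed.

(** The surface lies in the hyperplane orthogonal to [n], and so do the derivatives
    of its parameterizations. *)
Lemma constant_normal_geodesic (M : topologicalType) (phi N : M -> 'rV[R]_4) (n : 'rV[R]_4) :
  (forall m, dot (phi m) n = 0) -> (forall m, N m = n) -> totally_geodesic phi N.
Proof.
move=> pn Nn U psi [_ _ _ [oU [C1 C2] _]] u v w hu; rewrite Nn.
have first u' : U u' -> dot ('D_w (phi \o psi) u') n = 0.
  move=> hu'; have [d _] := C1 u' hu'.
  have [_ <-] := derive_dot_cst n (diff_derivable d (v := w)).
  rewrite (_ : (fun x => _) = cst 0); first exact: derive_cst.
  by apply/funext => x; exact: pn.
have [d _] := C2 w u hu.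
have [_ <-] := derive_dot_cst n (diff_derivable d (v := v)).
have : is_derive u v (fun x => dot ('D_w (phi \o psi) x) n) 0.
  apply: near_eq_is_derive (is_derive_cst (0 : R) u v).
  by have := open_nbhs_nbhs (conj oU hu); apply: filterS => y hy; rewrite first.
by case.
Qed.

End TotallyGeodesic.

(** * Classification *)

Section Torus.
Context {R : realType}.
Variables (H E P Q ph : R).
Hypothesis Sh : shape H E P Q.
Hypothesis PQ : Q = P.
Local Notation L := (lam H).

(** If P = Q the ellipse is a circle, and both the height and |z| are constant. *)
Lemma torus_swept : swept H P Q ph = clifford_torus P.
Proof.
have P0 := shape_P Sh.
have mz t : modulus2 H P Q t = P ^+ 2.
  by rewrite /modulus2 PQ -mulrDr cos2Dsin2 mulr1.
have hE t : model_height H P Q t = Num.sqrt (1 - P ^+ 2).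
  by rewrite /model_height; congr Num.sqrt; rewrite -(mz t) (modulus2E Sh); ring.
apply/seteqP; split=> [_ [t [th ->]]|p [hp pP]].
  split; first by apply: rot_S3; exact: (model_S3 Sh).
  by rewrite /Defs.rot /model !vecE projection_sqr -/(modulus2 H P Q t) mz.
have LH : L - H != 0 by rewrite subr_eq0 gt_eqF// (le_lt_trans (ler_norm H) (lam_gt H)).
have [al [e1 e2]] := polar (x1 p) (y1 p); have [th [e3 e4]] := polar (x2 p) (y2 p).
have r1 : Num.sqrt (x1 p ^+ 2 + y1 p ^+ 2) = P by rewrite pP sqrtr_sqr gtr0_norm.
have r2 : x2 p ^+ 2 + y2 p ^+ 2 = 1 - P ^+ 2 by move/S3E: hp; rewrite -pP; lra.
rewrite r1 in e1 e2; rewrite r2 in e3 e4.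
pose t := (al - ph) / (L - H).
have et : al = L * t + (ph - H * t) by rewrite /t; field.
exists t, th; apply: vec4P; rewrite /Defs.rot /model !vecE ?hE.
- by rewrite e1 et cosD /model_x PQ; ring.
- by rewrite e2 et sinD /model_y PQ; ring.
- by rewrite e3; ring.
- by rewrite e4; ring.
Qed.

(** From P = Q we have B = (L - H) P, so P^2 = 1/2 means L - H = 1, that is H = 0. *)
Lemma torus_radius : coefB H P Q != 0 -> 0 < P < 1 /\ (P = Num.sqrt 2 / 2 <-> H = 0).
Proof.
move=> Bn; have P0 := shape_P Sh; have L0 := lam_gt0 H; have l2 := lam_sqr H.
have LH : 0 < L - H by rewrite subr_gt0 (le_lt_trans (ler_norm H) (lam_gt H)).
have pb := shape_PB Sh; have B2 : 0 < coefB H P Q ^+ 2 by rewrite lt_neqAle eq_sym sqrf_eq0 Bn sqr_ge0.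
have s2 : (Num.sqrt 2 / 2) ^+ 2 = 2^-1 :> R.
  by rewrite expr_div_n sqr_sqrtr//; field.
have hB : coefB H P Q = (L - H) * P by rewrite /coefB PQ; ring.
split; first by rewrite P0 -(@expr_lt1 _ 2) ?ltW//; lra.
split=> [e|H0].
  have P2 : P ^+ 2 = 2^-1 by rewrite e s2.
  have : (L - H) ^+ 2 = 1.
    by move: pb; rewrite hB exprMn P2; lra.
  move/eqP; rewrite sqrf_eq1 => /orP[/eqP k|/eqP k]; last by lra.
  have lE : L = 1 + H by lra.
  by move: l2; rewrite lE => ?; lra.
have LE : L = 1 by rewrite H0 lam0.
apply/eqP; rewrite -(@eqrXn2 _ 2) ?s2 ?ltW ?divr_gt0 ?sqrtr_gt0//.
by move: pb; rewrite hB LE H0 subr0 mul1r => ?; apply/eqP; lra.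
Qed.

End Torus.

Section Final.
Context {R : realType} (M : topologicalType) (phi : M -> 'rV[R]_4) (rho : R -> M -> M).
Variables (N : M -> 'rV[R]_4) (J : set R) (c : R -> M) (H E : R).
Hypothesis surf : C2_complete_connected_surface phi.
Hypothesis inv : rotationally_invariant phi rho.
Hypothesis gen : generating_curve phi rho J c.
Hypothesis nrm : unit_normal phi N.
Hypothesis nrm_along : normal_along phi N rho J c.
Hypothesis cmc : constant_mean_curvature phi N H.
Hypothesis energy : has_energy J (phi \o c) H E.
Local Notation g := (phi \o c).

Lemma full_structure : E != 0 -> exists (ph P Q : R) (xi w : R -> R),
  [/\ shape H E P Q /\ J = setT,
   (forall s : R, is_derive s 1 xi (w s) /\ 1 <= w s), (forall t, exists s, xi s = t),
   (forall s, g s = model H P Q ph (xi s)) & range phi = swept H P Q ph /\ g @` J = range (model H P Q ph)].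
Proof.
move=> En; have [ph [P [Q [xi [w [Sh dxi gE]]]]]] := curve_is_model surf inv gen nrm_along cmc energy.
have JT := domain_unbounded surf inv gen nrm_along cmc energy Sh gE En.
have JI s : J° s by rewrite JT interiorT.
have onto := time_onto surf inv gen nrm_along cmc energy Sh dxi gE En.
exists ph, P, Q, xi, w; split=> //.
- by move=> s; exact: dxi.
- by move=> s; exact: gE.
split; last exact: (image_unbounded surf inv gen nrm_along cmc energy Sh dxi gE En).
apply/seteqP; split=> p.
  by move/(sigma_rot inv gen) => [s [t [_ ->]]]; exists (xi s), t; rewrite gE.
move=> [t [th ->]]; apply/(sigma_rot inv gen); have [s <-] := onto t.
by exists s, th; rewrite JT gE.
Qed.

(** Reversing the time replaces (H, E, Q) by (- H, - E, - Q), so the ellipse may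
    be assumed to be traversed counterclockwise; [e] records the direction. *)
Lemma oriented_structure : E != 0 -> H <> - E -> exists (e ph P Q : R) (xi w : R -> R),
  [/\ e * e = 1 /\ J = setT, shape (e * H) (e * E) P Q /\ 0 < Q,
   (forall s : R, is_derive s 1 xi (e * w s) /\ 1 <= w s) /\ (forall t, exists s, xi s = t),
   (forall s, g s = model (e * H) P Q ph (xi s)) & range phi = swept (e * H) P Q ph].
Proof.
move=> En HE; have [ph [P [Q [xi [w [[Sh JT] dxi onto gE [sE _]]]]]]] := full_structure En.
have Qn : Q != 0.
  apply/eqP => q0; apply: HE; have := shape_PQ Sh; rewrite q0 mulr0; lra.
have [Q0|Q0] : 0 < Q \/ Q < 0 by case: (ltgtP Q 0) Qn => // h _; [right|left].
  exists 1, ph, P, Q, xi, w; rewrite !mul1r; split=> //; split=> // s; rewrite mul1r; exact: dxi.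
exists (-1), ph, P, (- Q), (fun s => - xi s), w; rewrite !mulN1r opprK.
split=> //.
- by split; [exact: shapeN|rewrite oppr_gt0].
- split=> [s|t]; last by have [s es] := onto (- t); exists s; rewrite es opprK.
  by have [d h] := dxi s; split=> //; rewrite mulN1r; exact: is_deriveN.
- by move=> s; rewrite mGN opprK.
rewrite sE; apply/seteqP; split=> _ [t [th ->]]; exists (- t), th; rewrite ?mGN ?opprK//.
Qed.

Lemma curve_speed s : J° s -> dot (derive1 g s) (derive1 g s) = 1.
Proof. by move=> hs; apply/enorm1; exact: (profile_arclength (gen_profile gen) hs). Qed.

(** Both types have nonconstant height, which excludes the tori. *)
Lemma two_heights : unduloidal J g \/ nodoidal J g -> exists s s', [/\ J s, J s' & x2 (g s) != x2 (g s')].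
Proof.
have key (om ta : R -> R) (s s' a b : R) : spherical_lift J g om ta -> J s -> J s' -> om s = a -> om s' = b ->
    0 < a -> a < b -> b < pi / 2 -> x2 (g s) != x2 (g s').
  move=> [_ _ l] hs hs' ea eb a0 ab b1; have [_ ->] := l s hs; have [_ ->] := l s' hs'.
  rewrite /spherical !vecE ea eb lt_eqF// ltr_sin// in_itv /=; lra.
case=> [[om [ta [w [l tr _ [a [b [a0 ab b1 rw]]] _]]]]|[om [ta [l _ [a [b [a0 ab b1 rw]]] _ _]]]].
  have [ra rb] : range w a /\ range w b by rewrite rw /= !in_itv /= !lexx ltW.
  have pick v : range w v -> exists2 s, J s & om s = v.
    move=> [t _ e]; have : plane_trace J om ta (t, w t) by rewrite tr; exists t.
    by move=> [s hs [_ e2]]; exists s => //; rewrite e2.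
  have [s hs es] := pick a ra; have [s' hs' es'] := pick b rb.
  by exists s, s'; split => //; exact: (key om ta s s' a b).
have [s hs es] : (om @` J) a by rewrite rw /= in_itv /= lexx ltW.
have [s' hs' es'] : (om @` J) b by rewrite rw /= in_itv /= lexx ltW.
by exists s, s'; split => //; exact: (key om ta s s' a b).
Qed.

Lemma half_structure : E = 0 -> exists (ph P Q al be : R) (xi w : R -> R),
  [/\ shape H 0 P Q /\ al < be, J = [set` `[al, be]],
   (forall s, al < s < be -> is_derive s 1 xi (w s) /\ 1 <= w s),
   (forall s, al < s < be -> g s = model H P Q ph (xi s) /\ 0 < xi s < pi / lam H) &
   range phi = half_swept H P Q ph /\ g @` J = model H P Q ph @` `[0, pi / lam H]].
Proof.
move=> E0; have [ph [P [Q [al [be [xi [w [[Sh ab] [JE _] dxi gE im]]]]]]]] := bounded_structure surf inv gen nrm_along cmc energy E0.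
rewrite E0 in Sh; exists ph, P, Q, al, be, xi, w; split => //; split=> //.
apply/seteqP; split=> p.
  move/(sigma_rot inv gen) => [s [th [hs ->]]].
  have [t ht <-] : (model H P Q ph @` `[0, pi / lam H]) (g s) by rewrite -im; exists s.
  by exists t; [move: ht; rewrite /= in_itv|exists th].
move=> [t ht [th ->]]; apply/(sigma_rot inv gen).
have [s hs <-] : (g @` J) (model H P Q ph t) by rewrite im; exists t => //; rewrite /= in_itv.
by exists s, th.
Qed.

(** The normal along the profile is w (- sin ph, cos ph, 0, 0), and w = 1 because it is
    a unit vector; by continuity this holds on the axis too. *)
Lemma minimal_sphere : H = 0 -> E = 0 -> half_meridian (g @` J) /\
  totally_geodesic phi N /\ homeomorphic_sets (range phi) (@usphere R 3).
Proof.
move=> H0 E0; have [ph [P [Q [al [be [xi [w [[Sh ab] JE dxi gE [sE im]]]]]]]]] := half_structure E0.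
rewrite H0 in Sh gE sE im; split; first by rewrite im; exact: half_circle_meridian.
split; last by rewrite sE; exact: half_swept_sphere.
have L1 := @lam0 R.
pose n : 'rV[R]_4 := vec4 (- sin ph) (cos ph) 0 0.
apply: (@constant_normal_geodesic _ _ _ _ n) => m.
  have : range phi (phi m) by exists m.
  rewrite sE => -[t ht [th ->]]; rewrite half_great_circle //; last by move: ht; rewrite L1 divr1.
  by rewrite dot4 /n /Defs.rot !vecE; ring.
have P' := gen_profile gen.
have inner s t : al < s < be -> N (rho t (c s)) = n.
  move=> hs; have Js : J° s by rewrite JE interior_itv_bnd /= in_itv.
  rewrite (nrm_along t (interior_subset Js) (interior_off_axis surf inv gen nrm_along cmc energy Js)).
  have near_s : \forall u \near s, al < u < be.
    by have : nbhs s [set` `]al, be[] by [apply: open_nbhs_nbhs; split; [exact: itv_open|rewrite /= in_itv]];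
       apply: filterS => u; rewrite /= in_itv.
  have gc u : al < u < be -> g u = vec4 (cos (xi u) * cos ph) (cos (xi u) * sin ph) (sin (xi u)) 0.
    move=> hu; have [-> hx] := gE u hu; rewrite half_great_circle//.
    by move: hx; rewrite L1 divr1 => /andP[/ltW -> /ltW ->].
  have [dx w1] := dxi s hs; have [d1 d2 d3 d4] := is_derive_components (curve_is_derive gen Js).
  have dc := chain_rule (f := @cos R) erefl (is_derive_cos (xi s)) dx erefl.
  have ds := chain_rule (f := @sin R) erefl (is_derive_sin (xi s)) dx erefl.
  have uniq (f h : R -> R) (a b : R) : is_derive s 1 f a -> is_derive s 1 h b ->
      (forall u, al < u < be -> h u = f u) -> a = b.
    move=> df dh e; have : is_derive s 1 f b.
      by apply: near_eq_is_derive dh; apply: filterS near_s => u hu; rewrite e.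
    by case: df => _ <- [_ <-].
  have e1 : x1 (derive1 g s) = - sin (xi s) * w s * cos ph.
    apply: (uniq _ (fun u => cos (xi u) * cos ph) _ _ d1); last by move=> u hu; rewrite gc// vecE.
    by apply: is_derive_eq; rewrite /GRing.scale /=; ring.
  have e2 : y1 (derive1 g s) = - sin (xi s) * w s * sin ph.
    apply: (uniq _ (fun u => cos (xi u) * sin ph) _ _ d2); last by move=> u hu; rewrite gc// vecE.
    by apply: is_derive_eq; rewrite /GRing.scale /=; ring.
  have e3 : x2 (derive1 g s) = cos (xi s) * w s.
    by apply: (uniq _ (fun u => sin (xi u)) _ _ d3 ds) => u hu; rewrite gc// vecE.
  have pn : profile_normal g s t = w s *: n.
    have cs := cos2Dsin2 (xi s).
    apply: vec4P; rewrite /profile_normal /n !coordE ?e1 ?e2 ?e3 (gc s hs) !vecE.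
    - by rewrite -[RHS]mul1r -cs; ring.
    - by rewrite -[RHS]mul1r -cs; ring.
    - by ring.
    - by ring.
  have := normal_unit nrm (rho t (c s)).
  rewrite (nrm_along t (interior_subset Js) (interior_off_axis surf inv gen nrm_along cmc energy Js)) pn.
  have -> : dot (w s *: n) (w s *: n) = w s ^+ 2.
    by rewrite dot4 /n !coordE -[RHS]mulr1 -(cos2Dsin2 ph); ring.
  move/eqP; rewrite sqrf_eq1 => /orP[/eqP ->|/eqP w2]; first by rewrite scale1r.
  by move: (lt_le_trans ltr01 w1); rewrite w2 oppr_gt0 ltr10.
have [s [t [hs ->]]] := gen_cover gen m.
have cont : {within `[al, be], continuous (fun s => N (rho t (c s)))}.
  rewrite -JE; have := profile_continuous P'; rewrite !within_continuousE => h u hu B hB.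
  have cN : nbhs (rho t (c u)) (N @^-1` B) by exact: (@normal_continuous _ _ _ _ nrm (rho t (c u)) B hB).
  have cr : nbhs (c u) (rho t @^-1` (N @^-1` B)) by exact: (rotation_continuous inv cN).
  exact: (h u hu _ cr).
have cl : closed [set n] by apply: compact_closed; [exact: norm_hausdorff|exact: compact_set1].
by apply: (segment_closure ab cont cl) => [u hu|]; [exact: inner|move: hs; rewrite JE /= in_itv].
Qed.

Lemma rational_sign (e x : R) : e * e = 1 -> is_rational (e * x) <-> is_rational x.
Proof.
move=> e1; have /orP[/eqP ->|/eqP ->] : (e == 1) || (e == -1) by rewrite -eqf_sqr expr2 e1 expr1n.
  by rewrite mul1r.
by rewrite mulN1r; split=> -[q hq]; exists (- q); rewrite rmorphN /= -?hq ?opprK// hq.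
Qed.

(** The sign of B decides whether the momentum keeps its sign. *)
Lemma turning_cases (e ph P Q : R) (xi w : R -> R) : e * e = 1 -> E != 0 -> J = setT ->
  shape (e * H) (e * E) P Q -> 0 < Q -> Q < P ->
  (forall s : R, is_derive s 1 xi (e * w s) /\ 1 <= w s) -> (forall t, exists s, xi s = t) ->
  (forall s, g s = model (e * H) P Q ph (xi s)) ->
  (0 < coefB (e * H) P Q -> unduloidal J g) /\
  (coefB (e * H) P Q < 0 -> nodoidal J g /\ self_intersecting J g).
Proof.
move=> e1 En JT Sh Q0 QP dxi onto gE.
have e0 : e != 0 by apply/eqP => z; move: e1; rewrite z mul0r => /esym/eqP; rewrite oner_eq0.
have Bn : coefB (e * H) P Q != 0 by rewrite -(shape_E0 Sh) mulf_neq0.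
have sp s : dot (derive1 g s) (derive1 g s) = 1 by apply: curve_speed; rewrite JT interiorT.
split=> B0; first exact: (model_unduloidal Sh Q0 QP Bn JT dxi onto gE B0).
split; first exact: (model_nodoidal Sh Q0 QP Bn JT e1 dxi onto gE sp B0).
exact: (model_self_intersecting Sh Q0 QP Bn JT e1 dxi onto gE B0).
Qed.

Lemma minimal_unduloid : H = 0 -> E <> 0 -> range phi = clifford_torus (Num.sqrt 2 / 2) \/
  (unduloidal J g /\ compact (range phi) /\ embedded_surface (range phi)).
Proof.
move=> H0 /eqP En; have HE : H <> - E by rewrite H0 => /esym/eqP; rewrite oppr_eq0 (negbTE En).
have [e [ph [P [Q [xi [w [[e1 JT] [Sh Q0] [dxi onto] gE sE]]]]]]] := oriented_structure En HE.
have e0 : e != 0 by apply/eqP => z; move: e1; rewrite z mul0r => /esym/eqP; rewrite oner_eq0.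
have Bn : coefB (e * H) P Q != 0 by rewrite -(shape_E0 Sh) mulf_neq0.
have := shape_Q Sh; rewrite (gtr0_norm Q0) le_eqVlt => /orP[/eqP PQ|QP].
  left; rewrite sE (torus_swept ph Sh PQ); have [_ [_ k]] := torus_radius Sh PQ Bn.
  by rewrite k// H0 mulr0.
right; split.
  have [u _] := turning_cases e1 En JT Sh Q0 QP dxi onto gE; apply: u.
  by rewrite H0 mulr0 mB_minimal.
rewrite sE H0 mulr0; rewrite H0 mulr0 in Sh; split; last exact: (swept_embedded _ Sh Q0).
by apply: swept_compact; exists 0; rewrite mul0r rmorph0.
Qed.

(** The three types correspond to Q = P, B > 0 and B < 0. *)
Lemma constant_energy_types : E * H <> 0 -> H <> - E ->
     ((exists r : R, 0 < r < 1 /\ r <> Num.sqrt 2 / 2 /\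
                     range phi = clifford_torus r) \/
      unduloidal J g \/
      (nodoidal J g /\ self_intersecting J g)) /\
     (unduloidal J g \/ nodoidal J g ->
      (compact (range phi) <-> is_rational (H / Num.sqrt (1 + H ^+ 2)))).
Proof.
move=> /eqP; rewrite mulf_eq0 negb_or => /andP[En Hn] HE.
have [e [ph [P [Q [xi [w [[e1 JT] [Sh Q0] [dxi onto] gE sE]]]]]]] := oriented_structure En HE.
have e0 : e != 0 by apply/eqP => z; move: e1; rewrite z mul0r => /esym/eqP; rewrite oner_eq0.
have Bn : coefB (e * H) P Q != 0 by rewrite -(shape_E0 Sh) mulf_neq0.
have lE : lam (e * H) = Num.sqrt (1 + H ^+ 2) by rewrite /lam exprMn [e ^+ 2]expr2 e1 mul1r.
have := shape_Q Sh; rewrite (gtr0_norm Q0) le_eqVlt => /orP[/eqP PQ|QP].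
  split.
    left; exists P; have [P1 k] := torus_radius Sh PQ Bn; split=> //; split; last by rewrite sE (torus_swept ph Sh PQ).
    by move/k/eqP; rewrite mulf_eq0 (negbTE e0) (negbTE Hn).
  move=> /two_heights [s [s' [_ _]]]; rewrite !gE /model !vecE.
  have hE t : model_height (e * H) P Q t = Num.sqrt (1 - P ^+ 2).
    rewrite /model_height; congr Num.sqrt; have := modulus2E Sh t; rewrite /modulus2 PQ -mulrDr cos2Dsin2 mulr1 => ->.
    by rewrite subKr.
  by rewrite !hE eqxx.
have [u n] := turning_cases e1 En JT Sh Q0 QP dxi onto gE; split.
  right; have [B0|B0] : 0 < coefB (e * H) P Q \/ coefB (e * H) P Q < 0.
    by case: (ltgtP (coefB (e * H) P Q) 0) Bn => // h _; [right|left].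
  - by left; apply: u.
  - by right; apply: n.
move=> _; rewrite sE -lE -(rational_sign (H / lam (e * H)) e1) mulrA.
by apply: (swept_compact_rational ph Sh); rewrite gtr0_norm.
Qed.

(** H = - E means L P Q = 0, that is Q = 0: the ellipse degenerates to a segment, and
    the curve passes through the pole once in each half period. *)
Lemma circles_through_north : H = - E -> H <> 0 -> circles_at_north (g @` J) /\
  (compact (range phi) <-> is_rational (H / Num.sqrt (1 + H ^+ 2))).
Proof.
move=> HE /eqP Hn; have En : E != 0 by rewrite -oppr_eq0 -HE.
have [ph [P [Q [xi [w [[Sh JT] _ _ _ [sE gJ]]]]]]] := full_structure En.
have P0 := shape_P Sh; have Ln : lam H != 0 by rewrite gt_eqF// lam_gt0.
have Q0 : Q = 0.
  have /eqP := shape_PQ Sh; rewrite HE subrr.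
  by rewrite !mulf_eq0 -HE (negbTE Ln) (gt_eqF P0) => /eqP.
have EE : E = - H by rewrite HE opprK.
rewrite Q0 in Sh sE gJ; rewrite EE in Sh; split.
  by rewrite gJ; exact: (loops_at_north Hn Sh).
rewrite sE; apply: (swept_compact_rational ph Sh).
by rewrite normr0.
Qed.

End Final.
Unset Implicit Arguments.

Theorem theorem6p4 (R : realType) (M : topologicalType)
    (phi : M -> 'rV[R]_4) (rho : R -> M -> M) (N : M -> 'rV[R]_4)
    (J : set R) (c : R -> M) (H E : R)
    (surf : C2_complete_connected_surface phi)
    (inv : rotationally_invariant phi rho)
    (gen : generating_curve phi rho J c)
    (nrm : unit_normal phi N)
    (nrm_along : normal_along phi N rho J c)
    (cmc : constant_mean_curvature phi N H)
    (energy : has_energy J (phi \o c) H E) :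
  let Sigma := range phi in
  let gamma := phi \o c in
  (H = 0 -> E = 0 ->
     half_meridian (gamma @` J) /\
     totally_geodesic phi N /\ homeomorphic_sets Sigma (@usphere R 3)) /\
  (H = 0 -> E <> 0 ->
     Sigma = clifford_torus (Num.sqrt 2 / 2) \/
     (unduloidal J gamma /\ compact Sigma /\ embedded_surface Sigma)) /\
  (H <> 0 -> E = 0 ->
     compact Sigma /\ congruent Sigma (sphere_S H)) /\
  (E * H <> 0 -> H <> - E ->
     ((exists r : R, 0 < r < 1 /\ r <> Num.sqrt 2 / 2 /\
                     Sigma = clifford_torus r) \/
      unduloidal J gamma \/
      (nodoidal J gamma /\ self_intersecting J gamma)) /\
     (unduloidal J gamma \/ nodoidal J gamma ->
      (compact Sigma <-> is_rational (H / Num.sqrt (1 + H ^+ 2))))) /\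
  (H = - E -> H <> 0 ->
     circles_at_north (gamma @` J) /\
     (compact Sigma <-> is_rational (H / Num.sqrt (1 + H ^+ 2)))).
Proof.
move=> Sigma gamma; split; first exact: (minimal_sphere surf inv gen nrm nrm_along cmc energy).
split; first exact: (minimal_unduloid surf inv gen nrm_along cmc energy).
split.
  move=> _ E0; have [ph [P [Q [al [be [xi [w [[Sh _] _ _ _ [sE _]]]]]]]]] :=
    half_structure surf inv gen nrm_along cmc energy E0.
  rewrite /Sigma sE; split; first exact: half_swept_compact.
  exact: (half_swept_congruent ph Sh).
split; first exact: (constant_energy_types surf inv gen nrm_along cmc energy).
exact: (circles_through_north surf inv gen nrm_along cmc energy).
Qed.
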